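(* Consider the translation invariant network and the supply rate $S(t)$ described in the context, and suppose that $\mathsf{A}(\sigma)$ is Hurwitz for every $\sigma\in\mathbb{T}^\nu$. Define the spatio-temporal transfer function $F(s,\sigma)=\mathsf{C}(\sigma)(sI_n-\mathsf{A}(\sigma))^{-1}\mathsf{B}(\sigma)+\mathsf{D}(\sigma)\in\mathbb{C}^{r\times m}$. Then the network is passive, in the sense that for zero initial state $x(0)=0$ and every input $u$ with $\int_0^T\sum_{k\in\mathbb{Z}^\nu}|u_k(t)|^2dt<\infty$ for all $T>0$, the work satisfies $$W(T):=\int_0^TS(t)\,dt\ge 0\quad\text{for all }T>0,$$ if and only if $$E(\omega,\sigma):=F(i\omega,\sigma)^*\mathsf{G}(\sigma)^*+\mathsf{G}(\sigma)F(i\omega,\sigma)\succcurlyeq 0$$ for almost all $(\omega,\sigma)\in\mathbb{R}\times\mathbb{T}^\nu$.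
   Context: Fix integers $\nu,n,m,r\ge1$ and let $\mathbb{T}=[-\pi,\pi)$. A translation invariant network on $\mathbb{Z}^\nu$ is specified by real matrices $A_\ell\in\mathbb{R}^{n\times n}$, $B_\ell\in\mathbb{R}^{n\times m}$, $C_\ell\in\mathbb{R}^{r\times n}$, $D_\ell\in\mathbb{R}^{r\times m}$, $\ell\in\mathbb{Z}^\nu$, with $\sum_\ell\big\|\begin{bmatrix}A_\ell&B_\ell\\C_\ell&D_\ell\end{bmatrix}\big\|^2<\infty$; symbols $\mathsf{A}(\sigma)=\sum_\ell e^{-i\ell^T\sigma}A_\ell$ (as an $L^2(\mathbb{T}^\nu)$-limit) and similarly $\mathsf{B},\mathsf{C},\mathsf{D}$, each with finite essential supremum of the operator norm over $\sigma\in\mathbb{T}^\nu$, so that the block Toeplitz matrices $A=(A_{j-k})_{j,k}$, $B$, $C$, $D$ are bounded operators between $L^2(\mathbb{Z}^\nu,\mathbb{R}^m)$, $L^2(\mathbb{Z}^\nu,\mathbb{R}^n)$, $L^2(\mathbb{Z}^\nu,\mathbb{R}^r)$. State, input and output obey $\dot x_j=\sum_k(A_{j-k}x_k+B_{j-k}u_k)$, $y_j=\sum_k(C_{j-k}x_k+D_{j-k}u_k)$ for $j\in\mathbb{Z}^\nu$, i.e. $x(t)=e^{tA}x(0)+\int_0^te^{(t-\tau)A}Bu(\tau)d\tau$, $y=Cx+Du$. Supply rate: given real $G_\ell\in\mathbb{R}^{m\times r}$ with $\sum_\ell\|G_\ell\|^2<\infty$ and symbol $\mathsf{G}(\sigma)=\sum_\ell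 e^{-i\ell^T\sigma}G_\ell$ with $\operatorname{ess\,sup}_\sigma\|\mathsf{G}(\sigma)\|<\infty$, $S(t)=\sum_{j,k\in\mathbb{Z}^\nu}u_j(t)^TG_{j-k}y_k(t)$. *)

(* Defs.v *)
From HB Require Import structures.
From mathcomp Require Import all_boot all_order all_algebra.
From mathcomp Require Import all_classical all_reals all_analysis.
From mathcomp Require Import complex.
Set Implicit Arguments. Unset Strict Implicit. Unset Printing Implicit Defensive.
Import Order.TTheory GRing.Theory Num.Theory.
Local Open Scope classical_set_scope.
Local Open Scope ring_scope.
Local Open Scope complex_scope.

Notation Zl nu := 'rV[int]_nu.

Section Defs.
Variable R : realType.
Local Notation C := R[i].

Definition sqnormR p q (M : 'M[R]_(p, q)) : R := \sum_i \sum_j M i j ^+ 2.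
Definition cabs2 (z : C) : R := complex.Re z ^+ 2 + complex.Im z ^+ 2.
Definition sqnormC p q (M : 'M[C]_(p, q)) : R := \sum_i \sum_j cabs2 (M i j).

(* sum of a real family over a countable index set (meaningful for absolutely
   summable families): sum of positive parts minus sum of negative parts *)
Definition zsum (I : choiceType) (f : I -> R) : R :=
  fine (\esum_(i in [set: I]) (Num.max (f i) 0)%:E)%E -
  fine (\esum_(i in [set: I]) (Num.max (- f i) 0)%:E)%E.

Definition zsumv (I : choiceType) p (f : I -> 'cV[R]_p) : 'cV[R]_p :=
  \col_i zsum (fun k => f k i 0).

Definition toep nu p q (M : Zl nu -> 'M[R]_(p, q)) (v : Zl nu -> 'cV[R]_q)
  : Zl nu -> 'cV[R]_p := fun j => zsumv (fun k => M (j - k) *m v k).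

Definition l2sq nu p (v : Zl nu -> 'cV[R]_p) : \bar R :=
  (\esum_(k in [set: Zl nu]) (sqnormR (v k))%:E)%E.

Definition fchar nu (l : Zl nu) (s : 'rV[R]_nu) : C :=
  let th := \sum_i (l 0 i)%:~R * s 0 i in
  (cos th)%:C - 'i * (sin th)%:C.

Definition sq_ind nu N (k : 'rV['I_(2 * N + 1)]_nu) : Zl nu :=
  \row_i ((k 0 i : nat)%:Z - N%:Z).

Definition psum nu p q N (M : Zl nu -> 'M[R]_(p, q)) (s : 'rV[R]_nu)
  : 'M[C]_(p, q) :=
  \sum_(k : 'rV['I_(2 * N + 1)]_nu)
     fchar (sq_ind k) s *: map_mx (real_complex R) (M (sq_ind k)).

(* iterated Lebesgue integral over the torus [-pi,pi)^k; a point is encoded by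
   a sequence whose first k entries are the coordinates *)
Fixpoint torus_int (k : nat) (f : (nat -> R) -> \bar R) : \bar R :=
  match k with
  | 0 => f (fun _ => 0)
  | k'.+1 => (\int[lebesgue_measure]_(x in `[(- pi)%R, pi[)
                torus_int k' (fun s => f (fun i => if i == k' then x else s i)))%E
  end.

Definition rv_of_seq nu (s : nat -> R) : 'rV[R]_nu := \row_i s i.

Definition inT nu (s : 'rV[R]_nu) : Prop := forall i, - pi <= s 0 i < pi.

Definition inbox d (a b x : 'rV[R]_d) : Prop := forall i, a 0 i <= x 0 i <= b 0 i.
Definition boxvol d (a b : 'rV[R]_d) : R := \prod_i Num.max (b 0 i - a 0 i) 0.

Definition null_rV d (N : set 'rV[R]_d) : Prop :=
  forall e : R, 0 < e -> exists a b : nat -> 'rV[R]_d,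
    N `<=` \bigcup_k [set x | inbox (a k) (b k) x] /\
    (\sum_(0 <= k <oo) (boxvol (a k) (b k))%:E < e%:E)%E.

Definition boxes d : set (set 'rV[R]_d) :=
  [set B | exists a b, B = [set x | inbox a b x]].

Definition borel_fun d (f : 'rV[R]_d -> R) : Prop :=
  forall B : set R, measurable B -> <<s @boxes d >> (f @^-1` B).

Definition is_symbol nu p q (M : Zl nu -> 'M[R]_(p, q))
    (Msym : 'rV[R]_nu -> 'M[C]_(p, q)) : Prop :=
  (forall i j, borel_fun (fun s => complex.Re (Msym s i j)) /\
               borel_fun (fun s => complex.Im (Msym s i j))) /\
  (exists K : R, null_rV [set s | inT s /\ K < sqnormC (Msym s)]) /\
  (forall i j,
     (fun N : nat => torus_int nu (fun s =>
        (cabs2 (psum N M (rv_of_seq nu s) i j - Msym (rv_of_seq nu s) i j))%:E))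
       @ \oo --> 0%E).

Definition hurwitz n (M : 'M[C]_n) : Prop :=
  forall l : C, eigenvalue M l -> complex.Re l < 0.

Definition adjmx p q (M : 'M[C]_(p, q)) : 'M[C]_(q, p) := (map_mx (@conjc R) M)^T.

Definition psdmx p (M : 'M[C]_p) : Prop :=
  forall v : 'cV[C]_p, 0 <= (adjmx v *m M *m v) 0 0.

Definition transfer nu n m r (As : 'rV[R]_nu -> 'M[C]_n)
    (Bs : 'rV[R]_nu -> 'M[C]_(n, m)) (Cs : 'rV[R]_nu -> 'M[C]_(r, n))
    (Ds : 'rV[R]_nu -> 'M[C]_(r, m)) (z : C) (s : 'rV[R]_nu) : 'M[C]_(r, m) :=
  Cs s *m invmx (z%:M - As s) *m Bs s + Ds s.

Definition Emx nu n m r As Bs Cs Ds (Gs : 'rV[R]_nu -> 'M[C]_(m, r))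
    (w : R) (s : 'rV[R]_nu) : 'M[C]_m :=
  let F := @transfer nu n m r As Bs Cs Ds ('i * w%:C) s in
  adjmx F *m adjmx (Gs s) + Gs s *m F.

Definition ae_psd nu n m r As Bs Cs Ds Gs : Prop :=
  null_rV [set z : 'rV[R]_(1 + nu) | exists (w : R) (s : 'rV[R]_nu),
     z = row_mx (\row_(_ < 1) w) s /\ inT s /\
     ~ psdmx (@Emx nu n m r As Bs Cs Ds Gs w s)].

Definition admissible nu m (u : R -> Zl nu -> 'cV[R]_m) : Prop :=
  (forall k i, measurable_fun [set: R] (fun t => u t k i 0)) /\
  (forall T : R, 0 < T ->
     (\int[lebesgue_measure]_(t in `[0%R, T]) l2sq (u t) < +oo)%E).

Definition is_state nu n m (A : Zl nu -> 'M[R]_n) (B : Zl nu -> 'M[R]_(n, m))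
    (u : R -> Zl nu -> 'cV[R]_m) (x : R -> Zl nu -> 'cV[R]_n) : Prop :=
  (forall j, x 0 j = 0) /\
  (forall T : R, 0 < T -> exists K : R, forall t, 0 <= t <= T ->
      (l2sq (x t) <= K%:E)%E) /\
  (forall t : R, 0 <= t -> forall j i,
     let g := fun tau => (toep A (x tau) j + toep B (u tau) j) i 0 in
     lebesgue_measure.-integrable `[0%R, t] (fun tau => (g tau)%:E) /\
     x t j i 0 = fine (\int[lebesgue_measure]_(tau in `[0%R, t]) (g tau)%:E)%E).

Definition output nu n m r (C : Zl nu -> 'M[R]_(r, n)) (D : Zl nu -> 'M[R]_(r, m))
    (x : Zl nu -> 'cV[R]_n) (u : Zl nu -> 'cV[R]_m) : Zl nu -> 'cV[R]_r :=
  fun j => toep C x j + toep D u j.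

Definition supply nu m r (G : Zl nu -> 'M[R]_(m, r))
    (u : Zl nu -> 'cV[R]_m) (y : Zl nu -> 'cV[R]_r) : R :=
  zsum (fun j => ((u j)^T *m toep G y j) 0 0).

Definition passive nu n m r A B C D (G : Zl nu -> 'M[R]_(m, r)) : Prop :=
  forall (u : R -> Zl nu -> 'cV[R]_m) (x : R -> Zl nu -> 'cV[R]_n),
    admissible u -> @is_state nu n m A B u x ->
    forall T : R, 0 < T ->
      (0 <= \int[lebesgue_measure]_(t in `[0%R, T])
              (supply G (u t) (@output nu n m r C D (x t) (u t)))%:E)%E.

End Defs.

(* Main.v *)
Require Import Defs.
From HB Require Import structures.
From mathcomp Require Import all_boot all_order all_algebra.
From mathcomp Require Import all_classical all_reals all_analysis.
From mathcomp Require Import measurable_realfun complex ring lra zify.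
Set Implicit Arguments. Unset Strict Implicit. Unset Printing Implicit Defensive.
Import Order.TTheory GRing.Theory Num.Theory.
Import numFieldNormedType.Exports.
Local Open Scope classical_set_scope.
Local Open Scope ring_scope.

(**
For one frequency sigma the network is an n-dimensional system with state equation
x' = A(sigma) x + B(sigma) v, and Parseval's identity over the torus writes the work of a
finitely supported input u as the integral over sigma of Re q_sigma(u^(sigma)), where
q_sigma(v) is the work int_0^T v^* G(sigma) y of that system.

Sufficiency: if E(omega, sigma) >= 0 for all omega, then Re q_sigma >= 0.  Approximating v by
trigonometric polynomials in time of period P, the output differs from the periodic regime by a
term decaying like e^(t A), and in the periodic regime the work over a period is a sum of
the forms v_k^* E v_k.  A general input is truncated in space and in amplitude; Gronwall's
inequality in l2 controls the state, hence the work.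

Necessity: the inputs p_k e^(i omega t) c, with p the coefficients of a product of Fejer means
of indicators of intervals, localize the integral over sigma on small cubes, so that
Re q_sigma(e^(i omega t) c) >= 0 for almost every sigma; letting the horizon tend to infinity
gives c^* E(omega, sigma) c >= 0 for rational omega and c, then for all by continuity.
*)

(** * Complex-valued integrals and series *)

(** The time side uses neither the matrix exponential nor convolutions: the state is the series of
    [A^k B] against iterated integrals of the input. Each term is a finite sum of products of a
    function of sigma and a function of t, so time and frequency integrals are exchanged term by
    term, without joint measurability. Symbols are only essentially bounded; the analysis takes
    place on a measurable set [D], the torus minus a null set, on which they are bounded and the
    characters stay orthogonal. The data are real while the analysis is complex, so the Fourier
    coefficients of the responses must be shown real before they can be read as a state of the
    network. Passivity speaks of every state driven by u, whose supply rate is not shown to be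
    measurable in time; in the sufficiency it is compared pointwise with the supply rate of states
    built from transforms. The frequency condition holds almost everywhere in R x T^nu with null
    sets given by box covers; instead of Fubini it is enough that, for almost every sigma, no
    rational interval of frequencies is entirely bad, because E is continuous in omega. *)

Section ComplexNorm.
Variable R : realType.
Local Notation C := R[i].
Implicit Types z w : C.

(** The modulus on [R[i]] takes its values in [R[i]]. This norm is real-valued, submultiplicative,
    and splits into real and imaginary parts as the integrals below do. *)
Definition n1 z : R := `|complex.Re z| + `|complex.Im z|.

Lemma cReD z w : complex.Re (z + w) = complex.Re z + complex.Re w.
Proof. by case: z w => [a b] [c d]. Qed.
Lemma cImD z w : complex.Im (z + w) = complex.Im z + complex.Im w.
Proof. by case: z w => [a b] [c d]. Qed.
Lemma cReN z : complex.Re (- z) = - complex.Re z.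
Proof. by case: z. Qed.
Lemma cImN z : complex.Im (- z) = - complex.Im z.
Proof. by case: z. Qed.
Lemma cReM z w : complex.Re (z * w) =
  complex.Re z * complex.Re w - complex.Im z * complex.Im w.
Proof. by case: z w => [a b] [c d]. Qed.
Lemma cImM z w : complex.Im (z * w) =
  complex.Re z * complex.Im w + complex.Im z * complex.Re w.
Proof. by case: z w => [a b] [c d]. Qed.
Lemma cReJ z : complex.Re (conjc z) = complex.Re z.
Proof. by case: z. Qed.
Lemma cImJ z : complex.Im (conjc z) = - complex.Im z.
Proof. by case: z. Qed.
Lemma cRe_sum I (r : seq I) (P : pred I) (F : I -> C) :
  complex.Re (\sum_(i <- r | P i) F i) = \sum_(i <- r | P i) complex.Re (F i).
Proof. by apply: (big_morph _ cReD). Qed.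
Lemma cIm_sum I (r : seq I) (P : pred I) (F : I -> C) :
  complex.Im (\sum_(i <- r | P i) F i) = \sum_(i <- r | P i) complex.Im (F i).
Proof. by apply: (big_morph _ cImD). Qed.
Lemma cext z w : complex.Re z = complex.Re w -> complex.Im z = complex.Im w -> z = w.
Proof. by case: z w => [a b] [c d] /= -> ->. Qed.

Lemma n1_ge0 z : 0 <= n1 z.
Proof. by rewrite addr_ge0. Qed.
Lemma n10 : n1 0 = 0.
Proof. by rewrite /n1 /= normr0 addr0. Qed.
Lemma n1N z : n1 (- z) = n1 z.
Proof. by rewrite /n1 cReN cImN !normrN. Qed.
Lemma n1J z : n1 (conjc z) = n1 z.
Proof. by rewrite /n1 cReJ cImJ !normrN. Qed.
Lemma n1D z w : n1 (z + w) <= n1 z + n1 w.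
Proof.
rewrite /n1 cReD cImD addrACA; apply: lerD; exact: ler_normD.
Qed.
Lemma n1M z w : n1 (z * w) <= n1 z * n1 w.
Proof.
rewrite /n1 cReM cImM mulrDl !mulrDr -!normrM.
apply: (@le_trans _ _ ((`|complex.Re z * complex.Re w| + `|complex.Im z * complex.Im w|) +
  (`|complex.Re z * complex.Im w| + `|complex.Im z * complex.Re w|))).
  by apply: lerD; [exact: ler_normB|exact: ler_normD].
lra.
Qed.
Lemma n1_real (x : R) : n1 x%:C%C = `|x|.
Proof. by rewrite /n1 /= normr0 addr0. Qed.
Lemma n1_sum I (r : seq I) (P : pred I) (F : I -> C) :
  n1 (\sum_(i <- r | P i) F i) <= \sum_(i <- r | P i) n1 (F i).
Proof.
elim/big_rec2: _ => [|i x y _ yx]; first by rewrite n10.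
by rewrite (le_trans (n1D _ _))// lerD2l.
Qed.
Lemma n1_eq0 z : n1 z = 0 -> z = 0.
Proof.
move=> /eqP; rewrite paddr_eq0// !normr_eq0 => /andP[/eqP a /eqP b].
by apply: cext; rewrite /= ?a ?b.
Qed.
Lemma le_Re_n1 z : `|complex.Re z| <= n1 z.
Proof. by rewrite lerDl. Qed.
Lemma le_Im_n1 z : `|complex.Im z| <= n1 z.
Proof. by rewrite lerDr. Qed.
Lemma cabs2_le_n1 z : cabs2 z <= n1 z ^+ 2.
Proof.
rewrite /cabs2 /n1 sqrrD !real_normK ?num_real//.
have : 0 <= `|complex.Re z| * `|complex.Im z| *+ 2 by rewrite mulrn_wge0 ?mulr_ge0.
lra.
Qed.
Lemma n1_le_cabs2 z : n1 z ^+ 2 <= 2 * cabs2 z.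
Proof.
rewrite /cabs2 /n1 sqrrD !real_normK ?num_real//.
rewrite -[complex.Re z ^+ 2]real_normK ?num_real//.
rewrite -[complex.Im z ^+ 2]real_normK ?num_real//.
have := sqr_ge0 (`|complex.Re z| - `|complex.Im z|); lra.
Qed.
Lemma cabs2M z w : cabs2 (z * w) = cabs2 z * cabs2 w.
Proof. by rewrite /cabs2 cReM cImM; ring. Qed.
Lemma cabs2_ge0 z : 0 <= cabs2 z.
Proof. by rewrite addr_ge0 ?sqr_ge0. Qed.
Lemma mulJ_cabs2 z : conjc z * z = (cabs2 z)%:C%C.
Proof. by case: z => a b; apply: cext => /=; rewrite /cabs2 /=; ring. Qed.

(** The entrywise sum is submultiplicative for products of all shapes and dominates each entry,
    which is all that the estimates use. *)
Definition nrm p q (M : 'M[C]_(p, q)) : R := \sum_i \sum_j n1 (M i j).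

Lemma nrm_ge0 p q (M : 'M[C]_(p, q)) : 0 <= nrm M.
Proof. by rewrite sumr_ge0// => i _; rewrite sumr_ge0// => j _; exact: n1_ge0. Qed.
Lemma nrm0 p q : nrm (0 : 'M[C]_(p, q)) = 0.
Proof. by rewrite /nrm big1// => i _; rewrite big1// => j _; rewrite mxE n10. Qed.
Lemma nrmD p q (M N : 'M[C]_(p, q)) : nrm (M + N) <= nrm M + nrm N.
Proof.
rewrite /nrm -big_split/=; apply: ler_sum => i _; rewrite -big_split/=.
by apply: ler_sum => j _; rewrite mxE n1D.
Qed.
Lemma nrmN p q (M : 'M[C]_(p, q)) : nrm (- M) = nrm M.
Proof. by apply: eq_bigr => i _; apply: eq_bigr => j _; rewrite mxE n1N. Qed.
Lemma nrm_entry p q (M : 'M[C]_(p, q)) i j : n1 (M i j) <= nrm M.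
Proof.
rewrite /nrm (bigD1 i)//= (bigD1 j)//= -addrA lerDl addr_ge0//.
  by rewrite sumr_ge0// => k _; exact: n1_ge0.
by rewrite sumr_ge0// => k _; rewrite sumr_ge0// => l _; exact: n1_ge0.
Qed.
Lemma nrmZ p q z (M : 'M[C]_(p, q)) : nrm (z *: M) <= n1 z * nrm M.
Proof.
rewrite /nrm mulr_sumr; apply: ler_sum => i _; rewrite mulr_sumr.
by apply: ler_sum => j _; rewrite mxE n1M.
Qed.
Lemma nrmM p q s (M : 'M[C]_(p, q)) (N : 'M[C]_(q, s)) :
  nrm (M *m N) <= nrm M * nrm N.
Proof.
rewrite /nrm mulr_suml; apply: ler_sum => i _.
apply: (@le_trans _ _ (\sum_j \sum_k n1 (M i k) * n1 (N k j))).
  apply: ler_sum => j _; rewrite mxE (le_trans (n1_sum _ _ _))//.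
  by apply: ler_sum => k _; exact: n1M.
rewrite exchange_big/= mulr_suml; apply: ler_sum => k _.
rewrite -mulr_sumr ler_wpM2l ?n1_ge0//.
rewrite [leRHS](bigD1 k)//= lerDl sumr_ge0// => l _.
by rewrite sumr_ge0// => j _; exact: n1_ge0.
Qed.
Lemma nrm_sum p q I (r : seq I) (P : pred I) (F : I -> 'M[C]_(p, q)) :
  nrm (\sum_(i <- r | P i) F i) <= \sum_(i <- r | P i) nrm (F i).
Proof.
elim/big_rec2: _ => [|i x y _ yx]; first by rewrite nrm0.
by rewrite (le_trans (nrmD _ _))// lerD2l.
Qed.
Lemma nrm_adj p q (M : 'M[C]_(p, q)) : nrm (adjmx M) = nrm M.
Proof.
rewrite /nrm exchange_big/=; apply: eq_bigr => i _; apply: eq_bigr => j _.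
by rewrite !mxE n1J.
Qed.

End ComplexNorm.

Section ComplexIntegral.
Context d (T : measurableType d) (R : realType) (mu : {measure set T -> \bar R}).
Local Notation C := R[i].
Implicit Types (D : set T) (f g : T -> C).

Definition cmf D f := measurable_fun D (fun x => complex.Re (f x)) /\
  measurable_fun D (fun x => complex.Im (f x)).
(** Bounded and measurable rather than integrable: on a set of finite measure this gives
    integrability, and the class is closed under products. *)
Definition cbm D f := cmf D f /\ exists M : R, forall x, D x -> n1 (f x) <= M.

Definition Cint D f : C :=
  ((\int[mu]_(x in D) complex.Re (f x)) +i* (\int[mu]_(x in D) complex.Im (f x)))%C.

Lemma cmf_cst D z : cmf D (fun=> z).
Proof. by split; exact: measurable_cst. Qed.
Lemma cmfD D f g : cmf D f -> cmf D g -> cmf D (fun x => f x + g x).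
Proof.
move=> [f1 f2] [g1 g2]; split.
  under eq_fun do rewrite cReD; exact: measurable_funD.
under eq_fun do rewrite cImD; exact: measurable_funD.
Qed.
Lemma cmfN D f : cmf D f -> cmf D (fun x => - f x).
Proof.
move=> [f1 f2]; split.
  under eq_fun do rewrite cReN; exact: measurableT_comp.
under eq_fun do rewrite cImN; exact: measurableT_comp.
Qed.
Lemma cmfM D f g : cmf D f -> cmf D g -> cmf D (fun x => f x * g x).
Proof.
move=> [f1 f2] [g1 g2]; split.
  under eq_fun do rewrite cReM.
  by apply: measurable_funB; exact: measurable_funM.
under eq_fun do rewrite cImM.
by apply: measurable_funD; exact: measurable_funM.
Qed.
Lemma cmfJ D f : cmf D f -> cmf D (fun x => conjc (f x)).
Proof.
move=> [f1 f2]; split; first by under eq_fun do rewrite cReJ.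
under eq_fun do rewrite cImJ; exact: measurableT_comp.
Qed.
Lemma cmf_real D (h : T -> R) : measurable_fun D h -> cmf D (fun x => (h x)%:C%C).
Proof. by move=> mh; split => //=; exact: measurable_cst. Qed.
Lemma cmf_sum D I (r : seq I) (F : I -> T -> C) :
  (forall i, cmf D (F i)) -> cmf D (fun x => \sum_(i <- r) F i x).
Proof.
move=> mF; elim: r => [|i r ih].
  under eq_fun do rewrite big_nil; exact: cmf_cst.
under eq_fun do rewrite big_cons; exact: cmfD.
Qed.

Lemma cbm_cst D z : cbm D (fun=> z).
Proof. by split; [exact: cmf_cst|exists (n1 z)]. Qed.
Lemma cbmD D f g : cbm D f -> cbm D g -> cbm D (fun x => f x + g x).
Proof.
move=> [mf [M fM]] [mg [N gN]]; split; first exact: cmfD.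
exists (M + N) => x Dx; rewrite (le_trans (n1D _ _))// lerD ?fM ?gN//.
Qed.
Lemma cbmN D f : cbm D f -> cbm D (fun x => - f x).
Proof.
by move=> [mf [M fM]]; split; [exact: cmfN|exists M => x Dx; rewrite n1N fM].
Qed.
Lemma cbmB D f g : cbm D f -> cbm D g -> cbm D (fun x => f x - g x).
Proof. by move=> bf bg; apply: cbmD => //; exact: cbmN. Qed.
Lemma cbmM D f g : cbm D f -> cbm D g -> cbm D (fun x => f x * g x).
Proof.
move=> [mf [M fM]] [mg [N gN]]; split; first exact: cmfM.
exists (M * N) => x Dx; rewrite (le_trans (n1M _ _))// ler_pM ?n1_ge0 ?fM ?gN//.
Qed.
Lemma cbmJ D f : cbm D f -> cbm D (fun x => conjc (f x)).
Proof.
by move=> [mf [M fM]]; split; [exact: cmfJ|exists M => x Dx; rewrite n1J fM].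
Qed.
Lemma cbm_sum D I (r : seq I) (F : I -> T -> C) :
  (forall i, cbm D (F i)) -> cbm D (fun x => \sum_(i <- r) F i x).
Proof.
move=> mF; elim: r => [|i r ih].
  under eq_fun do rewrite big_nil; exact: cbm_cst.
under eq_fun do rewrite big_cons; exact: cbmD.
Qed.
Lemma cbmZ D z f : cbm D f -> cbm D (fun x => z * f x).
Proof. by move=> bf; apply: cbmM => //; exact: cbm_cst. Qed.
Lemma sub_cbm D E f : measurable E -> D `<=` E -> cbm E f -> cbm D f.
Proof.
move=> mE DE [[f1 f2] [M fM]]; split; last by exists M => x /DE; exact: fM.
by split; [apply: measurable_funS f1|apply: measurable_funS f2].
Qed.
Lemma eq_cbm D f g : (forall x, D x -> f x = g x) -> cbm D f -> cbm D g.
Proof.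
move=> fg [[f1 f2] [M fM]]; split; last by exists M => x Dx; rewrite -fg ?fM.
by split; [apply: eq_measurable_fun f1|apply: eq_measurable_fun f2];
  move=> x; rewrite inE => Dx; rewrite fg.
Qed.

Section finite.
Variable D : set T.
Hypotheses (mD : measurable D) (fD : (mu D < +oo)%E).

Lemma bounded_integrable (h : T -> R) (M : R) :
  measurable_fun D h -> (forall x, D x -> `|h x| <= M) ->
  mu.-integrable D (EFin \o h).
Proof.
move=> mh hM; apply: measurable_bounded_integrable => //.
exists M; split; first by rewrite num_real.
by move=> N /ltW MN x Dx; exact: le_trans (hM _ Dx) MN.
Qed.

Lemma cbm_iRe f : cbm D f -> mu.-integrable D (EFin \o (fun x => complex.Re (f x))).
Proof.
move=> [[f1 f2] [M fM]]; apply: (@bounded_integrable _ M) => // x Dx.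
by rewrite (le_trans (le_Re_n1 _))// fM.
Qed.
Lemma cbm_iIm f : cbm D f -> mu.-integrable D (EFin \o (fun x => complex.Im (f x))).
Proof.
move=> [[f1 f2] [M fM]]; apply: (@bounded_integrable _ M) => // x Dx.
by rewrite (le_trans (le_Im_n1 _))// fM.
Qed.
Lemma cbm_mn1 f : cbm D f -> measurable_fun D (fun x => n1 (f x)).
Proof.
move=> [[f1 f2] _]; apply: measurable_funD; exact: measurableT_comp.
Qed.
Lemma cbm_in1 f : cbm D f -> mu.-integrable D (EFin \o (fun x => n1 (f x))).
Proof.
move=> bf; have [_ [M fM]] := bf; apply: (@bounded_integrable _ M) => //.
  exact: cbm_mn1.
by move=> x Dx; rewrite ger0_norm ?n1_ge0 ?fM.
Qed.

Lemma CintD f g : cbm D f -> cbm D g ->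
  Cint D (fun x => f x + g x) = Cint D f + Cint D g.
Proof.
move=> bf bg; apply: cext; rewrite ?cReD ?cImD /=.
  rewrite -RintegralD//; [|exact: cbm_iRe|exact: cbm_iRe].
  by apply: eq_Rintegral => x _; rewrite cReD.
rewrite -RintegralD//; [|exact: cbm_iIm|exact: cbm_iIm].
by apply: eq_Rintegral => x _; rewrite cImD.
Qed.
Lemma CintZ z f : cbm D f -> Cint D (fun x => z * f x) = z * Cint D f.
Proof.
have aux (a b : R) (u v : T -> R) : mu.-integrable D (EFin \o u) ->
    mu.-integrable D (EFin \o v) ->
    \int[mu]_(x in D) (a * u x + b * v x) =
    a * \int[mu]_(x in D) u x + b * \int[mu]_(x in D) v x.
  move=> iu iv; rewrite RintegralD ?RintegralZl//.
    by have := integrableZl mD a iu.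
  by have := integrableZl mD b iv.
move=> bf; apply: cext; rewrite ?cReM ?cImM /=.
  rewrite -mulNr -aux; [|exact: cbm_iRe|exact: cbm_iIm].
  by apply: eq_Rintegral => x _; rewrite cReM mulNr.
rewrite -aux; [|exact: cbm_iIm|exact: cbm_iRe].
by apply: eq_Rintegral => x _; rewrite cImM.
Qed.
Lemma CintN f : cbm D f -> Cint D (fun x => - f x) = - Cint D f.
Proof.
by move=> bf; rewrite -mulN1r -CintZ//; congr Cint; apply: funext => x; rewrite mulN1r.
Qed.
Lemma CintB f g : cbm D f -> cbm D g ->
  Cint D (fun x => f x - g x) = Cint D f - Cint D g.
Proof. by move=> bf bg; rewrite CintD ?CintN//; exact: cbmN. Qed.
Lemma CintJ f : cbm D f -> Cint D (fun x => conjc (f x)) = conjc (Cint D f).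
Proof.
move=> bf; apply: cext; rewrite ?cReJ ?cImJ /=.
  by apply: eq_Rintegral => x _; rewrite cReJ.
rewrite -mulN1r -RintegralZl//; last exact: cbm_iIm.
by apply: eq_Rintegral => x _; rewrite cImJ mulN1r.
Qed.
Lemma Cint_cst z : Cint D (fun=> z) = z * (fine (mu D))%:C%C.
Proof. by case: z => a b; apply: cext => /=; rewrite Rintegral_cst//; ring. Qed.
Lemma Cint0 : Cint D (fun=> 0) = 0.
Proof. by rewrite Cint_cst mul0r. Qed.
Lemma Cint_sum I (r : seq I) (F : I -> T -> C) : (forall i, cbm D (F i)) ->
  Cint D (fun x => \sum_(i <- r) F i x) = \sum_(i <- r) Cint D (F i).
Proof.
move=> bF; elim: r => [|i r ih].
  by rewrite big_nil -[RHS]Cint0; congr Cint; apply: funext => x; rewrite big_nil.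
rewrite big_cons -ih -CintD//; last exact: cbm_sum.
by congr Cint; apply: funext => x; rewrite big_cons.
Qed.
Lemma eq_Cint f g : (forall x, D x -> f x = g x) -> Cint D f = Cint D g.
Proof.
by move=> fg; apply: cext => /=; apply: eq_Rintegral => x; rewrite inE => Dx; rewrite fg.
Qed.
Lemma n1_Cint f : cbm D f -> n1 (Cint D f) <= \int[mu]_(x in D) n1 (f x).
Proof.
move=> bf; rewrite {1}/n1 /=.
have mu_n (h : T -> R) : mu.-integrable D (EFin \o h) ->
   mu.-integrable D (EFin \o (fun x => `|h x|)).
  by move=> ih; exact: integrable_norm.
rewrite [leRHS]RintegralD//; [|exact/mu_n/cbm_iRe|exact/mu_n/cbm_iIm].
by apply: lerD; apply: le_normr_Rintegral => //; [exact: cbm_iRe|exact: cbm_iIm].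
Qed.
Lemma n1_Cint_le f (M : R) : cbm D f -> (forall x, D x -> n1 (f x) <= M) ->
  n1 (Cint D f) <= M * fine (mu D).
Proof.
move=> bf fM; rewrite (le_trans (n1_Cint bf))// -Rintegral_cst//.
apply: le_Rintegral => //; first exact: cbm_in1.
by apply: (@bounded_integrable _ `|M|) => //; exact: measurable_cst.
Qed.

End finite.

End ComplexIntegral.

Section ComplexSeries.
Variable R : realType.
Local Notation C := R[i].
Implicit Types (h k : nat -> C) (m : nat -> R).

Definition csum h : C := (limn (series (fun p => complex.Re (h p))) +i*
  limn (series (fun p => complex.Im (h p))))%C.

(** Domination by one convergent real series: it gives convergence of both parts at once, and with a
    majorant uniform in a parameter it also justifies integrating term by term. *)
Definition csbl h := exists2 m, cvgn (series m) & forall p, n1 (h p) <= m p.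

Lemma csbl_Re h : csbl h -> cvgn (series (fun p => complex.Re (h p))).
Proof.
move=> [m cm hm]; apply: normed_cvg; apply: series_le_cvg cm => p //=.
  exact: le_trans (n1_ge0 _) (hm p).
exact: le_trans (le_Re_n1 _) (hm p).
Qed.
Lemma csbl_Im h : csbl h -> cvgn (series (fun p => complex.Im (h p))).
Proof.
move=> [m cm hm]; apply: normed_cvg; apply: series_le_cvg cm => p //=.
  exact: le_trans (n1_ge0 _) (hm p).
exact: le_trans (le_Im_n1 _) (hm p).
Qed.

Lemma csblD h k : csbl h -> csbl k -> csbl (fun p => h p + k p).
Proof.
move=> [m cm hm] [m' cm' km]; exists (m + m'); first exact: is_cvg_seriesD.
by move=> p; rewrite (le_trans (n1D _ _))// lerD.
Qed.
Lemma csblZ z h : csbl h -> csbl (fun p => z * h p).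
Proof.
move=> [m cm hm]; exists (n1 z *: m); first exact: is_cvg_seriesZ.
by move=> p; rewrite (le_trans (n1M _ _))// ler_wpM2l ?n1_ge0.
Qed.
Lemma csbl0 : csbl (fun=> 0).
Proof.
exists (0 *: 0); last by move=> p; rewrite n10 scale0r.
rewrite scale0r (_ : series 0 = 0); first exact: is_cvg_cst.
by apply: funext => n; rewrite /series /= big1.
Qed.
Lemma csbl_sum I (r : seq I) (F : I -> nat -> C) : (forall i, csbl (F i)) ->
  csbl (fun p => \sum_(i <- r) F i p).
Proof.
move=> cF; elim: r => [|i r ih].
  under eq_fun do rewrite big_nil; exact: csbl0.
under eq_fun do rewrite big_cons; exact: csblD.
Qed.

Lemma csumD h k : csbl h -> csbl k ->
  csum (fun p => h p + k p) = csum h + csum k.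
Proof.
move=> ch ck; apply: cext; rewrite ?cReD ?cImD /=.
  rewrite -lim_seriesD; [|exact: csbl_Re..].
  by congr (limn (series _)); apply: funext => p; rewrite cReD.
rewrite -lim_seriesD; [|exact: csbl_Im..].
by congr (limn (series _)); apply: funext => p; rewrite cImD.
Qed.
Lemma csumZ z h : csbl h -> csum (fun p => z * h p) = z * csum h.
Proof.
have aux (a b : R) (u v : R^nat) : cvgn (series u) -> cvgn (series v) ->
    limn (series (fun p => a * u p + b * v p)) =
    a * limn (series u) + b * limn (series v).
  move=> cu cv; have := @lim_seriesZ R u a cu; have := @lim_seriesZ R v b cv.
  rewrite /GRing.scale /= => <- <-; rewrite -lim_seriesD//.
  - exact: is_cvg_seriesZ.
  - exact: is_cvg_seriesZ.
move=> ch; apply: cext; rewrite ?cReM ?cImM /=.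
  rewrite -mulNr -aux; [|exact: csbl_Re|exact: csbl_Im].
  by congr (limn (series _)); apply: funext => p; rewrite cReM mulNr.
rewrite -aux; [|exact: csbl_Im|exact: csbl_Re].
by congr (limn (series _)); apply: funext => p; rewrite cImM.
Qed.
Lemma csum0 : csum (fun=> 0) = 0.
Proof.
have -> : (fun=> 0 : C) = (fun p : nat => 0 * 0 :> C).
  by apply: funext => p; rewrite mul0r.
rewrite csumZ ?mul0r//; exact: csbl0.
Qed.
Lemma csum_sum I (r : seq I) (F : I -> nat -> C) : (forall i, csbl (F i)) ->
  csum (fun p => \sum_(i <- r) F i p) = \sum_(i <- r) csum (F i).
Proof.
move=> cF; elim: r => [|i r ih].
  by rewrite big_nil -[RHS]csum0; congr csum; apply: funext => x; rewrite big_nil.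
rewrite big_cons -ih -csumD//; last exact: csbl_sum.
by congr csum; apply: funext => x; rewrite big_cons.
Qed.
Lemma n1_csum h m : cvgn (series m) -> (forall p, n1 (h p) <= m p) ->
  n1 (csum h) <= limn (series m).
Proof.
move=> cm hm; have ch : csbl h by exists m.
have m0 p : 0 <= m p by exact: le_trans (n1_ge0 _) (hm p).
have cR : cvgn (series (fun p => `|complex.Re (h p)|)).
  by apply: series_le_cvg cm => p //; exact: le_trans (le_Re_n1 _) (hm p).
have cI : cvgn (series (fun p => `|complex.Im (h p)|)).
  by apply: series_le_cvg cm => p //; exact: le_trans (le_Im_n1 _) (hm p).
rewrite /n1 /=.
have eqs : series m = series m by [].
apply: (@le_trans _ _ (limn (series (fun p => `|complex.Re (h p)|)) +
   limn (series (fun p => `|complex.Im (h p)|)))).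
  by apply: lerD; apply: lim_series_norm.
rewrite -lim_seriesD//; apply: lim_series_le => //; exact: is_cvg_seriesD.
Qed.
Lemma csumS h : csbl h -> csum h = h 0%N + csum (fun p => h p.+1).
Proof.
have aux (u : R^nat) : cvgn (series u) ->
    limn (series u) = u 0%N + limn (series (fun p => u p.+1)).
  move=> cu; have : series u n @[n --> \oo] --> limn (series u) by [].
  rewrite -(cvg_shiftS (series u)) => /cvg_lim <-//.
  rewrite [X in limn X](_ : _ =
     (fun n => u 0%N + series (fun p => u p.+1) n)); last first.
    by apply: funext => n; rewrite /series /= big_nat_recl.
  apply/cvg_lim => //; apply: cvgD; first exact: cvg_cst.
  have cu' : cvgn (fun n => series u n.+1) by apply/cvg_ex; exists (limn (series u)); rewrite (cvg_shiftS (series u)).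
  rewrite (_ : series _ = (fun n => series u n.+1 - u 0%N)).
    by apply: is_cvgB cu' _; exact: is_cvg_cst.
  by apply: funext => n; rewrite /series /= big_nat_recl// addrAC subrr add0r.
move=> ch; apply: cext; rewrite ?cReD ?cImD /=.
  by apply: (aux (fun p => complex.Re (h p))); exact: csbl_Re.
by apply: (aux (fun p => complex.Im (h p))); exact: csbl_Im.
Qed.
End ComplexSeries.

Lemma Rint_sum d (T : measurableType d) (R : realType) (mu : {measure set T -> \bar R})
    (D : set T) I (r : seq I) (F : I -> T -> R) : measurable D ->
  (forall i, mu.-integrable D (EFin \o F i)) ->
  \int[mu]_(x in D) (\sum_(i <- r) F i x) = \sum_(i <- r) \int[mu]_(x in D) F i x.
Proof.
move=> mD iF.
have iS r' : mu.-integrable D (EFin \o (fun x => \sum_(i <- r') F i x)).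
  have := integrable_sum mD r' (P := xpredT) (fun i _ => iF i).
  by apply: eq_integrable => // x _; rewrite /= sumEFin.
elim: r => [|i r ih].
  rewrite big_nil -[RHS](@mul0r _ (fine (mu D))) -Rintegral_cst//.
  by apply: eq_Rintegral => x _; rewrite big_nil.
rewrite big_cons -ih -RintegralD//.
by apply: eq_Rintegral => x _; rewrite big_cons.
Qed.

Section BoundedConvergence.
Context d (T : measurableType d) (R : realType) (mu : {measure set T -> \bar R}).
Variable D : set T.
Hypotheses (mD : measurable D) (fD : (mu D < +oo)%E).

Lemma cvg_EFinr (I : Type) (F : set_system I) (FF : Filter F) (f : I -> R) (l : R) :
  f @ F --> l -> (fun x => (f x)%:E) @ F --> l%:E.
Proof. by move=> fl; apply: cvg_EFin => //; exact: nearW. Qed.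

Lemma bounded_cvg (h : nat -> T -> R) (f : T -> R) (M : R) :
  (forall n, measurable_fun D (h n)) -> (forall n x, D x -> `|h n x| <= M) ->
  (forall x, D x -> h n x @[n --> \oo] --> f x) ->
  \int[mu]_(x in D) h n x @[n --> \oo] --> \int[mu]_(x in D) f x.
Proof.
move=> mh hM hf.
have mf : measurable_fun D f by apply: (measurable_fun_cvg mh).
have := @dominated_convergence _ _ _ mu D mD
  (fun n x => (h n x)%:E) (fun x => (f x)%:E) (cst M%:E).
case.
- by move=> n; exact/measurable_EFinP.
- exact/measurable_EFinP.
- by apply: aeW => x Dx; apply: cvg_EFinr; exact: hf.
- apply: (@bounded_integrable _ _ _ _ _ mD fD _ `|M|) => //.
- by apply: aeW => x n Dx; rewrite /= lee_fin hM.
move=> intf _ h1; apply: fine_cvg; rewrite fineK//.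
exact: integrable_fin_num.
Qed.
End BoundedConvergence.

Section ExchangeSeries.
Context d (T : measurableType d) (R : realType) (mu : {measure set T -> \bar R}).
Variable D : set T.
Hypotheses (mD : measurable D) (fD : (mu D < +oo)%E).
Local Notation C := R[i].

(** Weierstrass majorants bound all partial sums by the sum of [m], so bounded convergence applies
    to the partial sums. *)
Lemma Rintegral_series (h : nat -> T -> R) (m : nat -> R) : cvgn (series m) ->
  (forall p, measurable_fun D (h p)) -> (forall p x, D x -> `|h p x| <= m p) ->
  measurable_fun D (fun x => limn (series (h^~ x))) /\
  \int[mu]_(x in D) limn (series (h^~ x)) =
    limn (series (fun p => \int[mu]_(x in D) h p x)).
Proof.
move=> cm mh hm.
have cN x : D x -> cvgn (series (fun p => `|h p x|)).
  by move=> Dx; apply: series_le_cvg cm => // p; [exact: le_trans (hm p x Dx)|exact: hm].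
have ch x : D x -> cvgn (series (h^~ x)) by move=> Dx; exact/normed_cvg/cN.
have ms n : measurable_fun D (fun x => series (h^~ x) n).
  by rewrite /series /=; exact: measurable_sum.
have ml : measurable_fun D (fun x => limn (series (h^~ x))).
  by apply: (measurable_fun_cvg ms) => x Dx; exact: ch.
split => //.
have ih p : mu.-integrable D (EFin \o h p).
  by apply: (@bounded_integrable _ _ _ _ _ mD fD _ (m p)) => // x Dx; exact: hm.
have bnd x n : D x -> `|series (h^~ x) n| <= limn (series m).
  move=> Dx; rewrite /series /= (le_trans (ler_norm_sum _ _ _))//.
  apply: (@le_trans _ _ (series m n)); first by apply: ler_sum => p _; exact: hm.
  apply: nondecreasing_cvgn_le => //; apply: nondecreasing_series => p _ _.
  exact: le_trans (hm p x Dx).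
have := @bounded_cvg _ _ _ mu D mD fD (fun n x => series (h^~ x) n) _ _ ms (fun n x => bnd x n) ch.
move=> /cvg_lim <-//; congr (limn _); apply: funext => n.
elim: n => [|n ih1].
  rewrite /series /= big_geq// -[RHS](@mul0r _ (fine (mu D))) -Rintegral_cst//.
  by apply: eq_Rintegral => x _; rewrite big_geq.
rewrite seriesSr -ih1 -RintegralD//.
- by apply: eq_Rintegral => x _; rewrite seriesSr.
- apply: (@bounded_integrable _ _ _ _ _ mD fD _ (limn (series m))) => // x Dx.
  exact: bnd.
Qed.

Lemma Cint_csum (h : nat -> T -> C) (m : nat -> R) : cvgn (series m) ->
  (forall p, cmf D (h p)) -> (forall p x, D x -> n1 (h p x) <= m p) ->
  cbm D (fun x => csum (h^~ x)) /\
  Cint mu D (fun x => csum (h^~ x)) = csum (fun p => Cint mu D (h p)).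
Proof.
move=> cm mh hm.
have [r1 r2] := @Rintegral_series (fun p x => complex.Re (h p x)) m cm
  (fun p => (mh p).1) (fun p x Dx => le_trans (le_Re_n1 _) (hm p x Dx)).
have [i1 i2] := @Rintegral_series (fun p x => complex.Im (h p x)) m cm
  (fun p => (mh p).2) (fun p x Dx => le_trans (le_Im_n1 _) (hm p x Dx)).
split; last by apply: cext; [exact: r2|exact: i2].
split; first by split; [exact: r1|exact: i1].
by exists (limn (series m)) => x Dx; apply: n1_csum => // p; exact: hm.
Qed.

End ExchangeSeries.

(** * Response series of a linear system *)

Section TimeIntegral.
Variable R : realType.
Local Notation C := R[i].
Local Notation lam := (@lebesgue_measure R).
Implicit Types (f g : R -> C) (t T : R).

(** Boundedness on each [[0, T]], and not only integrability, makes the class stable under products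
    and primitives. *)
Definition tbf f := forall T, cbm `[0, T] f.

Definition CI f t := Cint lam `[0, t] f.
(** Iterated primitives stand for convolution with [(t - s)^(p-1) / (p-1)!], so no integral in two
    time variables occurs. *)
Definition Ip p f := iter p CI f.

Lemma lam_fin (a b : R) : (lam `[a, b] < +oo)%E.
Proof. by rewrite lebesgue_measure_itv/=; case: ifP => _; rewrite ?ltry// -EFinB ltry. Qed.
Local Hint Resolve lam_fin : core.
Lemma mI (a b : R) : @measurable _ (g_sigma_algebraType (@measurable _ (ocitv_type R))) `[a, b].
Proof. exact: measurable_itv. Qed.

Lemma fine_lam (a b : R) : a <= b -> fine (lam `[a, b]) = b - a.
Proof.
rewrite lebesgue_measure_itv/= lte_fin le_eqVlt => /predU1P[->|->//].
by rewrite ltxx subrr.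
Qed.

Lemma fine_lam_oc (a b : R) : a <= b -> fine (lam `]a, b]) = b - a.
Proof.
rewrite lebesgue_measure_itv/= lte_fin le_eqVlt => /predU1P[->|->//].
by rewrite ltxx subrr.
Qed.

Lemma CI_at0 f : CI f 0 = 0.
Proof. by apply: cext => /=; rewrite set_itv1 Rintegral_set1. Qed.

Lemma CI_split f s t : tbf f -> 0 <= s -> s <= t ->
  CI f t = CI f s + Cint lam `]s, t] f.
Proof.
move=> tf s0 st.
have aux (h : R -> R) : lam.-integrable `[0, t] (EFin \o h) ->
   \int[lam]_(x in `[0, t]) h x = \int[lam]_(x in `[0, s]) h x + \int[lam]_(x in `]s, t]) h x.
  move=> ih; rewrite -Rintegral_setU//.
  - by rewrite -itv_bndbnd_setU ?bnd_simp.
  - by rewrite -itv_bndbnd_setU ?bnd_simp.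
  - apply/disj_set2P; rewrite -subset0 => x /= [].
    by rewrite !in_itv/= => /andP[_ xs] /andP[sx _]; have := lt_le_trans sx xs; rewrite ltxx.
apply: cext; rewrite ?cReD ?cImD /=; apply: aux.
  exact: (cbm_iRe (mI 0 t) (lam_fin 0 t) (tf t)).
exact: (cbm_iIm (mI 0 t) (lam_fin 0 t) (tf t)).
Qed.

Lemma tbf_CI_aux f T (M : R) : tbf f -> (forall t, 0 <= t <= T -> n1 (f t) <= M) ->
  forall s t, 0 <= s -> s <= t -> t <= T -> n1 (CI f t - CI f s) <= M * (t - s).
Proof.
move=> tf fM s t s0 st tT.
rewrite (CI_split tf s0 st) [X in n1 X]addrAC subrr add0r.
have st' := fine_lam_oc st.
have sub : ([set` `]s, t]] : set R) `<=` [set` `[0, t]].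
  by move=> x /=; rewrite !in_itv/= => /andP[/ltW sx ->]; rewrite (le_trans s0 sx).
rewrite -st'; apply: n1_Cint_le => //; first by rewrite (le_lt_trans _ (lam_fin 0 t))// le_measure// inE.
  by apply: (sub_cbm _ sub) => //; exact: tf.
move=> x /sub; rewrite /= in_itv/= => /andP[x0 xt]; apply: fM.
by rewrite x0 (le_trans xt).
Qed.

Lemma tbf_bound f T : tbf f -> exists2 M : R, 0 <= M & forall t, 0 <= t <= T -> n1 (f t) <= M.
Proof.
move=> /(_ T)[_ [M fM]]; exists `|M| => // t tT.
by rewrite (le_trans _ (ler_norm M))//; apply: fM; rewrite /= in_itv.
Qed.

Lemma tbf_CI f : tbf f -> tbf (CI f).
Proof.
move=> tf T; have [T0|T0] := ltP T 0.
  rewrite set_itv_ge ?bnd_simp -?ltNge//.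
  by split; [split; exact: measurable_fun_set0|exists 0].
have aux (h : R -> R) : lam.-integrable `[0, T] (EFin \o h) ->
    measurable_fun `[0, T] (fun t => \int[lam]_(x in `[0, t]) h x).
  move=> ih; apply: subspace_continuous_measurable_fun => //.
  exact: parameterized_integral_continuous.
split; first by split; apply: aux; [exact: (cbm_iRe (mI 0 T) (lam_fin 0 T) (tf T))|exact: (cbm_iIm (mI 0 T) (lam_fin 0 T) (tf T))].
have [M M0 fM] := tbf_bound T tf.
exists (M * T) => t; rewrite /= in_itv/= => /andP[t0 tT].
have := tbf_CI_aux tf fM (lexx 0) t0 tT.
rewrite CI_at0 !subr0 => /le_trans; apply; by rewrite ler_wpM2l.
Qed.

Lemma tbf_Ip p f : tbf f -> tbf (Ip p f).
Proof. by move=> tf; elim: p => [//|p ih]; rewrite /Ip /= -/(Ip p f); exact: tbf_CI. Qed.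

Lemma CI_D f g t : tbf f -> tbf g -> CI (fun x => f x + g x) t = CI f t + CI g t.
Proof. by move=> tf tg; exact: (CintD (mI 0 t) (lam_fin 0 t) (tf t) (tg t)). Qed.
Lemma CI_Z z f t : tbf f -> CI (fun x => z * f x) t = z * CI f t.
Proof. by move=> tf; exact: (CintZ (mI 0 t) (lam_fin 0 t) z (tf t)). Qed.
Lemma tbfD f g : tbf f -> tbf g -> tbf (fun x => f x + g x).
Proof. by move=> tf tg T; apply: cbmD. Qed.
Lemma tbfZ z f : tbf f -> tbf (fun x => z * f x).
Proof. by move=> tf T; apply: cbmZ. Qed.
Lemma tbfM f g : tbf f -> tbf g -> tbf (fun x => f x * g x).
Proof. by move=> tf tg T; apply: cbmM. Qed.
Lemma tbfJ f : tbf f -> tbf (fun x => conjc (f x)).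
Proof. by move=> tf T; apply: cbmJ. Qed.
Lemma tbf_cst z : tbf (fun=> z).
Proof. by move=> T; exact: cbm_cst. Qed.
Lemma tbf_sum I (r : seq I) (F : I -> R -> C) : (forall i, tbf (F i)) ->
  tbf (fun x => \sum_(i <- r) F i x).
Proof. by move=> tF T; apply: cbm_sum => i; exact: tF. Qed.

Lemma CI_sum I (r : seq I) (F : I -> R -> C) t : (forall i, tbf (F i)) ->
  CI (fun x => \sum_(i <- r) F i x) t = \sum_(i <- r) CI (F i) t.
Proof. by move=> tF; exact: (Cint_sum (mI 0 t) (lam_fin 0 t) r (fun i => tF i t)). Qed.
Lemma CI_csum (h : nat -> R -> C) (m : nat -> R) t : cvgn (series m) ->
  (forall k, tbf (h k)) -> (forall k s, 0 <= s <= t -> n1 (h k s) <= m k) ->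
  cbm `[0, t] (fun s => csum (h^~ s)) /\
  CI (fun s => csum (h^~ s)) t = csum (fun k => CI (h k) t).
Proof.
move=> cm th hm; apply: (Cint_csum (mI 0 t) (lam_fin 0 t) cm).
  by move=> k; have [] := th k t.
by move=> k x; rewrite /= in_itv/=; exact: hm.
Qed.
Lemma Ip_S p f : Ip p.+1 f = CI (Ip p f). Proof. by []. Qed.
Lemma Ip_Sr p f : Ip p.+1 f = Ip p (CI f). Proof. exact: iterSr. Qed.
Lemma Ip_D p f g : tbf f -> tbf g ->
  Ip p (fun x => f x + g x) = (fun t => Ip p f t + Ip p g t).
Proof.
move=> tf tg; elim: p => [//|p ih]; rewrite Ip_S ih; apply: funext => t.
by rewrite CI_D//; exact: tbf_Ip.
Qed.
Lemma Ip_Z p z f : tbf f -> Ip p (fun x => z * f x) = (fun t => z * Ip p f t).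
Proof.
move=> tf; elim: p => [//|p ih]; rewrite Ip_S ih; apply: funext => t.
by rewrite CI_Z//; exact: tbf_Ip.
Qed.
Lemma Ip_0 p : Ip p (fun=> 0) = (fun=> 0).
Proof.
have -> : (fun=> 0 : C) = (fun x : R => 0 * (0 : C)) by apply: funext => x; rewrite mul0r.
by rewrite Ip_Z; [apply: funext => t; rewrite !mul0r|exact: tbf_cst].
Qed.
Lemma Ip_sum p I (r : seq I) (F : I -> R -> C) : (forall i, tbf (F i)) ->
  Ip p (fun x => \sum_(i <- r) F i x) = (fun t => \sum_(i <- r) Ip p (F i) t).
Proof.
move=> tF; elim: r => [|i r ih].
  rewrite (_ : (fun x => _) = (fun=> 0)); last by apply: funext => x; rewrite big_nil.
  by rewrite Ip_0; apply: funext => x; rewrite big_nil.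
rewrite (_ : (fun x => _) = (fun x => F i x + \sum_(i <- r) F i x)); last first.
  by apply: funext => x; rewrite big_cons.
rewrite Ip_D//; last exact: tbf_sum.
by rewrite ih; apply: funext => t; rewrite big_cons.
Qed.
Lemma eq_CI f g T t : (forall x, 0 <= x <= T -> f x = g x) -> t <= T -> CI f t = CI g t.
Proof.
move=> fg tT; apply: eq_Cint => // x; rewrite /= in_itv/= => /andP[x0 xt].
by apply: fg; rewrite x0 (le_trans xt).
Qed.
Lemma eq_Ip p f g T t : (forall x, 0 <= x <= T -> f x = g x) -> 0 <= t <= T ->
  Ip p f t = Ip p g t.
Proof.
move=> fg; elim: p t => [|p ih] t tT; first exact: fg.
by rewrite !Ip_S; apply: (eq_CI (T := T)) => //; case/andP: tT.
Qed.

Lemma int_pow (p : nat) (t : R) : 0 <= t ->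
  \int[lam]_(x in `[0, t]) (x ^+ p / p`!%:R) = t ^+ p.+1 / p.+1`!%:R.
Proof.
rewrite le_eqVlt => /predU1P[<-|t0].
  by rewrite set_itv1 Rintegral_set1 expr0n mul0r.
have dF (x : R) : is_derive x 1 (fun x : R => x ^+ p.+1 / p.+1`!%:R) (x ^+ p / p`!%:R).
  have -> : x ^+ p / p`!%:R = p.+1`!%:R^-1 *: (p.+1%:R *: (x ^+ p * 1)).
    rewrite /GRing.scale/= factS natrM mulr1; field.
    by rewrite pnatr_eq0 -lt0n fact_gt0 /= nat1r pnatr_eq0.
  have -> : (fun x : R => x ^+ p.+1 / p.+1`!%:R) = p.+1`!%:R^-1 *: (fun x : R => x ^+ p.+1).
    by apply: funext => y; rewrite /GRing.scale/= mulrC.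
  apply: is_deriveZ.
  have -> : p.+1%:R *: (x ^+ p * 1) = (p.+1%:R * x ^+ p.+1.-1) *: (1 : R).
    by rewrite /GRing.scale /= !mulr1.
  have -> : (GRing.exp (R:=R))^~ p.+1 = (@idfun R) ^+ p.+1.
    by apply: funext => y; rewrite exprfctE.
  exact: is_deriveX.
rewrite /Rintegral (@continuous_FTC2 _ _ (fun x : R => x ^+ p.+1 / p.+1`!%:R))//.
- by rewrite -EFinB /= expr0n mul0r subr0.
- apply: continuous_subspaceT => x.
  by apply: cvgM; [exact: exprn_continuous|exact: cvg_cst].
- split.
  + by move=> x _; have [] := dF x.
  + apply: cvg_at_right_filter; apply: cvgM; [exact: exprn_continuous|exact: cvg_cst].
  + apply: cvg_at_left_filter; apply: cvgM; [exact: exprn_continuous|exact: cvg_cst].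
- by move=> x _; rewrite derive1E; have [] := dF x.
Qed.

Lemma n1_Ip p f (M T : R) : tbf f -> (forall t, 0 <= t <= T -> n1 (f t) <= M) ->
  forall t, 0 <= t <= T -> n1 (Ip p f t) <= M * (t ^+ p / p`!%:R).
Proof.
move=> tf fM; elim: p => [|p ih] t tT.
  by rewrite fact0 expr0 divr1 mulr1 fM.
have /andP[t0 tT'] := tT.
have tI := tbf_Ip p tf.
rewrite Ip_S; apply: (le_trans (n1_Cint (mI 0 t) (lam_fin 0 t) (tI t))).
have mX : measurable_fun `[0, t] (fun x : R => x ^+ p / p`!%:R).
  by apply: measurable_funM => //; exact: measurable_funX.
have iX : lam.-integrable `[0, t] (EFin \o (fun x : R => x ^+ p / p`!%:R)).
  apply: (@bounded_integrable _ _ _ _ _ (mI 0 t) (lam_fin 0 t) _ (t ^+ p / p`!%:R)) => // x /=.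
  rewrite in_itv/= => /andP[x0 xt].
  by rewrite ger0_norm ?divr_ge0 ?exprn_ge0// ler_wpM2r ?invr_ge0// lerXn2r ?nnegrE.
rewrite -int_pow// -RintegralZl//; apply: le_Rintegral => //.
- exact: (cbm_in1 (mI 0 t) (lam_fin 0 t) (tI t)).
- by have := integrableZl (mI 0 t) M iX.
- move=> x /=; rewrite in_itv/= => /andP[x0 xt]; apply: ih.
  by rewrite x0 (le_trans xt).
Qed.

(** One of the [p.+1] integrations is spent on the L^1 norm of [f], the other [p] on the factorial.
    This is what makes an input that is small only in L^1 produce a small state. *)
Lemma n1_Ip_L1 p f T t : tbf f -> 0 <= t <= T ->
  n1 (Ip p.+1 f t) <= (\int[lam]_(x in `[0, T]) n1 (f x)) * (T ^+ p / p`!%:R).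
Proof.
move=> tf /andP[t0 tT].
have T0 : 0 <= T by exact: le_trans tT.
set J := \int[lam]_(x in _) _.
have hM s : 0 <= s <= T -> n1 (CI f s) <= J.
  move=> /andP[s0 sT]; apply: (le_trans (n1_Cint (mI 0 s) (lam_fin 0 s) (tf s))).
  rewrite /J /Rintegral fine_le//.
  - by apply: integrable_fin_num => //; exact: (cbm_in1 (mI 0 s) (lam_fin 0 s) (tf s)).
  - by apply: integrable_fin_num => //; exact: (cbm_in1 (mI 0 T) (lam_fin 0 T) (tf T)).
  apply: ge0_subset_integral => //.
  - by apply/measurable_EFinP; exact: cbm_mn1 (tf T).
  - by move=> x _; rewrite lee_fin n1_ge0.
  - by move=> x /=; rewrite !in_itv/= => /andP[-> /le_trans]; apply.
rewrite Ip_Sr; apply: (le_trans (@n1_Ip p (CI f) J T (tbf_CI tf) hM t _)); first by rewrite t0.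
have J0 : 0 <= J by apply: Rintegral_ge0 => x _; exact: n1_ge0.
by rewrite ler_wpM2l// ler_wpM2r ?invr_ge0// lerXn2r ?nnegrE// ?(le_trans t0).
Qed.

End TimeIntegral.

(** * Matrix series of iterated integrals *)

Section MatrixSeries.
Variable R : realType.
Local Notation C := R[i].

Definition vsum p q (h : nat -> 'M[C]_(p, q)) : 'M[C]_(p, q) :=
  \matrix_(i, j) csum (fun k => h k i j).
Definition vsbl p q (h : nat -> 'M[C]_(p, q)) :=
  exists2 m : R^nat, cvgn (series m) & forall k, nrm (h k) <= m k.

Lemma vsbl_entry p q (h : nat -> 'M[C]_(p, q)) i j : vsbl h -> csbl (fun k => h k i j).
Proof. by move=> [m cm hm]; exists m => // k; apply: le_trans (hm k); exact: nrm_entry. Qed.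
Lemma vsumD p q (h k : nat -> 'M[C]_(p, q)) : vsbl h -> vsbl k ->
  vsum (fun l => h l + k l) = vsum h + vsum k.
Proof.
move=> sh sk; apply/matrixP => i j; rewrite !mxE -csumD; [|exact: vsbl_entry..].
by congr csum; apply: funext => l; rewrite mxE.
Qed.
Lemma vsumZ p q z (h : nat -> 'M[C]_(p, q)) : vsbl h ->
  vsum (fun l => z *: h l) = z *: vsum h.
Proof.
move=> sh; apply/matrixP => i j; rewrite !mxE -csumZ; [|exact: vsbl_entry].
by congr csum; apply: funext => l; rewrite mxE.
Qed.
Lemma mulmx_vsum p q s (A : 'M[C]_(s, p)) (h : nat -> 'M[C]_(p, q)) : vsbl h ->
  A *m vsum h = vsum (fun k => A *m h k).
Proof.
move=> sh; apply/matrixP => i j; rewrite !mxE.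
rewrite (_ : (fun k => _) = (fun k => \sum_l A i l * h k l j)); last first.
  by apply: funext => k; rewrite mxE.
rewrite csum_sum; last by move=> l; apply: csblZ; exact: vsbl_entry.
apply: eq_bigr => l _; rewrite mxE csumZ//; exact: vsbl_entry.
Qed.
Lemma vsumS p q (h : nat -> 'M[C]_(p, q)) : vsbl h ->
  vsum h = h 0%N + vsum (fun k => h k.+1).
Proof.
by move=> sh; apply/matrixP => i j; rewrite !mxE csumS//; exact: vsbl_entry.
Qed.
Lemma nrm_vsum p q (h : nat -> 'M[C]_(p, q)) (m : R^nat) : cvgn (series m) ->
  (forall k, nrm (h k) <= m k) -> nrm (vsum h) <= (p * q)%:R * limn (series m).
Proof.
move=> cm hm; rewrite /nrm.
apply: (@le_trans _ _ (\sum_(i < p) \sum_(j < q) limn (series m))).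
  apply: ler_sum => i _; apply: ler_sum => j _; rewrite mxE.
  by apply: n1_csum => // k; apply: le_trans (hm k); exact: nrm_entry.
under eq_bigr do rewrite sumr_const card_ord.
by rewrite sumr_const card_ord -mulrnA mulr_natl mulnC.
Qed.

(** At most geometric growth, which the factorials of [n1_Ip] beat on every bounded interval. The
    lower bound on [K] keeps the class stable under the shift [sh]. *)
Definition geo p q (M : nat -> 'M[C]_(p, q)) (c K : R) :=
  [/\ 0 <= c, 1 <= K & forall k, nrm (M k) <= c * K ^+ k].

Definition vt m (v : R -> 'cV[C]_m) := forall i, tbf (fun t => v t i 0).
Definition VIp m p (v : R -> 'cV[C]_m) (t : R) : 'cV[C]_m :=
  \col_i Ip p (fun s => v s i 0) t.
(* With M_k = A^k B this is B v + A x, where x' = A x + B v and x(0) = 0; shifting M by one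
   index gives x itself. *)
Definition ms p q (M : nat -> 'M[C]_(p, q)) (v : R -> 'cV[C]_q) (t : R) : 'cV[C]_p :=
  vsum (fun k => M k *m VIp k v t).
Definition sh p q (M : nat -> 'M[C]_(p, q)) k := if k is k'.+1 then M k' else 0.
(** Kernel of the memoryless map [v -> M v]; it brings feed-through terms into the same calculus of
    series as the state. *)
Definition dl p q (M : 'M[C]_(p, q)) k : 'M[C]_(p, q) := if k is k'.+1 then 0 else M.

Lemma geo_sh p q (M : nat -> 'M[C]_(p, q)) c K : geo M c K -> geo (sh M) c K.
Proof.
move=> [c0 K1 MK]; split => // -[|k] /=; first by rewrite nrm0 mulr_ge0// exprn_ge0// (le_trans ler01).
rewrite (le_trans (MK k))// ler_wpM2l// exprS ler_peMl// exprn_ge0// (le_trans ler01)//.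
Qed.
Lemma geo_dl p q (M : 'M[C]_(p, q)) : geo (dl M) (nrm M) 1.
Proof.
split => //; first exact: nrm_ge0.
by case=> [|k] /=; rewrite expr1n mulr1// nrm0 nrm_ge0.
Qed.
Lemma geo_le p q (M : nat -> 'M[C]_(p, q)) c K c' K' : geo M c K -> c <= c' -> K <= K' ->
  geo M c' K'.
Proof.
move=> [c0 K1 MK] cc KK; split; [exact: le_trans cc|exact: le_trans KK|].
move=> k; apply: (le_trans (MK k)); apply: ler_pM => //.
  by rewrite exprn_ge0// (le_trans ler01).
by rewrite lerXn2r ?nnegrE// (le_trans ler01)// (le_trans K1).
Qed.
Lemma geoD p q (M N : nat -> 'M[C]_(p, q)) c K c' K' : geo M c K -> geo N c' K' ->
  geo (fun k => M k + N k) (c + c') (Num.max K K').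
Proof.
move=> gM gN.
have [c0 K1 MK] := @geo_le _ _ _ _ _ c (Num.max K K') gM (lexx _) (ltac:(by rewrite le_max lexx)).
have [c0' K1' NK] := @geo_le _ _ _ _ _ c' (Num.max K K') gN (lexx _) (ltac:(by rewrite le_max lexx orbT)).
by split => //; [exact: addr_ge0|move=> k; rewrite (le_trans (nrmD _ _))// mulrDl lerD].
Qed.
Lemma geoM p q s (A : 'M[C]_(s, p)) (M : nat -> 'M[C]_(p, q)) c K : geo M c K ->
  geo (fun k => A *m M k) (nrm A * c) K.
Proof.
move=> [c0 K1 MK]; split => //; first by rewrite mulr_ge0 ?nrm_ge0.
by move=> k; rewrite (le_trans (nrmM _ _))// -mulrA ler_wpM2l ?nrm_ge0.
Qed.
Lemma geo_iter n q (A : 'M[C]_n) (b : 'M[C]_(n, q)) :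
  geo (fun k => iter k (mulmx A) b) (nrm b) (Num.max 1 (nrm A)).
Proof.
split; [exact: nrm_ge0|by rewrite le_max lexx|].
elim=> [|k ih]; first by rewrite expr0 mulr1.
rewrite /= (le_trans (nrmM _ _))// exprS mulrCA ler_pM ?nrm_ge0//.
by rewrite le_max lexx orbT.
Qed.

Lemma VIp_bound m p (v : R -> 'cV[C]_m) (T : R) (M : R) : vt v ->
  (forall t, 0 <= t <= T -> nrm (v t) <= M) ->
  forall t, 0 <= t <= T -> nrm (VIp p v t) <= m%:R * M * (T ^+ p / p`!%:R).
Proof.
move=> tv vM t tT; have /andP[t0 tT'] := tT.
have M0 : 0 <= M by apply: le_trans (vM t tT); exact: nrm_ge0.
rewrite /nrm; apply: (@le_trans _ _ (\sum_(i < m) M * (T ^+ p / p`!%:R))); last first.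
  by rewrite sumr_const card_ord -mulrA mulr_natl.
apply: ler_sum => i _; rewrite big_ord1 mxE.
have h s : 0 <= s <= T -> n1 (v s i 0) <= M.
  by move=> sT; apply: le_trans (vM s sT); exact: nrm_entry.
apply: (le_trans (n1_Ip p (tv i) h tT)); rewrite ler_wpM2l// ler_wpM2r ?invr_ge0//.
by rewrite lerXn2r ?nnegrE// (le_trans t0).
Qed.
Lemma vt_bound m (v : R -> 'cV[C]_m) (T : R) : vt v ->
  exists2 M : R, 0 <= M & forall t, 0 <= t <= T -> nrm (v t) <= M.
Proof.
move=> tv; have h i : {M : R | 0 <= M & forall t, 0 <= t <= T -> n1 (v t i 0) <= M}.
  by apply: cid2; exact: tbf_bound.
exists (\sum_i s2val (h i)); first by apply: sumr_ge0 => i _; case: (h i).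
move=> t tT; apply: ler_sum => i _; rewrite big_ord1; case: (h i) => /= M _; exact.
Qed.

Lemma exp_series (c K M T : R) : cvgn (series (fun k => c * K ^+ k * (M * (T ^+ k / k`!%:R)))) /\
  limn (series (fun k => c * K ^+ k * (M * (T ^+ k / k`!%:R)))) = c * M * expR (K * T).
Proof.
have -> : (fun k => c * K ^+ k * (M * (T ^+ k / k`!%:R))) = (c * M) *: exp_coeff (K * T).
  apply: funext => k; transitivity (c * M * exp_coeff (K * T) k) => //.
  rewrite (_ : exp_coeff (K * T) k = K ^+ k * (T ^+ k / k`!%:R)); first by ring.
  by rewrite /exp_coeff /= exprMn mulrA.
split; first by apply: is_cvg_seriesZ; exact: is_cvg_series_exp_coeff.
by rewrite lim_seriesZ//; exact: is_cvg_series_exp_coeff.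
Qed.

Section ms.
Variables (p q : nat) (M : nat -> 'M[C]_(p, q)) (c K : R).
Hypothesis gM : geo M c K.

Lemma ms_term (v : R -> 'cV[C]_q) (T : R) (B : R) : vt v ->
  (forall t, 0 <= t <= T -> nrm (v t) <= B) -> forall t k, 0 <= t <= T ->
  nrm (M k *m VIp k v t) <= c * K ^+ k * (q%:R * B * (T ^+ k / k`!%:R)).
Proof.
move=> tv vB t k tT; case: gM => c0 K1 MK; rewrite (le_trans (nrmM _ _))//.
by apply: ler_pM; rewrite ?nrm_ge0//; exact: (VIp_bound k tv vB tT).
Qed.
Lemma ms_sbl (v : R -> 'cV[C]_q) (t : R) : vt v -> 0 <= t -> vsbl (fun k => M k *m VIp k v t).
Proof.
move=> tv t0; have [B B0 vB] := vt_bound t tv.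
exists (fun k => c * K ^+ k * (q%:R * B * (t ^+ k / k`!%:R))).
  exact: (exp_series _ _ _ _).1.
by move=> k; apply: ms_term => //; rewrite t0 lexx.
Qed.
Lemma ms_bound (v : R -> 'cV[C]_q) (T : R) (B : R) : vt v ->
  (forall t, 0 <= t <= T -> nrm (v t) <= B) -> forall t, 0 <= t <= T ->
  nrm (ms M v t) <= p%:R * (c * (q%:R * B) * expR (K * T)).
Proof.
move=> tv vB t tT; rewrite -(exp_series c K (q%:R * B) T).2.
apply: (le_trans (nrm_vsum (exp_series c K (q%:R * B) T).1 _)); last by rewrite muln1.
by move=> k; exact: ms_term.
Qed.
Lemma tbf_term (v : R -> 'cV[C]_q) k i : vt v -> tbf (fun t => (M k *m VIp k v t) i 0).
Proof.
move=> tv; rewrite (_ : (fun t => _) = (fun t => \sum_l M k i l * Ip k (fun s => v s l 0) t)).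
  by apply: tbf_sum => l; apply: tbfZ; exact: tbf_Ip.
by apply: funext => t; rewrite mxE; apply: eq_bigr => l _; rewrite mxE.
Qed.
Lemma ms_CI_aux (v : R -> 'cV[C]_q) (t : R) i : vt v ->
  cbm `[0, t] (fun s => csum (fun k => (M k *m VIp k v s) i 0)) /\
  CI (fun s => csum (fun k => (M k *m VIp k v s) i 0)) t =
    csum (fun k => CI (fun s => (M k *m VIp k v s) i 0) t).
Proof.
move=> tv; have [B B0 vB] := vt_bound t tv.
apply: (CI_csum (m := fun k => c * K ^+ k * (q%:R * B * (t ^+ k / k`!%:R)))).
- exact: (exp_series _ _ _ _).1.
- by move=> k; exact: tbf_term.
- by move=> k s st; apply: le_trans (ms_term tv vB k st); exact: nrm_entry.
Qed.
Lemma msE (v : R -> 'cV[C]_q) i : (fun s => ms M v s i 0) =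
  (fun s => csum (fun k => (M k *m VIp k v s) i 0)).
Proof. by apply: funext => s; rewrite mxE. Qed.
Lemma vt_ms (v : R -> 'cV[C]_q) : vt v -> vt (ms M v).
Proof. by move=> tv i T; rewrite msE; exact: (ms_CI_aux T i tv).1. Qed.
Lemma CI_term (v : R -> 'cV[C]_q) (t : R) k i : vt v ->
  CI (fun s => (M k *m VIp k v s) i 0) t = (M k *m VIp k.+1 v t) i 0.
Proof.
move=> tv; rewrite (_ : (fun s => _) = (fun s => \sum_l M k i l * Ip k (fun s => v s l 0) s)); last first.
  by apply: funext => s; rewrite mxE; apply: eq_bigr => l _; rewrite mxE.
rewrite CI_sum; last by move=> l; apply: tbfZ; exact: tbf_Ip.
by rewrite mxE; apply: eq_bigr => l _; rewrite mxE CI_Z//; exact: tbf_Ip.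
Qed.
Lemma ms_CI (v : R -> 'cV[C]_q) (t : R) i : vt v -> 0 <= t ->
  CI (fun s => ms M v s i 0) t = vsum (fun k => M k *m VIp k.+1 v t) i 0.
Proof.
move=> tv t0; rewrite msE (ms_CI_aux t i tv).2 mxE.
by congr csum; apply: funext => k; rewrite CI_term.
Qed.
Lemma ms_mul s (A : 'M[C]_(s, p)) (v : R -> 'cV[C]_q) (t : R) : vt v -> 0 <= t ->
  A *m ms M v t = ms (fun k => A *m M k) v t.
Proof.
move=> tv t0; rewrite /ms mulmx_vsum; last exact: ms_sbl.
by congr vsum; apply: funext => k; rewrite mulmxA.
Qed.
Lemma msv_add (v w : R -> 'cV[C]_q) (t : R) : vt v -> vt w -> 0 <= t ->
  ms M (fun s => v s + w s) t = ms M v t + ms M w t.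
Proof.
move=> tv tw t0; rewrite /ms -vsumD; [|exact: ms_sbl..].
congr vsum; apply: funext => k; rewrite -mulmxDr; congr (_ *m _).
apply/matrixP => i j; rewrite !mxE.
by have := congr1 (@^~ t) (Ip_D k (tv i) (tw i)) => /= <-; congr Ip; apply: funext => s; rewrite mxE.
Qed.
Lemma msv_scale z (v : R -> 'cV[C]_q) (t : R) : vt v -> 0 <= t ->
  ms M (fun s => z *: v s) t = z *: ms M v t.
Proof.
move=> tv t0; rewrite /ms -vsumZ; [|exact: ms_sbl].
congr vsum; apply: funext => k; rewrite scalemxAr; congr (_ *m _).
apply/matrixP => i j; rewrite !mxE.
by have := congr1 (@^~ t) (Ip_Z k z (tv i)) => /= <-; congr Ip; apply: funext => s; rewrite mxE.
Qed.
Lemma vtD (v w : R -> 'cV[C]_q) : vt v -> vt w -> vt (fun s => v s + w s).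
Proof.
by move=> tv tw i; rewrite (_ : (fun t => _) = (fun t => v t i 0 + w t i 0));
  [exact: tbfD|apply: funext => t; rewrite mxE].
Qed.
Lemma vtZ z (v : R -> 'cV[C]_q) : vt v -> vt (fun s => z *: v s).
Proof.
by move=> tv i; rewrite (_ : (fun t => _) = (fun t => z * v t i 0));
  [exact: tbfZ|apply: funext => t; rewrite mxE].
Qed.
Lemma vt_sum I (r : seq I) (v : I -> R -> 'cV[C]_q) : (forall i, vt (v i)) ->
  vt (fun s => \sum_(i <- r) v i s).
Proof.
move=> tv j; rewrite (_ : (fun t => _) = (fun t => \sum_(i <- r) v i t j 0)).
  by apply: tbf_sum => i; exact: tv.
by apply: funext => t; rewrite summxE.
Qed.
Lemma vt0 : vt (fun=> 0 : 'cV[C]_q).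
Proof.
by move=> i; rewrite (_ : (fun t => _) = (fun=> 0)); [exact: tbf_cst|apply: funext => t; rewrite mxE].
Qed.
Lemma msv_sum I (r : seq I) (v : I -> R -> 'cV[C]_q) (t : R) : (forall i, vt (v i)) -> 0 <= t ->
  ms M (fun s => \sum_(i <- r) v i s) t = \sum_(i <- r) ms M (v i) t.
Proof.
move=> tv t0; elim: r => [|i r ih].
  transitivity (ms M (fun s : R => 0 *: (0 : 'cV[C]_q)) t).
    by congr (ms M _ t); apply: funext => s; rewrite big_nil scaler0.
  by rewrite msv_scale// ?scale0r ?big_nil//; exact: vt0.
rewrite big_cons -ih; apply: etrans (msv_add (tv i) (vt_sum r tv) t0).
by congr (ms M _ t); apply: funext => s; rewrite big_cons.
Qed.
Lemma eq_ms (v w : R -> 'cV[C]_q) (T t : R) : (forall s, 0 <= s <= T -> v s = w s) ->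
  0 <= t <= T -> ms M v t = ms M w t.
Proof.
move=> vw tT; congr vsum; apply: funext => k; congr (_ *m _).
apply/matrixP => i j; rewrite !mxE; apply: (@eq_Ip _ _ _ _ T) => // s sT.
by rewrite vw.
Qed.
Lemma ms_L1 (v : R -> 'cV[C]_q) (t T : R) : vt v -> 0 <= t <= T ->
  nrm (vsum (fun k => M k *m VIp k.+1 v t)) <=
  p%:R * (c * (\int[@lebesgue_measure R]_(s in `[0, T]) nrm (v s)) * expR (K * T)).
Proof.
move=> tv tT; set J := \int[_]_(_ in _) _.
have JE : J = \sum_i \int[@lebesgue_measure R]_(s in `[0, T]) n1 (v s i 0).
  rewrite /J -Rint_sum//.
    by apply: eq_Rintegral => s _; apply: eq_bigr => i _; rewrite big_ord1.
  by move=> i; exact: (cbm_in1 (mI 0 T) (lam_fin 0 T) (tv i T)).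
rewrite -(exp_series c K J T).2.
apply: (le_trans (nrm_vsum (exp_series c K J T).1 _)); last by rewrite muln1.
move=> k; case: gM => c0 K1 MK; rewrite (le_trans (nrmM _ _))//.
apply: ler_pM; rewrite ?nrm_ge0// /nrm JE mulr_suml.
by apply: ler_sum => i _; rewrite big_ord1 mxE; exact: n1_Ip_L1.
Qed.

End ms.
Lemma ms_sh p q (M : nat -> 'M[C]_(p, q)) c K (v : R -> 'cV[C]_q) (t : R) : geo M c K ->
  vt v -> 0 <= t -> ms (sh M) v t = vsum (fun k => M k *m VIp k.+1 v t).
Proof.
move=> gM tv t0; have /= h := ms_sbl (geo_sh gM) tv t0; rewrite /ms vsumS//=.
by rewrite mul0mx add0r.
Qed.
Lemma ms_dl p q (M : 'M[C]_(p, q)) (v : R -> 'cV[C]_q) (t : R) :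
  vt v -> 0 <= t -> ms (dl M) v t = M *m v t.
Proof.
move=> tv t0; have /= h := ms_sbl (geo_dl M) tv t0; rewrite /ms vsumS//=.
rewrite (_ : vsum _ = 0) ?addr0.
  by congr (_ *m _); apply/matrixP => i j; rewrite mxE ord1.
apply/matrixP => i j; rewrite !mxE -[RHS](@csum0 R); congr csum.
by apply: funext => k; rewrite mul0mx mxE.
Qed.
Lemma msD p q (M N : nat -> 'M[C]_(p, q)) c K c' K' (v : R -> 'cV[C]_q) (t : R) :
  geo M c K -> geo N c' K' -> vt v -> 0 <= t ->
  ms (fun k => M k + N k) v t = ms M v t + ms N v t.
Proof.
move=> gM gN tv t0; rewrite /ms -vsumD; [|exact: (ms_sbl gM)|exact: (ms_sbl gN)].
by congr vsum; apply: funext => k; rewrite mulmxDl.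
Qed.
End MatrixSeries.

(** * Stability and frequency response *)

Section Stability.
Variable R : realType.
Local Notation C := R[i].

(** Only an upper bound: it is applied to norms, where it means convergence to 0 at infinity. *)
Definition tends0 (f : R -> R) := forall e : R, 0 < e -> exists s : R, forall t, s <= t -> f t <= e.

Definition cder (z : R -> C) (t : R) (w : C) :=
  is_derive t 1 (fun s => complex.Re (z s)) (complex.Re w) /\
  is_derive t 1 (fun s => complex.Im (z s)) (complex.Im w).

Lemma cderD z1 z2 t w1 w2 : cder z1 t w1 -> cder z2 t w2 ->
  cder (fun s => z1 s + z2 s) t (w1 + w2).
Proof.
move=> [a1 b1] [a2 b2]; split.
  rewrite cReD (_ : (fun s => _) = (fun s => complex.Re (z1 s)) + (fun s => complex.Re (z2 s))).
    exact: is_deriveD.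
  by apply: funext => s; rewrite cReD.
rewrite cImD (_ : (fun s => _) = (fun s => complex.Im (z1 s)) + (fun s => complex.Im (z2 s))).
  exact: is_deriveD.
by apply: funext => s; rewrite cImD.
Qed.
Lemma cderZ c z t w : cder z t w -> cder (fun s => c * z s) t (c * w).
Proof.
move=> [a b]; split.
  rewrite cReM (_ : (fun s => _) = (complex.Re c *: (fun s => complex.Re (z s))) -
    (complex.Im c *: (fun s => complex.Im (z s)))).
    by apply: is_deriveB; apply: is_deriveZ.
  by apply: funext => s; rewrite cReM.
rewrite cImM (_ : (fun s => _) = (complex.Re c *: (fun s => complex.Im (z s))) +
    (complex.Im c *: (fun s => complex.Re (z s)))).
  by apply: is_deriveD; apply: is_deriveZ.
by apply: funext => s; rewrite cImM.
Qed.
Lemma cder_cst c t : cder (fun=> c) t 0.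
Proof. by split => /=; exact: is_derive_cst. Qed.
Lemma cder_sum I (r : seq I) (z : I -> R -> C) t (w : I -> C) :
  (forall i, cder (z i) t (w i)) ->
  cder (fun s => \sum_(i <- r) z i s) t (\sum_(i <- r) w i).
Proof.
move=> zw; elim: r => [|i r ih].
  by under eq_fun do rewrite big_nil; rewrite big_nil; exact: cder_cst.
by under eq_fun do rewrite big_cons; rewrite big_cons; exact: cderD.
Qed.

Lemma exp_decay (a M e : R) : 0 < a -> 0 < e -> exists s : R, forall t, s <= t ->
  M * expR (- (a * t)) <= e.
Proof.
move=> a0 e0; exists ((`|M| + 1) / (a * e)) => t st.
have t0 : 0 < t by apply: lt_le_trans st; rewrite divr_gt0 ?mulr_gt0// ltr_wpDl.
have h1 : 1 + a * t <= expR (a * t) by exact: expR_ge1Dx.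
have at0 : 0 < a * t by rewrite mulr_gt0.
apply: (le_trans (ler_norm _)); rewrite normrM (gtr0_norm (expR_gt0 _)) expRN.
rewrite ler_pdivrMr ?expR_gt0//.
have h2 : `|M| + 1 <= a * t * e.
  by move: st; rewrite ler_pdivrMr ?mulr_gt0// mulrCA mulrA.
rewrite (le_trans _ (ler_wpM2l (ltW e0) h1))//; nra.
Qed.

Lemma psi_der (x y : R -> R) (dx dy a e t : R) : is_derive t 1 x dx -> is_derive t 1 y dy ->
  is_derive t 1 (fun t => (x t ^+ 2 + y t ^+ 2 - e) * expR (a * t))
    ((2 * (x t * dx + y t * dy) + a * (x t ^+ 2 + y t ^+ 2 - e)) * expR (a * t)).
Proof.
move=> d1 d2.
have -> : (fun t => (x t ^+ 2 + y t ^+ 2 - e) * expR (a * t)) =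
  (x * x + y * y - cst e) * (fun t => expR (a * t)) by apply: funext => s.
have d3 : is_derive t 1 (fun t => expR (a * t)) (a * expR (a * t)).
  have d4 : is_derive t 1 (fun x : R => a * x) a.
    have -> : (fun x : R => a * x) = a *: (@idfun R) by [].
    by apply: is_derive_eq; rewrite /GRing.scale /= mulr1.
  by have := is_derive1_comp (is_derive_expR (a * t)) d4; rewrite mulrC.
apply: (is_derive_eq (is_deriveM (is_deriveB (is_deriveD (is_deriveM d1 d1) (is_deriveM d2 d2)) (is_derive_cst e t 1)) d3)).
rewrite /GRing.scale /=.
rewrite [(_ + _ - _) t](_ : _ = x t * x t + y t * y t - e)//; ring.
Qed.

(** With [a = - Re l], once [|f|^2 <= a^2 e / 2] the function [(|z|^2 - e / 2) e^(a t)] is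
    nonincreasing, so [|z|^2] ends up below [e / 2] plus an exponentially small term. *)
Lemma scalar_stable (z f : R -> C) (l : C) (t0 : R) : complex.Re l < 0 ->
  (forall t, t0 < t -> cder z t (l * z t + f t)) ->
  tends0 (fun t => n1 (f t)) -> tends0 (fun t => n1 (z t)).
Proof.
move=> l0 zd f0.
pose a := - complex.Re l; have a0 : 0 < a by rewrite oppr_gt0.
suff h e : 0 < e -> exists s : R, forall t, s <= t -> cabs2 (z t) <= e.
  move=> e e0; have e20 : 0 < e ^+ 2 / 2 by rewrite divr_gt0 ?exprn_gt0.
  have [s hs] := h _ e20.
  exists s => t st; rewrite -ler_sqr ?nnegrE ?n1_ge0 ?(ltW e0)//.
  by apply: (le_trans (n1_le_cabs2 _)); rewrite mulrC -ler_pdivlMr// hs.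
move=> e0; pose e2 := e / 2; have e20 : 0 < e2 by rewrite divr_gt0.
(* As [d <= 1], a bound [n1 (f t) <= d] gives [|f t|^2 <= d <= a^2 * e2]. *)
pose d := Num.min 1 (a ^+ 2 * e2).
have d0 : 0 < d by rewrite lt_min ltr01 mulr_gt0 ?exprn_gt0.
have [s0 hs0] := f0 d d0.
pose s := Num.max (s0) (t0 + 1).
have st0 : t0 < s by rewrite lt_max ltrDl ltr01 orbT.
have fb t : s <= t -> cabs2 (f t) <= a ^+ 2 * e2.
  move=> st; apply: (le_trans (cabs2_le_n1 _)).
  have h1 : n1 (f t) <= d by apply: hs0; rewrite (le_trans _ st)// le_max lexx.
  have h2 : d <= 1 by rewrite ge_min lexx.
  have h3 : d <= a ^+ 2 * e2 by rewrite ge_min lexx orbT.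
  rewrite expr2 (le_trans _ h3)// -[leRHS]mulr1 ler_pM ?n1_ge0// (le_trans h1)//.
pose psi := fun t => (cabs2 (z t) - e2) * expR (a * t).
pose dphi := fun t => 2 * (complex.Re (z t) * complex.Re (l * z t + f t) +
   complex.Im (z t) * complex.Im (l * z t + f t)).
have psid t : s <= t -> is_derive t 1 psi ((dphi t + a * (cabs2 (z t) - e2)) * expR (a * t)).
  move=> st; have [d1 d2] := zd t (lt_le_trans st0 st).
  exact: psi_der.
have dle t : s <= t -> dphi t + a * (cabs2 (z t) - e2) <= 0.
  move=> st; have := fb t st; rewrite /dphi cReD cImD cReM cImM /cabs2.
  have -> : complex.Re l = - a by rewrite opprK.
  set x := complex.Re (z t); set y := complex.Im (z t).
  set u := complex.Re (f t); set v := complex.Im (f t) => uv.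
  (* Young's inequality with weight [a]: the cross term is absorbed by the part of the damping
     [2 a |z|^2] that the factor [expR (a * t)] leaves over. *)
  have h1 : 2 * (x * u) <= a * x ^+ 2 + u ^+ 2 / a.
    rewrite -subr_ge0 (_ : _ - _ = (a * x - u) ^+ 2 / a) ?divr_ge0 ?sqr_ge0 ?ltW//.
    by field; rewrite gt_eqF.
  have h2 : 2 * (y * v) <= a * y ^+ 2 + v ^+ 2 / a.
    rewrite -subr_ge0 (_ : _ - _ = (a * y - v) ^+ 2 / a) ?divr_ge0 ?sqr_ge0 ?ltW//.
    by field; rewrite gt_eqF.
  have h3 : u ^+ 2 / a + v ^+ 2 / a <= a * e2.
    by rewrite -mulrDl ler_pdivrMr// mulrAC -expr2.
  nra.
have psidec t : s <= t -> psi t <= psi s.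
  move=> st; apply: (@ler0_derive1_nincry _ psi s) => //.
  - by move=> x; rewrite in_itv/= andbT => /ltW /psid [].
  - move=> x; rewrite in_itv/= andbT => /ltW sx; rewrite derive1E.
    have [_ ->] := psid x sx; rewrite mulr_le0_ge0 ?expR_ge0//; exact: dle.
  - apply: continuous_in_subspaceT => x; rewrite inE/= in_itv/= andbT => sx.
    by apply: differentiable_continuous; apply/derivable1_diffP; have [] := psid x sx.
have [s1 hs1] := exp_decay (psi s) a0 e20.
exists (Num.max s s1) => t; rewrite ge_max => /andP[st s1t].
have := psidec t st; have := hs1 t s1t; rewrite {2}/psi expRN.
rewrite ler_pdivrMr ?expR_gt0// => h1 h2.
have := le_trans h2 h1; rewrite ler_pM2r ?expR_gt0// lerBlDr => h3.
by rewrite (le_trans h3)// /e2; lra.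
Qed.

Lemma eq_tends0 f g : (forall t, f t = g t) -> tends0 f -> tends0 g.
Proof. by move=> fg f0 e /f0 [s hs]; exists s => t st; rewrite -fg hs. Qed.

Lemma tends0_sum I (r : seq I) (F : I -> R -> R) :
  (forall i, tends0 (F i)) -> tends0 (fun t => \sum_(i <- r) F i t).
Proof.
move=> F0; elim: r => [|i r ih].
  by move=> e e0; exists 0 => t _; rewrite big_nil ltW.
move=> e e0; have e20 : 0 < e / 2 by rewrite divr_gt0.
have [s1 h1] := F0 i _ e20; have [s2 h2] := ih _ e20.
exists (Num.max s1 s2) => t; rewrite ge_max => /andP[t1 t2].
by rewrite big_cons (splitr e) lerD ?h1 ?h2.
Qed.

(** Descent along the roots of the characteristic polynomial instead of a normal form. With [W s]
    the product of the [A - z] for [z] in [s], applied to [Z], one has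
    [(W s)' = l (W s) + W (l :: s)]. The full product vanishes by Cayley-Hamilton, and
    [scalar_stable] removes one root at a time until [W [::] = Z]. *)
Lemma matrix_stable n (A : 'M[C]_n) (Z : R -> 'cV[C]_n) (t0 : R) : hurwitz A ->
  (forall t, t0 < t -> forall i, cder (fun s => Z s i 0) t ((A *m Z t) i 0)) ->
  tends0 (fun t => nrm (Z t)).
Proof.
case: n A Z => [|n] A Z hA dZ.
  by move=> e e0; exists 0 => t _; rewrite /nrm big_ord0 ltW.
have [r hr] := closed_field_poly_normal (char_poly A).
have lr l : l \in r -> complex.Re l < 0.
  move=> lr; apply: hA; rewrite eigenvalue_root_char hr rootE hornerZ.
  by have /rootP -> : root (\prod_(z <- r) ('X - z%:P)) l; rewrite ?mulr0// root_prod_XsubC.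
pose q (s : seq C) := \prod_(z <- s) ('X - z%:P).
pose W (s : seq C) t := horner_mx A (q s) *m Z t.
have CH t : W r t = 0.
  have : horner_mx A (char_poly A) = 0 by exact: Cayley_Hamilton.
  rewrite hr (monicP (char_poly_monic A)) scale1r /W => ->.
  by rewrite mul0mx.
have WS l s t : W (l :: s) t = A *m W s t - l *: W s t.
  rewrite /W /q big_cons rmorphM /= rmorphB /= horner_mx_X horner_mx_C.
  by rewrite -mulmxE -mulmxA mulmxBl mul_scalar_mx.
have dW s t : t0 < t -> forall i, cder (fun x => W s x i 0) t ((A *m W s t) i 0).
  move=> tt i; rewrite /W mulmxA (_ : A *m horner_mx A (q s) = horner_mx A (q s) *m A).
    rewrite -mulmxA mxE.
    under eq_fun do rewrite mxE.
    by apply: cder_sum => k; apply: cderZ; exact: dZ.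
  transitivity (horner_mx A ('X * q s)).
    by rewrite rmorphM /= horner_mx_X mulmxE.
  by rewrite mulrC rmorphM /= horner_mx_X mulmxE.
have Wr : tends0 (fun t => nrm (W r t)).
  by move=> e e0; exists 0 => t _; rewrite CH nrm0 ltW.
have step l s : l \in r -> tends0 (fun t => nrm (W (l :: s) t)) -> tends0 (fun t => nrm (W s t)).
  move=> lr' h; rewrite /nrm; apply: tends0_sum => i.
  apply: (@eq_tends0 (fun t => n1 (W s t i 0))).
    by move=> t; rewrite big_ord1.
  apply: (@scalar_stable _ (fun t => W (l :: s) t i 0) l t0); first exact: lr.
    move=> t tt; have := dW s t tt i; congr cder.
    by rewrite WS !mxE; ring.
  move=> e e0; have [x hx] := h e e0; exists x => t xt.
  by apply: le_trans (hx t xt); exact: nrm_entry.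
have main s : {subset s <= r} -> tends0 (fun t => nrm (W s t)) -> tends0 (fun t => nrm (W [::] t)).
  elim: s => [//|l s ih] sr h; apply: ih; first by move=> x xs; apply: sr; rewrite inE xs orbT.
  by apply: step h; apply: sr; rewrite inE eqxx.
have := main r (fun x => id) Wr; apply: eq_tends0 => t.
by rewrite /W /q big_nil rmorph1 mul1mx.
Qed.

End Stability.

(** * The state equation at one frequency *)

Section SingleFrequency.
Variable R : realType.
Local Notation C := R[i].
Local Notation lam := (@lebesgue_measure R).

Lemma near_gt (x y : R) : x < y -> \forall s \near y, x < s.
Proof. by move=> xy; apply: open_nbhs_nbhs; split; [exact: open_gt|]. Qed.
Lemma near_ge (x y : R) : x < y -> \forall s \near y, x <= s.
Proof. by move=> xy; apply: filterS (near_gt xy) => s /ltW. Qed.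
Lemma near_lt (x y : R) : x < y -> \forall s \near x, s < y.
Proof. by move=> xy; apply: open_nbhs_nbhs; split; [exact: open_lt|]. Qed.
Lemma near_le (x y : R) : x < y -> \forall s \near x, s <= y.
Proof. by move=> xy; apply: filterS (near_lt xy) => s /ltW. Qed.

Definition ccont (z : R -> C) (t : R) :=
  complex.Re (z s) @[s --> t] --> complex.Re (z t) /\
  complex.Im (z s) @[s --> t] --> complex.Im (z t).

Lemma near_cder (z1 z2 : R -> C) (t : R) w : (\forall s \near t, z1 s = z2 s) ->
  cder z1 t w -> cder z2 t w.
Proof.
move=> zz [a b]; split.
  by apply: near_eq_is_derive a; apply: filterS zz => s ->.
by apply: near_eq_is_derive b; apply: filterS zz => s ->.
Qed.

Lemma cder_CI (f : R -> C) (t : R) : tbf f -> 0 < t -> ccont f t -> cder (CI f) t (f t).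
Proof.
move=> tf t0 [c1 c2].
have t1 : t < t + 1 by rewrite ltrDl.
have aux (h : R -> R) : lam.-integrable `[0, t + 1] (EFin \o h) -> {for t, continuous h} ->
   is_derive t 1 (fun s => \int[lam]_(x in `[0, s]) h x) (h t).
  move=> ih ch; have [d1 d2] := continuous_FTC1_closed t1 ih t0 ch.
  by apply: DeriveDef; [exact: d1|rewrite -derive1E; exact: d2].
split; apply: aux => //.
  exact: (cbm_iRe (mI 0 _) (lam_fin 0 _) (tf _)).
exact: (cbm_iIm (mI 0 _) (lam_fin 0 _) (tf _)).
Qed.

(** Primitives of bounded functions are Lipschitz; continuity of the state then allows it to be
    differentiated once more than the input. *)
Lemma ccont_lip (z : R -> C) (t : R) (M T : R) : 0 < t -> t < T ->
  (forall s u, 0 <= s -> s <= u -> u <= T -> n1 (z u - z s) <= M * (u - s)) -> ccont z t.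
Proof.
move=> t0 tT zM.
have M0 : 0 <= M.
  by have := le_trans (n1_ge0 _) (zM _ _ (ltW t0) (ltW tT) (lexx _)); rewrite pmulr_lge0 ?subr_gt0.
suff aux (h : R -> R) : (forall s u, 0 <= s -> s <= u -> u <= T -> `|h u - h s| <= M * (u - s)) ->
    h s @[s --> t] --> h t.
  split; apply: aux => s u s0 su uT; apply: le_trans (zM s u s0 su uT).
    by rewrite -cReN -cReD; exact: le_Re_n1.
  by rewrite -cImN -cImD; exact: le_Im_n1.
move=> hM; apply/cvgrPdist_le => e e0.
near=> s.
have s0 : 0 <= s by near: s; apply: near_ge.
have sT : s <= T by near: s; apply: near_le.
have h1 : `|h t - h s| <= M * `|t - s|.
  have [st|st] := leP s t.
    by rewrite (ger0_norm (x := t - s)) ?subr_ge0//; apply: hM => //; exact: ltW.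
  have -> : `|t - s| = s - t by rewrite distrC ger0_norm ?subr_ge0 ?ltW.
  by rewrite distrC; apply: hM => //; exact: ltW.
apply: (le_trans h1).
have h2 : `|t - s| <= e / (M + 1).
  by near: s; apply: cvgr_dist_le => //; rewrite divr_gt0// ltr_wpDl.
apply: (le_trans (ler_wpM2l M0 h2)); rewrite mulrA ler_pdivrMr ?ltr_wpDl//.
nra.
Unshelve. all: by end_near. Qed.

Lemma ccont_CI (f : R -> C) (t : R) : tbf f -> 0 < t -> ccont (CI f) t.
Proof.
move=> tf t0; have [M M0 fM] := tbf_bound (t + 1) tf.
apply: (@ccont_lip _ _ M (t + 1)) => //; first by rewrite ltrDl.
exact: tbf_CI_aux.
Qed.

Lemma ccontD (z1 z2 : R -> C) t : ccont z1 t -> ccont z2 t -> ccont (fun s => z1 s + z2 s) t.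
Proof.
move=> [a b] [c d]; split.
  under eq_fun do rewrite cReD; rewrite cReD; exact: cvgD.
under eq_fun do rewrite cImD; rewrite cImD; exact: cvgD.
Qed.
Lemma ccontZ c (z : R -> C) t : ccont z t -> ccont (fun s => c * z s) t.
Proof.
move=> [a b]; split.
  under eq_fun do rewrite cReM; rewrite cReM.
  by apply: cvgB; apply: cvgM => //; exact: cvg_cst.
under eq_fun do rewrite cImM; rewrite cImM.
by apply: cvgD; apply: cvgM => //; exact: cvg_cst.
Qed.
Lemma ccont_cst c t : ccont (fun=> c) t.
Proof. by split; exact: cvg_cst. Qed.
Lemma ccont_sum I (r : seq I) (z : I -> R -> C) t :
  (forall i, ccont (z i) t) -> ccont (fun s => \sum_(i <- r) z i s) t.
Proof.
move=> zw; elim: r => [|i r ih].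
  by under eq_fun do rewrite big_nil; exact: ccont_cst.
by under eq_fun do rewrite big_cons; exact: ccontD.
Qed.
Lemma near_ccont (z1 z2 : R -> C) (t : R) : (\forall s \near t, z1 s = z2 s) ->
  ccont z1 t -> ccont z2 t.
Proof.
move=> zz [a b]; have e := nbhs_singleton zz; split; rewrite /= -e.
  by apply: cvg_trans a; apply: near_eq_cvg; apply: filterS zz => s ->.
by apply: cvg_trans b; apply: near_eq_cvg; apply: filterS zz => s ->.
Qed.

Section State.
Variables (n m : nat) (a : 'M[C]_n) (b : 'M[C]_(n, m)).

Definition Xp k := iter k (mulmx a) b.
Definition xs (v : R -> 'cV[C]_m) t := ms (sh Xp) v t.

Lemma geo_Xp : geo Xp (nrm b) (Num.max 1 (nrm a)).
Proof. exact: geo_iter. Qed.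
Local Hint Resolve geo_Xp : core.

(** The state equation index by index: the shifted kernel produces the state and the zeroth term the
    input, so [Xp] is the kernel of [a x + b v]. *)
Lemma Xp_rec : Xp = (fun k => a *m sh Xp k + dl b k).
Proof. by apply: funext => -[|k] /=; rewrite ?mulmx0 ?add0r// addr0. Qed.

Lemma msXp v t : vt v -> 0 <= t -> ms Xp v t = a *m xs v t + b *m v t.
Proof.
move=> tv t0; rewrite {1}Xp_rec (msD (geoM a (geo_sh geo_Xp)) (geo_dl b))//.
by rewrite -(ms_mul (geo_sh geo_Xp))// ms_dl.
Qed.

(** Integrating the series term by term raises every iterated integral by one, which is the shift;
    with [msXp] this is the integral form of the state equation. *)
Lemma xs_CI v t i : vt v -> 0 <= t -> xs v t i 0 = CI (fun s => ms Xp v s i 0) t.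
Proof. by move=> tv t0; rewrite (ms_CI geo_Xp i tv t0) /xs (ms_sh geo_Xp tv t0). Qed.

Lemma ccont_xs v t i : vt v -> 0 < t -> ccont (fun s => xs v s i 0) t.
Proof.
move=> tv t0; apply: (@near_ccont (CI (fun s => ms Xp v s i 0))).
  by near=> s; apply/esym/xs_CI; [exact: tv|near: s; exact: near_ge].
by apply: ccont_CI => //; exact: (vt_ms geo_Xp tv).
Unshelve. all: by end_near. Qed.

Lemma xs_cder v t i : vt v -> 0 < t -> (forall l, ccont (fun s => v s l 0) t) ->
  cder (fun s => xs v s i 0) t ((a *m xs v t + b *m v t) i 0).
Proof.
move=> tv t0 cv; apply: (@near_cder (CI (fun s => ms Xp v s i 0))).
  by near=> s; apply/esym/xs_CI; [exact: tv|near: s; exact: near_ge].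
rewrite -msXp ?ltW//; apply: cder_CI => //; first exact: (vt_ms geo_Xp tv).
apply: (@near_ccont (fun s => (a *m xs v s + b *m v s) i 0)).
  by near=> s; rewrite msXp//; near: s; exact: near_ge.
rewrite (_ : (fun s => _) = (fun s => \sum_l a i l * xs v s l 0 + \sum_l b i l * v s l 0)).
  by apply: ccontD; apply: ccont_sum => l; apply: ccontZ => //; exact: ccont_xs.
by apply: funext => s; rewrite !mxE.
Unshelve. all: by end_near. Qed.

Lemma xs_decay v (T : R) : hurwitz a -> vt v -> 0 <= T -> (forall t, T < t -> v t = 0) ->
  tends0 (fun t => nrm (xs v t)).
Proof.
move=> ha tv T0 v0; apply: (@matrix_stable _ _ a _ T) => // t Tt i.
have t0 : 0 < t by exact: le_lt_trans Tt.
have := @xs_cder v t i tv t0; rewrite v0// mulmx0 addr0; apply.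
move=> l; apply: (@near_ccont (fun=> 0)); last exact: ccont_cst.
near=> s; rewrite v0 ?mxE//; near: s; exact: near_gt.
Unshelve. all: by end_near. Qed.

End State.

Lemma FTC_C (F f : R -> C) (x y : R) : x <= y -> (forall s, cder F s (f s)) ->
  (forall s, ccont f s) -> Cint lam `[x, y] f = F y - F x.
Proof.
rewrite le_eqVlt => /predU1P[<-|xy] dF cf.
  by rewrite subrr; apply: cext => /=; rewrite set_itv1 Rintegral_set1.
have aux (G h : R -> R) : (forall s : R, is_derive s 1 G (h s)) -> (forall s : R, h u @[u --> s] --> h s) ->
   \int[lam]_(s in `[x, y]) h s = G y - G x.
  move=> dG ch.
  have cG s : G u @[u --> s] --> G s.
    by apply: differentiable_continuous; apply/derivable1_diffP; have [] := dG s.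
  rewrite /Rintegral (@continuous_FTC2 _ _ G)//.
  - exact: continuous_subspaceT.
  - split; first by move=> s _; have [] := dG s.
      exact: cvg_at_right_filter.
    exact: cvg_at_left_filter.
  - by move=> s _; rewrite derive1E; have [] := dG s.
apply: cext; rewrite ?cReD ?cImD ?cReN ?cImN.
  exact: (aux (fun s => complex.Re (F s)) (fun s => complex.Re (f s))
    (fun s => (dF s).1) (fun s => (cf s).1)).
exact: (aux (fun s => complex.Im (F s)) (fun s => complex.Im (f s))
  (fun s => (dF s).2) (fun s => (cf s).2)).
Qed.

Definition ce (x : R) : C := (cos x +i* sin x)%C.

Lemma ceD x y : ce (x + y) = ce x * ce y.
Proof. by apply: cext; rewrite ?cReM ?cImM /= ?cosD ?sinD //; ring. Qed.
Lemma ce0 : ce 0 = 1.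
Proof. by rewrite /ce cos0 sin0. Qed.
Lemma ceJ x : conjc (ce x) = ce (- x).
Proof. by rewrite /ce /= cosN sinN. Qed.
Lemma cabs2_ce x : cabs2 (ce x) = 1.
Proof. by rewrite /cabs2 /= cos2Dsin2. Qed.
Lemma n1_ce x : n1 (ce x) <= 2.
Proof. by rewrite /n1 /= -[2]/(1 + 1) lerD// ler_norml ?cos_geN1 ?cos_le1 ?sin_geN1 ?sin_le1. Qed.
Lemma is_derive_mulr (w s : R) : is_derive s 1 (fun x : R => w * x) w.
Proof.
have -> : (fun x : R => w * x) = w *: (@idfun R) by [].
by apply: is_derive_eq; rewrite /GRing.scale /= mulr1.
Qed.
Lemma cder_ce w s : cder (fun t => ce (w * t)) s (('i * w%:C)%C * ce (w * s)).
Proof.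
split => /=.
  have := is_derive1_comp (is_derive_cos (w * s)) (is_derive_mulr w s).
  by congr (is_derive _ _ _ _); rewrite mulrC; ring.
have := is_derive1_comp (is_derive_sin (w * s)) (is_derive_mulr w s).
by congr (is_derive _ _ _ _); ring.
Qed.
Lemma ccont_ce w s : ccont (fun t => ce (w * t)) s.
Proof.
have [[d1 _] [d2 _]] := cder_ce w s.
by split; apply: differentiable_continuous; apply/derivable1_diffP.
Qed.
Lemma tbf_ce w : tbf (fun t => ce (w * t)).
Proof.
move=> T; split; last by exists 2 => x _; exact: n1_ce.
split; apply: measurable_funTS; apply: continuous_measurable_fun => s; first by have [] := ccont_ce w s.
by have [] := ccont_ce w s.
Qed.
Lemma CI_ce w t : 0 <= t -> ('i * w%:C)%C * CI (fun s => ce (w * s)) t = ce (w * t) - 1.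
Proof.
move=> t0; rewrite -CI_Z; last exact: tbf_ce.
rewrite /CI (FTC_C t0 (F := fun s => ce (w * s))).
- by rewrite mulr0 ce0.
- by move=> s; exact: cder_ce.
- by move=> s; apply: ccontZ; exact: ccont_ce.
Qed.

End SingleFrequency.

(** * Free motion and response to exponentials *)

Section FrequencyResponse.
Variable R : realType.
Local Notation C := R[i].
Local Notation lam := (@lebesgue_measure R).

Lemma vt_cst m (c : 'cV[C]_m) : vt (fun _ : R => c).
Proof. by move=> i; exact: tbf_cst. Qed.

Lemma hurwitz_unit n (a : 'M[C]_n) (w : R) : hurwitz a ->
  (('i * w%:C)%C%:M - a) \in unitmx.
Proof.
move=> ha; rewrite unitmxE unitfE; apply/negP => /det0P [v v0 va].
have : eigenvalue a ('i * w%:C)%C.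
  apply/eigenvalueP; exists v => //.
  by move/eqP: va; rewrite mulmxBr mul_mx_scalar subr_eq0 => /eqP.
by move=> /ha; rewrite cReM /= mulr0 mul0r subrr ltxx.
Qed.

(* e^(t a) xi *)
Definition Es n (a : 'M[C]_n) (xi : 'cV[C]_n) (t : R) : 'cV[C]_n :=
  ms (Xp a xi) (fun=> 1%:M : 'cV[C]_1) t.

Lemma eq_msl p q (M N : nat -> 'M[C]_(p, q)) (v : R -> 'cV[C]_q) (t : R) :
  (forall k, M k = N k) -> ms M v t = ms N v t.
Proof. by move=> MN; rewrite (_ : M = N)//; apply: funext. Qed.

Section Es.
Variables (n : nat) (a : 'M[C]_n).

Lemma EsE xi t : 0 <= t -> Es a xi t = a *m xs a xi (fun=> 1%:M : 'cV[C]_1) t + xi.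
Proof. by move=> t0; rewrite /Es msXp// ?mulmx1//; exact: vt_cst. Qed.

Lemma Es_decay xi : hurwitz a -> tends0 (fun t => nrm (Es a xi t)).
Proof.
move=> ha; apply: (@matrix_stable _ _ a _ 0) => // t t0 i.
apply: (@near_cder _ (fun s => (a *m xs a xi (fun=> 1%:M : 'cV[C]_1) s + xi) i 0)).
  by near=> s; rewrite EsE//; near: s; exact: near_ge.
rewrite EsE ?ltW//.
under eq_fun do rewrite mxE [X in X + _]mxE.
rewrite -[X in cder _ _ X]addr0; apply: cderD; last exact: cder_cst.
rewrite mxE; apply: cder_sum => l; apply: cderZ.
have := @xs_cder R _ _ a xi (fun=> 1%:M : 'cV[C]_1) t l (vt_cst _) t0.
rewrite mulmx1; apply; move=> k; exact: ccont_cst.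
Unshelve. all: by end_near. Qed.

Lemma EsD xi eta t : 0 <= t -> Es a (xi + eta) t = Es a xi t + Es a eta t.
Proof.
move=> t0; rewrite /Es -(msD (geo_Xp a xi) (geo_Xp a eta) (vt_cst _) t0).
by apply: eq_msl => k; elim: k => [//|k /= ->]; rewrite mulmxDr.
Qed.
Lemma Es_mul (M : 'M[C]_n) xi t : M *m a = a *m M -> 0 <= t ->
  M *m Es a xi t = Es a (M *m xi) t.
Proof.
move=> Ma t0; rewrite /Es (ms_mul (geo_Xp a xi) M (vt_cst _) t0).
by apply: eq_msl => k; elim: k => [//|k /= <-]; rewrite !mulmxA Ma.
Qed.
Lemma EsZ z xi t : 0 <= t -> Es a (z *: xi) t = z *: Es a xi t.
Proof.
move=> t0; rewrite -!mul_scalar_mx Es_mul// mul_scalar_mx mul_mx_scalar//.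
Qed.
Lemma Es_sum I (r : seq I) (xi : I -> 'cV[C]_n) t : 0 <= t ->
  Es a (\sum_(i <- r) xi i) t = \sum_(i <- r) Es a (xi i) t.
Proof.
move=> t0; elim: r => [|i r ih].
  by rewrite !big_nil -(scale0r (0 : 'cV[C]_n)) EsZ// !scale0r.
by rewrite !big_cons EsD// ih.
Qed.

(** For each basis vector the free motion is bounded on a bounded interval by the series estimate
    and afterwards by its decay; linearity in [xi] gives one constant for all vectors. *)
Lemma Es_bound : hurwitz a -> exists2 K : R, 0 < K &
  forall xi t, 0 <= t -> nrm (Es a xi t) <= K * nrm xi.
Proof.
move=> ha.
have bnd (xi : 'cV[C]_n) : exists2 K : R, 0 <= K & forall t, 0 <= t -> nrm (Es a xi t) <= K.
  have [s hs] := Es_decay xi ha ltr01.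
  have tE : vt (Es a xi) by exact: (vt_ms (geo_Xp a xi) (vt_cst _)).
  have [M M0 hM] := vt_bound (Num.max s 0) tE.
  exists (Num.max M 1); first by rewrite le_max M0.
  move=> t t0; rewrite le_max; have [ts|ts] := leP s t; first by rewrite hs// orbT.
  by rewrite hM// t0 le_max ltW.
have {}bnd i := cid2 (bnd (delta_mx i 0)).
exists (1 + \sum_i s2val (bnd i)).
  by rewrite ltr_wpDr// sumr_ge0// => i _; case: (bnd i).
move=> xi t t0; rewrite {1}(matrix_sum_delta xi).
under eq_bigr do rewrite big_ord1.
rewrite Es_sum// (le_trans (nrm_sum _ _ _))//.
apply: (@le_trans _ _ (\sum_i nrm xi * s2val (bnd i))).
  apply: ler_sum => i _; rewrite EsZ// (le_trans (nrmZ _ _))//.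
  by apply: ler_pM; rewrite ?n1_ge0 ?nrm_ge0 ?nrm_entry//; case: (bnd i) => /= K _; apply.
by rewrite -mulr_sumr mulrC ler_wpM2r ?nrm_ge0// ler_wpDl.
Qed.

Lemma Es_unif : hurwitz a -> forall e : R, 0 < e -> exists s : R, forall t, s <= t ->
  0 <= t -> forall xi, nrm (Es a xi t) <= e * nrm xi.
Proof.
move=> ha e e0.
(* [n] basis vectors each contribute at most this; the successor keeps the divisor positive. *)
have e1 : 0 < e / n.+1%:R by rewrite divr_gt0.
pose h i := cid (Es_decay (delta_mx i 0) ha e1).
exists (\sum_i `|sval (h i)|) => t st t0 xi.
rewrite {1}(matrix_sum_delta xi).
under eq_bigr do rewrite big_ord1.
rewrite Es_sum// (le_trans (nrm_sum _ _ _))//.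
apply: (@le_trans _ _ (\sum_(i < n) nrm xi * (e / n.+1%:R))).
  apply: ler_sum => i _; rewrite EsZ// (le_trans (nrmZ _ _))//.
  apply: ler_pM; rewrite ?n1_ge0 ?nrm_ge0 ?nrm_entry//.
  apply: (svalP (h i)); apply: le_trans st.
  by rewrite (bigD1 i)//= (le_trans (ler_norm _))// lerDl sumr_ge0.
rewrite sumr_const card_ord -mulrnAr mulrC ler_wpM2r ?nrm_ge0//.
by rewrite -mulr_natr mulrAC ler_pdivrMr// ler_pM2l// ler_nat.
Qed.
End Es.

Section Response.
Variables (n m : nat) (a : 'M[C]_n) (b : 'M[C]_(n, m)).
Definition res w := invmx (('i * w%:C)%C%:M - a).
Definition ev (w : R) (c0 : 'cV[C]_m) (t : R) : 'cV[C]_m := ce (w * t) *: c0.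

Lemma vt_ev w c0 : vt (ev w c0).
Proof.
move=> i; rewrite (_ : (fun t => _) = (fun t => c0 i 0 * ce (w * t))).
  by apply: tbfZ; exact: tbf_ce.
by apply: funext => t; rewrite mxE mulrC.
Qed.

Lemma res_comm w : hurwitz a -> res w *m a = a *m res w.
Proof.
move=> ha; have u := hurwitz_unit w ha.
have h : (('i * w%:C)%C%:M - a) *m a = a *m (('i * w%:C)%C%:M - a).
  by rewrite mulmxBl mulmxBr mul_scalar_mx mul_mx_scalar.
by rewrite -[LHS]mulmx1 -(mulmxV u) !mulmxA -(mulmxA _ a) -h mulmxA mulVmx// mul1mx.
Qed.

Lemma ms_Xp_cst c0 t : ms (Xp a b) (fun=> c0) t = Es a (b *m c0) t.
Proof.
congr vsum; apply: funext => k.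
have -> : VIp k (fun=> c0) t = c0 *m VIp k (fun=> 1%:M : 'cV[C]_1) t.
  apply/matrixP => i j; rewrite !mxE big_ord1 ord1 !mxE.
  have := congr1 (@^~ t) (Ip_Z k (c0 i 0) (@tbf_cst R 1)) => /= <-.
  by congr (Ip k _ t); apply: funext => s; rewrite mulr1.
rewrite mulmxA; congr (_ *m _); rewrite /Xp; elim: k => [//|k /= <-].
by rewrite mulmxA.
Qed.

#[local] Opaque Es.
(** From rest, the response is the periodic regime minus the free motion that cancels it at [t = 0].
    The identity is proved after multiplication by [i w - a], which is invertible since [a] is
    Hurwitz. *)
Lemma xs_ev w c0 t : hurwitz a -> 0 <= t ->
  xs a b (ev w c0) t = ce (w * t) *: (res w *m b *m c0) - Es a (res w *m b *m c0) t.
Proof.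
move=> ha t0; have u := hurwitz_unit w ha.
suff h : (('i * w%:C)%C%:M - a) *m xs a b (ev w c0) t =
    ce (w * t) *: (b *m c0) - Es a (b *m c0) t.
  have -> : xs a b (ev w c0) t = res w *m ((('i * w%:C)%C%:M - a) *m xs a b (ev w c0) t).
    by rewrite mulmxA mulVmx ?mul1mx.
  rewrite h mulmxBr.
  rewrite (Es_mul _ (res_comm w ha) t0).
  rewrite (mulmxA (res w) b c0); congr (_ - _).
  by rewrite -(scalemxAr (ce (w * t)) (res w) (b *m c0)) (mulmxA (res w) b c0).
have tv := vt_ev w c0.
(* [i w] times a primitive of [e^(i w t)] is [e^(i w t) - 1]; the constants left over at each level
   sum up to the free motion. *)
have Iv k : ('i * w%:C)%C *: VIp k.+1 (ev w c0) t =
    VIp k (ev w c0) t - VIp k (fun=> c0) t.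
  apply/matrixP => i j; rewrite !mxE.
  have tc := @tbf_ce R w.
  have e1 : (fun s => ev w c0 s i 0) = (fun s => c0 i 0 * ce (w * s)).
    by apply: funext => s; rewrite mxE mulrC.
  have e2 : (fun s : R => c0 i 0) = (fun s : R => c0 i 0 * 1).
    by apply: funext => s; rewrite mulr1.
  rewrite e1 [in RHS]e2 !Ip_Z//; last exact: tbf_cst.
  rewrite mulrCA -mulrBr; congr (_ * _).
  have -> : Ip k.+1 (fun s => ce (w * s)) t = Ip k (CI (fun s => ce (w * s))) t.
    by rewrite Ip_Sr.
  have := congr1 (@^~ t) (Ip_Z k ('i * w%:C)%C (tbf_CI tc)) => /= <-.
  have e3 s : 0 <= s <= t -> ('i * w%:C)%C * CI (fun s => ce (w * s)) s =
     ce (w * s) + (-1) * 1.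
    by move=> /andP[s0 _]; rewrite CI_ce// mulr1.
  have tt : 0 <= t <= t by rewrite t0 lexx.
  rewrite (eq_Ip k e3 tt) Ip_D//; last by apply: tbfZ; exact: tbf_cst.
  by rewrite Ip_Z ?mulN1r//; exact: tbf_cst.
rewrite mulmxBl mul_scalar_mx.
have g0 := geo_Xp a b; have g1 := geo_sh g0.
have -> : ('i * w%:C)%C *: xs a b (ev w c0) t = ms (Xp a b) (ev w c0) t - Es a (b *m c0) t.
  rewrite -ms_Xp_cst /xs (ms_sh g0 tv t0).
  have hS : vsbl (fun k => Xp a b k *m VIp k.+1 (ev w c0) t).
    have [mm cm hm] := ms_sbl g1 tv t0.
    exists (fun k => mm k.+1); last by move=> k; exact: (hm k.+1).
    have cm' : cvgn (fun n => series mm n.+1).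
      by apply/cvg_ex; exists (limn (series mm)); rewrite (cvg_shiftS (series mm)).
    rewrite (_ : series _ = (fun n => series mm n.+1 - mm 0%N)).
      by apply: is_cvgB cm' _; exact: is_cvg_cst.
    by apply: funext => p; rewrite /series /= big_nat_recl// addrAC subrr add0r.
  rewrite -vsumZ// /ms; apply/eqP; rewrite eq_sym subr_eq eq_sym; apply/eqP.
  have s1 := ms_sbl g0 tv t0; have s2 := ms_sbl g0 (vt_cst c0) t0.
  rewrite -vsumD//; last first.
    have [mm cm hm] := hS; exists (n1 ('i * w%:C)%C *: mm); first exact: is_cvg_seriesZ.
    by move=> k; rewrite (le_trans (nrmZ _ _))// ler_wpM2l ?n1_ge0.
  congr vsum; apply: funext => k; rewrite scalemxAr Iv mulmxBr subrK//.
rewrite (msXp _ _ tv t0) addrAC (addrC (a *m _)) addrK; congr (_ - _).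
by rewrite /ev -scalemxAr.
Qed.
End Response.
End FrequencyResponse.

#[global] Opaque ms xs Es res.

(** * The work form at one frequency *)

Section Work.
Variable R : realType.
Local Notation C := R[i].
Local Notation lam := (@lebesgue_measure R).
Variables (n m r : nat) (a : 'M[C]_n) (b : 'M[C]_(n, m)) (c : 'M[C]_(r, n))
  (d : 'M[C]_(r, m)) (g : 'M[C]_(m, r)).

Definition Zp k := g *m (c *m sh (Xp a b) k + dl d k).
Definition zs (v : R -> 'cV[C]_m) t := ms Zp v t.

Lemma geo_Zp : geo Zp (nrm g * (nrm c * nrm b + nrm d)) (Num.max 1 (nrm a)).
Proof.
have := geoD (geoM c (geo_sh (geo_Xp a b))) (geo_dl d) => /(geoM g).
by rewrite (max_idPl _)// le_max lexx.
Qed.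

Lemma vt_zs v : vt v -> vt (zs v).
Proof. by move=> tv; exact: (vt_ms geo_Zp tv). Qed.

Lemma zsE v t : vt v -> 0 <= t -> zs v t = g *m (c *m xs a b v t + d *m v t).
Proof.
move=> tv t0.
have g1 := geo_sh (geo_Xp a b).
have h1 : ms (fun k => c *m sh (Xp a b) k + dl d k) v t = c *m xs a b v t + d *m v t.
  by rewrite (msD (geoM c g1) (geo_dl d) tv t0) -(ms_mul g1 c tv t0) (ms_dl d tv t0).
by rewrite -h1 (ms_mul (geoD (geoM c g1) (geo_dl d)) g tv t0).
Qed.

(* qf T v w is the work int_0^T v^* G y, y being the output driven by w from rest *)
Definition wf (v w : R -> 'cV[C]_m) (t : R) : C := (adjmx (v t) *m zs w t) 0 0.
Definition qf T v w : C := CI (wf v w) T.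

Definition trf w : 'M[C]_(r, m) := c *m res a w *m b + d.
Definition psdat (w : R) := psdmx (adjmx (trf w) *m adjmx g + g *m trf w).

Lemma adjE p (x y : 'cV[C]_p) : (adjmx x *m y) 0 0 = \sum_i conjc (x i 0) * y i 0.
Proof. by rewrite mxE; apply: eq_bigr => i _; rewrite !mxE. Qed.

Lemma tbf_wf v w : vt v -> vt w -> tbf (wf v w).
Proof.
move=> tv tw; rewrite (_ : wf v w = fun t => \sum_i conjc (v t i 0) * zs w t i 0).
  by apply: tbf_sum => i; apply: tbfM; [apply: tbfJ|]; [exact: tv|exact: vt_zs].
by apply: funext => t; rewrite /wf adjE.
Qed.

Lemma adjmxM p q s (M : 'M[C]_(p, q)) (N : 'M[C]_(q, s)) : adjmx (M *m N) = adjmx N *m adjmx M.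
Proof.
apply/matrixP => i j; rewrite !mxE rmorph_sum; apply: eq_bigr => k _.
by rewrite !mxE rmorphM mulrC.
Qed.
Lemma adjmxK p q (M : 'M[C]_(p, q)) : adjmx (adjmx M) = M.
Proof. by apply/matrixP => i j; rewrite !mxE conjcK. Qed.

(** [E] is the sum of [G F] and its adjoint, so its form is twice the real part of the form of
    [G F]; nonnegativity in [R[i]] includes being real, which holds for this sum. *)
Lemma psdatP w : psdat w <-> forall x : 'cV[C]_m,
  0 <= complex.Re ((adjmx x *m (g *m trf w *m x)) 0 0).
Proof.
have key (x : 'cV[C]_m) : (adjmx x *m (adjmx (trf w) *m adjmx g + g *m trf w) *m x) 0 0 =
   conjc ((adjmx x *m (g *m trf w *m x)) 0 0) + (adjmx x *m (g *m trf w *m x)) 0 0.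
  rewrite mulmxDr mulmxDl mxE; congr (_ + _); last by rewrite !mulmxA.
  have -> : conjc ((adjmx x *m (g *m trf w *m x)) 0 0) = (adjmx (adjmx x *m (g *m trf w *m x))) 0 0.
    by rewrite !mxE.
  by rewrite !adjmxM adjmxK !mulmxA.
split=> h x; have := h x; rewrite /= key lecE /= ?cReD ?cImD ?cReJ ?cImJ.
  by case/andP => _ hh; lra.
by move=> hh; rewrite addrC subrr eqxx addr_ge0.
Qed.

(** The phases of input and periodic regime cancel, so the power is a constant plus a term carrying
    the decaying free motion. *)
Lemma wf_ev w c0 t : hurwitz a -> 0 <= t ->
  wf (ev w c0) (ev w c0) t = (adjmx c0 *m (g *m trf w *m c0)) 0 0 -
   conjc (ce (w * t)) * (adjmx c0 *m (g *m c *m Es a (res a w *m b *m c0) t)) 0 0.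
Proof.
move=> ha t0; rewrite /wf (zsE (vt_ev w c0) t0) (xs_ev b w c0 ha t0).
have -> : adjmx (ev w c0 t) = conjc (ce (w * t)) *: adjmx c0.
  by apply/matrixP => i j; rewrite !mxE rmorphM.
set E := Es a _ t; set z := ce (w * t); set A0 := res a w.
have -> : c *m (z *: (A0 *m b *m c0) - E) + d *m ev w c0 t = z *: (trf w *m c0) - c *m E.
  by rewrite mulmxBr -scalemxAr /ev -scalemxAr /trf mulmxDl !mulmxA scalerDr addrAC.
rewrite mulmxBr -scalemxAr mulmxBr -!scalemxAl -scalemxAr scalerA.
have -> : conjc z * z = 1 by rewrite mulJ_cabs2 cabs2_ce.
by rewrite scale1r !mxE !mulmxA.
Qed.

Lemma tbf_Es xi i : tbf (fun t => Es a xi t i 0).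
Proof. by move: i; exact: (vt_ms (geo_Xp a xi) (vt_cst _)). Qed.

(** The power tends to the constant of [wf_ev]. If its real part were negative, the work over
    [[0, N]] would decrease at least linearly in the end and become negative. *)
Lemma freq_necessary w c0 : hurwitz a ->
  (forall N : nat, 0 <= complex.Re (qf N%:R (ev w c0) (ev w c0))) ->
  0 <= complex.Re ((adjmx c0 *m (g *m trf w *m c0)) 0 0).
Proof.
move=> ha hq; rewrite leNgt; apply/negP => lt0.
set x := complex.Re _ in lt0.
pose e := - x / 2; have e0 : 0 < e by rewrite divr_gt0// oppr_gt0.
have tv := vt_ev w c0; have tw := tbf_wf tv tv.
(* The factor by which the free motion enters the power, [2] bounding the phase; one is added to
   keep it positive. *)
pose K := 2 * nrm (adjmx c0) * nrm (g *m c) + 1.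
have K0 : 0 < K by rewrite ltr_wpDl// !mulr_ge0 ?nrm_ge0.
have [s hs] := Es_decay (res a w *m b *m c0) ha (divr_gt0 e0 K0).
pose s0 := Num.max s 0.
have s00 : 0 <= s0 by rewrite le_max lexx orbT.
have bound t : s0 <= t -> complex.Re (wf (ev w c0) (ev w c0) t) <= - e.
  rewrite ge_max => /andP[st t0]; rewrite wf_ev// cReD cReN.
  set y := complex.Re (conjc _ * _); have hy : - e <= y.
    have : `|y| <= e.
      apply: (le_trans (le_Re_n1 _)); apply: (le_trans (n1M _ _)).
      have h1 : n1 (conjc (ce (w * t))) <= 2 by rewrite n1J n1_ce.
      have h2 : n1 ((adjmx c0 *m (g *m c *m Es a (res a w *m b *m c0) t)) 0 0) <=
          nrm (adjmx c0) * (nrm (g *m c) * (e / K)).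
        apply: (le_trans (nrm_entry _ _ _)); apply: (le_trans (nrmM _ _)).
        rewrite ler_wpM2l ?nrm_ge0//; apply: (le_trans (nrmM _ _)).
        by rewrite ler_wpM2l ?nrm_ge0// hs.
      apply: (le_trans (ler_pM (n1_ge0 _) (n1_ge0 _) h1 h2)).
      have -> : 2 * (nrm (adjmx c0) * (nrm (g *m c) * (e / K))) = e * ((K - 1) / K).
        by rewrite /K addrK; field; rewrite -/K gt_eqF.
      by rewrite ler_piMr ?(ltW e0)// ler_pdivrMr// mul1r lerBlDr lerDl ler01.
    by rewrite ler_norml => /andP[].
  by rewrite -/x /e in hy *; lra.
have [M M0 hM] := tbf_bound s0 tw.
have J0 N : (s0 <= N%:R) -> complex.Re (qf N%:R (ev w c0) (ev w c0)) <= M * s0 - e * (N%:R - s0).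
  move=> sN.
  rewrite /qf (CI_split tw s00 sN) cReD; apply: lerD.
    apply: (le_trans (ler_norm _)); apply: (le_trans (le_Re_n1 _)).
    have := tbf_CI_aux tw hM (lexx 0) s00 (lexx _); rewrite CI_at0 !subr0; exact.
  have fl : (lam `]s0, (N%:R : R)] < +oo)%E.
    by rewrite lebesgue_measure_itv/=; case: ifP => _; rewrite ?ltry// -EFinB ltry.
  have mI' : measurable (`]s0, (N%:R : R)] : set (g_sigma_algebraType (@measurable _ (ocitv_type R)))).
    exact: measurable_itv.
  have bw : cbm `]s0, N%:R] (wf (ev w c0) (ev w c0)).
    apply: (sub_cbm (mI 0 N%:R) _ (tw N%:R)) => y /=.
    by rewrite !in_itv/= => /andP[/ltW sy ->]; rewrite (le_trans s00 sy).
  have -> : - (e * (N%:R - s0)) = \int[lam]_(x in `]s0, (N%:R : R)]) (- e).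
    rewrite Rintegral_cst// mulNr; congr (- (_ * _)).
    exact/esym/fine_lam_oc.
  apply: (le_Rintegral mI').
  - exact: (cbm_iRe mI' fl bw).
  - by apply: (@bounded_integrable _ _ _ _ _ mI' fl _ `|e|) => // y _; rewrite normrN.
  - by move=> y /=; rewrite in_itv/= => /andP[/ltW sy _]; exact: bound.
(* Past this horizon the linear loss [e * (N - s0)] exceeds [M * s0], the most that can be gained
   before [s0]. *)
pose N := (Num.truncn (s0 + M * s0 / e)).+1.
have hN : s0 + M * s0 / e < N%:R by rewrite /N truncnS_gt.
have sN : s0 <= N%:R.
  apply: (le_trans _ (ltW hN)); rewrite lerDl; apply: divr_ge0; [exact: mulr_ge0|exact: ltW].
have := le_trans (hq N) (J0 N sN); apply/negP; rewrite -ltNge subr_lt0.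
by rewrite -ltr_pdivrMl// mulrC ltrBrDl.
Qed.

End Work.

(** * Fejer means *)

Section Fejer.
Variable R : realType.
Local Notation C := R[i].
Local Notation lam := (@lebesgue_measure R).

Lemma cos_ler (x y : R) : 0 <= x -> x <= y -> y <= pi -> cos y <= cos x.
Proof.
move=> x0; rewrite le_eqVlt => /predU1P[->//|xy] yp; apply: ltW.
by rewrite ltr_cos// in_itv/= ?x0 ?yp ?(le_trans x0 (ltW xy)) ?(le_trans (ltW xy) yp).
Qed.
Lemma ce_natmul (x : R) k : ce (k%:R * x) = ce x ^+ k.
Proof.
elim: k => [|k ih]; first by rewrite mul0r ce0.
by rewrite exprS -ih -ceD -nat1r mulrDl mul1r.
Qed.
Lemma ce_2pi : ce (pi *+ 2) = 1 :> C.
Proof. by rewrite /ce cos2pi sin2pi. Qed.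
Lemma ce_int2pi (z : int) : ce (z%:~R * (pi *+ 2)) = 1 :> C.
Proof.
case: z => k; first by rewrite ce_natmul ce_2pi expr1n.
by rewrite NegzE rmorphN /= mulNr -ceJ ce_natmul ce_2pi expr1n conjc1.
Qed.

Variables (al P : R).
Hypothesis P0 : 0 < P.
Let th : R := (pi *+ 2) / P.
Let th0 : 0 < th.
Proof. by rewrite divr_gt0// mulrn_wgt0// pi_gt0. Qed.
Local Notation I := ([set` `[al, al + P]] : set R).
Let mJ : @measurable _ (g_sigma_algebraType (@measurable _ (ocitv_type R))) I := measurable_itv _.
Let fJ : (lam I < +oo)%E := lam_fin _ _.
Let lJ : fine (lam I) = P.
Proof. by rewrite fine_lam ?lerDl ?(ltW P0)//; ring. Qed.

Lemma cbm_ce (D : set R) w : cbm D (fun y : R => ce (w * y)).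
Proof.
split; last by exists 2 => x _; exact: n1_ce.
split; apply: measurable_funTS; apply: continuous_measurable_fun => s; first by have [] := ccont_ce w s.
by have [] := ccont_ce w s.
Qed.

Lemma ce_orth (z : int) : Cint lam I (fun y => ce (z%:~R * th * y)) = if z == 0 then P%:C%C else 0.
Proof.
case: eqP => [->|/eqP z0].
  transitivity (Cint lam I (fun=> 1 : C)).
    by apply: eq_Cint => y _; rewrite mul0r mul0r ce0.
  by rewrite (Cint_cst lam mJ) mul1r lJ.
have w0 : ('i * (z%:~R * th)%:C)%C != 0 :> C.
  apply: mulf_neq0; rewrite eq_complex /= ?oner_eq0 ?andbF// eqxx andbT.
  by apply: mulf_neq0; [rewrite intr_eq0|rewrite gt_eqF].
have aP : al <= al + P by rewrite lerDl ltW.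
have bc : cbm I (fun y : R => ce (z%:~R * th * y)) := cbm_ce _ _.
apply: (mulfI w0); rewrite mulr0 -(CintZ mJ fJ _ bc).
rewrite (FTC_C aP (F := fun y => ce (z%:~R * th * y))).
- rewrite mulrDr ceD [X in ce _ * ce X](_ : _ = z%:~R * (pi *+ 2)).
    by rewrite ce_int2pi mulr1 subrr.
  by rewrite /th -mulrA divfK// gt_eqF.
- by move=> s; exact: cder_ce.
- by move=> s; apply: ccontZ; exact: ccont_ce.
Qed.

Definition fker (N : nat) (x : R) : R := N%:R^-1 * cabs2 (\sum_(j < N) ce (j%:R * x)).

Lemma fker_ge0 N x : 0 <= fker N x.
Proof. by rewrite mulr_ge0 ?invr_ge0// cabs2_ge0. Qed.

Lemma fkerE N x : (fker N x)%:C%C =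
  (N%:R^-1)%:C%C * \sum_(j < N) \sum_(k < N) ce ((k%:Z - j%:Z)%:~R * x).
Proof.
rewrite /fker rmorphM /=; congr (_ * _).
rewrite -mulJ_cabs2 rmorph_sum mulr_suml; apply: eq_bigr => j _.
rewrite mulr_sumr; apply: eq_bigr => k _.
rewrite -[X in X * _ = _]/(conjc (ce _)) ceJ -ceD; congr ce.
by rewrite rmorphB /= -!pmulrn; ring.
Qed.

(** [2 - 2 cos x = |e^(i x) - 1|^2], and this factor turns the geometric sum into [e^(i N x) - 1],
    of squared modulus at most 4. Away from the period lattice the kernel is thus of order
    [1 / N]. *)
Lemma fker_tail N x : fker N x * (2 - 2 * cos x) <= 4 / N%:R.
Proof.
case: N => [|N]; first by rewrite /fker invr0 !mul0r mulr0.
rewrite /fker mulrC mulrA [leRHS]mulrC mulrAC [X in X <= _]mulrC ler_wpM2l ?invr_ge0//.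
have -> : 2 - 2 * cos x = cabs2 (ce x - 1).
  rewrite /cabs2 cReD cImD cReN cImN /= oppr0 addr0.
  have := cos2Dsin2 x; nra.
rewrite -cabs2M [X in cabs2 (_ * X)](_ : _ = \sum_(j < N.+1) ce x ^+ j); last first.
  by apply: eq_bigr => j _; rewrite ce_natmul.
rewrite -subrX1 -ce_natmul /cabs2 cReD cImD cReN cImN /= oppr0 addr0.
set y := _ * x; have := cos2Dsin2 y; have := cos_geN1 y; nra.
Qed.

(** In the expanded double sum orthogonality keeps only the [N] diagonal terms. *)
Lemma fker_mass N (x : R) : (0 < N)%N -> \int[lam]_(y in I) fker N (th * (x - y)) = P.
Proof.
move=> N0.
have e1 : Cint lam I (fun y => (fker N (th * (x - y)))%:C%C) = P%:C%C.
  transitivity (Cint lam I (fun y => \sum_(j < N) \sum_(k < N)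
      ((N%:R^-1)%:C%C * ce ((k%:Z - j%:Z)%:~R * th * x)) * ce ((j%:Z - k%:Z)%:~R * th * y))).
    apply: eq_Cint => y _; rewrite fkerE mulr_sumr; apply: eq_bigr => j _.
    rewrite mulr_sumr; apply: eq_bigr => k _; rewrite -mulrA -ceD; congr (_ * ce _).
    by rewrite !rmorphB /=; ring.
  have bc j k : cbm I (fun y : R => ((N%:R^-1)%:C%C * ce ((k%:Z - j%:Z)%:~R * th * x)) *
     ce ((j%:Z - k%:Z)%:~R * th * y)) by apply: cbmZ; exact: cbm_ce.
  rewrite (Cint_sum mJ fJ); last by move=> j; apply: cbm_sum => k; exact: bc.
  transitivity (\sum_(j < N) (N%:R^-1 * P)%:C%C : C).
    apply: eq_bigr => j _; rewrite (Cint_sum mJ fJ); last by move=> k; exact: bc.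
    rewrite (bigD1 j)//= big1 ?addr0.
      rewrite (CintZ mJ fJ) ?ce_orth; last exact: cbm_ce.
      by rewrite !subrr eqxx mul0r mul0r ce0 mulr1 rmorphM.
    move=> k kj; rewrite (CintZ mJ fJ) ?ce_orth; last exact: cbm_ce.
    rewrite ifF ?mulr0//; apply/negbTE; rewrite subr_eq0 eqz_nat.
    by apply: contra kj => /eqP jk; apply/eqP/val_inj.
  rewrite sumr_const card_ord -rmorphMn /= -mulr_natl mulrA divff ?mul1r//.
  by rewrite pnatr_eq0 -lt0n.
by have := congr1 (@complex.Re R) e1.
Qed.

Definition fejer (N : nat) (f : R -> R) (x : R) : R :=
  P^-1 * \int[lam]_(y in I) (f y * fker N (th * (x - y))).

Variables (f : R -> R) (M : R).
Hypotheses (mf : measurable_fun I f) (fM : forall y, I y -> `|f y| <= M).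

Lemma cbm_fker N (x : R) : cbm I (fun y => (fker N (th * (x - y)))%:C%C).
Proof.
apply: (@eq_cbm _ _ _ _ (fun y => \sum_(j < N) \sum_(k < N)
      ((N%:R^-1)%:C%C * ce ((k%:Z - j%:Z)%:~R * th * x)) * ce ((j%:Z - k%:Z)%:~R * th * y))).
  move=> y _; rewrite fkerE mulr_sumr; apply: eq_bigr => j _.
  rewrite mulr_sumr; apply: eq_bigr => k _; rewrite -mulrA -ceD; congr (_ * ce _).
  by rewrite !rmorphB /=; ring.
by apply: cbm_sum => j; apply: cbm_sum => k; apply: cbmZ; exact: cbm_ce.
Qed.

Lemma cbm_f : cbm I (fun y => (f y)%:C%C).
Proof. by split; [exact: cmf_real|exists M => y Iy; rewrite n1_real fM]. Qed.

Lemma fker_int N (x : R) : lam.-integrable I (EFin \o (fun y => fker N (th * (x - y)))).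
Proof. exact: (cbm_iRe mJ fJ (cbm_fker N x)). Qed.

Lemma fejer_int N (x : R) : lam.-integrable I (EFin \o (fun y => f y * fker N (th * (x - y)))).
Proof.
have := cbm_iRe mJ fJ (cbmM cbm_f (cbm_fker N x)); apply: eq_integrable => // y _.
by rewrite /= mulr0 subr0.
Qed.

(** The kernel is nonnegative with mass [P], so a Fejer mean is an average and keeps the bound [M].
    Plain Fourier partial sums would not. *)
Lemma fejer_bound N x : (0 < N)%N -> `|fejer N f x| <= M.
Proof.
move=> N0; rewrite /fejer normrM gtr0_norm ?invr_gt0// mulrC ler_pdivrMr//.
apply: (le_trans (le_normr_Rintegral mJ (fejer_int N x))).
rewrite -[X in M * X](fker_mass x N0) -(RintegralZl M mJ (fker_int N x)).
apply: (le_Rintegral mJ).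
- exact: integrable_norm (fejer_int N x).
- by have := integrableZl mJ M (fker_int N x).
- by move=> y Iy; rewrite normrM (ger0_norm (fker_ge0 _ _)) ler_wpM2r ?fker_ge0 ?fM.
Qed.

Lemma fejer_cvg (x : R) : al < x < al + P -> {for x, continuous f} ->
  fejer N.+1 f x @[N --> \oo] --> f x.
Proof.
move=> /andP[ax xa] cfx; apply/cvgrPdist_le => e e0.
have e20 : 0 < e / 2 by rewrite divr_gt0.
move/cvgrPdist_le: cfx => /(_ _ e20)/nbhs_ballP[d0 /= d00 hd0].
(* Halved to be strictly below [d0] and below the distances from [x] to both ends; then
   [d <= |x - y|] confines [th * |x - y|] to [[th * d, 2 pi - th * d]], away from the zeros of
   [2 - 2 cos]. *)
pose d := Num.min (d0 / 2) (Num.min (x - al) (al + P - x)) / 2.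
have d00' : 0 < d by rewrite divr_gt0// !lt_min divr_gt0//= !subr_gt0 ax.
have dd0 : d < d0.
  have : d <= (d0 / 2) / 2 by rewrite ler_pM2r// ge_min lexx.
  by move/le_lt_trans; apply; rewrite -mulrA gtr_pMr//; lra.
have d1 : d < x - al.
  have : d <= (x - al) / 2 by rewrite ler_pM2r// !ge_min lexx orbT.
  by move/le_lt_trans; apply; lra.
have d2 : d < al + P - x.
  have : d <= (al + P - x) / 2 by rewrite ler_pM2r// !ge_min lexx !orbT.
  by move/le_lt_trans; apply; lra.
pose ka := 2 - 2 * cos (th * d).
have thP : th * P = pi *+ 2 by rewrite /th divfK// gt_eqF.
have thd : 0 < th * d < pi.
  rewrite mulr_gt0//= -(ltr_pMn2r (n := 2))// -thP -mulrnAr ltr_pM2l// mulr2n; lra.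
have ka0 : 0 < ka.
  rewrite subr_gt0 -[ltRHS]mulr1 ltr_pM2l// -[ltRHS]cos0 ltr_cos ?in_itv/= ?lexx ?pi_ge0//.
    by case/andP: thd.
  by case/andP: thd => /ltW -> /ltW ->.
have tail y : I y -> d <= `|x - y| -> ka <= 2 - 2 * cos (th * (x - y)).
  rewrite /= in_itv/= => /andP[ay ya] dxy.
  rewrite lerD2l lerN2 ler_pM2l//.
  have {1}-> : cos (th * (x - y)) = cos (th * `|x - y|).
    have [xy|xy] := leP 0 (x - y); first by rewrite ger0_norm.
    by rewrite ltr0_norm// mulrN cosN.
  have xyP : `|x - y| <= P - d by rewrite ler_norml; apply/andP; split; lra.
  case/andP: thd => td0 tdpi.
  have h1 : th * d <= th * `|x - y| by rewrite ler_pM2l.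
  have h2 : th * `|x - y| <= pi *+ 2 - th * d by rewrite -thP -mulrBr ler_pM2l.
  have [le|lt] := leP (th * `|x - y|) pi.
    by apply: cos_ler => //; exact: ltW.
  have -> : cos (th * `|x - y|) = cos (pi *+ 2 - th * `|x - y|).
    by rewrite -[LHS]cosN -[LHS]cosD2pi addrC.
  apply: cos_ler; [exact: ltW| |]; lra.
near=> N.
rewrite distrC.
have N0 : (0 < N.+1)%N by [].
set K := fun y => fker N.+1 (th * (x - y)).
have iK := fker_int N.+1 x; have iF := fejer_int N.+1 x.
have iD : lam.-integrable I (EFin \o (fun y => f y * K y - f x * K y)).
  by have := integrableB mJ iF (integrableZl mJ (f x) iK).
have -> : fejer N.+1 f x - f x = P^-1 * \int[lam]_(y in I) (f y * K y - f x * K y).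
  rewrite (RintegralB mJ iF); last by have := integrableZl mJ (f x) iK.
  rewrite (RintegralZl (f x) mJ iK) fker_mass// mulrBr; congr (_ - _).
  by rewrite mulrCA mulVf ?mulr1// gt_eqF.
rewrite normrM gtr0_norm ?invr_gt0// mulrC ler_pdivrMr//.
apply: (le_trans (le_normr_Rintegral mJ iD)).
(* Bound of the integrand away from [x]: [|f y - f x| <= 2 M] times the tail of the kernel. *)
pose c := 2 * M * (4 / N.+1%:R / ka).
apply: (@le_trans _ _ (\int[lam]_(y in I) (e / 2 * K y + c))).
  have ic : lam.-integrable I (EFin \o (fun=> c : R)).
    by apply: (@bounded_integrable _ _ _ _ _ mJ fJ _ `|c|) => //.
  apply: (le_Rintegral mJ).
  - exact: integrable_norm iD.
  - by have := integrableD mJ (integrableZl mJ (e / 2) iK) ic.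
  move=> y Iy; rewrite -mulrBl normrM (ger0_norm (fker_ge0 _ _)).
  have K0 : 0 <= K y := fker_ge0 _ _.
  have M0 : 0 <= M by exact: le_trans (fM Iy).
  have c0 : 0 <= c.
    by apply: mulr_ge0; [apply: mulr_ge0|apply: divr_ge0; [apply: divr_ge0|exact: ltW]].
  have [lt|le] := ltP `|x - y| d.
    have := hd0 y (lt_trans lt dd0); rewrite distrC => h.
    by apply: (@le_trans _ _ (e / 2 * K y)); [rewrite ler_wpM2r|rewrite lerDl].
  have hK : K y <= 4 / N.+1%:R / ka.
    rewrite ler_pdivlMr//; apply: le_trans (fker_tail N.+1 (th * (x - y))).
    by rewrite ler_wpM2l// tail.
  have Ix : I x by rewrite /= in_itv/= !ltW.
  apply: (@le_trans _ _ c); last by rewrite lerDr mulr_ge0// ltW.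
  apply: ler_pM => //; apply: (le_trans (ler_normB _ _)).
  by have := fM Iy; have := fM Ix; lra.
rewrite RintegralD//; last 2 first.
  by have := integrableZl mJ (e / 2) iK.
  by apply: (@bounded_integrable _ _ _ _ _ mJ fJ _ `|c|) => //.
rewrite (RintegralZl (e / 2) mJ iK) fker_mass// (Rintegral_cst lam mJ) lJ -mulrDl ler_pM2r//.
suff : c <= e / 2 by lra.
have -> : c = (8 * M / ka) / N.+1%:R by rewrite /c; field; rewrite ?nat1r ?pnatr_eq0 ?gt_eqF.
rewrite ler_pdivrMr// [leRHS]mulrC -ler_pdivrMr//.
apply: ltW; near: N.
have : \forall N \near \oo, (8 * M / ka / (e / 2) < N%:R).
  exact: nbhs_infty_gtr.
by move=> [N0 _ hN]; exists N0 => // k /= Nk; apply: (lt_le_trans (hN k Nk)); rewrite ler_nat.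
Unshelve. all: by end_near. Qed.

Definition trigpoly N (c : 'I_(2 * N + 1) -> C) (x : R) : C :=
  \sum_z c z * ce (((z : nat)%:Z - N%:Z)%:~R * th * x).

(** Expanding the kernel separates [x] from the integration variable. The frequency [k - j] gets the
    index [k - j + N], the same convention as in [sq_ind]. *)
Lemma fejer_trig N : exists c : 'I_(2 * N + 1) -> C,
  forall x, (fejer N f x)%:C%C = trigpoly c x.
Proof.
pose ga (j k : 'I_N) : C := (P^-1)%:C%C * ((N%:R^-1)%:C%C *
   Cint lam I (fun y => (f y)%:C%C * ce ((j%:Z - k%:Z)%:~R * th * y))).
have h x : (fejer N f x)%:C%C = \sum_(j < N) \sum_(k < N) ga j k * ce ((k%:Z - j%:Z)%:~R * th * x).
  rewrite /fejer rmorphM /=.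
  have -> : (\int[lam]_(y in I) (f y * fker N (th * (x - y))))%:C%C =
      Cint lam I (fun y => \sum_(j < N) \sum_(k < N)
      ((N%:R^-1)%:C%C * ce ((k%:Z - j%:Z)%:~R * th * x)) * ((f y)%:C%C * ce ((j%:Z - k%:Z)%:~R * th * y))).
    transitivity (Cint lam I (fun y => (f y * fker N (th * (x - y)))%:C%C)).
      apply: cext => //=; rewrite (Rintegral_cst lam mJ) mul0r//.
    apply: eq_Cint => y _; rewrite rmorphM /= fkerE mulrCA mulr_sumr mulr_sumr; apply: eq_bigr => j _.
    rewrite mulr_sumr mulr_sumr; apply: eq_bigr => k _.
    rewrite -!mulrA; congr (_ * _); rewrite [RHS]mulrCA; congr (_ * _); rewrite -ceD; congr ce.
    by rewrite !rmorphB /=; ring.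
  have bc (j k : 'I_N) : cbm I (fun y : R => (f y)%:C%C * ce ((j%:Z - k%:Z)%:~R * th * y)).
    by apply: cbmM; [exact: cbm_f|exact: cbm_ce].
  rewrite (Cint_sum mJ fJ); last by move=> j; apply: cbm_sum => k; apply: cbmZ; exact: bc.
  rewrite mulr_sumr; apply: eq_bigr => j _.
  rewrite (Cint_sum mJ fJ); last by move=> k; apply: cbmZ; exact: bc.
  rewrite mulr_sumr; apply: eq_bigr => k _; rewrite (CintZ mJ fJ _ (bc j k)) /ga; ring.
have idx (p : 'I_N * 'I_N) : (p.2 + N - p.1 < 2 * N + 1)%N.
  case: p => [[j hj] [k hk]] /=; lia.
exists (fun z => \sum_(p : 'I_N * 'I_N | Ordinal (idx p) == z) ga p.1 p.2) => x.
rewrite h pair_big /= /trigpoly (partition_big (fun p => Ordinal (idx p)) xpredT)//=.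
apply: eq_bigr => z _; rewrite mulr_suml; apply: eq_bigr => -[[j hj] [k hk]] /= /eqP <- /=.
congr (_ * ce (_ * _ * _)); congr (_%:~R).
by rewrite -subzn ?PoszD; [ring|lia].
Qed.
End Fejer.

(** * Density of trigonometric polynomials in time *)

Section TrigDense.
Variable R : realType.
Local Notation C := R[i].
Local Notation lam := (@lebesgue_measure R).
Variable P : R.
Hypothesis P0 : 0 < P.
Local Notation I := ([set` `[0, P]] : set R).

Lemma integrable_sumr d (T : measurableType d) (mu : {measure set T -> \bar R})
    (D : set T) I (r : seq I) (F : I -> T -> R) : measurable D ->
  (forall i, mu.-integrable D (EFin \o F i)) ->
  mu.-integrable D (EFin \o (fun x => \sum_(i <- r) F i x)).
Proof.
move=> mD iF; apply: (eq_integrable mD (fun x => (\sum_(i <- r) (F i x)%:E)%E)).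
  by move=> x _; rewrite /= sumEFin.
by apply: (integrable_sum mD) => i _; exact: iF.
Qed.

Lemma integrableZr d (T : measurableType d) (mu : {measure set T -> \bar R})
    (D : set T) k (F : T -> R) : measurable D -> mu.-integrable D (EFin \o F) ->
  mu.-integrable D (EFin \o (fun x => k * F x)).
Proof.
move=> mD iF; apply: (eq_integrable mD (fun x => (k%:E * (F x)%:E)%E)) => //.
exact: (integrableZl mD k iF).
Qed.

Lemma vtB q (v w : R -> 'cV[C]_q) : vt v -> vt w -> vt (fun t => v t - w t).
Proof.
move=> tv tw i T; apply: (eq_cbm (f := fun t => v t i 0 - w t i 0)) => [t _|].
  by rewrite !mxE.
by apply: cbmB; [exact: tv|exact: tw].
Qed.

Lemma vt_inrm q (v : R -> 'cV[C]_q) T : vt v -> lam.-integrable ([set` `[0, T]] : set R) (EFin \o (fun t => nrm (v t))).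
Proof.
move=> tv; rewrite (_ : (fun t => nrm (v t)) = (fun t => \sum_i n1 (v t i 0))); last first.
  by apply: funext => t; apply: eq_bigr => i _; rewrite big_ord1.
apply: (@integrable_sumr _ _ lam _ _ _ (fun i t => n1 (v t i 0)) (mI 0 T)) => i.
exact: (cbm_in1 (mI 0 T) (lam_fin 0 T) (tv i T)).
Qed.

(** A continuous function close to [f] in L^1 is replaced by its Fejer means, which converge
    boundedly. The conclusion holds for all large [N], so that one degree serves the real and
    imaginary parts of all coordinates. *)
Lemma trig_dense_real (f : R -> R) (M e : R) : measurable_fun I f ->
  (forall x, I x -> `|f x| <= M) -> 0 < e ->
  \forall N \near \oo, exists c : 'I_(2 * N + 1) -> C,
    (forall x, n1 (trigpoly P c x) <= M) /\
    \int[lam]_(x in I) n1 ((f x)%:C%C - trigpoly P c x) <= e.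
Proof.
move=> mf fM e0.
have mI0 := mI 0 P; have fI := lam_fin 0 P.
have M0 : 0 <= M by apply: le_trans (fM 0 _); rewrite //= in_itv/= lexx ltW.
have intf : lam.-integrable I (EFin \o f) by exact: (bounded_integrable mI0 fI mf fM).
have e20 : 0 < e / 2 by rewrite divr_gt0.
have [g_ [cg ig g0]] := approximation_continuous_integrable mI0 fI intf.
have [k hk] : exists k, \int[lam]_(z in I) `|f z - g_ k z| <= e / 2.
  have /fine_cvgP[fin cv] := g0.
  have := cvgr_lt _ cv _ e20 => -[k _ hk]; exists k; apply: ltW.
  exact: (hk k (leqnn k)).
(* Clipping to [[- M, M]] cannot increase the distance to [f], which takes its values there. *)
pose g x := Num.max (- M) (Num.min M (g_ k x)).
have gM x : `|g x| <= M.
  by rewrite ler_norml /g le_max lexx /= ge_max ge_min lexx /= andbT; lra.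
have cgg : continuous g.
  move=> x; apply: (@continuous_max R R (cst (- M)) (fun x => Num.min M (g_ k x)) x); first exact: cvg_cst.
  by apply: (@continuous_min R R (cst M) (g_ k) x); [exact: cvg_cst|exact: cg].
have mg : measurable_fun I g by apply: measurable_funTS; exact: continuous_measurable_fun.
have mgk : measurable_fun I (g_ k) by apply: measurable_funTS; exact: continuous_measurable_fun (cg k).
have mfg : measurable_fun I (fun x => `|f x - g x|).
  by apply: measurableT_comp => //; exact: measurable_funB.
have bfg x : I x -> `|(`|f x - g x|)| <= M + M.
  by move=> Ix; rewrite normr_id (le_trans (ler_normB _ _))// lerD ?fM.
have ifg := bounded_integrable mI0 fI mfg bfg.
have h1 : \int[lam]_(x in I) `|f x - g x| <= e / 2.
  apply: (le_trans _ hk); apply: (le_Rintegral mI0 ifg).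
    have := integrable_norm (integrableB mI0 intf (ig k)).
    by apply: eq_integrable => // x _.
  move=> x Ix; have := fM x Ix; rewrite /g ler_norml => /andP[h2 h3].
  have [h4|h4] := lerP M (g_ k x).
    by rewrite (max_idPr _) ?(min_idPl _)//; [rewrite ler0_norm ?ler0_norm; lra|lra].
  have [h5|h5] := lerP (- M) (g_ k x); first by [].
  by rewrite !ger0_norm; lra.
have EI : I = [set` `[0, 0 + P]] by rewrite add0r.
have mg' : measurable_fun ([set` `[0, 0 + P]] : set R) g by rewrite -EI.
have gM' x : ([set` `[0, 0 + P]] : set R) x -> `|g x| <= M by move=> _.
have cN N : cbm I (fun x => (fejer 0 P N.+1 g x)%:C%C).
  have [c hc] := fejer_trig P0 mg' gM' N.+1.
  rewrite (_ : (fun x => _) = trigpoly P c); last by apply: funext => x; rewrite hc.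
  by apply: cbm_sum => i; apply: cbmZ; exact: cbm_ce.
have mN N : measurable_fun I (fun x => fejer 0 P N.+1 g x) by exact: (cN N).1.1.
(* The values at the two ends of the period may differ, so the means converge only in the open
   interval; the ends have measure zero. *)
pose J := [set` `]0, P[] : set R.
have mJ : @measurable _ (g_sigma_algebraType (@measurable _ (ocitv_type R))) J by exact: measurable_itv.
have JI : J `<=` I by move=> x /=; rewrite !in_itv/= => /andP[/ltW-> /ltW->].
have fJ : (lam J < +oo)%E by apply: le_lt_trans fI; apply: le_measure; rewrite ?inE.
have IJ (h : R -> R) : lam.-integrable I (EFin \o h) -> \int[lam]_(x in I) h x = \int[lam]_(x in J) h x.
  move=> ih; rewrite Rintegral_itv_obnd_cbnd; last first.
    by apply: (integrableS mI0 _ _ ih) => // x /=; rewrite !in_itv/= => /andP[-> /ltW->].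
  rewrite Rintegral_itv_bndo_bndc//.
  by apply: (integrableS mI0 _ _ ih) => // x /=; rewrite !in_itv/= => /andP[-> /ltW->].
have bgN N x : `|(`|g x - fejer 0 P N.+1 g x|)| <= M + M.
  by rewrite normr_id (le_trans (ler_normB _ _))// lerD// (fejer_bound P0 mg' gM').
have mgN N : measurable_fun I (fun x => `|g x - fejer 0 P N.+1 g x|).
  by apply: measurableT_comp => //; exact: measurable_funB.
have igN N := bounded_integrable mI0 fI (mgN N) (fun x _ => bgN N x).
have h2 : \int[lam]_(x in J) `|g x - fejer 0 P N.+1 g x| @[N --> \oo] --> \int[lam]_(x in J) (fun=> 0) x.
  apply: (bounded_cvg mJ fJ (M := M + M)) => [N|//|x Jx].
    exact: measurable_funS (mgN N).
  have Px : 0 < x < 0 + P by rewrite add0r; move: Jx; rewrite /J /= in_itv.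
  have := fejer_cvg P0 mg' gM' Px (cgg x) => /(cvgB (cvg_cst (g x)))/cvg_norm.
  by rewrite subrr normr0; exact.
rewrite Rintegral_cst// mul0r in h2.
have := cvgr_lt _ h2 _ e20 => h3.
apply: near_inftyS; near=> N.
have [c hc] := fejer_trig P0 mg' gM' N.+1.
exists c; split=> [x|].
  by rewrite -hc n1_real (fejer_bound P0 mg' gM').
under eq_Rintegral do rewrite -hc -rmorphB n1_real.
have -> : e = e / 2 + e / 2 by lra.
apply: (@le_trans _ _ (\int[lam]_(x in I) (`|f x - g x| + `|g x - fejer 0 P N.+1 g x|))).
  apply: (le_Rintegral mI0).
  - apply: (bounded_integrable mI0 fI (M := M + M)).
      by apply: measurableT_comp => //; exact: (measurable_funB mf (mN N)).
    by move=> x Ix; rewrite normr_id (le_trans (ler_normB _ _))// lerD ?fM// (fejer_bound P0 mg' gM').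
  - exact: (integrableD mI0 ifg (igN N)).
  - by move=> x _; rewrite (le_trans _ (ler_normD _ _))// addrA subrK.
rewrite (RintegralD mI0 ifg (igN N)) lerD// (IJ _ (igN N)).
by apply: ltW; near: N; exact: h3.
Unshelve. all: by end_near. Qed.

Definition frq N (z : 'I_(2 * N + 1)) : R := ((z : nat)%:Z - N%:Z)%:~R * (pi *+ 2 / P).
Definition trigv q N (c : 'I_(2 * N + 1) -> 'cV[C]_q) (t : R) : 'cV[C]_q :=
  \sum_z ev (frq z) (c z) t.

Lemma vt_trigv q N (c : 'I_(2 * N + 1) -> 'cV[C]_q) : vt (trigv c).
Proof. by apply: vt_sum => z; exact: vt_ev. Qed.

Lemma trigvE q N (c : 'I_(2 * N + 1) -> 'cV[C]_q) t i :
  trigv c t i 0 = trigpoly P (fun z => c z i 0) t.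
Proof.
rewrite summxE; apply: eq_bigr => z _.
by rewrite mxE mulrC.
Qed.

(** The sup bound [M] does not depend on the accuracy [e]: the work is quadratic and is
    L^1-continuous only on uniformly bounded inputs. *)
Lemma trig_dense q (v : R -> 'cV[C]_q) : vt v ->
  exists2 M, 0 <= M & forall e, 0 < e -> exists N (c : 'I_(2 * N + 1) -> 'cV[C]_q),
    (forall t, nrm (trigv c t) <= M) /\ \int[lam]_(t in I) nrm (v t - trigv c t) <= e.
Proof.
move=> tv; have [M M0 vM] := vt_bound P tv.
have mI0 := mI 0 P; have fI := lam_fin 0 P.
exists (q%:R * (M + M)) => [|e e0]; first by rewrite mulr_ge0// addr_ge0.
pose e1 := e / (2 * q.+1%:R); have e10 : 0 < e1 by rewrite divr_gt0// mulr_gt0.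
have vMi t i : I t -> n1 (v t i 0) <= M.
  rewrite /= in_itv/= => /vM; exact: le_trans (nrm_entry _ _ _).
have hr i := @trig_dense_real (fun t => complex.Re (v t i 0)) M e1 (tv i P).1.1
  (fun t It => le_trans (le_Re_n1 _) (vMi t i It)) e10.
have hi i := @trig_dense_real (fun t => complex.Im (v t i 0)) M e1 (tv i P).1.2
  (fun t It => le_trans (le_Im_n1 _) (vMi t i It)) e10.
have := filterI (filter_forall _ hr) (filter_forall _ hi) => -[N _ /(_ N (leqnn N))[/= hr' hi']].
have {hr'}/choice[cr hr'] := hr'.
have {hi'}/choice[ci hi'] := hi'.
exists N, (fun z => \col_i (cr i z + 'i%C * ci i z)).
have E t i : trigv (fun z => \col_i (cr i z + 'i%C * ci i z)) t i 0 =
   trigpoly P (cr i) t + 'i%C * trigpoly P (ci i) t.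
  rewrite trigvE /trigpoly mulr_sumr -big_split; apply: eq_bigr => z _.
  by rewrite mxE mulrDl mulrA.
have ni : n1 ('i%C : C) = 1 by rewrite /n1 /= normr0 normr1 add0r.
split=> [t|].
  rewrite /nrm; apply: (@le_trans _ _ (\sum_(i < q) (M + M))).
    apply: ler_sum => i _; rewrite big_ord1 E.
    rewrite (le_trans (n1D _ _))// lerD ?(hr' i).1// (le_trans (n1M _ _))// ni mul1r.
    exact: (hi' i).1.
  by rewrite sumr_const card_ord mulr_natl.
have cp (c : 'I_(2 * N + 1) -> C) : cbm I (trigpoly P c).
  by apply: cbm_sum => z; apply: cbmZ; exact: cbm_ce.
have cr1 i : cbm I (fun t => (complex.Re (v t i 0))%:C%C - trigpoly P (cr i) t).
  apply: cbmB => //; split; first by apply: cmf_real; exact: (tv i P).1.1.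
  by exists M => t It; rewrite n1_real (le_trans (le_Re_n1 _))// vMi.
have ci1 i : cbm I (fun t => (complex.Im (v t i 0))%:C%C - trigpoly P (ci i) t).
  apply: cbmB => //; split; first by apply: cmf_real; exact: (tv i P).1.2.
  by exists M => t It; rewrite n1_real (le_trans (le_Im_n1 _))// vMi.
apply: (@le_trans _ _ (\int[lam]_(t in I) \sum_i
  (n1 ((complex.Re (v t i 0))%:C%C - trigpoly P (cr i) t) +
   n1 ((complex.Im (v t i 0))%:C%C - trigpoly P (ci i) t)))).
  apply: (le_Rintegral mI0).
  - by apply: vt_inrm; apply: vtB => //; exact: vt_trigv.
  - apply: (@integrable_sumr _ _ lam _ _ _ (fun i t => n1 ((complex.Re (v t i 0))%:C%C - trigpoly P (cr i) t) +
      n1 ((complex.Im (v t i 0))%:C%C - trigpoly P (ci i) t)) mI0) => i.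
    exact: (integrableD mI0 (cbm_in1 mI0 fI (cr1 i)) (cbm_in1 mI0 fI (ci1 i))).
  - move=> t _; apply: ler_sum => i _; rewrite big_ord1.
    have -> : (v t - trigv (fun z => \col_i (cr i z + 'i%C * ci i z)) t) i 0 =
      ((complex.Re (v t i 0))%:C%C - trigpoly P (cr i) t) +
      'i%C * ((complex.Im (v t i 0))%:C%C - trigpoly P (ci i) t).
      rewrite mxE [X in _ + X]mxE E mulrBr addrACA -opprD; congr (_ - _).
      by apply: cext; rewrite /=; ring.
    by rewrite (le_trans (n1D _ _))// lerD2l (le_trans (n1M _ _))// ni mul1r.
rewrite Rint_sum//; last first.
  by move=> i; exact: (integrableD mI0 (cbm_in1 mI0 fI (cr1 i)) (cbm_in1 mI0 fI (ci1 i))).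
apply: (@le_trans _ _ (\sum_(i < q) (e1 + e1))).
  apply: ler_sum => i _; rewrite (RintegralD mI0 (cbm_in1 mI0 fI (cr1 i)) (cbm_in1 mI0 fI (ci1 i))).
  by apply: lerD; [exact: (hr' i).2|exact: (hi' i).2].
rewrite sumr_const card_ord -[_ *+ q]mulr_natl.
have -> : q%:R * (e1 + e1) = e * (q%:R / q.+1%:R) by rewrite /e1; field; rewrite gt_eqF.
by rewrite ler_piMr ?(ltW e0)// ler_pdivrMr// mul1r ler_nat.
Qed.

End TrigDense.

(** * Nonnegative work at one frequency *)

Section Sufficiency.
Variable R : realType.
Local Notation C := R[i].
Local Notation lam := (@lebesgue_measure R).
Variables (n m r : nat) (a : 'M[C]_n) (b : 'M[C]_(n, m)) (c : 'M[C]_(r, n))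
  (d : 'M[C]_(r, m)) (g : 'M[C]_(m, r)).
Local Notation qf := (qf a b c d g).
Local Notation wf := (wf a b c d g).
(* otherwise unification unfolds the series *)
Opaque zs.
Local Notation zs := (zs a b c d g).

Lemma xs_L1 (v : R -> 'cV[C]_m) (T : R) : 0 <= T ->
  exists2 L, 0 <= L & forall v : R -> 'cV[C]_m, vt v -> forall t, 0 <= t <= T ->
    nrm (xs a b v t) <= L * \int[lam]_(s in `[0, T]) nrm (v s).
Proof.
move=> T0; exists (n%:R * (nrm b * expR (Num.max 1 (nrm a) * T))).
  by rewrite !mulr_ge0 ?nrm_ge0 ?expR_ge0.
move=> w tw t /[dup] /andP[t0 _] tT.
have -> : xs a b w t = ms (sh (Xp a b)) w t by [].
rewrite (ms_sh (geo_Xp a b) tw t0).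
apply: (le_trans (ms_L1 (geo_Xp a b) tw tT)).
by rewrite [leRHS](_ : _ = n%:R * (nrm b * (\int[lam]_(s in `[0, T]) nrm (w s)) * expR (Num.max 1 (nrm a) * T)))//; ring.
Qed.

Lemma Rint_ge0 (T : R) (h : R -> R) : (forall t, 0 <= h t) -> 0 <= \int[lam]_(s in `[0, T]) h s.
Proof. by move=> h0; apply: Rintegral_ge0. Qed.

Lemma Rint_nrm_le (T M : R) q (v : R -> 'cV[C]_q) : 0 <= T -> vt v -> (forall t, 0 <= t <= T -> nrm (v t) <= M) ->
  \int[lam]_(s in `[0, T]) nrm (v s) <= M * T.
Proof.
move=> T0 tv vM; rewrite -{2}(subr0 T) -(fine_lam T0) -(Rintegral_cst _ (mI 0 T)).
apply: (le_Rintegral (mI 0 T) (vt_inrm T tv)).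
  by apply: (@bounded_integrable _ _ _ _ _ (mI 0 T) (lam_fin 0 T) _ `|M|) => // y _.
by move=> t; rewrite /= in_itv/=; exact: vM.
Qed.

Lemma Cint_zero (D : set R) (f : R -> C) : (forall t, D t -> f t = 0) -> Cint lam D f = 0.
Proof.
move=> f0; rewrite (@eq_Cint _ _ _ lam D f (fun=> 0) f0).
by apply: cext; rewrite /= /Rintegral integral0.
Qed.

Lemma Re_close (e : R) (z1 z2 : C) : n1 (z1 - z2) <= e -> complex.Re z2 - e <= complex.Re z1.
Proof. move=> h; have := le_trans (le_Re_n1 _) h; rewrite cReD cReN ler_norml => /andP[]; lra. Qed.

Lemma sufficiency_arith (x q i s e D eps : R) : q - e <= x -> - i <= q -> i <= s ->
  s <= (D - 1) * (4 * e) -> 0 <= e -> (4 * D + 1) * e = eps -> 0 <= x + eps.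
Proof. by nra. Qed.

Lemma adj_subE q (p1 p2 x y : 'cV[C]_q) : (adjmx p1 *m x) 0 0 - (adjmx p2 *m y) 0 0 =
  (adjmx (p1 - p2) *m x) 0 0 + (adjmx p2 *m (x - y)) 0 0.
Proof.
rewrite !adjE -sumrB -big_split/=; apply: eq_bigr => i _.
by rewrite !mxE rmorphB /=; ring.
Qed.

(** The difference of the powers is [(v - w)] against the output of [v], plus [w] against the output
    of [v - w]. The first output is bounded, the second is controlled by the L^1 norm through
    [xs_L1]; hence [L] depends on [v] and [B] but not on [w]. *)
Lemma qf_L1 (v : R -> 'cV[C]_m) (T B : R) : 0 <= T -> 0 <= B -> vt v ->
  exists2 L, 0 <= L & forall w, vt w -> (forall t, 0 <= t <= T -> nrm (w t) <= B) ->
    n1 (qf T v v - qf T w w) <= L * \int[lam]_(s in `[0, T]) nrm (v s - w s).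
Proof.
move=> T0 B0 tv.
have [M M0 vM] := vt_bound T (vt_zs a b c d g tv).
have [L L0 hL] := xs_L1 v T0.
exists (M + B * (nrm (g *m c) * L * T + nrm (g *m d))).
  by rewrite addr_ge0// mulr_ge0// addr_ge0 ?mulr_ge0 ?nrm_ge0.
move=> w tw wB; have td := vtB tv tw.
set J := \int[_]_(_ in _) _.
have J0 : 0 <= J by apply: Rint_ge0 => t; exact: nrm_ge0.
have tvv := tbf_wf a b c d g tv tv; have tww := tbf_wf a b c d g tw tw.
rewrite /qf /CI -(CintB (mI 0 T) (lam_fin 0 T) (tvv T) (tww T)).
apply: (le_trans (n1_Cint (mI 0 T) (lam_fin 0 T) (cbmB (tvv T) (tww T)))).
have i1 := cbm_in1 (mI 0 T) (lam_fin 0 T) (cbmB (tvv T) (tww T)).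
pose k := B * (nrm (g *m c) * (L * J)).
have i2 : lam.-integrable ([set` `[0, T]] : set R) (EFin \o (fun t => (M + B * nrm (g *m d)) * nrm (v t - w t))).
  exact: (integrableZr _ (mI 0 T) (vt_inrm T td)).
have i3 : lam.-integrable ([set` `[0, T]] : set R) (EFin \o (fun=> k)).
  by apply: (@bounded_integrable _ _ _ _ _ (mI 0 T) (lam_fin 0 T) _ `|k|) => // y _.
apply: (@le_trans _ _ (\int[lam]_(t in `[0, T]) ((M + B * nrm (g *m d)) * nrm (v t - w t) + k))).
  apply: (le_Rintegral (mI 0 T) i1 (integrableD (mI 0 T) i2 i3)) => t.
  rewrite /= in_itv/= => tT; have /andP[t0 tT'] := tT.
  have -> : wf v v t - wf w w t = (adjmx (v t - w t) *m zs v t) 0 0 + (adjmx (w t) *m zs (fun s => v s - w s) t) 0 0.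
    have -> : zs (fun s => v s - w s) t = zs v t - zs w t.
      have h : zs (fun s => v s - w s) t + zs w t = zs v t.
        rewrite -(msv_add (geo_Zp a b c d g) td tw t0).
        by apply: (@eq_ms _ _ _ _ _ _ T t) => // s _; rewrite subrK.
      by apply/eqP; rewrite eq_sym subr_eq h.
    exact: adj_subE.
  have -> : (M + B * nrm (g *m d)) * nrm (v t - w t) + k = M * nrm (v t - w t) +
    B * (nrm (g *m d) * nrm (v t - w t) + nrm (g *m c) * (L * J)) by rewrite /k; ring.
  apply: (le_trans (n1D _ _)); apply: lerD.
    apply: (le_trans (nrm_entry _ _ _)); apply: (le_trans (nrmM _ _)); rewrite nrm_adj mulrC.
    by rewrite ler_wpM2r ?nrm_ge0// vM.
  apply: (le_trans (nrm_entry _ _ _)); apply: (le_trans (nrmM _ _)); rewrite nrm_adj.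
  apply: ler_pM; rewrite ?nrm_ge0// ?wB//.
  rewrite (zsE a b c d g td t0) mulmxDr !mulmxA (le_trans (nrmD _ _))// addrC.
  apply: lerD; rewrite (le_trans (nrmM _ _))// ler_wpM2l ?nrm_ge0//.
  exact: hL.
rewrite (RintegralD (mI 0 T) i2 i3) (RintegralZl _ (mI 0 T) (vt_inrm T td)) -/J.
rewrite (Rintegral_cst lam (mI 0 T)) (fine_lam T0) subr0.
by rewrite /k le_eqVlt; apply/orP; left; apply/eqP; ring.
Qed.

Lemma frq_orth (P : R) N (P0 : 0 < P) (z z' : 'I_(2 * N + 1)) :
  CI (fun t => conjc (ce (frq P z * t)) * ce (frq P z' * t)) P = if z == z' then P%:C%C else 0.
Proof.
transitivity (Cint lam ([set` `[0, 0 + P]] : set R)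
   (fun y => ce ((z' : nat)%:Z%:~R * (pi *+ 2 / P) * y - (z : nat)%:Z%:~R * (pi *+ 2 / P) * y))).
  rewrite add0r; apply: eq_Cint => y _; rewrite ceJ -ceD; congr ce.
  by rewrite /frq !rmorphB /=; ring.
transitivity (Cint lam ([set` `[0, 0 + P]] : set R)
   (fun y => ce (((z' : nat)%:Z - (z : nat)%:Z)%:~R * (pi *+ 2 / P) * y))).
  by apply: eq_Cint => y _; rewrite -mulrBl -mulrBl rmorphB.
rewrite ce_orth// subr_eq0 eqz_nat eq_sym (inj_eq val_inj).
by [].
Qed.

Lemma ce_frq (P : R) N (P0 : 0 < P) (z : 'I_(2 * N + 1)) : ce (frq P z * P) = 1 :> C.
Proof. by rewrite /frq -mulrA divfK ?gt_eqF// ce_int2pi. Qed.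

Lemma tbf_adjEs xi (v : R -> 'cV[C]_m) : vt v ->
  tbf (fun t => (adjmx (v t) *m (g *m c *m Es a xi t)) 0 0).
Proof.
move=> tv; rewrite (_ : (fun t => _) = fun t => \sum_i conjc (v t i 0) * (\sum_j (g *m c) i j * Es a xi t j 0)).
  apply: tbf_sum => i; apply: tbfM; first by apply: tbfJ.
  by apply: tbf_sum => j; apply: tbfZ; exact: tbf_Es.
by apply: funext => t; rewrite adjE; apply: eq_bigr => i _; congr (_ * _); rewrite mxE.
Qed.

Hypothesis ha : hurwitz a.
Hypothesis hpsd : forall w, psdat a b c d g w.

(** [xi] is the state of the periodic regime at time 0. After one period the true state is
    [xi - e^(P a) xi], so a contraction by one half bounds [xi] by twice that state. By
    orthogonality the periodic work is [P] times a sum of diagonal forms, nonnegative by hypothesis;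
    only the free motion started at [xi] can be negative. *)
Lemma trig_work (P : R) N (C0 : 'I_(2 * N + 1) -> 'cV[C]_m) : 0 < P ->
  (forall xi : 'cV[C]_n, nrm (Es a xi P) <= 2^-1 * nrm xi) ->
  exists xi : 'cV[C]_n, nrm xi <= 2 * nrm (xs a b (trigv P C0) P) /\
    - complex.Re (CI (fun t => (adjmx (trigv P C0 t) *m (g *m c *m Es a xi t)) 0 0) P)
      <= complex.Re (qf P (trigv P C0) (trigv P C0)).
Proof.
move=> P0 hE; have P0' := ltW P0.
pose x z := res a (frq P z) *m b *m C0 z.
have xsE t : 0 <= t -> xs a b (trigv P C0) t = \sum_z ce (frq P z * t) *: x z - Es a (\sum_z x z) t.
  move=> t0; transitivity (\sum_z xs a b (ev (frq P z) (C0 z)) t).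
    exact: (msv_sum (geo_sh (geo_Xp a b)) _ (fun z => vt_ev _ _) t0).
  rewrite Es_sum// -sumrB; apply: eq_bigr => z _.
  exact: (xs_ev b _ (C0 z) ha t0).
exists (\sum_z x z); split.
  have := xsE P P0'; under eq_bigr do rewrite ce_frq// scale1r.
  set xi := \sum_z x z => h.
  have : nrm xi <= nrm (xs a b (trigv P C0) P) + nrm (Es a xi P).
    by rewrite h -{1}(subrK (Es a xi P) xi) nrmD.
  have := hE xi; lra.
set xi := \sum_z x z.
pose q z z' := (adjmx (C0 z) *m (g *m trf a b c d (frq P z') *m C0 z')) 0 0.
have tE := tbf_adjEs xi (vt_trigv P C0).
have tcc (z z' : 'I_(2 * N + 1)) : tbf (fun t => conjc (ce (frq P z * t)) * ce (frq P z' * t)).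
  by apply: tbfM; [apply: tbfJ|]; exact: tbf_ce.
have tq z z' : tbf (fun t => q z z' * (conjc (ce (frq P z * t)) * ce (frq P z' * t))).
  by apply: tbfZ; exact: tcc.
have tqq : tbf (fun t => \sum_z \sum_z' q z z' * (conjc (ce (frq P z * t)) * ce (frq P z' * t))).
  by apply: tbf_sum => z; exact: tbf_sum.
have -> : qf P (trigv P C0) (trigv P C0) =
   CI (fun t => \sum_z \sum_z' q z z' * (conjc (ce (frq P z * t)) * ce (frq P z' * t))) P -
   CI (fun t => (adjmx (trigv P C0 t) *m (g *m c *m Es a xi t)) 0 0) P.
  rewrite /CI -(CintB (mI 0 P) (lam_fin 0 P) (tqq P) (tE P)).
  apply: eq_Cint => t; rewrite /= in_itv/= => /andP[t0 _].
  rewrite /wf (zsE a b c d g (vt_trigv P C0) t0) xsE// -/xi.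
  have -> : g *m (c *m (\sum_z ce (frq P z * t) *: x z - Es a xi t) + d *m trigv P C0 t) =
     \sum_z ce (frq P z * t) *: (g *m trf a b c d (frq P z) *m C0 z) - g *m c *m Es a xi t.
    rewrite mulmxBr mulmxDr mulmxBr !mulmxA addrAC; congr (_ - _).
    rewrite /trigv !mulmx_sumr -big_split/=; apply: eq_bigr => z _.
    rewrite /ev /x -!scalemxAr -scalerDr; congr (_ *: _).
    by rewrite /trf mulmxDr mulmxDl !mulmxA.
  rewrite mulmxBr mxE [X in _ + X]mxE; congr (_ - _).
  have -> : adjmx (trigv P C0 t) = \sum_z conjc (ce (frq P z * t)) *: adjmx (C0 z).
    apply/matrixP => i j; rewrite !mxE summxE rmorph_sum [RHS]summxE; apply: eq_bigr => z _.
    by rewrite !mxE rmorphM.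
  rewrite mulmx_suml summxE; apply: eq_bigr => z _.
  rewrite mulmx_sumr summxE; apply: eq_bigr => z' _.
  by rewrite -scalemxAl -scalemxAr scalerA mxE mulrC.
rewrite cReD cReN lerDr.
have -> : CI (fun t => \sum_z \sum_z' q z z' * (conjc (ce (frq P z * t)) * ce (frq P z' * t))) P =
    \sum_z P%:C%C * q z z.
  rewrite CI_sum; last by move=> z; exact: tbf_sum.
  apply: eq_bigr => z _; rewrite CI_sum//.
  rewrite (bigD1 z)//= big1 => [|z' zz'].
    rewrite (CI_Z _ _ (tcc z z)).
    by rewrite frq_orth// eqxx addr0 mulrC.
  rewrite (CI_Z _ _ (tcc z z')).
  by rewrite frq_orth// eq_sym (negbTE zz') mulr0.
rewrite cRe_sum sumr_ge0// => z _; rewrite cReM /= mul0r subr0 mulr_ge0//.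
exact: ((psdatP a b c d g _).1 (hpsd _)).
Qed.

(** The input is switched off at [T] and observed until a late time [P], when its state has nearly
    died out. Approximating it over the period [P] gives a trigonometric input with small state at
    [P], hence small [xi] in [trig_work], hence nearly nonnegative work. *)
Lemma freq_sufficient (v : R -> 'cV[C]_m) (T : R) : vt v -> 0 <= T ->
  0 <= complex.Re (qf T v v).
Proof.
move=> tv0 T0.
pose v1 t : 'cV[C]_m := if t <= T then v t else 0.
have tv : vt v1.
  move=> i S; apply: (eq_cbm (f := fun t : R => ((if t <= T then 1 else 0) : R)%:C%C * v t i 0)).
    by move=> t _; rewrite /v1; case: ifP => _; rewrite ?mul1r // mul0r mxE.
  apply: cbmM; last exact: tv0.
  split; last by exists 1 => t _; rewrite n1_real; case: ifP => _; rewrite ?normr1 ?normr0.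
  apply: cmf_real; apply: measurable_funTS.
  by apply: measurable_fun_ifT => //; exact: measurable_fun_ler.
have vT t : T < t -> v1 t = 0 by rewrite /v1 ltNge => /negbTE ->.
have -> : qf T v v = qf T v1 v1.
  apply: (@eq_CI _ _ _ T T _ (lexx T)) => t tT; have /andP[t0 t1] := tT.
  have e1 : v1 t = v t by rewrite /v1 t1.
  have e2 : zs v1 t = zs v t by apply: (@eq_ms _ _ _ _ _ _ T t) => // s /andP[_ sT]; rewrite /v1 sT.
  by rewrite /wf e1 e2.
have [B0 B00 vB] := vt_bound T tv.
have [K K0 hK] := Es_bound ha.
set x := complex.Re _; apply/ler_addgt0Pr => eps eps0.
pose D := (T * B0 + 1) * (nrm (g *m c) * K) + 1.
have D0 : 0 < D.
  by rewrite ltr_wpDl// mulr_ge0 ?addr_ge0 ?mulr_ge0 ?nrm_ge0// ltW.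
(* One [e] is lost in the approximation of the work and [(D - 1) * (4 * e)] to the free motion,
   whose initial vector is at most [4 * e]. *)
pose e := eps / (4 * D + 1); have e0 : 0 < e by rewrite divr_gt0// addr_gt0// mulr_gt0.
have [s1 hs1] := Es_unif ha (ltac:(lra) : 0 < 2^-1 :> R).
have [s2 hs2] := xs_decay b ha tv T0 vT e0.
(* Later than [T], so the work is unchanged; than [s1], so the free motion is halved over a period;
   and than [s2], so the state of [v1] is below [e]. *)
pose P := Num.max (T + 1) (Num.max s1 s2) + 1.
have P0 : 0 < P by rewrite ltr_wpDl// le_max addr_ge0.
have TP : T <= P by rewrite (@le_trans _ _ (T + 1)) ?lerDl// ler_wpDr// le_max lexx.
have s1P : s1 <= P by rewrite ler_wpDr// !le_max lexx !orbT.
have s2P : s2 <= P by rewrite ler_wpDr// !le_max lexx !orbT.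
have P0' := ltW P0.
have xE : x = complex.Re (qf P v1 v1).
  have tw := tbf_wf a b c d g tv tv.
  rewrite /x /qf (CI_split tw T0 TP) (_ : Cint _ _ _ = 0) ?addr0//.
  apply: Cint_zero => t; rewrite /= in_itv/= => /andP[Tt _].
  by rewrite /wf vT// adjE big1// => i _; rewrite mxE conjc0 mul0r.
have [B1 B10 hB1] := trig_dense P0 tv.
have [L L0 hL] := qf_L1 P0' B10 tv.
have [L' L'0 hL'] := xs_L1 v1 P0'.
(* The bound 1 limits the L^1 norm of the approximant to [T * B0 + 1]; the other makes both [L * de]
   and [L' * de] at most [e]. *)
pose de := Num.min 1 (e / (L + L' + 1)).
have de0 : 0 < de by rewrite lt_min ltr01 divr_gt0// ltr_wpDl// addr_ge0.
have [N [C0 [hC1 hC2]]] := hB1 _ de0.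
have [xi [xi1 xi2]] := trig_work C0 P0 (fun xi => hs1 P s1P P0' xi).
set w := trigv P C0 in hC1 hC2 xi1 xi2.
have tw : vt w by exact: vt_trigv.
have Lde k : 0 <= k -> k <= L + L' -> k * de <= e.
  move=> k0 kL; apply: (@le_trans _ _ ((L + L' + 1) * (e / (L + L' + 1)))).
    by apply: ler_pM => //; [exact: ltW|rewrite ler_wpDr|rewrite ge_min lexx orbT].
  by rewrite mulrC divfK// gt_eqF// ltr_wpDl// addr_ge0.
have a1 : complex.Re (qf P w w) - e <= x.
  rewrite xE; apply: Re_close; apply: (le_trans (hL w tw (fun t _ => hC1 t))).
  by apply: (le_trans (ler_wpM2l L0 hC2)); rewrite Lde// lerDl.
have a2 : nrm (xs a b w P) <= 2 * e.
  have -> : w = (fun t => v1 t + (w t - v1 t)) by apply: funext => t; rewrite addrC subrK.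
  have tq : vt (fun t => w t - v1 t) by exact: vtB.
  have h : xs a b (fun t => v1 t + (w t - v1 t)) P = xs a b v1 P + xs a b (fun t => w t - v1 t) P.
    exact: (msv_add (geo_sh (geo_Xp a b)) tv tq P0').
  rewrite h (le_trans (nrmD _ _))// mulrDl mul1r; apply: lerD.
    exact: hs2.
  apply: (le_trans (hL' _ tq P _)); first by rewrite P0' lexx.
  apply: (@le_trans _ _ (L' * de)); last by rewrite Lde// lerDr.
  rewrite ler_wpM2l//; apply: le_trans hC2; rewrite le_eqVlt; apply/orP; left; apply/eqP.
  by apply: eq_Rintegral => t _; rewrite -nrmN opprB.
have a3 : \int[lam]_(t in `[0, P]) nrm (w t) <= T * B0 + 1.
  have tn : tbf (fun t => (nrm (v1 t))%:C%C).
    move=> S; split; last by exists (\sum_i s2val (cid2 (tbf_bound S (tv i)))) => t tS;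
      rewrite n1_real ger0_norm ?nrm_ge0// /nrm; apply: ler_sum => i _; rewrite big_ord1;
      case: (cid2 _) => /= M _; apply; move: tS; rewrite /= in_itv.
    apply: cmf_real; have /measurable_EFinP := (integrableP _ _ _ (vt_inrm S tv)).1; exact.
  have e1 : \int[lam]_(t in `[0, P]) nrm (v1 t) <= T * B0.
    have h1 := CI_split tn T0 TP.
    have h2 : Cint lam `]T, P] (fun t => (nrm (v1 t))%:C%C) = 0.
      apply: Cint_zero => t; rewrite /= in_itv/= => /andP[Tt _].
      by rewrite vT// nrm0.
    rewrite h2 addr0 in h1; have {h1} := congr1 (@complex.Re R) h1; rewrite /= => ->.
    by rewrite mulrC; exact: Rint_nrm_le.
  have i1 := vt_inrm P tv; have i2 := vt_inrm P (vtB tv tw).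
  apply: (@le_trans _ _ (\int[lam]_(t in `[0, P]) (nrm (v1 t) + nrm (v1 t - w t)))).
    apply: (le_Rintegral (mI 0 P) (vt_inrm P tw) (integrableD (mI 0 P) i1 i2)) => t _.
    by rewrite -{1}(subKr (v1 t) (w t)) -(nrmN (v1 t - w t)) nrmD.
  rewrite (RintegralD (mI 0 P) i1 i2) lerD//; apply: (le_trans hC2).
  by rewrite /de ge_min lexx.
have a4 : complex.Re (CI (fun t => (adjmx (w t) *m (g *m c *m Es a xi t)) 0 0) P) <=
    (T * B0 + 1) * (nrm (g *m c) * K * nrm xi).
  have tE : tbf (fun t => (adjmx (w t) *m (g *m c *m Es a xi t)) 0 0) by exact: tbf_adjEs.
  apply: (le_trans (ler_norm _)); apply: (le_trans (le_Re_n1 _)).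
  apply: (le_trans (n1_Cint (mI 0 P) (lam_fin 0 P) (tE P))).
  set k := nrm (g *m c) * K * nrm xi.
  have k0 : 0 <= k by rewrite !mulr_ge0 ?nrm_ge0// ltW.
  apply: (@le_trans _ _ (\int[lam]_(t in `[0, P]) (k * nrm (w t)))).
    apply: (le_Rintegral (mI 0 P) (cbm_in1 (mI 0 P) (lam_fin 0 P) (tE P))
      (integrableZr k (mI 0 P) (vt_inrm P tw))) => t; rewrite /= in_itv/= => /andP[t0 _].
    apply: (le_trans (nrm_entry _ _ _)); apply: (le_trans (nrmM _ _)); rewrite nrm_adj mulrC.
    rewrite ler_wpM2r ?nrm_ge0// (le_trans (nrmM _ _))// /k -mulrA ler_wpM2l ?nrm_ge0//.
    exact: hK.
  rewrite (RintegralZl _ (mI 0 P) (vt_inrm P tw)) mulrC.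
  by rewrite ler_wpM2r.
have a5 : nrm xi <= 4 * e.
  apply: (le_trans xi1); rewrite (_ : 4 * e = 2 * (2 * e)); last by rewrite mulrA -natrM.
  by rewrite ler_wpM2l.
have a6 : (T * B0 + 1) * (nrm (g *m c) * K * nrm xi) <= (D - 1) * (4 * e).
  rewrite /D addrK -!mulrA ler_wpM2l ?addr_ge0 ?mulr_ge0//.
  by rewrite ler_wpM2l ?nrm_ge0// ler_wpM2l// ltW.
have a7 : (4 * D + 1) * e = eps by rewrite /e mulrC divfK// gt_eqF// addr_gt0// mulr_gt0.
exact: (sufficiency_arith a1 xi2 a4 a6 (ltW e0) a7).
Qed.

End Sufficiency.
Transparent zs.

(** * Lebesgue measure on the torus *)

Section Grid.
Variables (R : realType) (nu : nat).
Local Notation V := 'rV[R]_nu.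
Local Notation BT := (g_sigma_algebraType (@boxes R nu)).

(* index of the cell of side 2 pi / N containing s, the torus being the cells 0 <= c < N *)
Definition gridc (N : nat) (s : V) : 'rV[int]_nu :=
  \row_i Num.floor (N%:R * ((s 0 i + pi) / (pi *+ 2))).

(** For an integer [k], [k <= x] amounts to [M k <= floor (M x)], so the finer floor determines the
    coarser one: cells of a refined grid lie inside cells of the original. *)
Lemma floorM_inj (M : nat) (x y : R) : (0 < M)%N ->
  Num.floor (M%:R * x) = Num.floor (M%:R * y) -> Num.floor x = Num.floor y.
Proof.
move=> M0; have h (u v : R) : Num.floor (M%:R * u) = Num.floor (M%:R * v) -> (Num.floor u <= Num.floor v)%O.
  move=> uv; rewrite floor_ge_int.
  have : (M%:Z * Num.floor u <= Num.floor (M%:R * v))%O.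
    by rewrite -uv floor_ge_int rmorphM /= ler_pM2l ?ltr0n// floor_le.
  by rewrite floor_ge_int rmorphM /= ler_pM2l ?ltr0n.
by move=> xy; apply/eqP; rewrite eq_le !h.
Qed.

Lemma gridc_dvd M N s s' : (0 < M)%N -> gridc (M * N) s = gridc (M * N) s' -> gridc N s = gridc N s'.
Proof.
move=> M0 /matrixP h; apply/rowP => i; have := h 0 i; rewrite !mxE natrM -!mulrA.
exact: floorM_inj.
Qed.

(** Unions of cells of one grid. The common refinement of two grids makes these sets an algebra; it
    generates the Borel sets while its members are countable disjoint unions of cells of known
    volume. *)
Definition saturated (X : set V) := exists2 N, (0 < N)%N &
  forall s s', gridc N s = gridc N s' -> X s -> X s'.

Lemma saturated0 : saturated set0.
Proof. by exists 1%N. Qed.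
Lemma saturatedU : setU_closed saturated.
Proof.
move=> X Y [M M0 hM] [N N0 hN]; exists (M * N)%N; first by rewrite muln_gt0 M0.
move=> s s' ss' [Xs|Ys]; [left|right].
  by apply: (hM s) => //; apply: (@gridc_dvd N); rewrite // mulnC.
by apply: (hN s) => //; apply: (@gridc_dvd M).
Qed.
Lemma saturatedC : setC_closed saturated.
Proof.
move=> X [N N0 hN]; exists N => // s s' ss' Xs Xs'; apply: Xs.
exact: (hN s').
Qed.

(** An alias, so that the same vectors carry the algebra of saturated sets beside the sigma-algebra
    generated by boxes. *)
Definition gridT : Type := V.
Definition grid_display : measure_display. Proof. exact: default_measure_display. Qed.
HB.instance Definition _ := Pointed.on gridT.
HB.instance Definition _ := @isAlgebraOfSets.Build grid_display gridT saturated
  saturated0 saturatedU saturatedC.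
Local Notation GT := (g_sigma_algebraType (@measurable _ gridT)).

Lemma measurable_coord (i : 'I_nu) : measurable_fun [set: BT] (fun s : BT => s 0 i : R).
Proof.
apply: (@measurability _ _ BT R setT _ (@RGenCInfty.G R)); first exact: RGenCInfty.measurableE.
move=> _ [_ [a ->] <-]; rewrite setTI.
rewrite (_ : _ @^-1` _ = \bigcup_n [set x : V | inbox (\row_j if j == i then a else - n%:R) (\row__ n%:R) x]).
  by apply: bigcupT_measurable => n; apply: sub_sigma_algebra; do 2 eexists.
apply/seteqP; split => x /=; rewrite in_itv/= andbT; [move=> ax|by move=> [n _ /(_ i)]; rewrite !mxE eqxx => /andP[]].
pose M := \sum_j `|x 0 j|.
exists (Num.truncn M).+1 => // j; rewrite !mxE.
have : `|x 0 j| <= (Num.truncn M).+1%:R.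
  apply: (@le_trans _ _ M); last by exact/ltW/truncnS_gt.
  by rewrite /M (bigD1 j)//= lerDl sumr_ge0.
by rewrite ler_norml => /andP[h1 ->]; rewrite andbT; case: eqP => // ->.
Qed.

Lemma saturated_borel : @measurable _ gridT `<=` @measurable _ BT.
Proof.
move=> X [N N0 hX].
have -> : X = \bigcup_(c in [set c | exists2 s, X s & gridc N s = c]) [set s | gridc N s = c].
  by apply/seteqP; split => [s Xs|s [c [s' Xs' <-]] /= h]; [exists (gridc N s) => //; exists s|exact: (hX s')].
rewrite bigcup_mkcond; apply: countable_bigcupT_measurable => // c.
case: ifP => // _.
have -> : [set s | gridc N s = c] = \bigcap_(i in [set: 'I_nu])
   ((fun s : V => s 0 i) @^-1` ((fun x : R => N%:R * ((x + pi) / (pi *+ 2))) @^-1` `[(c 0 i)%:~R, (c 0 i + 1)%:~R[)).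
  apply/seteqP; split => [s <- i _|s h] /=.
    by rewrite in_itv/= mxE floor_itv.
  by apply/rowP => i; have := h i I; rewrite /= in_itv/= mxE => /floor_def.
apply: fin_bigcap_measurable => // i _.
rewrite -[X in measurable X]setTI; apply: measurable_coord => //.
rewrite -[X in measurable X]setTI; apply: continuous_measurable_fun => // x.
by apply: cvgM; [exact: cvg_cst|apply: cvgM; [apply: cvgD; [exact: cvg_id|exact: cvg_cst]|exact: cvg_cst]].
Qed.

(** If [x < a], some multiple [N] moves [N a] more than 1 above [N x], so that their floors differ
    in the wrong direction. *)
Lemma ge_grid (x a : R) : (forall N : nat, Num.floor (N%:R * a) <= Num.floor (N%:R * x)) -> a <= x.
Proof.
move=> h; rewrite leNgt; apply/negP => xa.
pose N := (Num.truncn (a - x)^-1).+1.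
have hN : 1 < N%:R * (a - x) by rewrite mulrC -ltr_pdivrMl ?subr_gt0// mulr1 truncnS_gt.
have := h N; rewrite floor_ge_int => h1.
have := floorD1_gt (N%:R * a); rewrite rmorphD /= => h2.
have h3 : ((1%:~R : R) = 1) by [].
by rewrite mulrBr in hN; lra.
Qed.

(** A box is the intersection over [N] of the saturated sets lying between the grid indices of its
    corners; conversely a saturated set is a countable union of measurable cells. *)
Lemma grid_borel : @measurable _ BT = @measurable _ GT.
Proof.
apply/seteqP; split; apply: smallest_sub; try exact: smallest_sigma_algebra.
  move=> _ [a [b ->]].
  have hh (x : R) : (x + pi) / (pi *+ 2) - (x + pi) / (pi *+ 2) = 0 by rewrite subrr.
  have p0 : 0 < (pi *+ 2 : R) by rewrite mulrn_wgt0// pi_gt0.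
  have -> : [set x | inbox a b x] = \bigcap_(N in [set: nat])
     [set s | forall i, gridc N a 0 i <= gridc N s 0 i <= gridc N b 0 i].
    apply/seteqP; split => s h /=; last first.
      move=> i; apply/andP; split.
        have : (a 0 i + pi) / (pi *+ 2) <= (s 0 i + pi) / (pi *+ 2).
          by apply: ge_grid => N; have := h N I i; rewrite !mxE => /andP[].
        by rewrite ler_pM2r ?invr_gt0// lerD2r.
      have : (s 0 i + pi) / (pi *+ 2) <= (b 0 i + pi) / (pi *+ 2).
        by apply: ge_grid => N; have := h N I i; rewrite !mxE => /andP[].
      by rewrite ler_pM2r ?invr_gt0// lerD2r.
    move=> N _ i; rewrite !mxE; have /andP[h1 h2] := h i.
    by apply/andP; split; apply: le_floor; rewrite ler_wpM2l// ler_wpM2r ?invr_ge0 ?(ltW p0)// lerD2r.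
  apply: bigcapT_measurable => N; have [->|N0] := posnP N.
    rewrite (_ : [set _ | _] = setT); first exact: measurableT.
    by apply/seteqP; split => // s _ i; rewrite !mxE !mul0r lexx.
  by apply: sub_sigma_algebra; exists N => // s s' + h i; move=> <-; exact: h.
exact: saturated_borel.
Qed.

Section Regularity.
Variable mu : {measure set BT -> \bar R}.
Hypothesis mufin : (mu setT < +oo)%E.

Definition mugrid (X : set gridT) : \bar R := mu X.
Lemma mugrid0 : mugrid set0 = 0%E. Proof. exact: measure0. Qed.
Lemma mugrid_ge0 X : (0 <= mugrid X)%E. Proof. exact: measure_ge0. Qed.
Lemma mugrid_add : semi_sigma_additive mugrid.
Proof.
move=> F mF tF mUF; apply: measure_semi_sigma_additive => // [i|]; exact: saturated_borel.
Qed.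
HB.instance Definition _ := isMeasure.Build _ _ _ mugrid mugrid0 mugrid_ge0 mugrid_add.

Definition muGT (X : set GT) : \bar R := mu X.
Lemma muGT0 : muGT set0 = 0%E. Proof. exact: measure0. Qed.
Lemma muGT_ge0 X : (0 <= muGT X)%E. Proof. exact: measure_ge0. Qed.
Lemma muGT_add : semi_sigma_additive muGT.
Proof.
by move=> F mF tF mUF; apply: measure_semi_sigma_additive => // [i|]; rewrite grid_borel.
Qed.
HB.instance Definition _ := isMeasure.Build _ _ _ muGT muGT0 muGT_ge0 muGT_add.

(** Outer regularity with respect to grids: by uniqueness of the extension, [mu] is the Caratheodory
    extension of its restriction to the algebra, and that is an infimum over countable covers by
    members of the algebra. *)
Lemma grid_cover (X : set V) (e : R) : @measurable _ BT X -> 0 < e ->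
  exists F : nat -> set V, [/\ forall k, saturated (F k), X `<=` \bigcup_k F k &
    (\sum_(0 <= k <oo) mu (F k) <= mu X + e%:E)%E].
Proof.
move=> mX e0; have sf : sigma_finite [set: gridT] mugrid.
  exists (fun=> setT); first by rewrite bigcup_const//; exists 0%N.
  by move=> _; split => //; exact: measurableT.
have := @measure_extension_unique _ _ _ mugrid sf muGT (fun _ _ => erefl) X.
rewrite -grid_borel => /(_ mX); rewrite /measure_extension => h.
have fX : (mu X < +oo)%E by apply: le_lt_trans mufin; apply: le_measure; rewrite ?inE//; exact: measurableT.
have : (mu_ext mugrid X < mu X + e%:E)%E.
  by rewrite h /muGT lteDl ?lte_fin// ge0_fin_numE.
move=> /ereal_inf_lt[_ [F [mF XF] <-] hF].
by exists F; split => //; exact: ltW.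
Qed.

End Regularity.

End Grid.

Section SigmaFinitePack.
Context d (X : measurableType d) (R : realType).
Variables (m : {measure set X -> \bar R}) (sfm : sigma_finite setT m).
(** The proof [sfm] is kept inside the term so that the sigma-finite structure can be attached to
    it. *)
Definition sigma_finite_pack : set X -> \bar R := let _ := sfm in m.
HB.instance Definition _ := Measure.copy sigma_finite_pack m.
HB.instance Definition _ := Measure_isSigmaFinite.Build _ _ _ sigma_finite_pack sfm.
End SigmaFinitePack.

Section TorusMeasure.
Variable R : realType.
Local Notation lam := (@lebesgue_measure R).
Local Notation D := ([set` `[- pi, pi[] : set R).

(** Measurability tested along every measurable family of coordinate sequences; no sigma-algebra on
    sequences has to be fixed. *)
Definition coord_measurable (f : (nat -> R) -> \bar R) := forall d (X : measurableType d)
  (phi : X -> nat -> R), (forall i, measurable_fun setT (fun t => phi t i)) ->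
  measurable_fun setT (fun t => f (phi t)).

(** Tonelli's theorem, one coordinate at a time. The underlying space grows with [k], so it is
    existentially quantified and reaches the integrand through the coordinate map [phi]. *)
Lemma iter_measure k : exists d (X : measurableType d) (m : {measure set X -> \bar R})
    (phi : X -> nat -> R), [/\ forall i, measurable_fun setT (fun t => phi t i),
  forall f, (forall s, (0 <= f s)%E) -> coord_measurable f ->
    torus_int k f = (\int[m]_(t in [set t | forall i, (i < k)%N -> D (phi t i)]) f (phi t))%E &
  forall B : nat -> set R, (forall i, measurable (B i)) ->
    m [set t | forall i, (i < k)%N -> B i (phi t i)] = (\prod_(i < k) lam (B i))%E].
Proof.
elim: k => [|k [d [X [m [phi [mphi hphi hB]]]]]].
  (* With no coordinate left the iterated integral is evaluation at the zero sequence, a Dirac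
     mass. *)
  exists _, unit, (\d_ tt), (fun _ _ => 0); split => [i|f f0 mf|B mB].
  - exact: measurable_cst.
  - rewrite (_ : [set _ | _] = setT); last by apply/seteqP; split.
    by rewrite integral_dirac// diracE in_setT mul1e.
  - transitivity ((\d_tt (setT : set unit)) : \bar R); last by rewrite diracE in_setT big_ord0.
    by apply: congr1; apply/seteqP; split.
pose psi (z : R * X) i := if i == k then z.1 else phi z.2 i.
have mpsi i : measurable_fun setT (fun z => psi z i).
  rewrite /psi; case: eqP => _; first exact: measurable_fst.
  exact: (measurableT_comp (mphi i) (measurable_snd)).
have mE (B : nat -> set R) : (forall i, measurable (B i)) -> measurable [set t | forall i, (i < k)%N -> B i (phi t i)].
  move=> mB; rewrite (_ : [set _ | _] = \bigcap_(i in [set i | (i < k)%N]) ((fun t => phi t i) @^-1` B i)).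
    apply: bigcap_measurableType => i _; rewrite -[X in measurable X]setTI.
    exact: mphi.
  by apply/seteqP; split.
(* The product formula of the induction hypothesis gives finite measure to the cubes
   [[- n, n]^k]. *)
have sfm : sigma_finite setT m.
  exists (fun n => [set t | forall i, (i < k)%N -> ([set` `[- n%:R, n%:R]] : set R) (phi t i)]).
    apply/seteqP; split => // t _; pose M := \sum_(i < k) `|phi t i|.
    exists (Num.truncn M).+1 => // i ik; rewrite /= in_itv/= -ler_norml.
    apply: (@le_trans _ _ M); last by exact/ltW/truncnS_gt.
    by rewrite /M (bigD1 (Ordinal ik))//= lerDl sumr_ge0.
  move=> n; split; first by apply: (mE (fun=> [set` `[- n%:R, n%:R]] : set R)) => i; exact: measurable_itv.
  rewrite (hB (fun=> [set` `[- n%:R, n%:R]] : set R)) => [|i]; last exact: measurable_itv.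
  pose K := [set` `[- n%:R, n%:R]] : set R; rewrite -/K.
  suff : (\prod_(i < k) lam K)%E \is a fin_num by rewrite fin_numE ltey => /andP[].
  elim/big_ind: _ => // [x y|i _]; first exact: fin_numM.
  by rewrite /K lebesgue_measure_itv /=; case: ifP.
pose m' : {sigma_finite_measure set X -> \bar R} := sigma_finite_pack sfm.
have setE (B : nat -> set R) : [set z | forall i, (i < k.+1)%N -> B i (psi z i)] =
    B k `*` [set t | forall i, (i < k)%N -> B i (phi t i)].
  apply/seteqP; split => -[x t] /=.
    move=> h; split; first by have := h k (ltnSn k); rewrite /psi eqxx.
    by move=> i ik; have := h i (ltnW ik); rewrite /psi /= ltn_eqF.
  move=> [h1 h2] i; rewrite ltnS leq_eqVlt /psi => /predU1P[->|ik]; first by rewrite eqxx.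
  by rewrite ltn_eqF//; exact: h2.
exists _, (g_sigma_algebraType (@measurable _ (ocitv_type R)) * X)%type, (lam \x m')%E, psi; split => [//|f f0 mf|B mB]; last first.
  transitivity ((lam \x m')%E (B k `*` [set t | forall i, (i < k)%N -> B i (phi t i)])).
    by apply: congr1; exact: setE.
  rewrite (product_measure1E lam m' (mB k) (mE B mB)) big_ord_recr/= muleC.
  by congr (_ * _)%E; exact: hB.
have mD : measurable D by exact: measurable_itv.
pose F (z : R * X) := f (psi z).
have mF : measurable_fun setT F by exact: mf.
pose E := [set t | forall i, (i < k)%N -> D (phi t i)].
have mE' : measurable (D `*` E) by apply: measurableX => //; exact: (mE (fun=> D)).
rewrite /= (setE (fun=> D)) -/E [RHS]integral_mkcond [LHS]integral_mkcond.
rewrite fubini_tonelli1; last 2 first.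
- by apply/(measurable_restrictT _ mE'); exact: measurable_funTS.
- by move=> z; rewrite /patch; case: ifP.
apply: eq_integral => x _; rewrite /fubini_F /patch.
case: ifPn => xD.
  rewrite hphi//; last first.
    move=> d' X' phi' mphi'; apply: (mf _ _ (fun t i => if i == k then x else phi' t i)) => i.
    by case: eqP => _ //; exact: measurable_cst.
  rewrite integral_mkcond -/E; apply: eq_integral => t _; rewrite /patch.
  by rewrite in_setX xD.
by rewrite integral0_eq// => t _; rewrite in_setX (negbTE xD).
Qed.

Variable nu : nat.
Local Notation V := 'rV[R]_nu.
Local Notation BT := (g_sigma_algebraType (@boxes R nu)).
Local Notation TT := ([set s | inT s] : set BT).

Lemma inTE : TT = [set s : V | forall i, D (s 0 i)].
Proof. by apply/seteqP; split => s h i; have := h i; rewrite /= in_itv. Qed.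

Lemma measurable_rect (B : 'I_nu -> set R) : (forall i, measurable (B i)) ->
  @measurable _ BT [set s : V | forall i, B i (s 0 i)].
Proof.
move=> mB; have -> : [set s : V | forall i, B i (s 0 i)] =
    \bigcap_(i in [set: 'I_nu]) ((fun s : V => s 0 i) @^-1` B i).
  by apply/seteqP; split => s h i; [move=> _|]; exact: h.
apply: fin_bigcap_measurable => // i _.
rewrite -[X in measurable X]setTI; exact: measurable_coord.
Qed.

Lemma measurable_inT : @measurable _ BT TT.
Proof. by rewrite inTE; apply: (measurable_rect (B := fun=> D)) => i; exact: measurable_itv. Qed.

(** The measure lives on all row vectors and the product formula allows arbitrary measurable sides,
    because the boxes covering a null set need not lie in the torus. *)
Lemma torus_measure : exists mu : {measure set BT -> \bar R},
  (forall f : V -> \bar R, (forall s, (0 <= f s)%E) -> measurable_fun [set: BT] (f : BT -> \bar R) ->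
     torus_int nu (fun s => f (rv_of_seq nu s)) = (\int[mu]_(s in TT) f s)%E) /\
  (forall B : 'I_nu -> set R, (forall i, measurable (B i)) ->
    mu [set s | forall i, B i (s 0 i)] = (\prod_(i < nu) lam (B i))%E).
Proof.
have [d [X [m [phi [mphi hphi hB]]]]] := iter_measure nu.
have mrv (d' : measure_display) (X' : measurableType d') (phi' : X' -> nat -> R) :
    (forall i, measurable_fun setT (fun t => phi' t i)) ->
    measurable_fun [set: X'] (fun t => rv_of_seq nu (phi' t) : BT).
  move=> mphi'; apply: (@measurability _ _ X' BT setT _ (@boxes R nu)) => //.
  move=> _ [_ [a [b ->]] <-]; rewrite setTI.
  rewrite (_ : _ @^-1` _ = \bigcap_(i in [set: 'I_nu]) ((fun t => phi' t i) @^-1` `[a 0 i, b 0 i])).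
    apply: fin_bigcap_measurable => // i _; rewrite -[X in measurable X]setTI.
    by apply: mphi'.
  by apply/seteqP; split => t h i; [move=> _|]; have := h i; rewrite /= in_itv/= mxE; [|move/(_ I)].
exists (pushforward m (fun t => rv_of_seq nu (phi t) : BT)); split => [f f0 mf|B mB].
  have cf : coord_measurable (fun s => f (rv_of_seq nu s)).
    by move=> d' X' phi' mphi'; exact: (measurableT_comp mf (mrv _ _ _ mphi')).
  rewrite (hphi _ (fun s => f0 _) cf).
  rewrite [RHS]ge0_integral_pushforward//; last 3 first.
  - exact: mrv.
  - exact: measurable_inT.
  - exact: measurable_funTS.
  congr (integral _ _ _); apply/seteqP; split => t /= h.
    by move=> i; have := h i (ltn_ord i); rewrite /= in_itv/= mxE.
  by move=> i i_nu; have := h (Ordinal i_nu); rewrite in_itv/= mxE.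
pose B' i := oapp B setT (insub i).
have mB' i : measurable (B' i) by rewrite /B'; case: insub => //=.
have B'E (i : 'I_nu) : B' i = B i by rewrite /B' valK.
rewrite -[RHS](eq_bigr _ (fun i _ => congr1 _ (B'E i))) -hB// /pushforward.
congr (m _); apply/seteqP; split => t /= h.
  by move=> i i_nu; have := h (Ordinal i_nu); rewrite -B'E mxE.
by move=> i; have := h i (ltn_ord i); rewrite B'E mxE.
Unshelve. exact: mrv.
Qed.

End TorusMeasure.

Section Torus.
Variables (R : realType) (nu : nat).
Local Notation C := R[i].
Local Notation lam := (@lebesgue_measure R).
Local Notation D := ([set` `[- pi, pi[] : set R).
Local Notation V := 'rV[R]_nu.
Local Notation BT := (g_sigma_algebraType (@boxes R nu)).
Local Notation TT := ([set s | inT s] : set BT).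

Lemma lam_D : lam D = (pi *+ 2)%:E.
Proof.
rewrite lebesgue_measure_itv /= lte_fin gt0_cp ?pi_gt0// -EFinB opprK; congr EFin.
Qed.

Lemma int_cos (l : int) (W b th : R) :
  (\int[lam]_(x in D) (W * (1 + b * cos (th + l%:~R * x)))%:E)%E =
   (W * (pi *+ 2) * (1 + (if l == 0 then b * cos th else 0)))%:E.
Proof.
have p0 : 0 < (pi *+ 2 : R) by rewrite mulrn_wgt0// pi_gt0.
set J := [set` `[- pi, pi]] : set R.
have mJ : @measurable _ (g_sigma_algebraType (@measurable _ (ocitv_type R))) J := measurable_itv _.
have fJ : (lam J < +oo)%E by rewrite lebesgue_measure_itv /=; case: ifP => _; rewrite ?ltry// -EFinB ltry.
have h : Cint lam J (fun x => ce (l%:~R * x)) = if l == 0 then (pi *+ 2)%:C%C else 0.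
  rewrite -(ce_orth (- pi : R) p0 l) (_ : - pi + pi *+ 2 = pi); last by rewrite mulr2n addKr.
  apply: eq_Cint => y _; congr (ce (_ * _)).
  by rewrite -[LHS]mulr1; congr (_ * _); rewrite divff// gt_eqF.
pose z : C := (W * b)%:C%C * ce th.
have cb1 : cbm J (fun x => z * ce (l%:~R * x)) by apply: cbmZ; exact: cbm_ce.
have cb0 : cbm J (fun x => W%:C%C + z * ce (l%:~R * x)) by apply: cbmD => //; exact: cbm_cst.
have E x : (W * (1 + b * cos (th + l%:~R * x))) = complex.Re (W%:C%C + z * ce (l%:~R * x)).
  have -> : z * ce (l%:~R * x) = (W * b)%:C%C * ce (th + l%:~R * x) by rewrite /z -mulrA -ceD.
  by rewrite cReD cReM /=; ring.
under eq_integral do rewrite E.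
rewrite integral_itv_bndo_bndc; last first.
  apply/measurable_EFinP; apply: measurable_funS mJ _ cb0.1.1 => x.
  by rewrite /J /= !in_itv/= => /andP[-> /ltW].
have i0 := cbm_iRe mJ fJ cb0.
rewrite -[LHS]fineK; last by have := integrable_fin_num mJ i0.
congr EFin; rewrite -[LHS]/(complex.Re (Cint lam J (fun x => W%:C%C + z * ce (l%:~R * x)))).
rewrite (CintD mJ fJ (cbm_cst _ _) cb1) (Cint_cst lam mJ) (CintZ mJ fJ z (cbm_ce _ _)) h.
have -> : fine (lam J) = pi *+ 2.
  rewrite lebesgue_measure_itv /= lte_fin gt0_cp ?pi_gt0// -EFinB opprK.
  by [].
case: ifP => _; rewrite cReD ?cReM /= /z ?cReM ?cImM /=; ring.
Qed.

(** Adding 1 keeps the integrand nonnegative, as the passage from [torus_int] to [mu] requires; the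
    free phase [th] absorbs the outermost variable in the induction. *)
Lemma torus_cos (l : nat -> int) k (th : R) :
  torus_int k (fun s => (1 + cos (\sum_(i < k) (l i)%:~R * s i + th))%:E) =
  ((pi *+ 2) ^+ k * (1 + (if [forall i : 'I_k, l i == 0] then cos th else 0)))%:E.
Proof.
elim: k th => [|k ih] th.
  rewrite /= big_ord0 add0r expr0 mul1r; case: ifP => // /negbT/forallPn[[]].
  by [].
rewrite /=.
pose b : R := if [forall i : 'I_k, l i == 0] then 1 else 0.
transitivity ((\int[lam]_(x in D) ((pi *+ 2) ^+ k * (1 + b * cos (th + (l k)%:~R * x)))%:E)%E).
  apply: eq_integral => x _.
  rewrite (_ : (fun s : nat -> R => _) = fun s : nat -> R => (1 + cos (\sum_(i < k) (l i)%:~R * s i + (th + (l k)%:~R * x)))%:E).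
    rewrite ih /b; congr (_ * (1 + _))%:E; case: ifP => _; rewrite ?mul1r ?mul0r//.
  apply: funext => s; congr (1 + cos _)%:E; rewrite big_ord_recr /= eqxx addrAC -addrA; congr (_ + _).
  by apply: eq_bigr => i _; rewrite ltn_eqF.
rewrite int_cos exprSr; congr (_ * (1 + _))%:E.
rewrite /b; have -> : [forall i : 'I_k.+1, l i == 0] = [forall i : 'I_k, l i == 0] && (l k == 0).
  apply/forallP/andP => [h|[/forallP h1 h2] i].
    by split; [apply/forallP => i; exact: (h (widen_ord (leqnSn k) i))|exact: (h ord_max)].
  have := ltn_ord i; rewrite ltnS leq_eqVlt => /predU1P[->//|ik].
  exact: (h1 (Ordinal ik)).
by rewrite andbC; case: (l k == 0) => //=; case: [forall _, _]; rewrite ?mul1r ?mul0r.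
Qed.

Lemma fcharE (l : Zl nu) s : fchar l s = conjc (ce (\sum_i (l 0 i)%:~R * s 0 i)) :> C.
Proof. by rewrite /fchar; apply: cext; rewrite /= ?mul0r ?mul1r ?subr0 ?add0r ?oppr0 ?addr0//; ring. Qed.

Lemma fchar0 (s : V) : fchar 0 s = 1 :> C.
Proof. by rewrite fcharE big1 ?ce0 ?conjc1// => i _; rewrite mxE mul0r. Qed.
Lemma fcharD (k l : Zl nu) (s : V) : fchar (k + l) s = fchar k s * fchar l s :> C.
Proof.
rewrite !fcharE -rmorphM -ceD -big_split; congr (conjc (ce _)); apply: eq_bigr => i _.
by rewrite mxE rmorphD mulrDl.
Qed.
Lemma fcharN (k : Zl nu) (s : V) : fchar (- k) s = conjc (fchar k s) :> C.
Proof.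
rewrite !fcharE; congr conjc; rewrite ceJ; congr ce; rewrite -sumrN; apply: eq_bigr => i _.
by rewrite mxE rmorphN mulNr.
Qed.
Lemma n1_fchar (k : Zl nu) (s : V) : n1 (fchar k s : C) <= 2. Proof. by rewrite fcharE n1J n1_ce. Qed.

Lemma measurable_lin (l : Zl nu) : measurable_fun [set: BT] (fun s : BT => \sum_i (l 0 i)%:~R * s 0 i : R).
Proof. by apply: measurable_sum => i; apply: measurable_funM => //; exact: measurable_coord. Qed.

Lemma measurable_cosl (l : Zl nu) th : measurable_fun [set: BT] (fun s : BT => cos (\sum_i (l 0 i)%:~R * s 0 i + th) : R).
Proof.
apply: (measurableT_comp (f := @cos R)); first by apply: continuous_measurable_fun; exact: continuous_cos.
by apply: measurable_funD => //; exact: measurable_lin.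
Qed.

Lemma cbm_fchar (l : Zl nu) : cbm [set: BT] (fun s : BT => fchar l s : C).
Proof.
split; last by exists 2 => s _; exact: n1_fchar.
under eq_fun do rewrite fcharE.
apply: cmfJ; split.
  have := measurable_cosl l 0; by under eq_fun do rewrite addr0.
have := measurable_cosl l (- (pi / 2)); apply: eq_measurable_fun => s _ /=.
by rewrite cosB cos_pihalf sin_pihalf mulr0 add0r mulr1.
Qed.

Variable mu : {measure set BT -> \bar R}.
Hypothesis muI : forall f : V -> \bar R, (forall s, (0 <= f s)%E) -> measurable_fun [set: BT] (f : BT -> \bar R) ->
     torus_int nu (fun s => f (rv_of_seq nu s)) = (\int[mu]_(s in TT) f s)%E.
Hypothesis mu_rect : forall B : 'I_nu -> set R, (forall i, measurable (B i)) ->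
    mu [set s | forall i, B i (s 0 i)] = (\prod_(i < nu) lam (B i))%E.

Definition tvol : R := (pi *+ 2) ^+ nu.

Lemma prod_EFin (I : finType) (F : I -> R) : (\prod_i (F i)%:E)%E = (\prod_i F i)%:E.
Proof. by elim/big_rec2: _ => // i x y _ ->; rewrite EFinM. Qed.

Lemma mu_TT : mu TT = tvol%:E.
Proof.
rewrite inTE (mu_rect (B := fun=> D)) => [|i]; last exact: measurable_itv.
by rewrite (eq_bigr (fun=> (pi *+ 2)%:E)) => [|i _]; [rewrite prod_EFin prodr_const card_ord|exact: lam_D].
Qed.
Lemma tvol_gt0 : 0 < tvol. Proof. by rewrite exprn_gt0// mulrn_wgt0// pi_gt0. Qed.
Lemma mu_fin : (mu TT < +oo)%E. Proof. by rewrite mu_TT ltry. Qed.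

Lemma int_cosl (l : Zl nu) th : \int[mu]_(s in TT) cos (\sum_i (l 0 i)%:~R * s 0 i + th) =
   if l == 0 then tvol * cos th else 0.
Proof.
pose l' i : int := oapp (l 0) 0 (insub i : option 'I_nu).
have l'E (i : 'I_nu) : l' i = l 0 i by rewrite /l' valK.
have := torus_cos l' nu th.
have E (s : nat -> R) : (\sum_(i < nu) (l' i)%:~R * s i) = \sum_i (l 0 i)%:~R * (rv_of_seq nu s) 0 i :> R.
  by apply: eq_bigr => i _; rewrite l'E mxE.
under eq_fun do rewrite E.
rewrite (muI (f := fun s => (1 + cos (\sum_i (l 0 i)%:~R * s 0 i + th))%:E)); last 2 first.
- by move=> s; rewrite lee_fin -lerBlDl sub0r cos_geN1.
- apply/measurable_EFinP; apply: measurable_funD => //; exact: measurable_cosl.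
move=> /(congr1 fine) /=; rewrite -[fine _]/(\int[mu]_(s in TT) (1 + cos (\sum_i (l 0 i)%:~R * s 0 i + th))).
have mT : @measurable _ BT TT := @measurable_inT R nu; have fT := mu_fin.
have i1 : mu.-integrable TT (EFin \o (fun=> 1 : R)).
  by apply: (bounded_integrable mT fT (M := 1)) => // s _; rewrite normr1.
have i2 : mu.-integrable TT (EFin \o (fun s => cos (\sum_i (l 0 i)%:~R * s 0 i + th))).
  apply: (bounded_integrable mT fT (M := 1)); first by apply: measurable_funTS; exact: measurable_cosl.
  by move=> s _; rewrite ler_norml cos_geN1 cos_le1.
rewrite (RintegralD mT i1 i2) (Rintegral_cst mu mT) mu_TT /= mul1r mulrDr mulr1 => /addrI ->.
have -> : [forall i : 'I_nu, l' i == 0] = (l == 0).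
  apply/forallP/eqP => [h|l0 i]; last by rewrite l'E l0 mxE.
  by apply/rowP => i; have /eqP := h i; rewrite l'E mxE.
by case: ifP => _; rewrite ?mulr0.
Qed.

(** The phases [0] and [pi / 2] in [int_cosl] give the real and the imaginary part. *)
Lemma int_char (l : Zl nu) : Cint mu TT (fun s => fchar l s) = if l == 0 then tvol%:C%C else 0.
Proof.
have h0 := int_cosl l 0; have h1 := int_cosl l (pi / 2).
have mT : @measurable _ BT TT := @measurable_inT R nu; have fT := mu_fin.
apply: cext.
  transitivity (\int[mu]_(s in TT) cos (\sum_i (l 0 i)%:~R * s 0 i + 0)).
    by apply: eq_Rintegral => s _; rewrite fcharE addr0.
  by rewrite h0 cos0 mulr1; case: ifP.
transitivity (\int[mu]_(s in TT) cos (\sum_i (l 0 i)%:~R * s 0 i + pi / 2)).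
  by apply: eq_Rintegral => s _; rewrite fcharE /= cosD cos_pihalf sin_pihalf mulr0 add0r mulr1.
by rewrite h1 cos_pihalf mulr0; case: ifP.
Qed.

End Torus.

(** * Null sets given by box covers *)

Section NullSets.
Variables (R : realType) (d : nat).
Local Notation V := 'rV[R]_d.

Lemma boxvol_ge0 (a b : V) : 0 <= boxvol a b.
Proof. by rewrite prodr_ge0// => i _; rewrite le_max lexx orbT. Qed.

Lemma null_sub (X Y : set V) : X `<=` Y -> null_rV Y -> null_rV X.
Proof. by move=> XY hY e /hY[a [b [h1 h2]]]; exists a, b; split => //; exact: subset_trans h1. Qed.

Lemma pair_cover (a b : nat -> nat -> V) (X : set V) (e : \bar R) :
  X `<=` \bigcup_k \bigcup_i [set x | inbox (a k i) (b k i) x] ->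
  (\sum_(0 <= k <oo) \sum_(0 <= i <oo) (boxvol (a k i) (b k i))%:E < e)%E ->
  exists a' b', X `<=` \bigcup_k [set x | inbox (a' k) (b' k) x] /\
    (\sum_(0 <= k <oo) (boxvol (a' k) (b' k))%:E < e)%E.
Proof.
move=> Xab he; have /card_esym/ppcard_eqP[f] := card_nat2.
exists (fun k => a (f k).1 (f k).2), (fun k => b (f k).1 (f k).2); split.
  move=> x /Xab[k _ [i _ xki]]; exists (f^-1%FUN (k, i)) => //=.
  by rewrite invK ?inE.
have v0 (p : nat * nat) : (0 <= (boxvol (a p.1 p.2) (b p.1 p.2))%:E)%E by rewrite lee_fin boxvol_ge0.
apply: le_lt_trans he; rewrite nneseries_esumT//.
rewrite -(reindex_esum setT setT (fun k => f k) (fun p : nat * nat => (boxvol (a p.1 p.2) (b p.1 p.2))%:E)); last first.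
  exact: 'bij_f.
rewrite (_ : setT = [set: nat] `*`` (fun=> [set: nat])); last by apply/seteqP; split.
rewrite -(esum_esum (a := fun i j => (boxvol (a i j) (b i j))%:E)); last by move=> i j _ _; exact: (v0 (i, j)).
rewrite nneseries_esumT; last by move=> k; apply: nneseries_ge0 => i _ _; exact: (v0 (k, i)).
by apply: le_esum => k _; rewrite nneseries_esumT// => i; exact: (v0 (k, i)).
Qed.

Lemma null_bigcup (N : nat -> set V) : (forall k, null_rV (N k)) -> null_rV (\bigcup_k N k).
Proof.
move=> hN e e0; have h k : exists ab : (nat -> V) * (nat -> V),
    N k `<=` \bigcup_i [set x | inbox (ab.1 i) (ab.2 i) x] /\
    (\sum_(0 <= i <oo) (boxvol (ab.1 i) (ab.2 i))%:E < ((e / 2) / (2 ^ k.+1)%:R)%:E)%E.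
  have e1 : 0 < (e / 2) / (2 ^ k.+1)%:R by rewrite !divr_gt0// ltr0n expn_gt0.
  by have [a [b hab]] := hN k _ e1; exists (a, b).
have [ab hab] := choice h.
apply: (@pair_cover (fun k => (ab k).1) (fun k => (ab k).2)).
  by move=> x [k _ /(hab k).1[i _ xi]]; exists k => //; exists i.
apply: (@le_lt_trans _ _ (e / 2)%:E); last by rewrite lte_fin; lra.
apply: le_trans (epsilon_trick0 xpredT (_ : 0 <= e / 2)); last by rewrite divr_ge0// ltW.
apply: lee_nneseries => [k _ _|k _].
  by apply: nneseries_ge0 => i _ _; rewrite lee_fin boxvol_ge0.
exact: (ltW (hab k).2).
Qed.

End NullSets.

Section Density.
Context d (T : measurableType d) (R : realType) (mu : {measure set T -> \bar R}).
Variable f : T -> R.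
Hypotheses (mf : measurable_fun setT f) (f0 : forall x, 0 <= f x).
Definition density (A : set T) : \bar R := let _ := (mf, f0) in (\int[mu]_(x in A) (f x)%:E)%E.
Lemma density0 : density set0 = 0%E. Proof. by rewrite /density integral_set0. Qed.
Lemma density_ge0 A : (0 <= density A)%E.
Proof. by apply: integral_ge0 => x _; rewrite lee_fin. Qed.
Lemma density_add : semi_sigma_additive density.
Proof.
apply: semi_sigma_additive_nng_induced; last by move=> x; rewrite lee_fin.
exact/measurable_EFinP.
Qed.
HB.instance Definition _ := isMeasure.Build _ _ _ density density0 density_ge0 density_add.
End Density.

(** * Null sets and measure zero; integrals over grid cells *)

Section Cells.
Variables (R : realType) (nu : nat).
Hypothesis nu0 : (0 < nu)%N.
Local Notation lam := (@lebesgue_measure R).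
Local Notation D := ([set` `[- pi, pi[] : set R).
Local Notation V := 'rV[R]_nu.
Local Notation BT := (g_sigma_algebraType (@boxes R nu)).
Local Notation TT := ([set s | inT s] : set BT).
Variable mu : {measure set BT -> \bar R}.
Hypothesis mu_rect : forall B : 'I_nu -> set R, (forall i, measurable (B i)) ->
    mu [set s | forall i, B i (s 0 i)] = (\prod_(i < nu) lam (B i))%E.

(** A degenerate box pads covers indexed by all naturals. In dimension 0 the empty product would
    give it volume 1. *)
Lemma boxvol00 : boxvol (0 : V) 0 = 0.
Proof.
by rewrite /boxvol (bigD1 (Ordinal nu0))//= subrr maxxx mul0r.
Qed.

Lemma mu_box (a b : V) : mu [set x | inbox a b x] = (boxvol a b)%:E.
Proof.
have -> : [set x | inbox a b x] = [set s : V | forall i, [set` `[a 0 i, b 0 i]] (s 0 i)].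
  by apply/seteqP; split => s h i; have := h i; rewrite /= in_itv.
rewrite (mu_rect (B := fun i => [set` `[a 0 i, b 0 i]])) => [|i]; last exact: measurable_itv.
rewrite -prod_EFin; apply: eq_bigr => i _; rewrite lebesgue_measure_itv /= lte_fin.
by case: ltP => h; rewrite -?EFinB; congr EFin; [rewrite max_l// subr_ge0 ltW|rewrite max_r// subr_le0].
Qed.

Lemma null_measurable (N : set V) : null_rV N ->
  exists N', [/\ @measurable _ BT N', N `<=` N' & mu N' = 0%E].
Proof.
move=> hN; have h (k : nat) : exists ab : (nat -> V) * (nat -> V),
    N `<=` \bigcup_i [set x | inbox (ab.1 i) (ab.2 i) x] /\
    (\sum_(0 <= i <oo) (boxvol (ab.1 i) (ab.2 i))%:E < (k.+1%:R^-1)%:E)%E.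
  have e1 : 0 < (k.+1%:R^-1 : R) by rewrite invr_gt0.
  by have [a [b hab]] := hN _ e1; exists (a, b).
have [ab hab] := choice h.
pose U k := \bigcup_i [set x | inbox ((ab k).1 i) ((ab k).2 i) x].
have mb k i : @measurable _ BT [set x | inbox ((ab k).1 i) ((ab k).2 i) x].
  by apply: sub_sigma_algebra; do 2 eexists.
have mU k : @measurable _ BT (U k) by exact: bigcupT_measurable.
have mN : @measurable _ BT (\bigcap_k U k) by exact: bigcapT_measurable.
exists (\bigcap_k U k); split => // [x Nx k _|]; first exact: (hab k).1.
apply/eqP; rewrite eq_le measure_ge0 andbT; apply/lee_addgt0Pr => e e0; rewrite add0e.
pose k := Num.truncn e^-1.
have ke : k.+1%:R^-1 <= e.
  by rewrite invf_ple ?posrE// ltW// truncnS_gt.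
apply: (@le_trans _ _ (mu (U k))).
  by apply: le_measure; rewrite ?inE// => x; exact.
apply: (le_trans (measure_sigma_subadditive mu (mb k) (mU k) (fun _ h => h))).
rewrite (eq_eseriesr (g := fun i => (boxvol ((ab k).1 i) ((ab k).2 i))%:E)); last by move=> i _; exact: mu_box.
by apply: (le_trans (ltW (hab k).2)); rewrite lee_fin.
Qed.

Definition cella N (c : 'rV[int]_nu) : V := \row_i ((c 0 i)%:~R * (pi *+ 2 / N%:R) - pi).
Definition cellb N (c : 'rV[int]_nu) : V := \row_i (((c 0 i)%:~R + 1) * (pi *+ 2 / N%:R) - pi).

Lemma gridcP N (s : V) c : (0 < N)%N ->
  gridc N s = c <-> forall i, cella N c 0 i <= s 0 i < cellb N c 0 i.
Proof.
move=> N0; have p0 : 0 < (pi *+ 2 : R) by rewrite mulrn_wgt0// pi_gt0.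
have Nr : 0 < (N%:R : R) by rewrite ltr0n.
have key i (z : int) : (z%:~R <= N%:R * ((s 0 i + pi) / (pi *+ 2))) = (z%:~R * (pi *+ 2 / N%:R) - pi <= s 0 i).
  by rewrite lerBlDr mulrA ler_pdivlMr// mulrA ler_pdivrMr// [(s 0 i + pi) * _]mulrC.
have E i (z : int) : (Num.floor (N%:R * ((s 0 i + pi) / (pi *+ 2))) == z) =
   (z%:~R * (pi *+ 2 / N%:R) - pi <= s 0 i < (z%:~R + 1) * (pi *+ 2 / N%:R) - pi).
  rewrite floor_eq key; congr (_ && _).
  by rewrite ltNge key -ltNge rmorphD.
split=> [<- i|h].
  by rewrite !mxE -E.
by apply/rowP => i; rewrite !mxE; apply/eqP; rewrite E; have := h i; rewrite !mxE.
Qed.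

Lemma mu_cell N c : (0 < N)%N -> mu [set s | gridc N s = c] = (boxvol (cella N c) (cellb N c))%:E.
Proof.
move=> N0; have -> : [set s : V | gridc N s = c] = [set s | forall i, [set` `[cella N c 0 i, cellb N c 0 i[] (s 0 i)].
  apply/seteqP; split => s /=.
    by move=> h i; rewrite in_itv; exact: ((gridcP s c N0).1 h i).
  by move=> h; apply: (gridcP s c N0).2 => i; have := h i; rewrite in_itv.
rewrite (mu_rect (B := fun i => [set` `[cella N c 0 i, cellb N c 0 i[])) => [|i]; last exact: measurable_itv.
rewrite -prod_EFin; apply: eq_bigr => i _; rewrite lebesgue_measure_itv /= lte_fin.
by case: ltP => h; rewrite -?EFinB; congr EFin; [rewrite max_l// subr_ge0 ltW|rewrite max_r// subr_le0].
Qed.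

Lemma measurable_cell N c : (0 < N)%N -> @measurable _ BT [set s | gridc N s = c].
Proof. by move=> N0; apply: saturated_borel; exists N => // s s' + <-. Qed.

Lemma saturated_TT : saturated ([set s | inT s] : set V).
Proof.
have E (s : V) : inT s <-> gridc 1 s = 0.
  rewrite (gridcP s 0 (ltn0Sn 0)); split=> h i; have := h i; rewrite !mxE mul0r add0r add0r mul1r divr1;
  by rewrite mulr2n addrK.
by exists 1%N => // s s' + /E; move=> + e; rewrite e => /esym /E.
Qed.

(** Each cell sits at the code of its index, which makes the family disjoint; codes of no cell in
    [F] carry the empty set. *)
Lemma saturated_pieces (F : set V) : saturated F -> exists N (c : nat -> option 'rV[int]_nu),
  let G j := if c j is Some c0 then [set s | gridc N s = c0] else set0 in
  [/\ (0 < N)%N, F = \bigcup_j G j & trivIset setT G].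
Proof.
move=> [N N0 hF].
pose A c := exists2 s, F s & gridc N s = c.
pose c j : option 'rV[int]_nu := if unpickle j is Some c0 then if pselect (pickle c0 = j /\ A c0) then Some c0 else None else None.
exists N, c => G; split => //.
  apply/seteqP; split => [s Fs|s [j _]].
    exists (pickle (gridc N s)) => //; rewrite /G /c pickleK.
    by case: pselect => // -[]; split => //; exists s.
  rewrite /G /c; case: unpickle => // c0; case: pselect => // -[_ [s' Fs' e]] /= h.
  by apply: (hF s') => //; rewrite h.
have Gj s j : G j s -> pickle (gridc N s) = j.
  by rewrite /G /c; case: unpickle => // c0; case: pselect => // -[e _] /= ->.
apply/trivIsetP => i j _ _ ij; apply/seteqP; split => // s [/Gj h1 /Gj h2].
by move: ij; rewrite -h1 -h2 eqxx.
Qed.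

Lemma mu_TTf : (mu TT < +oo)%E.
Proof.
rewrite inTE (mu_rect (B := fun=> D)) => [|i]; last exact: measurable_itv.
by rewrite (eq_bigr (fun=> (pi *+ 2)%:E)) => [|i _]; [rewrite prod_EFin ltry|exact: lam_D].
Qed.

Lemma saturatedI (X Y : set V) : saturated X -> saturated Y -> saturated (X `&` Y).
Proof.
move=> sX sY; rewrite -[X]setCK -[Y]setCK -setCU; apply: saturatedC; apply: saturatedU;
exact: saturatedC.
Qed.

(** Outer regularity, applied to the finite restriction of [mu] to the torus, covers [X] by
    saturated sets of small total measure; these split into cells, and each cell is enclosed in a
    closed box of the same volume. *)
Lemma mu0_null (X : set V) : @measurable _ BT X -> X `<=` TT -> mu X = 0%E -> null_rV X.
Proof.
move=> mX XT X0 e e0.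
have mT : @measurable _ BT TT := @measurable_inT R nu.
pose rho := mfrestr mT mu_TTf.
have rf : (rho setT < +oo)%E by rewrite /rho /mfrestr /mrestr setTI mu_TTf.
have e20 : 0 < e / 2 by rewrite divr_gt0.
have [F [sF XF hF]] := grid_cover rf mX e20.
have sG k : saturated (F k `&` TT) by apply: saturatedI => //; exact: saturated_TT.
have h k := saturated_pieces (sG k).
have [N {}h] := choice h; have [c {}h] := choice h.
apply: (@pair_cover R nu (fun k j => if c k j is Some c0 then cella (N k) c0 else 0)
   (fun k j => if c k j is Some c0 then cellb (N k) c0 else 0)).
  move=> x Xx; have [k _ Fx] := XF _ Xx; exists k => //.
  have : (F k `&` TT) x by split => //; exact: XT.
  have [N0 -> _] := h k; move=> [j _ Gx]; exists j => //; move: Gx.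
  case: (c k j) => [c0|//] /= hx i.
  by have /andP[-> /ltW] := (gridcP x c0 N0).1 hx i.
apply: (@le_lt_trans _ _ (e / 2)%:E); last by rewrite lte_fin; lra.
have rX : rho X = 0%E by apply/eqP; rewrite eq_le measure_ge0 andbT -X0 /rho /mfrestr /mrestr; apply: le_measure; rewrite ?inE//; exact: measurableI.
have hF2 : (\sum_(0 <= k <oo) rho (F k) <= (e / 2)%:E)%E.
  by apply: (le_trans hF); rewrite -[X in (X + _)%E]/(rho X) rX add0e.
apply: le_trans hF2.
apply: lee_nneseries => [k _ _|k _].
  by apply: nneseries_ge0 => i _ _; rewrite lee_fin boxvol_ge0.
rewrite /rho /mfrestr /mrestr.
have [N0 -> tG] := h k.
have mG j : @measurable _ BT (if c k j is Some c0 then [set s | gridc (N k) s = c0] else set0).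
  by case: (c k j) => // c0; exact: measurable_cell.
rewrite (measure_semi_bigcup mu mG tG); last exact: bigcupT_measurable.
rewrite le_eqVlt; apply/orP; left; apply/eqP; apply: eq_eseriesr => j _.
case: (c k j) => [c0|]; first by rewrite mu_cell.
by rewrite boxvol00 measure0.
Qed.

(** Let [rp] and [rm] be the measures with densities the positive and negative parts of [Q]. The
    hypothesis gives [rm <= rp] on cells, hence on saturated subsets of the torus. Outer regularity
    of [rp] carries this to [X], where [Q < 0]; there [rp] vanishes, so [rm] does, and with it the
    measure of [X]. *)
Lemma cell_integral_ge0 (Q : V -> R) (M : R) : measurable_fun [set: BT] (Q : BT -> R) ->
  (forall s, `|Q s| <= M) ->
  (forall N c, (0 < N)%N -> (exists2 s : V, inT s & gridc N s = c) ->
     0 <= \int[mu]_(s in [set s : BT | gridc N s = c]) Q s) ->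
  null_rV [set s | inT s /\ Q s < 0].
Proof.
move=> mQ QM hQ.
have mT : @measurable _ BT TT := @measurable_inT R nu.
have T1 : measurable_fun [set: BT] (\1_TT : BT -> R) by exact: measurable_indic.
pose fp (s : BT) := Num.max (Q s) 0 * \1_TT s; pose fm (s : BT) := Num.max (- Q s) 0 * \1_TT s.
have mp : measurable_fun setT fp by apply: measurable_funM => //; exact: measurable_maxr.
have mm : measurable_fun setT fm.
  by apply: measurable_funM => //; apply: measurable_maxr => //; exact: measurableT_comp.
have p0 s : 0 <= fp s by rewrite mulr_ge0// le_max lexx orbT.
have m0 s : 0 <= fm s by rewrite mulr_ge0// le_max lexx orbT.
have M0 : 0 <= M by exact: le_trans (QM 0).
have pM s : `|fp s| <= M.
  rewrite ger0_norm// /fp indicE; case: (_ \in _); rewrite ?mulr0 ?mulr1// ge_max M0 andbT.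
  exact: le_trans (ler_norm _) (QM s).
have mM s : `|fm s| <= M.
  rewrite ger0_norm// /fm indicE; case: (_ \in _); rewrite ?mulr0 ?mulr1// ge_max M0 andbT.
  by rewrite (le_trans (ler_norm _))// normrN.
pose rp : {measure set BT -> \bar R} := density mu mp p0.
pose rm : {measure set BT -> \bar R} := density mu mm m0.
have mX : @measurable _ BT [set s | inT s /\ Q s < 0].
  rewrite (_ : [set s | _] = TT `&` (Q : BT -> R) @^-1` `]-oo, 0[); last first.
    by apply/seteqP; split => s [h1] /=; rewrite in_itv.
  by apply: measurableI => //; rewrite -[X in measurable X]setTI; apply: mQ.
set X : set BT := [set s | _].
have rpfin : (rp setT < +oo)%E.
  apply: (@le_lt_trans _ _ (\int[mu]_s (M%:E * (\1_TT s)%:E))%E).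
    apply: ge0_le_integral => //.
    - by move=> s _; rewrite lee_fin.
    - exact/measurable_EFinP.
    - by apply/measurable_EFinP; exact: measurable_funM.
    - move=> s _; rewrite -EFinM lee_fin /fp ler_wpM2r// ge_max M0 andbT.
      exact: le_trans (ler_norm _) (QM s).
  have T1E : measurable_fun [set: BT] (EFin \o (\1_TT : BT -> R)) by exact/measurable_EFinP.
  rewrite (ge0_integralZl mu measurableT T1E) ?lee_fin//; last by move=> s _; rewrite lee_fin.
  by rewrite integral_indic// setIT lte_mul_pinfty// mu_TTf.
have rX : rp X = 0%E.
  apply: integral0_eq => s [_ Qs]; rewrite /fp (_ : Num.max _ _ = 0) ?mul0r//.
  by rewrite max_r// ltW.
have piece N c : (0 < N)%N -> [set s : V | gridc N s = c] `<=` TT ->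
    (rm [set s | gridc N s = c] <= rp [set s | gridc N s = c])%E.
  move=> N0 cT; set A := [set s | _].
  have [->|/set0P[s0 As0]] := eqVneq A set0; first by rewrite !measure0.
  have mA : @measurable _ BT A by exact: measurable_cell.
  have fA : (mu A < +oo)%E by rewrite mu_cell// ltry.
  have ip := bounded_integrable mA fA (measurable_funTS mp) (fun s _ => pM s).
  have im := bounded_integrable mA fA (measurable_funTS mm) (fun s _ => mM s).
  have -> : rp A = (\int[mu]_(s in A) fp s)%:E by rewrite -[LHS](fineK (integrable_fin_num mA ip)).
  have -> : rm A = (\int[mu]_(s in A) fm s)%:E by rewrite -[LHS](fineK (integrable_fin_num mA im)).
  rewrite lee_fin -subr_ge0 -[X in 0 <= X](RintegralB mA ip im).
  rewrite (_ : \int[mu]_(s in A) (fp s - fm s) = \int[mu]_(s in A) Q s).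
    by apply: hQ => //; exists s0 => //; exact: cT.
  apply: eq_Rintegral => s /set_mem As; rewrite /fp /fm indicE mem_set ?mulr1; last exact: cT.
  have [q|q] := leP 0 (Q s).
    by rewrite (_ : Num.max (- Q s) 0 = 0) ?subr0// max_r// oppr_le0.
  by rewrite (_ : Num.max (- Q s) 0 = - Q s) ?sub0r ?opprK// max_l// oppr_ge0 ltW.
have sat_le (F : set V) : saturated F -> F `<=` TT -> (rm F <= rp F)%E.
  move=> sF FT; have [N [c [N0 FE tG]]] := saturated_pieces sF.
  have mG j : @measurable _ BT (if c j is Some c0 then [set s | gridc N s = c0] else set0).
    by case: (c j) => // c0; exact: measurable_cell.
  rewrite FE !measure_semi_bigcup//; try exact: bigcupT_measurable.
  apply: lee_nneseries => // j _.
  have : (if c j is Some c0 then [set s | gridc N s = c0] else set0) `<=` TT.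
    by apply: subset_trans FT; rewrite FE => s Gs; exists j.
  by case: (c j) => [c0|_]; [exact: piece|rewrite !measure0].
have rmX : rm X = 0%E.
  apply/eqP; rewrite eq_le measure_ge0 andbT; apply/lee_addgt0Pr => e e0; rewrite add0e.
  have [F [sF XF hF]] := grid_cover rpfin mX e0; rewrite rX add0e in hF.
  have sG k : saturated (F k `&` TT) by apply: saturatedI => //; exact: saturated_TT.
  have mG k : @measurable _ BT (F k `&` TT) := @saturated_borel R nu _ (sG k).
  apply: le_trans hF; apply: (@le_trans _ _ (\sum_(0 <= k <oo) rm (F k `&` TT)))%E.
    apply: (measure_sigma_subadditive rm mG mX) => s Xs; have [k _ Fs] := XF s Xs.
    by exists k => //; split => //; case: Xs.
  apply: lee_nneseries => // k _; apply: (le_trans (sat_le _ (sG k) (@subIsetr _ _ _))).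
  by apply: le_measure; rewrite ?inE//; exact: (@saturated_borel R nu _ (sF k)).
apply: mu0_null => //; first by move=> s [].
have mmX : measurable_fun X (EFin \o fm).
  by apply/measurable_EFinP; exact: measurable_funTS.
have /(ae_eq_integral_abs mu mX mmX) : (\int[mu]_(s in X) `|(EFin \o fm) s| = 0)%E.
  by rewrite -rmX; apply: eq_integral => s _; rewrite /= ger0_norm.
move=> [Z [mZ Z0 hZ]]; apply: (subset_measure0 mX mZ _ Z0) => s Xs; apply: hZ => /= h.
have := h Xs; case: Xs => Ts Qs; rewrite /fm indicE mem_set// mulr1 max_l ?oppr_ge0 ?(ltW Qs)//.
by case=> /eqP; rewrite oppr_eq0 lt_eqF.
Qed.

End Cells.

(** * Cylinders over null sets and sections of null sets *)

Section Slices.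
Variables (R : realType) (nu : nat).
Local Notation lam := (@lebesgue_measure R).
Local Notation V := 'rV[R]_nu.
Local Notation BT := (g_sigma_algebraType (@boxes R nu)).

Lemma boxvol_split (a b : 'rV[R]_(1 + nu)) :
  boxvol a b = Num.max (b 0 0 - a 0 0) 0 * boxvol (rsubmx a : V) (rsubmx b).
Proof.
rewrite /boxvol big_split_ord /= big_ord1; congr (_ * _).
  by congr (Num.max (b 0 _ - a 0 _) _); apply: val_inj.
by apply: eq_bigr => i _; rewrite !mxE.
Qed.

(** The frequency axis has infinite length, so the cylinder is cut at [|w| <= k]; there every box of
    a cover only gains the factor [2 k]. *)
Lemma null_cylinder (N : set V) : null_rV N ->
  null_rV [set z : 'rV[R]_(1 + nu) | exists (w : R) (s : V), z = row_mx (\row_(_ < 1) w) s /\ N s].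
Proof.
move=> hN; pose Z (k : nat) := [set z : 'rV[R]_(1 + nu) |
   exists (w : R) (s : V), [/\ z = row_mx (\row_(_ < 1) w) s, `|w| <= k%:R & N s]].
apply: (@null_sub _ _ _ (\bigcup_k Z k)).
  move=> z [w [s [-> Ns]]]; exists (Num.truncn `|w|).+1 => //; exists w, s; split => //.
  exact/ltW/truncnS_gt.
apply: null_bigcup => k e e0.
have e1 : 0 < e / (2 * k%:R + 1) by rewrite divr_gt0// ltr_wpDl// mulr_ge0.
have [a [b [h1 h2]]] := hN _ e1.
exists (fun i => row_mx (\row_(_ < 1) - k%:R) (a i)), (fun i => row_mx (\row_(_ < 1) k%:R) (b i)); split.
  move=> z [w [s [-> wk /h1[i _ sab]]]]; exists i => // j /=.
  case: (split_ordP j) => j' ->; rewrite ?row_mxEl ?row_mxEr; last exact: sab.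
  by rewrite !mxE -ler_norml.
have E i : boxvol (row_mx (\row_(_ < 1) - k%:R) (a i) : 'rV[R]_(1 + nu)) (row_mx (\row_(_ < 1) k%:R) (b i)) =
    2 * k%:R * boxvol (a i) (b i).
  rewrite boxvol_split !row_mxKr; congr (_ * _).
  rewrite !mxE; case: splitP => // j _; rewrite !mxE opprK max_l ?addr_ge0//.
  by rewrite mulr_natl mulr2n.
under eq_eseriesr do rewrite E EFinM.
rewrite nneseriesZl; last by move=> i _; rewrite lee_fin boxvol_ge0.
have s0 : (0 <= \sum_(0 <= i <oo) (boxvol (a i) (b i))%:E)%E.
  by apply: nneseries_ge0 => i _ _; rewrite lee_fin boxvol_ge0.
case: (\sum_(0 <= i <oo) (boxvol (a i) (b i))%:E)%E h2 s0 => [x|//|//]; rewrite lte_fin lee_fin => xe x0.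
rewrite -EFinM lte_fin; move: xe; rewrite ltr_pdivlMr ?ltr_wpDl ?mulr_ge0// => xe.
apply: le_lt_trans xe; rewrite mulrC ler_wpM2l// lerDl//.
Qed.

Variable mu : {measure set BT -> \bar R}.
Hypothesis mu_rect : forall B : 'I_nu -> set R, (forall i, measurable (B i)) ->
    mu [set s | forall i, B i (s 0 i)] = (\prod_(i < nu) lam (B i))%E.

(* Markov's inequality for the total length of the sections of a small cover *)
Lemma slice_cover (N : set 'rV[R]_(1 + nu)) (p q e : R) : null_rV N -> p < q -> 0 < e ->
  exists Y : set BT, [/\ measurable Y, (mu Y <= e%:E)%E &
    forall s : V, (forall w, p <= w <= q -> N (row_mx (\row_(_ < 1) w) s)) -> Y s].
Proof.
move=> hN pq e0; have qp : 0 < q - p by rewrite subr_gt0.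
have [a [b [h1 h2]]] := hN _ (mulr_gt0 e0 qp).
pose B k : set BT := [set s : V | inbox (rsubmx (a k) : V) (rsubmx (b k)) s].
have mB k : measurable (B k) by apply: sub_sigma_algebra; do 2 eexists.
pose J k : set R := [set` `[a k 0 0, b k 0 0]].
have mJ k : measurable (J k) by exact: measurable_itv.
pose ell k : R := Num.max (b k 0 0 - a k 0 0) 0.
have ell0 k : 0 <= ell k by rewrite le_max lexx orbT.
have lamJ k : lam (J k) = (ell k)%:E.
  rewrite lebesgue_measure_itv /= lte_fin /ell.
  by case: ltP => h; rewrite -?EFinB; congr EFin; [rewrite max_l// subr_ge0 ltW|rewrite max_r// subr_le0].
pose t k (s : BT) : \bar R := ((ell k) * \1_(B k) s)%:E.
have t0 k s : (0 <= t k s)%E by rewrite lee_fin mulr_ge0.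
have mt k : measurable_fun setT (t k) by apply/measurable_EFinP; exact: measurable_funM.
pose f s := (\sum_(0 <= k <oo) t k s)%E.
have mf : measurable_fun [set: BT] f by apply: ge0_emeasurable_sum.
have f0 s : (0 <= f s)%E by apply: nneseries_ge0.
pose Y : set BT := [set s | ((q - p)%:E <= f s)%E].
have mY : measurable Y.
  rewrite (_ : Y = setT `&` f @^-1` `[(q - p)%:E, +oo[ `|` (setT `&` f @^-1` [set +oo%E])).
    apply: measurableU; apply: mf => //; exact: emeasurable_itv.
  apply/seteqP; split => s; rewrite /Y /=.
    rewrite in_itv /= andbT => h; case: (f s) h => [r|//|//] h; [left|right] => //.
  by rewrite in_itv /= andbT => -[[_ ]|[_ ->]]//; rewrite leey.
exists Y; split => // [|s hs].
  have i1 : ((q - p)%:E * mu Y <= \sum_(0 <= k <oo) (boxvol (a k) (b k))%:E)%E.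
    rewrite -(integral_cst mu mY).
    apply: (@le_trans _ _ (\int[mu]_(s in Y) f s)%E).
      apply: ge0_le_integral => //.
      - by move=> s _; rewrite lee_fin ltW.
      - exact: measurable_funTS.
    apply: (@le_trans _ _ (\int[mu]_s f s)%E).
      exact: ge0_subset_integral.
    rewrite integral_nneseries//; apply: lee_nneseries => [k _ _|k _].
      exact: integral_ge0.
    rewrite /t; under eq_integral do rewrite EFinM.
    rewrite ge0_integralZl ?lee_fin//; try (by move=> s _; rewrite lee_fin); try (by apply/measurable_EFinP).
    by rewrite integral_indic// setIT mu_box// -EFinM lee_fin boxvol_split.
  have := ltW (le_lt_trans i1 h2).
  by rewrite -lee_pdivlMl// -EFinM mulrC mulfK// gt_eqF.
rewrite /Y /=.
pose K k : set R := if s \in B k then J k else set0.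
have mK k : measurable (K k) by rewrite /K; case: ifP.
have -> : (q - p)%:E = lam [set` `[p, q]] by rewrite lebesgue_measure_itv /= lte_fin pq.
apply: (le_trans (measure_sigma_subadditive lam mK (measurable_itv _) _)).
  move=> w; rewrite /= in_itv /= => /hs /h1[k _ hk]; exists k => //.
  rewrite /K mem_set; last first.
    by move=> i; have := hk (rshift 1 i); rewrite !mxE /= (unsplitK (inr i)).
  have := hk 0; rewrite /J /= in_itv /= !mxE; case: splitP => // j _; by rewrite mxE.
apply: lee_nneseries => // k _; rewrite /K /t indicE; case: ifP => _.
  by rewrite mulr1 -lamJ.
by rewrite mulr0 [leLHS]measure0.
Qed.

(** This replaces Fubini. Excluding sections that contain a whole interval is enough, since by
    continuity in the frequency a single good point in each rational interval suffices. *)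
Lemma slice_null (N : set 'rV[R]_(1 + nu)) (p q : R) : null_rV N -> p < q ->
  exists Y : set BT, [/\ measurable Y, mu Y = 0%E &
    forall s : V, (forall w, p <= w <= q -> N (row_mx (\row_(_ < 1) w) s)) -> Y s].
Proof.
move=> hN pq; have h (k : nat) := @slice_cover N p q (k.+1%:R^-1) hN pq (ltac:(by rewrite invr_gt0)).
have [Y hY] := choice h.
have mY k : measurable (Y k) by have [] := hY k.
have mI : measurable (\bigcap_k Y k) by exact: bigcapT_measurable.
exists (\bigcap_k Y k); split => // [|s hs k _]; last by have [_ _] := hY k; apply.
apply/eqP; rewrite eq_le measure_ge0 andbT; apply/lee_addgt0Pr => e e0; rewrite add0e.
pose k := Num.truncn e^-1.
have ke : k.+1%:R^-1 <= e by rewrite invf_ple ?posrE// ltW// truncnS_gt.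
apply: (@le_trans _ _ (mu (Y k))); first by apply: le_measure; rewrite ?inE// => x; exact.
have [_ h1 _] := hY k; apply: (le_trans h1); by rewrite lee_fin.
Qed.

End Slices.

(** * Fourier coefficients and Toeplitz operators *)

Section BoxSums.
Variables (R : realType) (nu : nat).

(** The cubes [[- N, N]^nu], enumerated by [sq_ind] so that sums over them are the partial sums of
    [psum]. *)
Definition boxseq N : seq (Zl nu) := [seq @sq_ind nu N k | k <- enum {: 'rV['I_(2 * N + 1)]_nu}].
Definition bsum (E : zmodType) N (f : Zl nu -> E) : E := \sum_(l <- boxseq N) f l.

Lemma sq_ind_inj N : injective (@sq_ind nu N).
Proof.
move=> k l /rowP h; apply/rowP => i; have := h i; rewrite !mxE => /addIr /eqP.
by rewrite eqz_nat => /eqP /val_inj.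
Qed.

Lemma boxseq_uniq N : uniq (boxseq N).
Proof. by rewrite map_inj_uniq ?enum_uniq//; exact: sq_ind_inj. Qed.

Lemma mem_boxseq N (l : Zl nu) : (l \in boxseq N) = [forall i : 'I_nu, (absz (l 0%R i) <= N)%N].
Proof.
apply/mapP/forallP => [[k _ ->] i|h].
  rewrite /sq_ind mxE; move: (ltn_ord (k 0 i)); move: (nat_of_ord _) => x; lia.
have hb i : (absz (l 0%R i + N%:Z)%R < 2 * N + 1)%N by have := h i; lia.
exists (\row_i Ordinal (hb i)); first by rewrite mem_enum.
by apply/rowP => i; rewrite !mxE /=; have := h i; lia.
Qed.

Lemma boxseq_mono M N : (M <= N)%N -> {subset boxseq M <= boxseq N}.
Proof. by move=> MN l; rewrite !mem_boxseq => /forallP h; apply/forallP => i; exact: leq_trans (h i) MN. Qed.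

Lemma boxseq_exhaust (s : seq (Zl nu)) : exists N, {subset s <= boxseq N}.
Proof.
elim: s => [|l s [N hN]]; first by exists 0%N.
exists (maxn N (\max_(i < nu) absz (l 0%R i))) => k; rewrite inE => /orP[/eqP ->|/hN].
  rewrite mem_boxseq; apply/forallP => i; rewrite leq_max; apply/orP; right.
  exact: (leq_bigmax i).
by apply: boxseq_mono; rewrite leq_maxl.
Qed.

Lemma bsum_sq (E : zmodType) N (f : Zl nu -> E) : bsum N f = \sum_(k : 'rV['I_(2 * N + 1)]_nu) f (sq_ind k).
Proof. by rewrite /bsum big_map big_enum. Qed.

Lemma bsum_fsum N (f : Zl nu -> R) : (bsum N f)%:E = (\sum_(l \in [set` boxseq N]) (f l)%:E)%E.
Proof. by rewrite /bsum -sumEFin fsbig_seq// boxseq_uniq. Qed.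

Lemma le_bsum_box M N (f : Zl nu -> R) : (forall l, 0 <= f l) -> (M <= N)%N -> bsum M f <= bsum N f.
Proof.
move=> f0 MN; rewrite -lee_fin !bsum_fsum; apply: lee_fsum_nneg_subset; try exact: finite_seq.
- by move=> l; rewrite !inE; exact: boxseq_mono.
- by move=> l _; rewrite lee_fin.
Qed.

Lemma bsumD N (f g : Zl nu -> R) : bsum N (fun l => f l + g l) = bsum N f + bsum N g.
Proof. exact: big_split. Qed.
Lemma bsumZ N c (f : Zl nu -> R) : bsum N (fun l => c * f l) = c * bsum N f.
Proof. by rewrite /bsum mulr_sumr. Qed.
Lemma le_bsum N (f g : Zl nu -> R) : (forall l, f l <= g l) -> bsum N f <= bsum N g.
Proof. by move=> fg; apply: ler_sum. Qed.
Lemma bsum_ge0 N (f : Zl nu -> R) : (forall l, 0 <= f l) -> 0 <= bsum N f.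
Proof. by move=> f0; apply: sumr_ge0. Qed.
Lemma bsum_sum I (r : seq I) N (f : I -> Zl nu -> R) :
  bsum N (fun l => \sum_(i <- r) f i l) = \sum_(i <- r) bsum N (f i).
Proof. exact: exchange_big. Qed.

Lemma bsum_le_esum N (f : Zl nu -> R) : (forall l, 0 <= f l) ->
  ((bsum N f)%:E <= \esum_(l in [set: Zl nu]) (f l)%:E)%E.
Proof.
move=> f0; apply: esum_ge; exists [set` boxseq N]; first by split => //; exact: finite_seq.
by rewrite /bsum -sumEFin fsbig_seq// boxseq_uniq.
Qed.

Lemma esum_le_bsum (C : R) (f : Zl nu -> R) : (forall l, 0 <= f l) -> (forall N, bsum N f <= C) ->
  (\esum_(l in [set: Zl nu]) (f l)%:E <= C%:E)%E.
Proof.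
move=> f0 fC; apply: ge_ereal_sup => _ [A [fA _] <-].
have [s sA] := (finite_seqP A).1 fA.
have [N hN] := boxseq_exhaust s.
apply: (@le_trans _ _ (bsum N f)%:E); last by rewrite lee_fin.
rewrite bsum_fsum; apply: lee_fsum_nneg_subset => //.
- exact: finite_seq.
- by move=> l; rewrite sA !inE /= => /hN.
- by move=> l _; rewrite lee_fin.
Qed.

Definition sumb (f : Zl nu -> R) := exists C, forall N, bsum N (fun l => `|f l|) <= C.

Lemma sumb_fin (f : Zl nu -> R) : (forall l, 0 <= f l) -> (exists C, forall N, bsum N f <= C) ->
  (\esum_(l in [set: Zl nu]) (f l)%:E)%E \is a fin_num.
Proof.
move=> f0 [C fC]; rewrite ge0_fin_numE; last by apply: esum_ge0 => l _; rewrite lee_fin.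
by apply: le_lt_trans (esum_le_bsum f0 fC) _; rewrite ltry.
Qed.

Lemma bsum_cvg_esum (f : Zl nu -> R) : (forall l, 0 <= f l) -> (exists C, forall N, bsum N f <= C) ->
  bsum N f @[N --> \oo] --> fine (\esum_(l in [set: Zl nu]) (f l)%:E)%E.
Proof.
move=> f0 fC; have ff := sumb_fin f0 fC; set L := fine _.
have fL N : bsum N f <= L.
  by rewrite -lee_fin /L fineK//; exact: bsum_le_esum.
apply/cvgrPdist_le => e e0.
have [N hN] : exists N, L - e <= bsum N f.
  apply: contrapT => h.
  have : (\esum_(l in [set: Zl nu]) (f l)%:E <= (L - e)%:E)%E.
    apply: esum_le_bsum => // N; rewrite leNgt; apply/negP => hN; apply: h.
    by exists N; exact: ltW.
  by rewrite -(fineK ff) lee_fin -/L; lra.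
exists N => // n /= Nn; rewrite ger0_norm ?subr_ge0// lerBlDr.
have := le_bsum_box f0 Nn; lra.
Qed.

Lemma sumb_le (f g : Zl nu -> R) : (forall l, `|f l| <= g l) -> (exists C, forall N, bsum N g <= C) -> sumb f.
Proof. by move=> fg [C gC]; exists C => N; apply: le_trans (gC N); exact: le_bsum. Qed.

(** For absolutely summable families the difference of positive and negative parts is the limit of
    cube sums; linearity of [zsum] and all identities below are read off such limits. *)
Lemma zsum_cvg (f : Zl nu -> R) : sumb f -> bsum N f @[N --> \oo] --> zsum f.
Proof.
move=> [C fC]; pose p l := Num.max (f l) 0; pose q l := Num.max (- f l) 0.
have p0 l : 0 <= p l by rewrite le_max lexx orbT.
have q0 l : 0 <= q l by rewrite le_max lexx orbT.
have pC : exists C, forall N, bsum N p <= C.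
  by exists C => N; apply: le_trans (fC N); apply: le_bsum => l; rewrite ge_max ler_norm normr_ge0.
have qC : exists C, forall N, bsum N q <= C.
  by exists C => N; apply: le_trans (fC N); apply: le_bsum => l; rewrite ge_max -normrN ler_norm normr_ge0.
have -> : (fun N => bsum N f) = (fun N => bsum N p - bsum N q).
  apply: funext => N; rewrite /bsum -sumrB; apply: eq_bigr => l _; rewrite /p /q.
  by rewrite /Num.max; case: ltP => ?; case: ltP => ?; lra.
exact: cvgB (bsum_cvg_esum p0 pC) (bsum_cvg_esum q0 qC).
Qed.

Lemma zsum_lim (f : Zl nu -> R) (L : R) : sumb f -> bsum N f @[N --> \oo] --> L -> zsum f = L.
Proof. by move=> sf fL; apply: (cvg_unique _ (zsum_cvg sf) fL). Qed.

Lemma sumbD (f g : Zl nu -> R) : sumb f -> sumb g -> sumb (fun l => f l + g l).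
Proof.
move=> [C fC] [E gE]; apply: (@sumb_le _ (fun l => `|f l| + `|g l|)) => [l|]; first exact: ler_normD.
by exists (C + E) => N; rewrite bsumD lerD.
Qed.
Lemma sumbZ c (f : Zl nu -> R) : sumb f -> sumb (fun l => c * f l).
Proof.
move=> [C fC]; apply: (@sumb_le _ (fun l => `|c| * `|f l|)) => [l|]; first by rewrite normrM.
by exists (`|c| * C) => N; rewrite bsumZ ler_wpM2l.
Qed.
Lemma sumb_sum I (r : seq I) (f : I -> Zl nu -> R) : (forall i, sumb (f i)) -> sumb (fun l => \sum_(i <- r) f i l).
Proof.
move=> sf; elim: r => [|i r ih].
  by exists 0 => N; rewrite /bsum big1// => l _; rewrite big_nil normr0.
by under eq_fun do rewrite big_cons; exact: sumbD.
Qed.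
Lemma zsumD (f g : Zl nu -> R) : sumb f -> sumb g -> zsum (fun l => f l + g l) = zsum f + zsum g.
Proof.
move=> sf sg; apply: (zsum_lim (sumbD sf sg)); under eq_fun do rewrite bsumD.
by apply: cvgD; exact: zsum_cvg.
Qed.
Lemma zsumZ c (f : Zl nu -> R) : sumb f -> zsum (fun l => c * f l) = c * zsum f.
Proof.
move=> sf; apply: (zsum_lim (sumbZ c sf)); under eq_fun do rewrite bsumZ.
by apply: cvgM; [exact: cvg_cst|exact: zsum_cvg].
Qed.

Lemma zsum_reindex (j : Zl nu) (f : Zl nu -> R) : zsum (fun k => f (j - k)) = zsum f.
Proof.
have b : set_bij [set: Zl nu] [set: Zl nu] (fun k : Zl nu => j - k).
  split => [k _//|k l _ _|k _]; first by move=> /addrI /oppr_inj.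
  by exists (j - k) => //; rewrite subKr.
by rewrite /zsum (reindex_esum _ _ _ (fun l => (Num.max (f l) 0)%:E) b) (reindex_esum _ _ _ (fun l => (Num.max (- f l) 0)%:E) b).
Qed.

End BoxSums.

(** * Fourier coefficients on a set where the characters are orthogonal *)

Section Fourier.
Variables (R : realType) (nu : nat).
Local Notation C := R[i].
Local Notation V := 'rV[R]_nu.
Local Notation BT := (g_sigma_algebraType (@boxes R nu)).
Variables (mu : {measure set BT -> \bar R}) (D : set BT) (tv : R).
Hypotheses (mD : measurable D) (fD : (mu D < +oo)%E) (tv0 : 0 < tv).
Hypothesis orth : forall l : Zl nu, Cint mu D (fun s => fchar l s) = if l == 0 then tv%:C%C else 0.
Implicit Types (h f : V -> C) (k l j : Zl nu).

Lemma cJM (z w : C) : conjc (z * w) = conjc z * conjc w. Proof. exact: rmorphM. Qed.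

Lemma cbm_char l : cbm D (fun s : BT => fchar l s : C).
Proof. by apply: sub_cbm (cbm_fchar R l) => //; exact: measurableT. Qed.

Definition fcoef h k : C := (tv^-1)%:C%C * Cint mu D (fun s => h s * conjc (fchar k s)).
Local Notation coef := fcoef.

Lemma cbm_hc h k : cbm D h -> cbm D (fun s => h s * conjc (fchar k s)).
Proof. by move=> ch; apply: cbmM => //; apply: cbmJ; exact: cbm_char. Qed.

Lemma coefD h f k : cbm D h -> cbm D f -> coef (fun s => h s + f s) k = coef h k + coef f k.
Proof.
move=> ch cf; rewrite /coef -mulrDr -(CintD mD fD (cbm_hc k ch) (cbm_hc k cf)).
by congr (_ * _); apply: eq_Cint => s _; rewrite mulrDl.
Qed.
Lemma coefZ z h k : cbm D h -> coef (fun s => z * h s) k = z * coef h k.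
Proof.
move=> ch; rewrite /coef mulrCA -(CintZ mD fD z (cbm_hc k ch)).
by congr (_ * _); apply: eq_Cint => s _; rewrite mulrA.
Qed.
Lemma eq_coef h f k : (forall s, D s -> h s = f s) -> coef h k = coef f k.
Proof. by move=> hf; congr (_ * _); apply: eq_Cint => s Ds; rewrite hf. Qed.
Lemma coef0 k : coef (fun=> 0) k = 0.
Proof.
rewrite (@eq_coef _ (fun s => 0 * (fchar 0 s : C))) ?coefZ ?mul0r//; first exact: cbm_char.
by move=> s _; rewrite mul0r.
Qed.
Lemma coef_sum I (r : seq I) (F : I -> V -> C) k : (forall i, cbm D (F i)) ->
  coef (fun s => \sum_(i <- r) F i s) k = \sum_(i <- r) coef (F i) k.
Proof.
move=> cF; elim: r => [|i r ih].
  by rewrite big_nil; under eq_fun do rewrite big_nil; exact: coef0.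
rewrite big_cons -ih -coefD//; last exact: cbm_sum.
by under eq_fun do rewrite big_cons.
Qed.
Lemma coef_shift l h j : coef (fun s => fchar l s * h s) j = coef h (j - l).
Proof.
congr (_ * _); apply: eq_Cint => s _; rewrite fcharD fcharN cJM conjcK.
by ring.
Qed.
Lemma coef_char l k : coef (fun s => fchar l s) k = (k == l)%:R.
Proof.
rewrite /coef; transitivity ((tv^-1)%:C%C * Cint mu D (fun s => fchar (l - k) s)).
  by congr (_ * _); apply: eq_Cint => s _; rewrite fcharD fcharN.
rewrite orth subr_eq0 eq_sym; case: eqP => _; last by rewrite mulr0.
by rewrite -rmorphM mulVf ?gt_eqF.
Qed.

Lemma n1_coef h k : cbm D h -> n1 (coef h k) <= tv^-1 * (2 * \int[mu]_(s in D) n1 (h s)).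
Proof.
move=> ch; apply: (le_trans (n1M _ _)); rewrite n1_real ger0_norm ?invr_ge0 ?(ltW tv0)//.
apply: ler_wpM2l; first by rewrite invr_ge0 ltW.
have ch' := cbm_hc k ch.
apply: (le_trans (n1_Cint mD fD ch')); rewrite -(RintegralZl 2 mD (cbm_in1 mD fD ch)).
apply: (le_Rintegral mD (cbm_in1 mD fD ch')).
  exact: (integrableZr 2 mD (cbm_in1 mD fD ch)).
move=> s _; apply: (le_trans (n1M _ _)); rewrite mulrC ler_wpM2r ?n1_ge0//.
by rewrite n1J n1_fchar.
Qed.

Lemma cint_cabs2 h : cbm D h -> mu.-integrable D (EFin \o (fun s => cabs2 (h s))).
Proof.
move=> ch; have := cbm_iRe mD fD (cbmM (cbmJ ch) ch); apply: eq_integrable => // s _ /=.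
by rewrite -[X in X * _]/(conjc (h s)) mulJ_cabs2.
Qed.

(** Expanding the nonnegative integral of [|h - p|^2] with [p] the partial Fourier sum: by
    orthogonality the three other terms coincide up to sign. *)
Lemma bessel (I : finType) (ka : I -> Zl nu) h : injective ka -> cbm D h ->
  \sum_i cabs2 (coef h (ka i)) <= tv^-1 * \int[mu]_(s in D) cabs2 (h s).
Proof.
move=> ika ch; pose c i := coef h (ka i).
pose p s := \sum_i c i * (fchar (ka i) s : C).
have cp : cbm D p by apply: cbm_sum => i; apply: cbmZ; exact: cbm_char.
have cd : cbm D (fun s => h s - p s) by exact: cbmB.
have h0 : 0 <= \int[mu]_(s in D) cabs2 (h s - p s) by apply: Rintegral_ge0 => s _; exact: cabs2_ge0.
have E f : (\int[mu]_(s in D) cabs2 (f s))%:C%C = Cint mu D (fun s => f s * conjc (f s)).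
  apply: cext => /=; last first.
    rewrite /Rintegral (eq_integral (fun=> 0%E)) ?integral0// => s _.
    by rewrite mulrC mulJ_cabs2.
  by apply: eq_Rintegral => s _; rewrite mulrC mulJ_cabs2.
have e1 : Cint mu D (fun s => h s * conjc (p s)) = \sum_i tv%:C%C * (conjc (c i) * c i).
  transitivity (Cint mu D (fun s => \sum_i conjc (c i) * (h s * conjc (fchar (ka i) s)))).
    apply: eq_Cint => s _; rewrite rmorph_sum mulr_sumr; apply: eq_bigr => i _.
    by rewrite rmorphM /= mulrCA.
  rewrite (Cint_sum mD fD); last by move=> i; apply: cbmZ; exact: cbm_hc.
  apply: eq_bigr => i _; rewrite (CintZ mD fD _ (cbm_hc _ ch)) mulrCA; congr (_ * _).
  by rewrite /c /coef mulrA -rmorphM mulfV ?gt_eqF// mul1r.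
have e2 : Cint mu D (fun s => p s * conjc (p s)) = \sum_i tv%:C%C * (conjc (c i) * c i).
  transitivity (Cint mu D (fun s => \sum_i \sum_j (c i * conjc (c j)) * (fchar (ka i - ka j) s : C))).
    apply: eq_Cint => s _; rewrite rmorph_sum mulr_suml; apply: eq_bigr => i _.
    rewrite mulr_sumr; apply: eq_bigr => j _; rewrite fcharD fcharN rmorphM /=; ring.
  rewrite (Cint_sum mD fD); last by move=> i; apply: cbm_sum => j; apply: cbmZ; exact: cbm_char.
  apply: eq_bigr => i _; rewrite (Cint_sum mD fD); last by move=> j; apply: cbmZ; exact: cbm_char.
  rewrite (bigD1 i)//= big1 => [|j ji]; rewrite (CintZ mD fD _ (cbm_char _)) orth subr_eq0.
    by rewrite eqxx addr0 mulrC; congr (_ * _); rewrite mulrC.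
  by rewrite (inj_eq ika) eq_sym (negbTE ji) mulr0.
have e3 : Cint mu D (fun s => p s * conjc (h s)) = \sum_i tv%:C%C * (conjc (c i) * c i).
  have : Cint mu D (fun s => p s * conjc (h s)) = conjc (Cint mu D (fun s => h s * conjc (p s))).
    rewrite -(CintJ mD fD); last by apply: cbmM => //; exact: cbmJ.
    by apply: eq_Cint => s _; rewrite cJM conjcK mulrC.
  move=> ->; rewrite e1 rmorph_sum; apply: eq_bigr => i _.
  rewrite -[LHS]/(conjc (tv%:C%C * (conjc (c i) * c i))) cJM conjc_real [X in _ * X]cJM conjcK.
  by congr (_ * _); rewrite mulrC.
have := E (fun s => h s - p s).
have -> : Cint mu D (fun s => (h s - p s) * conjc (h s - p s)) =
   Cint mu D (fun s => h s * conjc (h s)) - \sum_i tv%:C%C * (conjc (c i) * c i).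
  transitivity (Cint mu D (fun s => (h s * conjc (h s) - h s * conjc (p s)) - (p s * conjc (h s) - p s * conjc (p s)))).
    by apply: eq_Cint => s _; rewrite rmorphB /=; ring.
  have [chh chp cph cpp] : [/\ cbm D (fun s => h s * conjc (h s)), cbm D (fun s => h s * conjc (p s)),
     cbm D (fun s => p s * conjc (h s)) & cbm D (fun s => p s * conjc (p s))].
    by split; apply: cbmM => //; exact: cbmJ.
  rewrite (CintB mD fD (cbmB chh chp) (cbmB cph cpp)) (CintB mD fD chh chp) (CintB mD fD cph cpp).
  by rewrite e1 e2 e3 subrr subr0.
rewrite -E => hC.
have hE : \int[mu]_(s in D) cabs2 (h s - p s) = \int[mu]_(s in D) cabs2 (h s) -
    \sum_i complex.Re (tv%:C%C * (conjc (c i) * c i)).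
  by have := congr1 (@complex.Re R) hC; rewrite cReD cReN cRe_sum.
rewrite hE in h0.
rewrite ler_pdivlMl// mulr_sumr; rewrite subr_ge0 in h0; apply: le_trans h0.
rewrite le_eqVlt; apply/orP; left; apply/eqP; apply: eq_bigr => i _.
by rewrite mulJ_cabs2 -rmorphM.
Qed.

Definition psums N (w : Zl nu -> R) (s : V) : C := bsum N (fun l => (w l)%:C%C * fchar l s).
(** What is kept of a symbol: boundedness at every point of [D], not only essentially, and L^2
    convergence of the cube sums. *)
Definition sym (w : Zl nu -> R) f := cbm D f /\
  \int[mu]_(s in D) cabs2 (psums N w s - f s) @[N --> \oo] --> 0.

Lemma cbm_psums N w : cbm D (psums N w).
Proof. by apply: cbm_sum => l; apply: cbmZ; exact: cbm_char. Qed.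

Lemma n1_young (d : R) (z : C) : 0 < d -> n1 z <= d + d^-1 * cabs2 z.
Proof.
move=> d0; rewrite -(ler_pM2l d0) [leRHS]mulrDr mulrA mulfV ?gt_eqF// mul1r.
have := n1_le_cabs2 z; have := sqr_ge0 (n1 z - 2 * d); nra.
Qed.

(** [n1 z <= d + |z|^2 / d] with [d] proportional to [e] plays the role of the Cauchy-Schwarz
    inequality. *)
Lemma L1_L2 (F : nat -> V -> C) : (forall N, cbm D (F N)) ->
  \int[mu]_(s in D) cabs2 (F N s) @[N --> \oo] --> 0 ->
  \int[mu]_(s in D) n1 (F N s) @[N --> \oo] --> 0.
Proof.
move=> cF F0; apply/cvgrPdist_le => e e0.
pose M := fine (mu D); have M0 : 0 <= M by exact: fine_ge0.
pose d := e / (2 * (M + 1)); have d0 : 0 < d by rewrite divr_gt0// mulr_gt0// ltr_wpDl.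
have e1 : 0 < d * (e / 2) by rewrite mulr_gt0// divr_gt0.
near=> N; have hN : \int[mu]_(s in D) cabs2 (F N s) <= d * (e / 2).
  by apply: ltW; near: N; exact: (cvgr_lt _ F0 _ e1).
have i0 : 0 <= \int[mu]_(s in D) n1 (F N s) by apply: Rintegral_ge0 => s _; exact: n1_ge0.
rewrite sub0r normrN ger0_norm//.
have i1 : mu.-integrable D (EFin \o (fun=> d)).
  by apply: (bounded_integrable mD fD (M := `|d|)).
have i2 := integrableZr d^-1 mD (cint_cabs2 (cF N)).
apply: (@le_trans _ _ (\int[mu]_(s in D) (d + d^-1 * cabs2 (F N s)))).
  apply: (le_Rintegral mD (cbm_in1 mD fD (cF N)) (integrableD mD i1 i2)) => s _; exact: n1_young.
rewrite (RintegralD mD i1 i2) (Rintegral_cst mu mD) (RintegralZl _ mD (cint_cabs2 (cF N))) -/M.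
have h1 : d^-1 * \int[mu]_(s in D) cabs2 (F N s) <= e / 2 by rewrite ler_pdivrMl.
have h2 : d * M <= e / 2.
  have -> : d * M = e / 2 * (M / (M + 1)) by rewrite /d; field; rewrite gt_eqF// ltr_wpDl.
  rewrite ler_piMr ?divr_ge0 ?(ltW e0)//.
  by rewrite ler_pdivrMr ?ltr_wpDl// mul1r lerDl.
have -> : e = e / 2 + e / 2 by lra.
exact: lerD.
Unshelve. all: by end_near. Qed.

Definition tendsC (u : nat -> C) (z : C) := n1 (u N - z) @[N --> \oo] --> 0.

(** The convolution theorem, with the symbol as one factor and a bounded [h] as the other. The cube
    sums are the coefficients of the truncated symbol times [h], and L^1 convergence of the
    truncations is enough since [h] is bounded. *)
Lemma coef_mul (w : Zl nu -> R) f h j : sym w f -> cbm D h ->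
  tendsC (fun N => bsum N (fun l => (w l)%:C%C * coef h (j - l))) (coef (fun s => f s * h s) j).
Proof.
move=> [cf f0] ch; have [_ [H hH]] := ch.
have cN N : cbm D (fun s => psums N w s - f s) by apply: cbmB => //; exact: cbm_psums.
have L1 := L1_L2 cN f0.
have H0 N : n1 (bsum N (fun l => (w l)%:C%C * coef h (j - l)) - coef (fun s => f s * h s) j) <=
   tv^-1 * (2 * (`|H| * \int[mu]_(s in D) n1 (psums N w s - f s))).
  have -> : bsum N (fun l => (w l)%:C%C * coef h (j - l)) - coef (fun s => f s * h s) j =
     coef (fun s => (psums N w s - f s) * h s) j.
    have -> : bsum N (fun l => (w l)%:C%C * coef h (j - l)) = coef (fun s => psums N w s * h s) j.
      under [RHS]eq_coef => s _ do rewrite /psums /bsum mulr_suml.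
      rewrite coef_sum; last by move=> l; apply: cbmM => //; apply: cbmZ; exact: cbm_char.
      apply: eq_bigr => l _; rewrite -coef_shift -coefZ; last by apply: cbmM => //; exact: cbm_char.
      by apply: eq_coef => s _; rewrite mulrA.
    have e2 : coef (fun s => - 1 * (f s * h s)) j = - coef (fun s => f s * h s) j.
      by rewrite coefZ ?mulN1r//; exact: cbmM.
    rewrite -e2 -coefD; last 2 first.
    - by apply: cbmM => //; exact: cbm_psums.
    - by apply: cbmZ; exact: cbmM.
    by apply: eq_coef => s _; rewrite mulN1r mulrBl.
  apply: (le_trans (n1_coef _ (cbmM (cN N) ch))).
  rewrite ler_wpM2l ?invr_ge0 ?(ltW tv0)// ler_wpM2l//.
  rewrite -(RintegralZl _ mD (cbm_in1 mD fD (cN N))).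
  apply: (le_Rintegral mD (cbm_in1 mD fD (cbmM (cN N) ch))).
    exact: (integrableZr _ mD (cbm_in1 mD fD (cN N))).
  move=> s Ds; apply: (le_trans (n1M _ _)); rewrite mulrC ler_wpM2r ?n1_ge0//.
  exact: le_trans (hH s Ds) (ler_norm _).
apply: (@squeeze_cvgr _ _ _ _ (fun=> 0) (fun N => tv^-1 * (2 * (`|H| * \int[mu]_(s in D) n1 (psums N w s - f s))))).
- by apply: nearW => N; rewrite n1_ge0 H0.
- exact: cvg_cst.
- rewrite -[X in _ --> X](mulr0 (tv^-1)) -[X in _ * X](mulr0 2) -[X in _ * (_ * X)](mulr0 `|H|).
  by do 3 (apply: cvgM; first exact: cvg_cst).
Qed.

Lemma coef_sym (w : Zl nu -> R) f k : sym w f -> coef f k = (w k)%:C%C.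
Proof.
move=> sf; have := coef_mul k sf (cbm_char 0).
have -> : coef (fun s => f s * fchar 0 s) k = coef f k.
  by apply: eq_coef => s _; rewrite fchar0 mulr1.
move=> h; apply/eqP; rewrite -subr_eq0 -oppr_eq0 opprB; apply/eqP/n1_eq0.
apply: (cvg_unique _ _ h) => //.
have [N hN] := boxseq_exhaust [:: k].
apply/cvgrPdist_le => e e0; exists N => // n /= Nn.
have -> : bsum n (fun l => (w l)%:C%C * coef (fun s => fchar 0 s) (k - l)) = (w k)%:C%C.
  rewrite /bsum (bigD1_seq k)/= ?boxseq_uniq//; last by apply: boxseq_mono Nn _ _; apply: hN; rewrite inE.
  rewrite big1 ?addr0 => [|l lk]; rewrite coef_char; first by rewrite subrr eqxx mulr1.
  by rewrite subr_eq0 eq_sym (negbTE lk) mulr0.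
by rewrite subrr normr0 ltW.
Qed.

(* the symbols and transforms of real lattice data *)
Definition rc h := cbm D h /\ forall k, complex.Im (coef h k) = 0.

Lemma rc_coef h k : rc h -> coef h k = (complex.Re (coef h k))%:C%C.
Proof. by move=> [_ hk]; apply: cext => //; exact: hk. Qed.
Lemma rcD h f : rc h -> rc f -> rc (fun s => h s + f s).
Proof. by move=> [ch hh] [cf hf]; split; [exact: cbmD|move=> k; rewrite coefD// cImD hh hf addr0]. Qed.
Lemma rc0 : rc (fun=> 0).
Proof. by split; [exact: cbm_cst|move=> k; rewrite coef0]. Qed.
Lemma rc_sum I (r : seq I) (F : I -> V -> C) : (forall i, rc (F i)) -> rc (fun s => \sum_(i <- r) F i s).
Proof.
move=> rF; split; first by apply: cbm_sum => i; have [] := rF i.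
move=> k; rewrite coef_sum; last by move=> i; have [] := rF i.
by rewrite cIm_sum big1// => i _; have [_] := rF i; apply.
Qed.
Lemma rcZ (x : R) h : rc h -> rc (fun s => x%:C%C * h s).
Proof.
move=> [ch hh]; split; first exact: cbmZ.
move=> k; rewrite coefZ// cImM hh.
have -> : complex.Im (x%:C%C : C) = 0 by [].
by rewrite mulr0 mul0r addr0.
Qed.
(** By [coef_mul] the coefficients of the product are limits of finite combinations of real numbers
    with real weights. *)
Lemma rcM w f h : sym w f -> rc h -> rc (fun s => f s * h s).
Proof.
move=> sf [ch hh]; split; first by apply: cbmM => //; case: sf.
move=> k; have hc := coef_mul k sf ch.
suff : `|complex.Im (coef (fun s => f s * h s) k)| = 0 by move/normr0P/eqP.
apply/eqP; rewrite eq_le normr_ge0 andbT.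
rewrite -(cvg_lim _ hc)//; apply: limr_ge; first by apply/cvg_ex; eexists; exact: hc.
apply: nearW => N; apply: le_trans (le_Im_n1 _).
rewrite cImD cImN (_ : complex.Im (bsum N _) = 0) ?add0r ?normrN//.
rewrite /bsum cIm_sum big1// => l _; rewrite cImM hh.
have -> : complex.Im ((w l)%:C%C : C) = 0 by [].
by rewrite mulr0 mul0r addr0.
Qed.

End Fourier.

Section SumSquares.
Variable R : realType.
Local Notation C := R[i].

Lemma sqr_sum_le (I : finType) (a : I -> R) : (\sum_i a i) ^+ 2 <= #|I|%:R * \sum_i a i ^+ 2.
Proof.
have h : 0 <= \sum_i \sum_j (a i - a j) ^+ 2 by apply: sumr_ge0 => i _; apply: sumr_ge0 => j _; exact: sqr_ge0.
have E : \sum_i \sum_j (a i - a j) ^+ 2 = 2 * (#|I|%:R * \sum_i a i ^+ 2) - 2 * (\sum_i a i) ^+ 2.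
  transitivity (\sum_i ((#|I|%:R * a i ^+ 2 - 2 * (a i * \sum_j a j)) + \sum_j a j ^+ 2)).
    apply: eq_bigr => i _.
    transitivity (\sum_j ((a i ^+ 2 - 2 * (a i * a j)) + a j ^+ 2)); first by apply: eq_bigr => j _; ring.
    by rewrite big_split/= sumrB sumr_const mulr_natl -!mulr_sumr.
  rewrite big_split/= sumrB -!mulr_sumr -mulr_suml sumr_const -[_ *+ #|_|]mulr_natl expr2; ring.
by rewrite E in h; lra.
Qed.

Lemma cabs2_sum_le (I : finType) (z : I -> C) : cabs2 (\sum_i z i) <= #|I|%:R * \sum_i cabs2 (z i).
Proof.
rewrite /cabs2 cRe_sum cIm_sum big_split/= mulrDr.
by apply: lerD; exact: sqr_sum_le.
Qed.

Lemma cRe_realM (x : R) (z : C) : complex.Re (x%:C%C * z) = x * complex.Re z.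
Proof. by rewrite cReM /= mul0r subr0. Qed.
Lemma cIm_realM (x : R) (z : C) : complex.Im (x%:C%C * z) = x * complex.Im z.
Proof. by rewrite cImM /= mul0r addr0. Qed.

Lemma sqnormR_ge0 p q (M : 'M[R]_(p, q)) : 0 <= sqnormR M.
Proof. by apply: sumr_ge0 => i _; apply: sumr_ge0 => j _; exact: sqr_ge0. Qed.
Lemma sqnormR_col q (v : 'cV[R]_q) : sqnormR v = \sum_b v b 0 ^+ 2.
Proof. by apply: eq_bigr => i _; rewrite big_ord1. Qed.
Lemma sqnormRD q (v w : 'cV[R]_q) : sqnormR (v + w) <= 2 * sqnormR v + 2 * sqnormR w.
Proof.
rewrite !sqnormR_col !mulr_sumr -big_split/=; apply: ler_sum => i _; rewrite mxE.
have := sqr_ge0 (v i 0 - w i 0); nra.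
Qed.
Lemma sqnormRN q (v : 'cV[R]_q) : sqnormR (- v) = sqnormR v.
Proof. by rewrite !sqnormR_col; apply: eq_bigr => i _; rewrite mxE sqrrN. Qed.
Lemma sqnormR0 q : sqnormR (0 : 'cV[R]_q) = 0.
Proof. by rewrite sqnormR_col big1// => i _; rewrite mxE expr0n. Qed.
Lemma young_mul (d a b : R) : 0 < d -> `|a * b| <= d * a ^+ 2 + d^-1 * b ^+ 2.
Proof.
move=> d0; rewrite -(ler_pM2l d0) [leRHS]mulrDr [X in _ <= _ + X]mulrA mulfV ?gt_eqF// mul1r normrM.
rewrite -[a ^+ 2]real_normK ?num_real// -[b ^+ 2]real_normK ?num_real//.
have := sqr_ge0 (d * `|a| - `|b|); have := normr_ge0 a; have := normr_ge0 b; nra.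
Qed.
Lemma young_dot q d (v w : 'cV[R]_q) : 0 < d ->
  `|(v^T *m w) 0 0| <= d * sqnormR v + d^-1 * sqnormR w.
Proof.
move=> d0; rewrite mxE (le_trans (ler_norm_sum _ _ _))// !sqnormR_col !mulr_sumr -big_split/=.
by apply: ler_sum => i _; rewrite mxE young_mul.
Qed.

End SumSquares.

Lemma cvg_bigsum (R : realType) I (r : seq I) (P : pred I) (u : I -> nat -> R) (l : I -> R) :
  (forall i, P i -> u i N @[N --> \oo] --> l i) ->
  \sum_(i <- r | P i) u i N @[N --> \oo] --> \sum_(i <- r | P i) l i.
Proof.
move=> h; elim: r => [|i r ih].
  by rewrite big_nil; under eq_fun do rewrite big_nil; exact: cvg_cst.
rewrite big_cons; under eq_fun do rewrite big_cons; case: ifP => // Pi.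
by apply: cvgD => //; exact: h.
Qed.

(** * Block Toeplitz operators on square-summable families *)

Section ToepL2.
Variables (R : realType) (nu : nat).
Local Notation C := R[i].
Local Notation V := 'rV[R]_nu.
Local Notation BT := (g_sigma_algebraType (@boxes R nu)).
Variables (mu : {measure set BT -> \bar R}) (D : set BT) (tv : R).
Hypotheses (mD : measurable D) (fD : (mu D < +oo)%E) (tv0 : 0 < tv).
Hypothesis orth : forall l : Zl nu, Cint mu D (fun s => fchar l s) = if l == 0 then tv%:C%C else 0.
Local Notation coef := (fcoef mu D tv).
Local Notation sym := (sym mu D).

Definition l2b q (v : Zl nu -> 'cV[R]_q) (K : R) := forall N, bsum N (fun k => sqnormR (v k)) <= K.

Lemma bessel_box h N : cbm D h ->
  bsum N (fun k => cabs2 (coef h k)) <= tv^-1 * \int[mu]_(s in D) cabs2 (h s).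
Proof. by move=> ch; rewrite bsum_sq; apply: bessel => //; exact: sq_ind_inj. Qed.

Lemma bessel_shift h N j : cbm D h ->
  bsum N (fun k => cabs2 (coef h (j - k))) <= tv^-1 * \int[mu]_(s in D) cabs2 (h s).
Proof.
move=> ch; rewrite bsum_sq; apply: (bessel mD fD tv0 orth (ka := fun k => j - sq_ind k)) => //.
by move=> k l /addrI /oppr_inj; exact: sq_ind_inj.
Qed.

Lemma sym_sq w f : sym w f -> exists K, forall N, bsum N (fun l => w l ^+ 2) <= K.
Proof.
move=> sf; have [cf _] := sf; eexists => N; apply: le_trans (bessel_box N cf).
apply: le_bsum => l; rewrite (coef_sym mD fD tv0 orth l sf) /cabs2 /= expr0n addr0//.
Qed.

Lemma sqr_Re_coef h k : complex.Re (coef h k) ^+ 2 <= cabs2 (coef h k).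
Proof. by rewrite /cabs2 lerDl sqr_ge0. Qed.

Lemma zsum_supp N (f : Zl nu -> R) : (forall l, l \notin boxseq nu N -> f l = 0) ->
  sumb f /\ zsum f = bsum N f.
Proof.
move=> f0.
have E n (g : Zl nu -> R) : (forall l, l \notin boxseq nu N -> g l = 0) -> (N <= n)%N -> bsum n g = bsum N g.
  move=> g0 Nn; rewrite /bsum (bigID (mem (boxseq nu N)))/= [X in _ + X]big1 ?addr0 => [|l /g0//].
  rewrite -big_filter; apply: perm_big; apply: uniq_perm; rewrite ?filter_uniq ?boxseq_uniq// => l.
  by rewrite mem_filter; apply/andP/idP => [[]//|h]; split => //; exact: boxseq_mono h.
have sf : sumb f.
  exists (bsum N (fun l => `|f l|)) => n.
  rewrite -(E (maxn n N) (fun l => `|f l|)) ?leq_maxr//; last by move=> l /f0 ->; rewrite normr0.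
  by apply: le_bsum_box => //; rewrite leq_maxl.
split => //; apply: (zsum_lim sf); apply/cvgrPdist_le => e e0; exists N => // n /= Nn.
by rewrite (E n)// subrr normr0 ltW.
Qed.

Variables p q : nat.
Implicit Types (M : Zl nu -> 'M[R]_(p, q)) (Ms : V -> 'M[C]_(p, q)).

Definition symM M Ms := forall i b, sym (fun l => M l i b) (fun s => Ms s i b).
Definition cbv r (h : V -> 'cV[C]_r) := forall b, cbm D (fun s : BT => h s b 0).
(** Inverse transform to real lattice data. On functions with real coefficients the real part loses
    nothing. *)
Definition cv r (h : V -> 'cV[C]_r) j : 'cV[R]_r := \col_b complex.Re (coef (fun s => h s b 0) j).

Lemma sumb_prod (f g : Zl nu -> R) : (exists K, forall N, bsum N (fun l => f l ^+ 2) <= K) ->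
  (exists K, forall N, bsum N (fun l => g l ^+ 2) <= K) -> sumb (fun l => f l * g l).
Proof.
move=> [K hK] [L hL]; apply: (@sumb_le _ _ _ (fun l => f l ^+ 2 + g l ^+ 2)) => [l|].
  by have := young_mul (f l) (g l) ltr01; rewrite invr1 !mul1r.
by exists (K + L) => N; rewrite bsumD lerD.
Qed.

(** [coef_mul] entry by entry; the lattice matrices are real, so convolution commutes with taking
    real parts and [h] may be any bounded function. *)
Lemma toep_cv M Ms (h : V -> 'cV[C]_q) j : symM M Ms -> cbv h ->
  toep M (cv h) j = cv (fun s => Ms s *m h s) j.
Proof.
move=> sM ch; apply/colP => i; rewrite !mxE.
pose F l := \sum_b M l i b * complex.Re (coef (fun s => h s b 0) (j - l)).
rewrite [LHS](_ : _ = zsum (fun k => F (j - k))); last first.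
  congr zsum; apply: funext => k; rewrite mxE; apply: eq_bigr => b _; rewrite mxE.
  by rewrite subKr.
rewrite zsum_reindex; apply: zsum_lim.
  apply: sumb_sum => b; apply: sumb_prod; first exact: sym_sq (sM i b).
  eexists => N; apply: le_trans (bessel_shift N j (ch b)).
  by apply: le_bsum => l; exact: sqr_Re_coef.
have cm b := coef_mul mD fD tv0 j (sM i b) (ch b).
have -> : (fun s => (Ms s *m h s) i 0) = (fun s => \sum_b Ms s i b * h s b 0).
  by apply: funext => s; rewrite mxE.
rewrite coef_sum//; last by move=> b; apply: cbmM => //; case: (sM i b).
rewrite cRe_sum; under eq_fun do rewrite /F bsum_sum.
apply: cvg_bigsum => b _; apply/cvgrPdist_le => e e0.
have [N0 _ hN0] := cvgr_lt _ (cm b) _ e0; exists N0 => // N /= /hN0 hN.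
rewrite distrC (le_trans _ (ltW hN))//; apply: le_trans (le_Re_n1 _).
rewrite cReD cReN /bsum cRe_sum le_eqVlt; apply/orP; left; apply/eqP.
congr (`|_ - _|); apply: eq_bigr => l _.
by rewrite cRe_realM.
Qed.

Lemma cabs2_mulmx_le (K : R) (Mm : 'M[C]_(p, q)) (h : 'cV[C]_q) i : (forall b, n1 (Mm i b) <= K) ->
  cabs2 ((Mm *m h) i 0) <= q%:R * K ^+ 2 * \sum_b cabs2 (h b 0).
Proof.
move=> MK; rewrite mxE (le_trans (cabs2_sum_le _))// card_ord -mulrA ler_wpM2l// mulr_sumr.
apply: ler_sum => b _; rewrite cabs2M ler_wpM2r ?cabs2_ge0//.
by apply: (le_trans (cabs2_le_n1 _)); rewrite ler_sqr ?nnegrE ?n1_ge0// (le_trans (n1_ge0 _) (MK b)).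
Qed.

Definition trigv_of N r (v : Zl nu -> 'cV[R]_r) (s : V) : 'cV[C]_r :=
  \sum_(k <- boxseq nu N) (fchar k s : C) *: map_mx (real_complex R) (v k).

Lemma trigv_ofE N r (v : Zl nu -> 'cV[R]_r) s b :
  trigv_of N v s b 0 = \sum_(k <- boxseq nu N) (v k b 0)%:C%C * fchar k s.
Proof. by rewrite summxE; apply: eq_bigr => k _; rewrite !mxE mulrC. Qed.

Lemma cbv_trig N r (v : Zl nu -> 'cV[R]_r) : cbv (trigv_of N v).
Proof.
move=> b; under eq_fun do rewrite trigv_ofE.
by apply: cbm_sum => k; apply: cbmZ; exact: cbm_char.
Qed.

Lemma cv_trig N r (v : Zl nu -> 'cV[R]_r) k : cv (trigv_of N v) k = if k \in boxseq nu N then v k else 0.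
Proof.
apply/colP => b; rewrite mxE; under eq_fun do rewrite trigv_ofE.
rewrite coef_sum//; last by move=> l; apply: cbmZ; exact: cbm_char.
under eq_bigr => l _ do rewrite (coefZ tv mD fD _ _ (cbm_char D l)) (coef_char tv0 orth).
case: ifPn => kN.
  rewrite (bigD1_seq k)/= ?boxseq_uniq// eqxx mulr1 big1 ?addr0// => l lk.
  by rewrite eq_sym (negbTE lk) mulr0.
rewrite big_seq big1 ?mxE// => l lN; case: eqP => [kl|_]; last by rewrite mulr0.
by rewrite kl lN in kN.
Qed.

Lemma parseval_trig N r (v : Zl nu -> 'cV[R]_r) :
  \sum_b tv^-1 * \int[mu]_(s in D) cabs2 (trigv_of N v s b 0) = bsum N (fun k => sqnormR (v k)).
Proof.
under [RHS]eq_bigr do rewrite sqnormR_col.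
rewrite [RHS]exchange_big/=; apply: eq_bigr => b _.
have E : (\int[mu]_(s in D) cabs2 (trigv_of N v s b 0))%:C%C =
   Cint mu D (fun s => \sum_(k <- boxseq nu N) (v k b 0)%:C%C * (trigv_of N v s b 0 * conjc (fchar k s))).
  transitivity (Cint mu D (fun s => conjc (trigv_of N v s b 0) * trigv_of N v s b 0)).
    apply: cext => /=; last first.
      by rewrite /Rintegral (eq_integral (fun=> 0%E)) ?integral0// => s _; rewrite mulJ_cabs2.
    by apply: eq_Rintegral => s _; rewrite mulJ_cabs2.
  apply: eq_Cint => s _; rewrite {1}trigv_ofE rmorph_sum mulr_suml; apply: eq_bigr => k _.
  by rewrite rmorphM /= oppr0 mulrA mulrAC.
have ch k := cbm_hc k (cbv_trig N v b).
have {}E : \int[mu]_(s in D) cabs2 (trigv_of N v s b 0) =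
    \sum_(k <- boxseq nu N) v k b 0 * complex.Re (Cint mu D (fun s => trigv_of N v s b 0 * conjc (fchar k s))).
  rewrite (Cint_sum mD fD) in E; last by move=> k; exact: cbmZ.
  have := congr1 (@complex.Re R) E; rewrite cRe_sum => e2.
  rewrite -[LHS]/(complex.Re (_%:C%C)) e2; apply: eq_bigr => k _.
  by rewrite (CintZ mD fD _ (ch k)) cRe_realM.
rewrite E mulr_sumr big_seq [RHS]big_seq; apply: eq_bigr => k kN.
have := congr1 (fun z : 'cV[R]_r => z b 0) (cv_trig N v k); rewrite mxE kN /fcoef cRe_realM => hk.
by rewrite mulrCA hk expr2.
Qed.

Lemma zsum_norm_le (f : Zl nu -> R) (K : R) : (forall N, bsum N (fun l => `|f l|) <= K) -> `|zsum f| <= K.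
Proof.
move=> fK; have sf : sumb f by exists K.
have h : `|bsum N f| @[N --> \oo] --> `|zsum f| by apply: cvg_norm; exact: zsum_cvg.
rewrite -(cvg_lim _ h)//; apply: limr_le; first by apply/cvg_ex; eexists; exact: h.
by apply: nearW => N; apply: le_trans (fK N); exact: ler_norm_sum.
Qed.

Lemma l2b_ent r (v : Zl nu -> 'cV[R]_r) K b : l2b v K -> forall N, bsum N (fun l => v l b 0 ^+ 2) <= K.
Proof.
move=> vK N; apply: le_trans (vK N); apply: le_bsum => l; rewrite sqnormR_col (bigD1 b)//= lerDl.
by apply: sumr_ge0 => c _; exact: sqr_ge0.
Qed.

Lemma sym_shift w f j : sym w f -> exists K, forall N, bsum N (fun k => w (j - k) ^+ 2) <= K.
Proof.
move=> sf; have [cf _] := sf; eexists => N; apply: le_trans (bessel_shift N j cf).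
by apply: le_bsum => l; rewrite (coef_sym mD fD tv0 orth _ sf) /cabs2 /= expr0n addr0.
Qed.

Lemma toep_sumb M Ms (v : Zl nu -> 'cV[R]_q) K j i : symM M Ms -> l2b v K ->
  sumb (fun k => (M (j - k) *m v k) i 0).
Proof.
move=> sM vK; under eq_fun do rewrite mxE; apply: sumb_sum => b; apply: sumb_prod.
  exact: sym_shift (sM i b).
by exists K => N; exact: l2b_ent.
Qed.

Lemma toepB M Ms (v w : Zl nu -> 'cV[R]_q) K L j : symM M Ms -> l2b v K -> l2b w L ->
  toep M (fun k => v k - w k) j = toep M v j - toep M w j.
Proof.
move=> sM vK wL; apply/colP => i; rewrite !mxE.
have sv := toep_sumb j i sM vK; have sw := toep_sumb j i sM wL.
rewrite -mulN1r -(zsumZ _ sw) -zsumD//; last exact: sumbZ.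
by congr zsum; apply: funext => k; rewrite mulN1r mulmxBr !mxE.
Qed.

Definition tr N r (v : Zl nu -> 'cV[R]_r) k : 'cV[R]_r := if k \in boxseq nu N then v k else 0.

Lemma toep_tr M (v : Zl nu -> 'cV[R]_q) N j i :
  toep M (tr N v) j i 0 = bsum N (fun k => (M (j - k) *m v k) i 0).
Proof.
rewrite mxE (zsum_supp (N := N) _).2; last by move=> k kN; rewrite /tr (negbTE kN) mulmx0 mxE.
by rewrite /bsum big_seq [RHS]big_seq; apply: eq_bigr => k kN; rewrite /tr kN.
Qed.

(** For truncated [v] the bound is Bessel on the output side and Parseval on the input side. Over a
    fixed finite cube of output sites the truncation is then removed by entrywise convergence. *)
Lemma toep_l2 M Ms (B : R) (v : Zl nu -> 'cV[R]_q) K : symM M Ms -> 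
  (forall s, D s -> forall i b, n1 (Ms s i b) <= B) -> l2b v K ->
  l2b (toep M v) (p%:R * (q%:R * B ^+ 2) * K).
Proof.
move=> sM MB vK.
have cM i b : cbm D (fun s => Ms s i b) by case: (sM i b).
have step N : l2b (toep M (tr N v)) (p%:R * (q%:R * B ^+ 2) * K).
  move=> L; have e1 : tr N v = cv (trigv_of N v) by apply: funext => k; rewrite cv_trig.
  have -> : (fun k => sqnormR (toep M (tr N v) k)) =
      (fun k => \sum_i cv (fun s => Ms s *m trigv_of N v s) k i 0 ^+ 2).
    by apply: funext => k; rewrite e1 (toep_cv _ sM (cbv_trig N v)) sqnormR_col.
  rewrite [leLHS](_ : _ = \sum_i bsum L (fun k => cv (fun s => Ms s *m trigv_of N v s) k i 0 ^+ 2)); last exact: exchange_big.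
  rewrite -!mulrA mulr_natl -[X in _ *+ X]card_ord -sumr_const; apply: ler_sum => i _.
  have ci : cbm D (fun s => (Ms s *m trigv_of N v s) i 0).
    under eq_fun do rewrite mxE; apply: cbm_sum => b; apply: cbmM => //; exact: cbv_trig.
  apply: (@le_trans _ _ (tv^-1 * \int[mu]_(s in D) cabs2 ((Ms s *m trigv_of N v s) i 0))).
    apply: le_trans (bessel_box L ci); apply: le_bsum => k; rewrite mxE; exact: sqr_Re_coef.
  apply: (@le_trans _ _ (tv^-1 * (q%:R * B ^+ 2 * \sum_b \int[mu]_(s in D) cabs2 (trigv_of N v s b 0)))).
    apply: ler_wpM2l; first by rewrite invr_ge0 ltW.
    have ib b := cint_cabs2 mD fD (cbv_trig N v b).
    rewrite -(Rint_sum _ mD ib) -(RintegralZl _ mD (integrable_sumr _ mD ib)).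
    apply: (le_Rintegral mD (cint_cabs2 mD fD ci)).
      exact: (integrableZr _ mD (integrable_sumr _ mD ib)).
    by move=> s Ds; apply: cabs2_mulmx_le => b; exact: MB.
  rewrite [leRHS](_ : _ = q%:R * B ^+ 2 * K); last by ring.
  rewrite mulrCA mulr_sumr parseval_trig; apply: ler_wpM2l; first by rewrite mulr_ge0 ?sqr_ge0.
  exact: vK.
move=> L.
have cvj j i : toep M (tr N v) j i 0 @[N --> \oo] --> toep M v j i 0.
  under eq_fun do rewrite toep_tr; rewrite mxE; exact: zsum_cvg (toep_sumb j i sM vK).
have E (w : Zl nu -> 'cV[R]_p) : bsum L (fun j => sqnormR (w j)) =
    \sum_(j <- boxseq nu L) \sum_i w j i 0 ^+ 2 by apply: eq_bigr => j _; rewrite sqnormR_col.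
have : bsum L (fun j => sqnormR (toep M (tr N v) j)) @[N --> \oo] --> bsum L (fun j => sqnormR (toep M v j)).
  rewrite E; under eq_fun do rewrite E.
  apply: cvg_bigsum => j _; apply: cvg_bigsum => i _; rewrite expr2; under eq_fun do rewrite expr2.
  by apply: cvgM; exact: cvj.
move=> h; rewrite -(cvg_lim _ h)//; apply: limr_le; first by apply/cvg_ex; eexists; exact: h.
by apply: nearW => N; exact: step.
Qed.

Lemma l2b_add r (v w : Zl nu -> 'cV[R]_r) K L : l2b v K -> l2b w L -> l2b (fun k => v k + w k) (2 * K + 2 * L).
Proof.
move=> vK wL N; apply: (@le_trans _ _ (bsum N (fun k => 2 * sqnormR (v k) + 2 * sqnormR (w k)))).
  by apply: le_bsum => k; exact: sqnormRD.
by rewrite bsumD !bsumZ lerD// ler_wpM2l.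
Qed.
Lemma l2b_sub r (v w : Zl nu -> 'cV[R]_r) K L : l2b v K -> l2b w L -> l2b (fun k => v k - w k) (2 * K + 2 * L).
Proof. by move=> vK wL; apply: l2b_add => // N; rewrite /bsum; under eq_bigr do rewrite sqnormRN; exact: wL. Qed.

Lemma dot_sumb r (v w : Zl nu -> 'cV[R]_r) K L d : 0 < d -> l2b v K -> l2b w L ->
  sumb (fun j => ((v j)^T *m w j) 0 0) /\ `|zsum (fun j => ((v j)^T *m w j) 0 0)| <= d * K + d^-1 * L.
Proof.
move=> d0 vK wL.
have h N : bsum N (fun j => `|((v j)^T *m w j) 0 0|) <= d * K + d^-1 * L.
  apply: (@le_trans _ _ (bsum N (fun k => d * sqnormR (v k) + d^-1 * sqnormR (w k)))).
    by apply: le_bsum => k; exact: young_dot.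
  by rewrite bsumD !bsumZ lerD// ler_wpM2l// ?invr_ge0 ltW.
by split; [eexists; exact: h|exact: zsum_norm_le].
Qed.

End ToepL2.

(** * Response of the network to finitely supported inputs *)

Section Exchange.
Context d (S : measurableType d) (R : realType) (mu : {measure set S -> \bar R}) (D : set S).
Hypotheses (mD : measurable D) (fD : (mu D < +oo)%E).
Local Notation C := R[i].
Variables (I : Type) (L : seq I) (al : nat -> I -> S -> C) (be : nat -> I -> R -> C) (m : R^nat) (T : R).
Hypotheses (T0 : 0 <= T) (cm : cvgn (series m)).
Hypotheses (ca : forall k l, cbm D (al k l)) (tb : forall k l, tbf (be k l)).
Let tm k t s := \sum_(l <- L) al k l s * be k l t.
Hypothesis bnd : forall k t s, 0 <= t <= T -> D s -> n1 (tm k t s) <= m k.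

Lemma cvg_mulr (w : R) : cvgn (series (fun k => m k * w)).
Proof. by rewrite (_ : (fun k => _) = w *: m); [exact: is_cvg_seriesZ|apply: funext => k; rewrite mulrC]. Qed.

Lemma exch_s t : 0 <= t <= T ->
  cbm D (fun s => csum (fun k => tm k t s)) /\
  Cint mu D (fun s => csum (fun k => tm k t s)) = csum (fun k => Cint mu D (tm k t)).
Proof.
move=> tT; apply: (Cint_csum mD fD cm) => [k|k s Ds]; last exact: bnd.
by have [] : cbm D (tm k t) by apply: cbm_sum => l; apply: cbmM => //; exact: cbm_cst.
Qed.

Lemma exch_t s : D s ->
  cbm ([set` `[0, T]] : set R) (fun t => csum (fun k => tm k t s)) /\
  CI (fun t => csum (fun k => tm k t s)) T = csum (fun k => CI (fun t => tm k t s) T).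
Proof.
move=> Ds; apply: (CI_csum (h := fun k t => tm k t s) cm) => [k|k t tT]; last exact: bnd.
by apply: tbf_sum => l; apply: tbfZ.
Qed.

(** Every term is a finite sum of products of a function of [s] and a function of [t], for which the
    exchange is linearity; the common majorant [m] lets both integrals pass through the series. *)
Lemma exchange : [/\ cbm D (fun s => CI (fun t => csum (fun k => tm k t s)) T),
  cbm ([set` `[0, T]] : set R) (fun t => Cint mu D (fun s => csum (fun k => tm k t s))) &
  CI (fun t => Cint mu D (fun s => csum (fun k => tm k t s))) T =
  Cint mu D (fun s => CI (fun t => csum (fun k => tm k t s)) T)].
Proof.
have E1 k t : Cint mu D (tm k t) = \sum_(l <- L) Cint mu D (al k l) * be k l t.
  rewrite (Cint_sum mD fD); last by move=> l; apply: cbmM => //; exact: cbm_cst.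
  apply: eq_bigr => l _; rewrite -[RHS]mulrC -(CintZ mD fD _ (ca k l)).
  by apply: eq_Cint => s _; rewrite mulrC.
have E2 k s : CI (fun t => tm k t s) T = \sum_(l <- L) CI (be k l) T * al k l s.
  rewrite CI_sum; last by move=> l; apply: tbfZ.
  by apply: eq_bigr => l _; rewrite CI_Z// mulrC.
have ct k : cbm D (fun s => CI (fun t => tm k t s) T).
  apply: (eq_cbm (f := fun s => \sum_(l <- L) CI (be k l) T * al k l s)) => [s _|]; first by rewrite E2.
  by apply: cbm_sum => l; exact: cbmZ.
have tt k : tbf (fun t => Cint mu D (tm k t)).
  by under eq_fun do rewrite E1; apply: tbf_sum => l; apply: tbfZ.
have bt k t : 0 <= t <= T -> n1 (Cint mu D (tm k t)) <= m k * fine (mu D).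
  move=> tT; apply: (n1_Cint_le mD fD); last by move=> s Ds; exact: bnd.
  by apply: cbm_sum => l; apply: cbmM => //; exact: cbm_cst.
have bs k s : D s -> n1 (CI (fun t => tm k t s) T) <= m k * T.
  move=> Ds; rewrite -[T in leRHS]subr0 -[T - 0](fine_lam T0).
  apply: (n1_Cint_le (mI 0 T) (lam_fin 0 T)).
    exact: (@tbf_sum _ _ L (fun l t => al k l s * be k l t) (fun l => tbfZ _ (tb k l)) T).
  by move=> t; rewrite /= in_itv => tT; exact: bnd.
have [h1 h2] := CI_csum (@cvg_mulr (fine (mu D))) tt bt.
have [h3 h4] := Cint_csum mD fD (@cvg_mulr T) (fun k => (ct k).1) bs.
split.
- by apply: eq_cbm h3 => s Ds; rewrite (exch_t Ds).2.
- by apply: eq_cbm h1 => t; rewrite /= in_itv => tT; rewrite (exch_s tT).2.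
transitivity (CI (fun t => csum (fun k => Cint mu D (tm k t))) T).
  by apply: (@eq_CI _ _ _ T T _ (lexx T)) => t tT; rewrite (exch_s tT).2.
transitivity (Cint mu D (fun s => csum (fun k => CI (fun t => tm k t s) T))); last first.
  by apply: eq_Cint => s Ds; rewrite (exch_t Ds).2.
rewrite h2 h4; congr csum; apply: funext => k.
transitivity (\sum_(l <- L) CI (be k l) T * Cint mu D (al k l)).
  under eq_fun do rewrite E1; rewrite CI_sum; last by move=> l; apply: tbfZ.
  by apply: eq_bigr => l _; rewrite CI_Z// mulrC.
rewrite (_ : (fun s => _) = fun s => \sum_(l <- L) CI (be k l) T * al k l s); last by apply: funext => s; exact: E2.
rewrite (Cint_sum mD fD); last by move=> l; exact: cbmZ.
by apply: eq_bigr => l _; rewrite (CintZ mD fD).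
Qed.

End Exchange.

Section Response.
Variables (R : realType) (nu : nat).
Local Notation C := R[i].
Local Notation V := 'rV[R]_nu.
Local Notation BT := (g_sigma_algebraType (@boxes R nu)).
Variables (mu : {measure set BT -> \bar R}) (D : set BT) (tv : R).
Hypotheses (mD : measurable D) (fD : (mu D < +oo)%E) (tv0 : 0 < tv).
Hypothesis orth : forall l : Zl nu, Cint mu D (fun s => fchar l s) = if l == 0 then tv%:C%C else 0.
Local Notation coef := (fcoef mu D tv).
Local Notation sym := (sym mu D).
Local Notation rc := (rc mu D tv).
Local Notation cv := (cv mu D tv).

Definition fin_input q N (u : R -> Zl nu -> 'cV[R]_q) :=
  (forall t k, k \notin boxseq nu N -> u t k = 0) /\
  (forall k b, tbf (fun t => (u t k b 0)%:C%C : C)).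

(* the kernels whose response series converges uniformly and maps real inputs to real outputs *)
Definition goodM p q (Mq : V -> nat -> 'M[C]_(p, q)) (c K : R) :=
  (forall s, D s -> geo (Mq s) c K) /\ (forall k i b, rc (fun s => Mq s k i b)).

Definition uh q N (u : R -> Zl nu -> 'cV[R]_q) (s : V) (t : R) : 'cV[C]_q := trigv_of N (u t) s.

Definition resp p q N (Mq : V -> nat -> 'M[C]_(p, q)) u (t : R) (s : V) : 'cV[C]_p := ms (Mq s) (uh N u s) t.

Variables (p q N : nat) (Mq : V -> nat -> 'M[C]_(p, q)) (c K : R) (u : R -> Zl nu -> 'cV[R]_q).
Hypotheses (gM : goodM Mq c K) (fu : fin_input N u).

Lemma vt_uh s : vt (uh N u s).
Proof.
move=> b; rewrite (_ : (fun t => _) = fun t => \sum_(k <- boxseq nu N) fchar k s * (u t k b 0)%:C%C).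
  by apply: tbf_sum => k; apply: tbfZ; exact: fu.2.
by apply: funext => t; rewrite /uh trigv_ofE; apply: eq_bigr => k _; rewrite mulrC.
Qed.

Lemma uh_bound T : exists2 B, 0 <= B & forall s t, 0 <= t <= T -> nrm (uh N u s t) <= B.
Proof.
have h k b : {B : R | 0 <= B & forall t, 0 <= t <= T -> n1 ((u t k b 0)%:C%C : C) <= B}.
  by apply: cid2; exact: tbf_bound (fu.2 k b).
exists (\sum_(b < q) \sum_(k <- boxseq nu N) 2 * s2val (h k b)).
  by apply: sumr_ge0 => b _; apply: sumr_ge0 => k _; rewrite mulr_ge0//; case: (h k b).
move=> s t tT; apply: ler_sum => b _; rewrite big_ord1 trigv_ofE (le_trans (n1_sum _ _ _))//.
apply: ler_sum => k _; rewrite (le_trans (n1M _ _))// mulrC ler_pM ?n1_ge0 ?n1_fchar//.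
by case: (h k b) => /= B _; exact.
Qed.

Let L := [seq (b, k) | b <- enum 'I_q, k <- boxseq nu N].
Let al i k (l : 'I_q * Zl nu) (s : BT) : C := Mq s k i l.1 * fchar l.2 s.
Let be k (l : 'I_q * Zl nu) (t : R) : C := Ip k (fun t => (u t l.2 l.1 0)%:C%C) t.

(** For each [k] the two variables separate into a finite sum over input entries and lattice sites,
    the form required by [exchange]. *)
Lemma term_sep i k t s : (Mq s k *m VIp k (uh N u s) t) i 0 = \sum_(l <- L) al i k l s * be k l t.
Proof.
rewrite mxE big_allpairs big_enum; apply: eq_bigr => b _ /=; rewrite mxE.
rewrite (_ : (fun t => _) = fun t => \sum_(k <- boxseq nu N) fchar k s * (u t k b 0)%:C%C); last first.
  by apply: funext => t'; rewrite /uh trigv_ofE; apply: eq_bigr => l _; rewrite mulrC.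
rewrite Ip_sum; last by move=> l; apply: tbfZ; exact: fu.2.
rewrite mulr_sumr; apply: eq_bigr => l _; rewrite Ip_Z ?mulrA//; exact: fu.2.
Qed.

Lemma rc_cbm h : rc h -> cbm D h. Proof. by case. Qed.

Lemma cbm_al i k l : cbm D (al i k l).
Proof. by apply: cbmM; [apply: rc_cbm; exact: gM.2|exact: cbm_char]. Qed.
Lemma tbf_be k l : tbf (be k l).
Proof. by apply: tbf_Ip; exact: fu.2. Qed.

Lemma resp_bound T : 0 <= T -> exists B, forall s t, D s -> 0 <= t <= T -> nrm (resp N Mq u t s) <= B.
Proof.
move=> T0; have [B B0 hB] := uh_bound T.
exists (p%:R * (c * (q%:R * B) * expR (K * T))) => s t Ds tT.
by apply: (ms_bound (gM.1 s Ds) (vt_uh s) _ tT) => t' t'T; exact: hB.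
Qed.

Lemma respE i t s : resp N Mq u t s i 0 = csum (fun k => \sum_(l <- L) al i k l s * be k l t).
Proof. by rewrite mxE; congr csum; apply: funext => k; rewrite term_sep. Qed.

Lemma resp_csum i t : 0 <= t -> cbm D (fun s => resp N Mq u t s i 0) /\
  forall g, cbm D g -> Cint mu D (fun s => resp N Mq u t s i 0 * g s) =
    csum (fun k => Cint mu D (fun s => (\sum_(l <- L) al i k l s * be k l t) * g s)).
Proof.
move=> t0; have [B B0 hB] := uh_bound t; have tt : 0 <= t <= t by rewrite t0 lexx.
have hm k s : D s -> n1 (\sum_(l <- L) al i k l s * be k l t) <= c * K ^+ k * (q%:R * B * (t ^+ k / k`!%:R)).
  move=> Ds; rewrite -term_sep.
  exact: (le_trans (nrm_entry _ _ _) (ms_term (gM.1 s Ds) (vt_uh s) (hB s) k tt)).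
have cs k : cbm D (fun s => \sum_(l <- L) al i k l s * be k l t).
  by apply: cbm_sum => l; apply: cbmM; [exact: cbm_al|exact: cbm_cst].
have cm := (exp_series c K (q%:R * B) t).1.
split; first by under eq_fun do rewrite respE; exact: (Cint_csum mD fD cm (fun k => (cs k).1) hm).1.
move=> g cg; have [_ [G hG]] := cg.
have hm' k s : D s -> n1 ((\sum_(l <- L) al i k l s * be k l t) * g s) <=
   c * K ^+ k * (q%:R * B * (t ^+ k / k`!%:R)) * `|G|.
  move=> Ds; rewrite (le_trans (n1M _ _))// ler_pM ?n1_ge0 ?hm//.
  exact: le_trans (hG s Ds) (ler_norm _).
rewrite -(Cint_csum mD fD (@cvg_mulr R _ cm `|G|) (fun k => (cbmM (cs k) cg).1) hm').2.
apply: eq_Cint => s Ds; rewrite respE mulrC -csumZ.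
  by congr csum; apply: funext => k; rewrite mulrC.
by exists (fun k => c * K ^+ k * (q%:R * B * (t ^+ k / k`!%:R))) => // k; exact: hm.
Qed.

Lemma CI_real (f : R -> C) t : (forall x, complex.Im (f x) = 0) -> complex.Im (CI f t) = 0.
Proof. by move=> f0; rewrite /CI /= /Rintegral (eq_integral (fun=> 0%E)) ?integral0// => x _; rewrite f0. Qed.

Lemma Ip_real k (f : R -> C) t : (forall x, complex.Im (f x) = 0) -> complex.Im (Ip k f t) = 0.
Proof. by move=> f0; elim: k t => [|k ih] t; [exact: f0|rewrite Ip_S; exact: CI_real]. Qed.

Lemma rc_shift l h : rc h -> rc (fun s => h s * fchar l s).
Proof.
move=> [ch hh]; split; first by apply: cbmM => //; exact: cbm_char.
move=> k; rewrite -(hh (k - l)) -coef_shift; congr complex.Im.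
by apply: eq_coef => s _; rewrite mulrC.
Qed.

Lemma csum_real (h : nat -> C) : (forall k, complex.Im (h k) = 0) -> complex.Im (csum h) = 0.
Proof.
move=> h0; rewrite /= (_ : (fun k => _) = fun=> 0); last by apply: funext => k; rewrite h0.
by rewrite (_ : series _ = fun=> 0) ?lim_cst//; apply: funext => n; rewrite /series /= big1.
Qed.

(** The coefficients are sums over [k] of real combinations of coefficients of shifted kernel
    entries, which are real by [goodM]; the iterated integrals of a real input are real. *)
Lemma rc_resp i t : 0 <= t -> rc (fun s => resp N Mq u t s i 0).
Proof.
move=> t0; have [h1 h2] := resp_csum i t0; split => // j.
rewrite /fcoef cIm_realM h2; last by apply: cbmJ; exact: cbm_char.
rewrite csum_real ?mulr0// => k.
have rk : rc (fun s => \sum_(l <- L) (complex.Re (be k l t))%:C%C * al i k l s).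
  by apply: (rc_sum mD fD) => l; apply: (rcZ mD fD); apply: rc_shift; exact: gM.2.
have e1 : Cint mu D (fun s => (\sum_(l <- L) al i k l s * be k l t) * conjc (fchar j s)) =
    tv%:C%C * coef (fun s => \sum_(l <- L) (complex.Re (be k l t))%:C%C * al i k l s) j.
  rewrite /fcoef mulrA -rmorphM mulfV ?gt_eqF// mul1r; apply: eq_Cint => s _.
  congr (_ * _); apply: eq_bigr => l _; rewrite mulrC; congr (_ * _).
  by apply: cext => //=; apply: Ip_real.
by rewrite e1 cIm_realM (rk.2 j) mulr0.
Qed.

Section Weighted.
Variables (g : V -> C) (v : R -> C) (T : R) (i : 'I_p).
Hypotheses (cg : cbm D g) (tv' : tbf v) (T0 : 0 <= T).

Let m_ex : exists2 m : R^nat, cvgn (series m) & forall k t s, 0 <= t <= T -> D s ->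
  n1 (g s * v t * (Mq s k *m VIp k (uh N u s) t) i 0) <= m k.
Proof.
have [B B0 hB] := uh_bound T; have [_ [G hG]] := cg; have [W W0 hW] := tbf_bound T tv'.
exists (fun k => (c * K ^+ k * (q%:R * B * (T ^+ k / k`!%:R))) * (`|G| * W)).
  by apply: cvg_mulr; exact: (exp_series c K (q%:R * B) T).1.
move=> k t s tT Ds; rewrite (le_trans (n1M _ _))// mulrC.
have h1 : n1 ((Mq s k *m VIp k (uh N u s) t) i 0) <= c * K ^+ k * (q%:R * B * (T ^+ k / k`!%:R)).
  exact: (le_trans (nrm_entry _ _ _) (ms_term (gM.1 s Ds) (vt_uh s) (hB s) k tT)).
apply: ler_pM; rewrite ?n1_ge0//.
apply: (le_trans (n1M _ _)); apply: ler_pM; rewrite ?n1_ge0 ?hW//.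
exact: le_trans (hG s Ds) (ler_norm _).
Qed.

Let csb t s : 0 <= t -> D s -> csbl (fun k => (Mq s k *m VIp k (uh N u s) t) i 0).
Proof. by move=> t0 Ds; exact: vsbl_entry (ms_sbl (gM.1 s Ds) (vt_uh s) t0). Qed.

Let wE t s : 0 <= t -> D s -> g s * v t * resp N Mq u t s i 0 =
  csum (fun k => \sum_(l <- L) (g s * al i k l s) * (v t * be k l t)).
Proof.
move=> t0 Ds; rewrite mxE -csumZ; last exact: csb.
congr csum; apply: funext => k; rewrite term_sep mulr_sumr; apply: eq_bigr => l _; ring.
Qed.

Lemma resp_exchange : [/\ cbm D (fun s => CI (fun t => g s * v t * resp N Mq u t s i 0) T),
  cbm ([set` `[0, T]] : set R) (fun t => Cint mu D (fun s => g s * v t * resp N Mq u t s i 0)) &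
  CI (fun t => Cint mu D (fun s => g s * v t * resp N Mq u t s i 0)) T =
  Cint mu D (fun s => CI (fun t => g s * v t * resp N Mq u t s i 0) T)].
Proof.
have [m cm hm] := m_ex.
have ca k l : cbm D (fun s => g s * al i k l s) by apply: cbmM => //; exact: cbm_al.
have tb k l : tbf (fun t => v t * be k l t) by apply: tbfM => //; exact: tbf_be.
have bnd k t s : 0 <= t <= T -> D s -> n1 (\sum_(l <- L) (g s * al i k l s) * (v t * be k l t)) <= m k.
  move=> tT Ds; apply: le_trans (hm k t s tT Ds); rewrite term_sep mulr_sumr le_eqVlt; apply/orP; left; apply/eqP.
  by congr n1; apply: eq_bigr => l _; ring.
have [h1 h2 h3] := exchange mD fD T0 cm ca tb bnd.
have pos t : 0 <= t <= T -> 0 <= t by case/andP.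
have inT' t : ([set` `[0, T]] : set R) t -> 0 <= t by rewrite /= in_itv/= => /andP[].
split.
- apply: eq_cbm h1 => s Ds; apply: (@eq_CI _ _ _ T T _ (lexx T)) => t tT; rewrite wE//; exact: pos tT.
- by apply: eq_cbm h2 => t /inT' t0; apply: eq_Cint => s Ds; rewrite wE.
rewrite (@eq_CI _ _ (fun t => Cint mu D (fun s => csum (fun k => \sum_(l <- L) (g s * al i k l s) * (v t * be k l t)))) T T _ (lexx T)); last first.
  by move=> t /pos t0; apply: eq_Cint => s Ds; rewrite wE.
rewrite h3; apply: eq_Cint => s Ds; apply: (@eq_CI _ _ _ T T _ (lexx T)) => t /pos t0; by rewrite wE.
Qed.

End Weighted.

End Response.

(** * State and output of the network for finitely supported inputs *)

Section Network.
Variables (R : realType) (nu : nat).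
Local Notation C := R[i].
Local Notation V := 'rV[R]_nu.
Local Notation BT := (g_sigma_algebraType (@boxes R nu)).
Variables (mu : {measure set BT -> \bar R}) (D : set BT) (tv : R).
Hypotheses (mD : measurable D) (fD : (mu D < +oo)%E) (tv0 : 0 < tv).
Hypothesis orth : forall l : Zl nu, Cint mu D (fun s => fchar l s) = if l == 0 then tv%:C%C else 0.
Local Notation coef := (fcoef mu D tv).
Local Notation sym := (sym mu D).
Local Notation rc := (rc mu D tv).
Local Notation cv := (cv mu D tv).
Local Notation symM := (symM mu D).
Local Notation goodM := (goodM mu D tv).

Lemma rc_sym w f : sym w f -> rc f.
Proof.
move=> sf; split; first by case: sf.
by move=> k; rewrite (coef_sym mD fD tv0 orth k sf).
Qed.

Lemma sym_nrm p q (M : Zl nu -> 'M[R]_(p, q)) Ms : symM M Ms ->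
  exists2 B, 0 <= B & forall s, D s -> nrm (Ms s) <= B.
Proof.
move=> sM; have h i b : {B : R | 0 <= B & forall s, D s -> n1 (Ms s i b) <= B}.
  apply: cid2; have [[_ [B hB]] _] := sM i b; exists `|B| => // s Ds.
  exact: le_trans (hB s Ds) (ler_norm _).
exists (\sum_i \sum_b s2val (h i b)).
  by apply: sumr_ge0 => i _; apply: sumr_ge0 => b _; case: (h i b).
by move=> s Ds; apply: ler_sum => i _; apply: ler_sum => b _; case: (h i b) => /= B _; exact.
Qed.

Lemma rc_mulmx p q r (M : Zl nu -> 'M[R]_(p, q)) Ms (X : V -> 'M[C]_(q, r)) i b : symM M Ms ->
  (forall j b, rc (fun s => X s j b)) -> rc (fun s => (Ms s *m X s) i b).
Proof.
move=> sM rX; under eq_fun do rewrite mxE.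
by apply: (rc_sum mD fD) => j; exact: (rcM mD fD tv0 (sM i j)).
Qed.

Variables (n m r : nat) (A : Zl nu -> 'M[R]_n) (B : Zl nu -> 'M[R]_(n, m))
  (Ck : Zl nu -> 'M[R]_(r, n)) (Dk : Zl nu -> 'M[R]_(r, m)) (G : Zl nu -> 'M[R]_(m, r))
  (As : V -> 'M[C]_n) (Bs : V -> 'M[C]_(n, m)) (Cs : V -> 'M[C]_(r, n))
  (Ds : V -> 'M[C]_(r, m)) (Gs : V -> 'M[C]_(m, r)).
Hypotheses (sA : symM A As) (sB : symM B Bs) (sC : symM Ck Cs) (sD : symM Dk Ds) (sG : symM G Gs).

Definition Xs s := Xp (As s) (Bs s).
Definition SXs s := sh (Xs s).
Definition Zs s := Zp (As s) (Bs s) (Cs s) (Ds s) (Gs s).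

Lemma rc_Xs k i b : rc (fun s => Xs s k i b).
Proof.
elim: k i b => [|k ih] i b; first exact: rc_sym (sB i b).
exact: (rc_mulmx (X := fun s => Xs s k) i b sA).
Qed.
Lemma rc_SXs k i b : rc (fun s => SXs s k i b).
Proof.
case: k => [|k]; last exact: rc_Xs.
rewrite (_ : (fun s => _) = fun=> 0); first exact: rc0.
by apply: funext => s; rewrite /= mxE.
Qed.
Lemma rc_Zs k i b : rc (fun s => Zs s k i b).
Proof.
apply: (rc_mulmx (X := fun s => Cs s *m SXs s k + dl (Ds s) k) i b sG) => j b'.
under eq_fun do rewrite mxE; apply: (rcD mD fD).
  by apply: (rc_mulmx (X := fun s => SXs s k) j b' sC) => *; exact: rc_SXs.
case: k => [|k]; first exact: rc_sym (sD j b').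
rewrite (_ : (fun s => _) = fun=> 0); first exact: rc0.
by apply: funext => s; rewrite /= mxE.
Qed.

Lemma good_Xs : exists c K, goodM Xs c K.
Proof.
have [KA KA0 hA] := sym_nrm sA; have [KB KB0 hB] := sym_nrm sB.
exists KB, (Num.max 1 KA); split; last exact: rc_Xs.
move=> s Dss; apply: (geo_le (geo_Xp _ _) (hB s Dss)).
by rewrite ge_max !le_max lexx /= hA ?orbT.
Qed.
Lemma good_SXs : exists c K, goodM SXs c K.
Proof.
have [c [K [gX _]]] := good_Xs; exists c, K; split; last exact: rc_SXs.
by move=> s Dss; apply: geo_sh; exact: gX.
Qed.
Lemma good_Zs : exists c K, goodM Zs c K.
Proof.
have [KA KA0 hA] := sym_nrm sA; have [KB KB0 hB] := sym_nrm sB; have [KC KC0 hC] := sym_nrm sC.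
have [KD KD0 hD] := sym_nrm sD; have [KG KG0 hG] := sym_nrm sG.
exists (KG * (KC * KB + KD)), (Num.max 1 KA); split; last exact: rc_Zs.
move=> s Dss; apply: (geo_le (geo_Zp _ _ _ _ _)).
  have [hb hc hd hg] := And4 (hB s Dss) (hC s Dss) (hD s Dss) (hG s Dss).
  rewrite ler_pM ?nrm_ge0 ?addr_ge0 ?mulr_ge0 ?nrm_ge0 ?hG//.
  by rewrite lerD// ler_pM ?nrm_ge0.
by rewrite ge_max !le_max lexx /= hA ?orbT.
Qed.

Section FiniteInput.
Variables (N : nat) (u : R -> Zl nu -> 'cV[R]_m).
Hypothesis fu : fin_input N u.

(** The state is built at each frequency and transformed back; [state_is_state] then checks the
    integral equation at every site. *)
Definition state t j := cv (resp N SXs u t) j.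
Definition gout t j := cv (resp N Zs u t) j.

Lemma cbv_resp p (Mq : V -> nat -> 'M[C]_(p, m)) c K t : goodM Mq c K -> 0 <= t -> cbv D (resp N Mq u t).
Proof. by move=> gM t0 b; exact: (resp_csum mD fD gM fu b t0).1. Qed.

Lemma cv_uh t k : cv (fun s => uh N u s t) k = u t k.
Proof. by rewrite cv_trig//; case: ifPn => // /fu.1 ->. Qed.

Lemma eq_cv p (h f : V -> 'cV[C]_p) j : (forall s, D s -> h s = f s) -> cv h j = cv f j.
Proof. by move=> hf; apply/colP => i; rewrite !mxE; congr complex.Re; apply: eq_coef => s Dss; rewrite hf. Qed.

Lemma cvD p (h f : V -> 'cV[C]_p) j : cbv D h -> cbv D f -> cv (fun s => h s + f s) j = cv h j + cv f j.
Proof.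
move=> ch cf; apply/colP => i; rewrite !mxE -cReD -coefD//; congr complex.Re.
by apply: eq_coef => s _; rewrite mxE.
Qed.

Lemma cbv_mul p q (M : Zl nu -> 'M[R]_(p, q)) Ms (h : V -> 'cV[C]_q) : symM M Ms -> cbv D h -> cbv D (fun s => Ms s *m h s).
Proof.
move=> sM ch i; under eq_fun do rewrite mxE; apply: cbm_sum => b; apply: cbmM; last exact: ch.
by case: (sM i b).
Qed.

Lemma cbv_uh t : cbv D (fun s => uh N u s t).
Proof. exact: cbv_trig. Qed.

Lemma output_state t j : 0 <= t ->
  toep A (state t) j + toep B (u t) j = cv (resp N Xs u t) j /\
  toep G (output Ck Dk (state t) (u t)) j = gout t j.
Proof.
move=> t0; have [c [K gS]] := good_SXs; have cS := cbv_resp gS t0; have cU := cbv_uh t.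
have uE : u t = (fun k => cv (fun s => uh N u s t) k) by apply: funext => k; rewrite cv_uh.
split.
  rewrite uE (toep_cv mD fD tv0 orth _ sA cS) (toep_cv mD fD tv0 orth _ sB cU).
  rewrite -(cvD _ (cbv_mul sA cS) (cbv_mul sB cU)).
  by apply: eq_cv => s Dss; rewrite /resp msXp//; exact: vt_uh.
have -> : output Ck Dk (state t) (u t) = (fun k => cv (fun s => Cs s *m resp N SXs u t s + Ds s *m uh N u s t) k).
  apply: funext => k; rewrite /output uE (toep_cv mD fD tv0 orth _ sC cS) (toep_cv mD fD tv0 orth _ sD cU).
  by rewrite -(cvD _ (cbv_mul sC cS) (cbv_mul sD cU)).
rewrite (toep_cv mD fD tv0 orth _ sG); last first.
  move=> b; under eq_fun do rewrite mxE; apply: cbmD; [exact: (cbv_mul sC cS)|exact: (cbv_mul sD cU)].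
apply: eq_cv => s Dss; by rewrite [RHS](zsE _ _ _ _ _ (vt_uh fu s) t0).
Qed.

Lemma l2b_cv p (h : V -> 'cV[C]_p) (H : R) : cbv D h -> (forall s, D s -> nrm (h s) <= H) ->
  l2b (cv h) (p%:R * (tv^-1 * (H ^+ 2 * fine (mu D)))).
Proof.
move=> ch hH L; rewrite (_ : bsum L _ = \sum_i bsum L (fun k => cv h k i 0 ^+ 2)); last first.
  by rewrite -bsum_sum; apply: eq_bigr => k _; rewrite sqnormR_col.
rewrite mulr_natl -[X in _ *+ X]card_ord -sumr_const; apply: ler_sum => i _.
apply: (@le_trans _ _ (tv^-1 * \int[mu]_(s in D) cabs2 (h s i 0))).
  apply: le_trans (bessel_box mD fD tv0 orth L (ch i)); apply: le_bsum => k; rewrite mxE.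
  exact: sqr_Re_coef.
rewrite ler_wpM2l ?invr_ge0 ?(ltW tv0)// -(Rintegral_cst mu mD).
apply: (le_Rintegral mD (cint_cabs2 mD fD (ch i))).
  by apply: (bounded_integrable mD fD (M := `|H ^+ 2|)).
move=> s Dss; apply: (le_trans (cabs2_le_n1 _)).
rewrite lerXn2r ?nnegrE ?n1_ge0//; first exact: le_trans (nrm_ge0 _) (hH s Dss).
exact: le_trans (nrm_entry _ _ _) (hH s Dss).
Qed.

Lemma l2b_state T : 0 <= T -> exists K, forall t, 0 <= t <= T -> l2b (state t) K.
Proof.
move=> T0; have [c [K gS]] := good_SXs; have [H hH] := resp_bound gS fu T0.
eexists => t tT; apply: l2b_cv; first by apply: (cbv_resp gS); case/andP: tT.
by move=> s Dss; exact: hH.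
Qed.

Lemma l2b_l2sq q (v : Zl nu -> 'cV[R]_q) K : l2b v K -> (l2sq v <= K%:E)%E.
Proof. by move=> vK; apply: esum_le_bsum => // k; exact: sqnormR_ge0. Qed.

Lemma Re_coef_CI p (Mq : V -> nat -> 'M[C]_(p, m)) c K i j v T : goodM Mq c K -> tbf v -> 0 <= T ->
  cbm ([set` `[0, T]] : set R) (fun t => v t * coef (fun s => resp N Mq u t s i 0) j) /\
  CI (fun t => v t * coef (fun s => resp N Mq u t s i 0) j) T =
  coef (fun s => CI (fun t => v t * resp N Mq u t s i 0) T) j.
Proof.
move=> gM tb T0; have cg : cbm D (fun s => conjc (fchar j s : C)) by apply: cbmJ; exact: cbm_char.
have [h1 h2 h3] := resp_exchange mD fD gM fu i cg tb T0.
have ci t : 0 <= t -> cbm D (fun s => resp N Mq u t s i 0 * conjc (fchar j s)).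
  by move=> t0; apply: cbmM => //; exact: (cbv_resp gM t0).
have E t : 0 <= t -> v t * coef (fun s => resp N Mq u t s i 0) j =
    (tv^-1)%:C%C * Cint mu D (fun s => conjc (fchar j s) * v t * resp N Mq u t s i 0).
  move=> t0; rewrite /fcoef mulrCA; congr (_ * _); rewrite -(CintZ mD fD _ (ci t t0)).
  by apply: eq_Cint => s _; ring.
have pos t : ([set` `[0, T]] : set R) t -> 0 <= t by rewrite /= in_itv/= => /andP[].
split.
  by apply: eq_cbm (cbmZ (tv^-1)%:C%C h2) => t /pos t0; rewrite E.
transitivity (CI (fun t => (tv^-1)%:C%C * Cint mu D (fun s => conjc (fchar j s) * v t * resp N Mq u t s i 0)) T).
  by apply: (@eq_CI _ _ _ T T _ (lexx T)) => t /andP[t0 _]; rewrite E.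
rewrite /CI (CintZ (mI 0 T) (lam_fin 0 T) _ h2) /fcoef; congr (_ * _).
rewrite -[LHS]/(CI _ T) h3; apply: eq_Cint => s Dss.
have tr : tbf (fun t => v t * resp N Mq u t s i 0).
  by apply: tbfM => //; exact: (vt_ms (gM.1 s Dss) (vt_uh fu s)).
rewrite mulrC -CI_Z//; congr CI; apply: funext => t; rewrite mulrA.
by [].
Qed.

(** By [Re_coef_CI] taking a Fourier coefficient commutes with the time integral, so the integral
    equation at each frequency becomes the one at each lattice site. *)
Lemma state_is_state : is_state A B u state.
Proof.
have [c [K gX]] := good_Xs; have [c' [K' gS]] := good_SXs.
have sE t s i : D s -> 0 <= t -> resp N SXs u t s i 0 = CI (fun tau => resp N Xs u tau s i 0) t.
  by move=> Dss t0; exact: (xs_CI _ _ i (vt_uh fu s) t0).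
split; [|split].
- move=> j; apply/colP => i; rewrite !mxE.
  rewrite (@eq_coef _ _ _ _ _ _ (fun=> 0)) ?coef0// => s Dss.
  by rewrite sE// CI_at0.
- move=> T T0; have [L hL] := l2b_state (ltW T0).
  by exists L => t tT; apply: l2b_l2sq; exact: hL.
move=> t t0 j i /=.
have gE tau : 0 <= tau -> (toep A (state tau) j + toep B (u tau) j) i 0 =
    complex.Re (1 * coef (fun s => resp N Xs u tau s i 0) j).
  by move=> tau0; rewrite (output_state j tau0).1 mxE mul1r.
have [h1 h2] := Re_coef_CI i j gX (tbf_cst 1) t0.
have pos tau : ([set` `[0, t]] : set R) tau -> 0 <= tau by rewrite /= in_itv/= => /andP[].
split.
  apply: (eq_integrable (mI 0 t) _ _ _ (cbm_iRe (mI 0 t) (lam_fin 0 t) h1)) => tau /set_mem /pos tau0.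
  by rewrite /= gE.
transitivity (complex.Re (CI (fun tau => 1 * coef (fun s => resp N Xs u tau s i 0) j) t)).
  rewrite h2 /state /cv mxE.
  congr complex.Re.
  apply: eq_coef => s Dss.
  apply: (etrans (sE t s i Dss t0)).
  by congr CI; apply: funext => tau; rewrite mul1r.
rewrite /= /Rintegral; congr fine; apply: eq_integral => tau /set_mem /pos tau0.
by rewrite gE.
Qed.

End FiniteInput.

End Network.

Section WorkIdentity.
Variables (R : realType) (nu : nat).
Local Notation C := R[i].
Local Notation V := 'rV[R]_nu.
Local Notation BT := (g_sigma_algebraType (@boxes R nu)).
Local Notation lam := (@lebesgue_measure R).
Variables (mu : {measure set BT -> \bar R}) (D : set BT) (tv : R).
Hypotheses (mD : measurable D) (fD : (mu D < +oo)%E) (tv0 : 0 < tv).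
Hypothesis orth : forall l : Zl nu, Cint mu D (fun s => fchar l s) = if l == 0 then tv%:C%C else 0.
Local Notation coef := (fcoef mu D tv).
Local Notation symM := (symM mu D).
Variables (n m r : nat) (A : Zl nu -> 'M[R]_n) (B : Zl nu -> 'M[R]_(n, m))
  (Ck : Zl nu -> 'M[R]_(r, n)) (Dk : Zl nu -> 'M[R]_(r, m)) (G : Zl nu -> 'M[R]_(m, r))
  (As : V -> 'M[C]_n) (Bs : V -> 'M[C]_(n, m)) (Cs : V -> 'M[C]_(r, n))
  (Ds : V -> 'M[C]_(r, m)) (Gs : V -> 'M[C]_(m, r)).
Hypotheses (sA : symM A As) (sB : symM B Bs) (sC : symM Ck Cs) (sD : symM Dk Ds) (sG : symM G Gs).
Local Notation Zs := (Zs As Bs Cs Ds Gs).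
Local Notation gout := (gout mu D tv As Bs Cs Ds Gs).
Local Notation qs T s := (qf (As s) (Bs s) (Cs s) (Ds s) (Gs s) T).
Implicit Types (u w : R -> Zl nu -> 'cV[R]_m) (T : R).

(** The two slots take different inputs because complex inputs produce cross works. *)
Definition power N u w t : R := zsum (fun j => ((u t j)^T *m gout N w t j) 0 0).

Lemma powerE N N' u w t : fin_input N u ->
  power N' u w t = \sum_(j <- boxseq nu N) \sum_b u t j b 0 * gout N' w t j b 0.
Proof.
move=> fu; rewrite /power (@zsum_supp _ _ N _ _).2 => [|j /fu.1 ->]; last by rewrite trmx0 mul0mx mxE.
by rewrite /bsum; apply: eq_bigr => j _; rewrite mxE; apply: eq_bigr => b _; rewrite mxE.
Qed.

Lemma power_supply N u t : fin_input N u -> 0 <= t ->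
  supply G (u t) (output Ck Dk (state mu D tv As Bs N u t) (u t)) = power N u u t.
Proof.
move=> fu t0; rewrite /supply /power; congr zsum; apply: funext => j.
by rewrite (output_state mD fD tv0 orth sA sB sC sD sG fu j t0).2.
Qed.

Lemma uh_conj N u s t b : conjc (uh N u s t b 0) = \sum_(j <- boxseq nu N) conjc (fchar j s) * (u t j b 0)%:C%C :> C.
Proof.
rewrite /uh trigv_ofE rmorph_sum; apply: eq_bigr => j _.
rewrite -[LHS]/(conjc (_ * _)) cJM mulrC; congr (_ * _); by apply: cext; rewrite ?cReJ ?cImJ //= oppr0.
Qed.

(* Parseval's identity for the work *)
Lemma work_identity N N' u w T : fin_input N u -> fin_input N' w -> 0 <= T ->
  [/\ lam.-integrable ([set` `[0, T]] : set R) (EFin \o power N' u w),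
   cbm D (fun s => qs T s (uh N u s) (uh N' w s)) &
   Cint mu D (fun s => qs T s (uh N u s) (uh N' w s)) =
   (tv * \int[lam]_(t in `[0, T]) power N' u w t)%:C%C].
Proof.
move=> fu fw T0; have [c [K gZ]] := good_Zs mD fD tv0 orth sA sB sC sD sG.
have pos t : ([set` `[0, T]] : set R) t -> 0 <= t by rewrite /= in_itv/= => /andP[].
pose W j b t : C := (u t j b 0)%:C%C * coef (fun s => resp N' Zs w t s b 0) j.
pose Y j b s : C := CI (fun t => (u t j b 0)%:C%C * resp N' Zs w t s b 0) T.
have hW j b := Re_coef_CI mD fD fw b j gZ (fu.2 j b) T0.
have cY j b : cbm D (Y j b).
  have [h _ _] := resp_exchange mD fD gZ fw b (cbm_cst D 1) (fu.2 j b) T0.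
  apply: eq_cbm h => s _; rewrite /Y; congr CI; apply: funext => t; by rewrite mul1r.
have cYc j b : cbm D (fun s => conjc (fchar j s : C) * Y j b s).
  by apply: cbmM => //; apply: cbmJ; exact: cbm_char.
have WE t : 0 <= t -> \sum_(j <- boxseq nu N) \sum_b W j b t = (power N' u w t)%:C%C.
  move=> t0; rewrite (powerE N' w t fu) (rmorph_sum (real_complex R)); apply: eq_bigr => j _.
  rewrite (rmorph_sum (real_complex R)); apply: eq_bigr => b _; rewrite /W rmorphM mxE; congr (_ * _).
  by apply: rc_coef; exact: (rc_resp mD fD tv0 gZ fw b t0).
have cW : cbm ([set` `[0, T]] : set R) (fun t => (power N' u w t)%:C%C : C).
  apply: (eq_cbm (f := fun t => \sum_(j <- boxseq nu N) \sum_b W j b t)) => [t /pos t0|]; first exact: WE.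
  by apply: cbm_sum => j; apply: cbm_sum => b; have [] := hW j b.
have qE s : D s -> qs T s (uh N u s) (uh N' w s) = \sum_(j <- boxseq nu N) \sum_b conjc (fchar j s) * Y j b s.
  move=> Dss; have tr j b : tbf (fun t => (u t j b 0)%:C%C * resp N' Zs w t s b 0).
    by apply: tbfM; [exact: fu.2|exact: (vt_ms (gZ.1 s Dss) (vt_uh fw s))].
  transitivity (CI (fun t => \sum_(j <- boxseq nu N) \sum_b conjc (fchar j s) * ((u t j b 0)%:C%C * resp N' Zs w t s b 0)) T).
    rewrite /qf; congr CI; apply: funext => t; rewrite /wf adjE exchange_big/=; apply: eq_bigr => b _.
    by rewrite uh_conj mulr_suml; apply: eq_bigr => j _; rewrite mulrA.
  rewrite CI_sum; last by move=> j; apply: tbf_sum => b; apply: tbfZ.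
  apply: eq_bigr => j _; rewrite CI_sum; last by move=> b; apply: tbfZ.
  by apply: eq_bigr => b _; rewrite CI_Z.
split.
- by apply: (eq_integrable (mI 0 T) _ _ _ (cbm_iRe (mI 0 T) (lam_fin 0 T) cW)).
- apply: (@eq_cbm _ BT _ D (fun s : BT => \sum_(j <- boxseq nu N) \sum_b conjc (fchar j s) * Y j b s)) => [s Dss|]; first by rewrite qE.
  by apply: cbm_sum => j; apply: cbm_sum => b.
transitivity (tv%:C%C * CI (fun t => \sum_(j <- boxseq nu N) \sum_b W j b t) T : C); last first.
  rewrite rmorphM; congr (_ * _).
  transitivity (CI (fun t => (power N' u w t)%:C%C : C) T).
    by apply: (@eq_CI _ _ _ T T _ (lexx T)) => t /andP[t0 _]; rewrite WE.
  by apply: cext => //=; rewrite /Rintegral integral0.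
transitivity (\sum_(j <- boxseq nu N) \sum_b tv%:C%C * CI (W j b) T : C).
  transitivity (Cint mu D (fun s => \sum_(j <- boxseq nu N) \sum_b conjc (fchar j s) * Y j b s)); first exact: eq_Cint.
  rewrite (Cint_sum mD fD); last by move=> j; apply: cbm_sum => b.
  apply: eq_bigr => j _; rewrite (Cint_sum mD fD)//; apply: eq_bigr => b _.
  rewrite (hW j b).2 /fcoef mulrA -rmorphM mulfV ?gt_eqF// mul1r.
  by apply: eq_Cint => s _; rewrite mulrC.
rewrite /CI (Cint_sum (mI 0 T) (lam_fin 0 T)); last by move=> j; apply: cbm_sum => b; have [] := hW j b.
rewrite mulr_sumr; apply: eq_bigr => j _; rewrite (Cint_sum (mI 0 T) (lam_fin 0 T)); last by move=> b; have [] := hW j b.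
by rewrite mulr_sumr.
Qed.

End WorkIdentity.

(* No measurability is needed: the positive and negative parts are integrated by suprema over
   simple functions, which are monotone. *)
Lemma le_integral_pw d (T : measurableType d) (R : realType) (mu : {measure set T -> \bar R})
    (D : set T) (f g : T -> \bar R) : (forall x, D x -> (f x <= g x)%E) ->
  (\int[mu]_(x in D) f x <= \int[mu]_(x in D) g x)%E.
Proof.
move=> fg; have h x : ((f \_ D) x <= (g \_ D) x)%E.
  by rewrite /patch; case: ifPn => // /set_mem; exact: fg.
rewrite /integral; apply: leeB; apply: le_ereal_sup => _ [k kf <-]; exists k => // x; apply: le_trans (kf x) _.
  by rewrite !funeposE ge_max !le_max h lexx orbT.
by rewrite !funenegE ge_max !le_max leeN2 h lexx orbT.
Qed.

(** * Necessity *)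

Section Sesquilinear.
Variables (R : realType) (n m r : nat).
Local Notation C := R[i].
Variables (a : 'M[C]_n) (b : 'M[C]_(n, m)) (c : 'M[C]_(r, n)) (d : 'M[C]_(r, m)) (g : 'M[C]_(m, r)).
Local Notation Q := (qf a b c d g).
Implicit Types (v w : R -> 'cV[C]_m) (T : R).

Lemma qfDl v1 v2 w T : vt v1 -> vt v2 -> vt w -> Q T (fun t => v1 t + v2 t) w = Q T v1 w + Q T v2 w.
Proof.
move=> t1 t2 tw; rewrite /qf -CI_D; [|exact: tbf_wf|exact: tbf_wf].
congr CI; apply: funext => t; rewrite /wf !adjE -big_split/=; apply: eq_bigr => i _.
by rewrite mxE rmorphD mulrDl.
Qed.

Lemma qfZl z v w T : vt v -> vt w -> Q T (fun t => z *: v t) w = conjc z * Q T v w.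
Proof.
move=> tv tw; rewrite /qf -CI_Z; last exact: tbf_wf.
congr CI; apply: funext => t; rewrite /wf !adjE mulr_sumr; apply: eq_bigr => i _.
by rewrite mxE -[X in X * _ = _]/(conjc (_ * _)) cJM mulrA.
Qed.

Lemma qfDr v w1 w2 T : vt v -> vt w1 -> vt w2 -> Q T v (fun t => w1 t + w2 t) = Q T v w1 + Q T v w2.
Proof.
move=> tv t1 t2; rewrite /qf -CI_D; [|exact: tbf_wf|exact: tbf_wf].
apply: (@eq_CI _ _ _ T T _ (lexx T)) => t /andP[t0 _].
by rewrite /wf /zs (msv_add (geo_Zp a b c d g))// mulmxDr mxE.
Qed.

Lemma qfZr z v w T : vt v -> vt w -> Q T v (fun t => z *: w t) = z * Q T v w.
Proof.
move=> tv tw; rewrite /qf -CI_Z; last exact: tbf_wf.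
apply: (@eq_CI _ _ _ T T _ (lexx T)) => t /andP[t0 _].
by rewrite /wf /zs (msv_scale (geo_Zp a b c d g))// -scalemxAr mxE.
Qed.

(** The cross terms enter only through [i] times a difference. For real lattice inputs their
    integrals over sigma are real, so they drop out of the real part. *)
Lemma qf_complex v1 v2 T : vt v1 -> vt v2 ->
  Q T (fun t => v1 t + ('i)%C *: v2 t) (fun t => v1 t + ('i)%C *: v2 t) =
  Q T v1 v1 + Q T v2 v2 + ('i)%C * (Q T v1 v2 - Q T v2 v1).
Proof.
move=> t1 t2; have t2' := vtZ ('i)%C t2; have t12 := vtD t1 t2'.
rewrite qfDl// !qfDr// !qfZl// !qfZr//.
have -> : conjc 'i%C = - 'i%C :> C by apply: cext => /=; rewrite ?oppr0.
have i2 : 'i%C * 'i%C = -1 :> C by apply: cext => /=; ring.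
have alg (i x y z w : C) : i * i = -1 -> x + i * z + (- i * w + - i * (i * y)) = x + y + i * (z - w).
  by move=> ii; rewrite (_ : - i * (i * y) = - (i * i) * y); [rewrite ii; ring|ring].
exact: alg.
Qed.

Lemma qf_scale z v T : vt v -> Q T (fun t => z *: v t) (fun t => z *: v t) = (cabs2 z)%:C%C * Q T v v.
Proof. by move=> tv; rewrite (qfZl z T tv (vtZ z tv)) (qfZr z T tv tv) mulrA mulJ_cabs2. Qed.
End Sesquilinear.

Section ComplexInput.
Variables (R : realType) (nu : nat).
Local Notation C := R[i].
Local Notation V := 'rV[R]_nu.
Local Notation BT := (g_sigma_algebraType (@boxes R nu)).
Local Notation lam := (@lebesgue_measure R).

Definition cinp m N (p : Zl nu -> C) (w : R) (c0 : 'cV[C]_m) (t : R) (k : Zl nu) : 'cV[R]_m :=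
  if k \in boxseq nu N then \col_b complex.Re (p k * (ce (w * t) * c0 b 0)) else 0.

Lemma cmf_cinp m (p : Zl nu -> C) (w : R) (c0 : 'cV[C]_m) k b :
  cmf [set: R] (fun t => p k * (ce (w * t) * c0 b 0)).
Proof.
apply: cmfM; first exact: cmf_cst.
by apply: cmfM; [exact: (cbm_ce [set: R] w).1|exact: cmf_cst].
Qed.

Lemma cinp_fin m N p w (c0 : 'cV[C]_m) : fin_input N (cinp N p w c0).
Proof.
split=> [t k kN|k b]; first by rewrite /cinp (negPf kN).
case: (boolP (k \in boxseq nu N)) => kN; rewrite /cinp ?kN ?(negPf kN); last first.
  by rewrite (_ : (fun t => _) = fun=> 0); [exact: tbf_cst|apply: funext => t; rewrite mxE].
rewrite (_ : (fun t => _) = fun t => (complex.Re (p k * (ce (w * t) * c0 b 0)))%:C%C); last first.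
  by apply: funext => t; rewrite mxE.
move=> T; split; first by apply: cmf_real; apply: measurable_funTS; exact: (cmf_cinp p w c0 k b).1.
exists (n1 (p k) * (2 * n1 (c0 b 0))) => t _; rewrite n1_real (le_trans (le_Re_n1 _))//.
rewrite (le_trans (n1M _ _))// ler_wpM2l ?n1_ge0// (le_trans (n1M _ _))// ler_wpM2r ?n1_ge0//.
exact: n1_ce.
Qed.

Lemma l2b_fin q N (v : Zl nu -> 'cV[R]_q) : (forall k, k \notin boxseq nu N -> v k = 0) ->
  l2b v (bsum N (fun k => sqnormR (v k))).
Proof.
move=> v0 L; apply: le_trans (le_bsum_box _ (leq_maxr N L)) _ => [k|]; first exact: sqnormR_ge0.
have s0 M : (N <= M)%N -> bsum M (fun k => sqnormR (v k)) = bsum N (fun k => sqnormR (v k)).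
  move=> NM; rewrite /bsum (bigID (fun k => k \in boxseq nu N))/= [X in _ + X]big1 ?addr0; last first.
    by move=> k /v0 ->; rewrite sqnormR0.
  rewrite -big_filter; apply: perm_big; apply: uniq_perm; rewrite ?filter_uniq ?boxseq_uniq// => k.
  by rewrite mem_filter; case: (boolP (k \in boxseq nu N)) => //= /(boxseq_mono NM) ->.
by rewrite s0 ?leq_maxl.
Qed.

Lemma cinp_admissible m N p w (c0 : 'cV[C]_m) : admissible (cinp N p w c0).
Proof.
split=> [k b|T T0].
  case: (boolP (k \in boxseq nu N)) => kN; rewrite /cinp ?kN ?(negPf kN); under eq_fun do rewrite mxE; last exact: measurable_cst.
  exact: (cmf_cinp p w c0 k b).1.
have [fz fb] := cinp_fin N p w c0.
have h k b : {Bk : R | forall t, 0 <= t <= T -> `|cinp N p w c0 t k b 0| <= Bk}.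
  by apply: cid; have [M M0 hM] := tbf_bound T (fb k b); exists M => t tT; rewrite -n1_real hM.
pose K := bsum N (fun k => \sum_b sval (h k b) ^+ 2).
have hK t : 0 <= t <= T -> (l2sq (cinp N p w c0 t) <= K%:E)%E.
  move=> tT; apply: esum_le_bsum => [k|L]; first exact: sqnormR_ge0.
  apply: (le_trans (l2b_fin (fz t) L)); apply: le_bsum => k; rewrite sqnormR_col; apply: ler_sum => b _.
  have hb := svalP (h k b) t tT.
  by rewrite -(real_normK (num_real (cinp _ _ _ _ _ _ _ _))) lerXn2r ?nnegrE//; exact: le_trans (normr_ge0 _) hb.
apply: (le_lt_trans (le_integral_pw lam (g := fun=> K%:E) _)).
  by move=> t; rewrite /= in_itv; exact: hK.
by rewrite integral_cst//= lte_mul_pinfty// ?lam_fin// lee_fin; apply: bsum_ge0 => k; apply: sumr_ge0 => b _; exact: sqr_ge0.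
Qed.

End ComplexInput.

Lemma Re_real_i (R : realType) (x1 x2 x3 x4 : R) :
  complex.Re ((x1%:C%C : R[i]) + x2%:C%C + 'i%C * (x3%:C%C - x4%:C%C)) = x1 + x2.
Proof. by rewrite /=; ring. Qed.

Section TrigInput.
Variables (R : realType) (nu : nat).
Local Notation C := R[i].
Local Notation V := 'rV[R]_nu.
Local Notation BT := (g_sigma_algebraType (@boxes R nu)).
Local Notation lam := (@lebesgue_measure R).
Variables (mu : {measure set BT -> \bar R}) (D : set BT) (tv : R).
Hypotheses (mD : measurable D) (fD : (mu D < +oo)%E) (tv0 : 0 < tv).
Hypothesis orth : forall l : Zl nu, Cint mu D (fun s => fchar l s) = if l == 0 then tv%:C%C else 0.
Local Notation symM := (symM mu D).
Variables (n m r : nat) (A : Zl nu -> 'M[R]_n) (B : Zl nu -> 'M[R]_(n, m))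
  (Ck : Zl nu -> 'M[R]_(r, n)) (Dk : Zl nu -> 'M[R]_(r, m)) (G : Zl nu -> 'M[R]_(m, r))
  (As : V -> 'M[C]_n) (Bs : V -> 'M[C]_(n, m)) (Cs : V -> 'M[C]_(r, n))
  (Ds : V -> 'M[C]_(r, m)) (Gs : V -> 'M[C]_(m, r)).
Hypotheses (sA : symM A As) (sB : symM B Bs) (sC : symM Ck Cs) (sD : symM Dk Ds) (sG : symM G Gs).
Local Notation qs T s := (qf (As s) (Bs s) (Cs s) (Ds s) (Gs s) T).
Local Notation power := (power mu D tv As Bs Cs Ds Gs).

Definition trigs N (p : Zl nu -> C) (s : V) : C := \sum_(k <- boxseq nu N) p k * fchar k s.

(* cinp takes real parts; the imaginary part of an input is the real part of -i times it. *)
Lemma uh_cinp N p w (c0 : 'cV[C]_m) s t :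
  uh N (cinp N p w c0) s t + ('i)%C *: uh N (cinp N (fun k => - 'i%C * p k) w c0) s t =
  trigs N p s *: ev w c0 t.
Proof.
apply/colP => b; rewrite !mxE /uh !trigv_ofE mulr_suml mulr_sumr -big_split/=.
rewrite !big_seq; apply: eq_bigr => k kN; rewrite /cinp kN !mxE.
set x := ce _ * _; set y := fchar k s.
have cri (z : C) : (complex.Re z)%:C%C + 'i%C * (complex.Re (- 'i%C * z))%:C%C = z.
  by apply: cext; rewrite ?cReD ?cImD ?cReM ?cImM ?cReN ?cImN /=; ring.
rewrite -[- 'i%C * p k * x]mulrA ['i%C * (_ * y)]mulrA -mulrDl cri.
by rewrite mulrAC.
Qed.

(** A complex input is [u1 + i u2] with [u1], [u2] real and admissible. After integration over sigma
    the real part is the sum of their two works, each nonnegative by [pas]. *)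
Lemma trig_work_ge0 N p w (c0 : 'cV[C]_m) (T : R) :
  (forall N u, fin_input N u -> admissible u -> 0 <= \int[lam]_(t in `[0, T]) power N u u t) ->
  0 <= T ->
  cbm D (fun s => (cabs2 (trigs N p s))%:C%C * qs T s (ev w c0) (ev w c0)) /\
  0 <= \int[mu]_(s in D) (cabs2 (trigs N p s) * complex.Re (qs T s (ev w c0) (ev w c0))).
Proof.
move=> pas T0; set p' := fun k => - 'i%C * p k.
have f1 := cinp_fin N p w c0; have f2 := cinp_fin N p' w c0.
have [i1 b1 e1] := work_identity mD fD tv0 orth sA sB sC sD sG f1 f1 T0.
have [i2 b2 e2] := work_identity mD fD tv0 orth sA sB sC sD sG f2 f2 T0.
have [i3 b3 e3] := work_identity mD fD tv0 orth sA sB sC sD sG f1 f2 T0.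
have [i4 b4 e4] := work_identity mD fD tv0 orth sA sB sC sD sG f2 f1 T0.
pose F s : C := qs T s (uh N (cinp N p w c0) s) (uh N (cinp N p w c0) s) +
  qs T s (uh N (cinp N p' w c0) s) (uh N (cinp N p' w c0) s) +
  'i%C * (qs T s (uh N (cinp N p w c0) s) (uh N (cinp N p' w c0) s) -
          qs T s (uh N (cinp N p' w c0) s) (uh N (cinp N p w c0) s)).
have FE s : F s = (cabs2 (trigs N p s))%:C%C * qs T s (ev w c0) (ev w c0).
  rewrite /F -qf_complex; [|exact: vt_uh|exact: vt_uh].
  rewrite -qf_scale; last exact: vt_ev.
  have uE : (fun t => uh N (cinp N p w c0) s t + 'i%C *: uh N (cinp N p' w c0) s t) =
    (fun t => trigs N p s *: ev w c0 t) by apply: funext => t; exact: uh_cinp.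
  by rewrite uE.
have b12 := cbmD b1 b2; have b34 := cbmB b3 b4.
have cF : cbm D (F : BT -> C) by apply: (cbmD b12); exact: cbmZ.
have cF' : cbm D (fun s => (cabs2 (trigs N p s))%:C%C * qs T s (ev w c0) (ev w c0)).
  by apply: (@eq_cbm _ BT _ D F) cF => s _; exact: FE.
split => //.
have -> : \int[mu]_(s in D) (cabs2 (trigs N p s) * complex.Re (qs T s (ev w c0) (ev w c0))) =
  complex.Re (Cint mu D F).
  rewrite -[RHS]/(\int[mu]_(s in D) complex.Re (F s)).
  by apply: eq_Rintegral => s _; rewrite -cRe_realM -FE.
have -> : Cint mu D F = (tv * \int[lam]_(t in `[0, T]) power N (cinp N p w c0) (cinp N p w c0) t)%:C%C +
  (tv * \int[lam]_(t in `[0, T]) power N (cinp N p' w c0) (cinp N p' w c0) t)%:C%C +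
  'i%C * ((tv * \int[lam]_(t in `[0, T]) power N (cinp N p w c0) (cinp N p' w c0) t)%:C%C -
   (tv * \int[lam]_(t in `[0, T]) power N (cinp N p' w c0) (cinp N p w c0) t)%:C%C).
  apply: (etrans (CintD mD fD b12 (cbmZ 'i%C b34))); congr (_ + _).
    by apply: (etrans (CintD mD fD b1 b2)); congr (_ + _); [exact: e1|exact: e2].
  apply: (etrans (CintZ mD fD 'i%C b34)); congr (_ * _).
  by apply: (etrans (CintB mD fD b3 b4)); congr (_ - _); [exact: e3|exact: e4].
rewrite Re_real_i.
by rewrite addr_ge0// mulr_ge0 ?(ltW tv0)// pas//; exact: cinp_admissible.
Qed.

End TrigInput.

Lemma cvg_bigprod (R : realType) I (r : seq I) (P : pred I) (u : I -> nat -> R) (l : I -> R) :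
  (forall i, P i -> u i N @[N --> \oo] --> l i) ->
  \prod_(i <- r | P i) u i N @[N --> \oo] --> \prod_(i <- r | P i) l i.
Proof.
move=> h; elim: r => [|i r ih].
  by under eq_fun do rewrite big_nil; rewrite big_nil; exact: cvg_cst.
under eq_fun do rewrite big_cons; rewrite big_cons; case: ifPn => // Pi.
by apply: cvgM => //; exact: h.
Qed.

(** * Localization on cells by products of Fejer means *)

Section FejerCells.
Variables (R : realType) (nu : nat).
Local Notation C := R[i].
Local Notation V := 'rV[R]_nu.
Local Notation BT := (g_sigma_algebraType (@boxes R nu)).
Local Notation lam := (@lebesgue_measure R).
Variables (a b : V).

Let f (i : 'I_nu) : R -> R := \1_(`[a 0 i, b 0 i[ : set R).
Let J := ([set` `[- pi, - pi + pi *+ 2]] : set R).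
Let mf i : measurable_fun J (f i).
Proof. by apply: measurable_indic. Qed.
Let f1 i y : J y -> `|f i y| <= 1.
Proof. by move=> _; rewrite /f indicE; case: (_ \in _); rewrite ?normr1 ?normr0. Qed.
Let P0 : 0 < pi *+ 2 :> R. Proof. by rewrite mulrn_wgt0// pi_gt0. Qed.

Definition cellf N (s : V) : R := \prod_i fejer (- pi) (pi *+ 2) N.+1 (f i) (s 0 i).

Lemma cellf_le1 N s : `|cellf N s| <= 1.
Proof.
rewrite /cellf normr_prod; apply: prodr_ile1 => i _; rewrite normr_ge0 /=.
exact: (fejer_bound P0 (@mf i) (@f1 i)).
Qed.

(** The product of one-variable polynomials is expanded over index functions. Conjugation appears
    because [fchar] has a negative exponent; it is harmless since the means are real. *)
Lemma cellf_trig N : exists p, forall s : V, (cellf N s)%:C%C = trigs N.+1 p s :> C.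
Proof.
have h i : {c : 'I_(2 * N.+1 + 1) -> C | forall x, (fejer (- pi) (pi *+ 2) N.+1 (f i) x)%:C%C = trigpoly (pi *+ 2) c x}.
  by apply: cid; exact: (@fejer_trig R (- pi) (pi *+ 2) P0 (f i) 1 (@mf i) (@f1 i) N.+1).
pose q (k : {ffun 'I_nu -> 'I_(2 * N.+1 + 1)}) : C := \prod_i conjc (sval (h i) (k i)).
pose p (l : Zl nu) : C := \sum_(k : 'rV['I_(2 * N.+1 + 1)]_nu | sq_ind k == l) q [ffun i => k 0 i].
exists p => s; transitivity (\prod_i conjc (trigpoly (pi *+ 2) (sval (h i)) (s 0 i))).
  rewrite /cellf (rmorph_prod (real_complex R)); apply: eq_bigr => i _.
  by rewrite -(svalP (h i)); apply: cext; rewrite ?cReJ ?cImJ //= oppr0.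
transitivity (\prod_i \sum_(z : 'I_(2 * N.+1 + 1)) conjc (sval (h i) z) * conjc (ce (((z : nat)%:Z - N.+1%:Z)%:~R * s 0 i))).
  apply: eq_bigr => i _; rewrite /trigpoly rmorph_sum; apply: eq_bigr => z _.
  rewrite -cJM; congr (conjc (_ * ce _)).
  by rewrite divff ?mulr1// gt_eqF.
rewrite (bigA_distr_bigA (fun i z => conjc (sval (h i) z) * conjc (ce (((z : nat)%:Z - N.+1%:Z)%:~R * s 0 i))))/=.
rewrite /trigs -/(bsum _ _) bsum_sq.
rewrite (reindex_onto (fun k : 'rV['I_(2 * N.+1 + 1)]_nu => [ffun i => k 0 i]) (fun k => \row_i k i)); last first.
  by move=> k _; apply/ffunP => i; rewrite ffunE mxE.
apply: eq_big => k; first by apply/eqP/rowP => i; rewrite mxE ffunE.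
move=> _; rewrite big_split /p (big_pred1 k) => [|k' /=]; last first.
  by apply/eqP/eqP => [/sq_ind_inj|->].
rewrite /q; congr (_ * _).
rewrite fcharE (big_morph (@ce R) (@ceD R) (@ce0 R)) (rmorph_prod (@conjc R)).
by apply: eq_bigr => i _; rewrite mxE ffunE.
Qed.

Lemma cellf_cvg (s : V) : (forall i, [/\ - pi < s 0 i, s 0 i < pi, s 0 i != a 0 i & s 0 i != b 0 i]) ->
  cellf N s @[N --> \oo] --> (if [forall i, a 0 i <= s 0 i < b 0 i] then 1 else 0 : R).
Proof.
move=> hs.
have -> : (if [forall i, a 0 i <= s 0 i < b 0 i] then 1 else 0 : R) = \prod_i f i (s 0 i).
  case: ifP => [/forallP h|/negbT]; first by rewrite big1// => i _; rewrite /f indicE mem_set//= in_itv; exact: h.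
  rewrite negb_forall => /existsP[i hi]; rewrite (bigD1 i)//= /f indicE memNset ?mul0r//= in_itv/=.
  exact/negP.
apply: cvg_bigprod => i _; have [h1 h2 h3 h4] := hs i.
apply: (fejer_cvg P0 (@mf i) (@f1 i)); first by rewrite h1/= mulr2n addrA addNr add0r.
have fE y : f i y = ((a 0 i <= y) && (y < b 0 i))%:R by rewrite /f indicE mem_setE in_itv.
have [sa|as'] := ltrP (s 0 i) (a 0 i).
  apply: cvg_near_cst; apply: filterS (near_lt sa) => y ya.
  by rewrite !fE leNgt ya leNgt sa.
have as2 : a 0 i < s 0 i by rewrite lt_neqAle eq_sym h3.
have [sb|bs] := ltrP (s 0 i) (b 0 i).
  apply: cvg_near_cst; apply: filterS2 (near_lt sb) (near_ge as2) => y yb ya.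
  by rewrite !fE ya yb as' sb.
have bs2 : b 0 i < s 0 i by rewrite lt_neqAle eq_sym h4.
apply: cvg_near_cst; apply: filterS (near_ge bs2) => y yb.
by rewrite !fE !ltNge yb bs !andbF.
Qed.

Variable mu : {measure set BT -> \bar R}.
Hypothesis mu_rect : forall B : 'I_nu -> set R, (forall i, measurable (B i)) ->
    mu [set s | forall i, B i (s 0 i)] = (\prod_(i < nu) lam (B i))%E.

Lemma hyperplane_null (i : 'I_nu) (x : R) : mu.-negligible [set s : BT | s 0 i = x].
Proof.
exists [set s : BT | forall j, (if j == i then [set x] else setT) (s 0 j)]; split => //.
- rewrite (_ : [set s : BT | _] = [set s : BT | s 0 i = x]); last first.
    apply/seteqP; split=> s /= h; first by have := h i; rewrite eqxx.
    by move=> j; case: eqP => // ->.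
  by have := measurable_coord (R := R) i measurableT (measurable_set1 x); rewrite setTI.
- rewrite -[LHS]/(mu [set s : V | forall j, (fun j => if j == i then [set x] else setT) j (s 0 j)]).
  rewrite mu_rect => [|j]; last by case: ifP.
  rewrite (bigD1 i)//= eqxx lebesgue_measure_set1 mul0e.
  by [].
- by move=> s /= h j; case: eqP => // ->.
Qed.

(** Weights must be squared moduli of trigonometric polynomials. The squares of [cellf] are such
    weights, bounded by 1, and converge to the indicator of the cell off finitely many hyperplanes;
    dominated convergence transfers nonnegativity. *)
Lemma cell_trig_ge0 (D : set BT) (Q : V -> R) (M : R) : measurable D -> D `<=` [set s | inT s] ->
  (mu D < +oo)%E ->
  measurable_fun D (Q : BT -> R) -> (forall s, D s -> `|Q s| <= M) ->
  (forall N p, 0 <= \int[mu]_(s in D) (cabs2 (trigs N p s) * Q s)) ->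
  0 <= \int[mu]_(s in D) ((if [forall i, a 0 i <= s 0 i < b 0 i] then 1 else 0) * Q s).
Proof.
move=> mD DT fD mQ QM h.
pose F N s := cellf N s ^+ 2 * Q s.
have mc N : measurable_fun D (fun s : BT => cellf N s).
  have [p hp] := cellf_trig N.
  rewrite (_ : (fun s : BT => _) = fun s => complex.Re (trigs N.+1 p s)); last first.
    by apply: funext => s; rewrite -hp.
  have [[] //] : cbm D (fun s : BT => trigs N.+1 p s).
  by apply: cbm_sum => k; apply: cbmZ; exact: cbm_char.
have mF N : measurable_fun D (F N : BT -> R) by apply: measurable_funM => //; exact: measurable_funX.
have F0 N : 0 <= \int[mu]_(s in D) F N s.
  have [p hp] := cellf_trig N; rewrite (_ : (\int[mu]_(s in D) F N s) = \int[mu]_(s in D) (cabs2 (trigs N.+1 p s) * Q s)) ?h//.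
  by apply: eq_Rintegral => s _; rewrite -hp /F; congr (_ * _); rewrite /cabs2 /= expr0n addr0.
have ae : {ae mu, forall s : BT, forall i, [/\ - pi != s 0 i, s 0 i != a 0 i & s 0 i != b 0 i]}.
  apply: filter_forall => i.
  have h1 := hyperplane_null i (- pi); have h2 := hyperplane_null i (a 0 i); have h3 := hyperplane_null i (b 0 i).
  apply: negligibleS (negligibleU h1 (negligibleU h2 h3)) => s /= hn.
  apply: contrapT => /not_orP[n1 /not_orP[n2 n3]]; apply: hn.
  by split; apply/eqP => // /esym.
pose lm (s : V) : R := (if [forall i, a 0 i <= s 0 i < b 0 i] then 1 else 0) * Q s.
have FM N s : D s -> `|F N s| <= M.
  move=> Ds; rewrite normrM -[M]mul1r ler_pM ?QM// normrX.
  by rewrite expr_le1 ?cellf_le1.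
have mI1 : measurable [set s : BT | [forall i, a 0 i <= s 0 i < b 0 i]].
  rewrite (_ : [set s : BT | _] = \bigcap_(i in [set: 'I_nu]) ((fun s : BT => s 0 i) @^-1` `[a 0 i, b 0 i[)); last first.
    apply/seteqP; split=> s /=; first by move=> /forallP hs i _; rewrite /= in_itv; exact: hs.
    by move=> hs; apply/forallP => i; have := hs i I; rewrite /= in_itv.
  apply: fin_bigcap_measurable => // i _.
  by have := measurable_coord (R := R) i measurableT (measurable_itv `[a 0 i, b 0 i[); rewrite setTI.
have mlm : measurable_fun D (lm : BT -> R).
  apply: measurable_funM => //; apply: measurable_funTS; apply: measurable_fun_ifT => //.
  by apply: (measurable_fun_bool true); rewrite setTI; exact: mI1.
have iM : mu.-integrable D (fun=> M%:E) by apply: (@bounded_integrable _ BT _ mu D mD fD _ `|M|).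
have cFl : {ae mu, forall s, D s -> (EFin \o F N) s @[N --> \oo] --> (EFin \o lm) s}.
  apply: filterS ae => s hs Ds; apply: cvg_EFin; first by near=> N.
  apply: cvgM; last exact: cvg_cst.
  have -> : (if [forall i, a 0 i <= s 0 i < b 0 i] then 1 else 0 : R) = (if [forall i, a 0 i <= s 0 i < b 0 i] then 1 else 0) ^+ 2.
    by case: ifP => _; rewrite ?expr1n ?expr0n.
  by apply: cvgM; apply: cellf_cvg => i; have [h1 h2 h3] := hs i; have /andP[p1 p2] := DT _ Ds i; split => //;
    rewrite lt_neqAle h1.
have bFl : {ae mu, forall s N, D s -> (`|(EFin \o F N) s| <= M%:E)%E}.
  by apply: aeW => s N Ds; rewrite lee_fin FM.
have mFE N : measurable_fun D (EFin \o F N : BT -> \bar R) by apply/measurable_EFinP.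
have mlE : measurable_fun D (EFin \o lm : BT -> \bar R) by apply/measurable_EFinP.
have [_ _ cv] := dominated_convergence mD mFE mlE cFl iM bFl.
rewrite /Rintegral fine_ge0// -(cvg_lim _ cv)//; apply: lime_ge; first by apply/cvg_ex; eexists; exact: cv.
apply: nearW => N; rewrite -[leRHS]fineK ?lee_fin; first exact: F0.
apply: integrable_fin_num => //; exact: (bounded_integrable mD fD (mF N) (FM N)).
Unshelve. all: by end_near. Qed.

End FejerCells.

(** Absorption argument for the resolvent identity, with [x] and [k] the norms of the two resolvents
    and [y] that of their difference: if [h K <= 1/2], then [x <= 2 K]. *)
Lemma perturb_bound (R : realType) (h x y k K : R) : 0 <= h -> 0 <= x -> 0 <= k -> k <= K ->
  h * K <= 2^-1 -> y <= h * (x * k) -> x <= y + k -> y <= h * (2 * K ^+ 2).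
Proof.
move=> h0 x0 k0 kK hK yh xy; have K0 := le_trans k0 kK.
have h1 : h * (x * k) <= 2^-1 * x.
  by rewrite mulrCA mulrC ler_wpM2r// (le_trans _ hK)// ler_wpM2l.
have x2 : x <= 2 * K by lra.
by rewrite (le_trans yh)// ler_wpM2l// expr2 mulrA ler_pM.
Qed.

(** * Continuity of the frequency condition in omega *)

Section PsdClosed.
Variables (R : realType) (n m r : nat).
Local Notation C := R[i].
Variables (a : 'M[C]_n) (b : 'M[C]_(n, m)) (c : 'M[C]_(r, n)) (d : 'M[C]_(r, m)) (g : 'M[C]_(m, r)).
Hypothesis ha : hurwitz a.
Local Notation tf := (trf a b c d).
Local Notation rs := (res a).

Local Transparent res.
(** The resolvent identity; it gives continuity of the transfer function in the frequency without
    estimating an inverse directly. *)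
Lemma res_sub w w' : rs w' - rs w = ('i%C * (w - w')%:C%C) *: (rs w' *m rs w).
Proof.
have u := hurwitz_unit w ha; have u' := hurwitz_unit w' ha.
have -> : ('i%C * (w - w')%:C%C) *: (rs w' *m rs w) =
   rs w' *m ((('i * w%:C)%C%:M - a) - (('i * w'%:C)%C%:M - a)) *m rs w.
  rewrite opprB addrA subrK -raddfB mul_mx_scalar -scalemxAl; congr (_ *: _).
    by rewrite -mulrBr rmorphB.
by rewrite mulmxBr mulmxBl (mulVmx u') mul1mx -mulmxA (mulmxV u) mulmx1.
Qed.
Local Opaque res.

Lemma trf_cont w e : 0 < e -> exists2 dl, 0 < dl & forall w', `|w' - w| <= dl -> nrm (tf w' - tf w) <= e.
Proof.
move=> e0; pose K := nrm (rs w) + 1; have K0 : 0 < K by rewrite ltr_wpDl ?nrm_ge0.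
pose L := nrm c * (2 * K ^+ 2) * nrm b + 1.
have L0 : 0 < L.
  apply: ltr_wpDl => //; apply: mulr_ge0; last exact: nrm_ge0.
  by apply: mulr_ge0; [exact: nrm_ge0|apply: mulr_ge0 => //; exact: sqr_ge0].
exists (Num.min (2 * K)^-1 (e / L)); first by rewrite lt_min invr_gt0 mulr_gt0// divr_gt0.
move=> w'; rewrite le_min => /andP[h1 h2].
have hd : nrm (rs w' - rs w) <= `|w' - w| * (nrm (rs w') * nrm (rs w)).
  rewrite res_sub (le_trans (nrmZ _ _))// ler_pM ?n1_ge0 ?nrm_ge0 ?nrmM//.
  by rewrite distrC (_ : 'i%C * (w - w')%:C%C = (0 +i* (w - w'))%C) /n1 /= ?normr0 ?add0r//; apply: cext => /=; ring.
have x0 := nrm_ge0 (rs w'); have k0 := nrm_ge0 (rs w).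
have kK : nrm (rs w) <= K by rewrite /K lerDl.
have h3 : nrm (rs w') <= nrm (rs w' - rs w) + nrm (rs w).
  by rewrite -{1}(subrK (rs w) (rs w')) nrmD.
have hw : `|w' - w| * K <= 2^-1.
  by rewrite (le_trans (ler_wpM2r (ltW K0) h1))// invfM -mulrA mulVf ?mulr1// gt_eqF.
have hR : nrm (rs w' - rs w) <= `|w' - w| * (2 * K ^+ 2).
  exact: (perturb_bound (normr_ge0 _) x0 k0 kK hw hd h3).
have -> : tf w' - tf w = c *m (rs w' - rs w) *m b.
  have gen (x y z : 'M[C]_(r, m)) : (x + z) - (y + z) = x - y by rewrite opprD addrACA subrr addr0.
  by rewrite mulmxBr mulmxBl; exact: gen.
apply: (le_trans (nrmM _ _)); apply: (le_trans (ler_wpM2r (nrm_ge0 _) (nrmM _ _))).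
apply: (@le_trans _ _ (`|w' - w| * L)); last by rewrite -ler_pdivlMr.
apply: (@le_trans _ _ (nrm c * (`|w' - w| * (2 * K ^+ 2)) * nrm b)).
  by rewrite ler_wpM2r ?nrm_ge0// ler_wpM2l ?nrm_ge0.
rewrite (_ : nrm c * (_ * _) * _ = `|w' - w| * (nrm c * (2 * K ^+ 2) * nrm b)); last by ring.
by apply: ler_wpM2l => //; rewrite /L lerDl.
Qed.

Lemma form_cont w (x : 'cV[C]_m) e : 0 < e -> exists2 dl, 0 < dl &
  forall w' (x' : 'cV[C]_m), `|w' - w| <= dl -> nrm (x' - x) <= dl ->
  n1 ((adjmx x' *m (g *m tf w' *m x')) 0 0 - (adjmx x *m (g *m tf w *m x)) 0 0) <= e.
Proof.
move=> e0; pose X := nrm x + 1; pose F := nrm g * (nrm (tf w) + 1) + 1.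
have X1 : 1 <= X by rewrite lerDr nrm_ge0.
have F1 : 1 <= F by rewrite lerDr mulr_ge0 ?addr_ge0 ?nrm_ge0.
pose L := 2 * F * X + nrm g * X ^+ 2.
have L0 : 0 < L.
  have : 0 <= nrm g * X ^+ 2 by rewrite mulr_ge0 ?nrm_ge0 ?sqr_ge0.
  by have : 0 < F * X by [apply: mulr_gt0; lra]; rewrite /L; lra.
pose q := Num.min 1 (e / L).
have q0 : 0 < q by rewrite lt_min ltr01 divr_gt0.
have [dl dl0 hdl] := trf_cont w q0.
exists (Num.min dl q); first by rewrite lt_min dl0.
move=> w' x'; rewrite le_min => /andP[/hdl hw _]; rewrite le_min => /andP[_ hx].
have q1 : q <= 1 by rewrite ge_min lexx.
have hx' : nrm x' <= X.
  rewrite -(subrK x x') (le_trans (nrmD _ _))// /X [leRHS]addrC lerD2r.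
  exact: le_trans hx q1.
have ht : nrm (tf w') <= nrm (tf w) + 1.
  rewrite -(subrK (tf w) (tf w')) (le_trans (nrmD _ _))// [leRHS]addrC lerD2r.
  exact: le_trans hw q1.
have hF : nrm (g *m tf w') <= F.
  apply: (le_trans (nrmM _ _)); rewrite /F ler_wpDr// ler_wpM2l ?nrm_ge0//.
rewrite adj_subE (le_trans (n1D _ _))//.
have e1 : g *m tf w' *m x' - g *m tf w *m x = g *m tf w' *m (x' - x) + g *m (tf w' - tf w) *m x.
  have gen (M M' : 'M[C]_m) : M' *m x' - M *m x = M' *m (x' - x) + (M' - M) *m x.
    by rewrite mulmxBr mulmxBl addrA subrK.
  by rewrite (mulmxBr g); exact: gen.
have n1' : n1 ((adjmx (x' - x) *m (g *m tf w' *m x')) 0 0) <= q * (F * X).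
  apply: (le_trans (nrm_entry _ _ _)); apply: (le_trans (nrmM _ _)).
  rewrite nrm_adj ler_pM ?nrm_ge0// (le_trans (nrmM _ _))// ler_pM ?nrm_ge0//.
have n2' : n1 ((adjmx x *m (g *m tf w' *m x' - g *m tf w *m x)) 0 0) <= X * (F * q + nrm g * q * X).
  apply: (le_trans (nrm_entry _ _ _)); apply: (le_trans (nrmM _ _)).
  rewrite nrm_adj e1 ler_pM ?nrm_ge0 ?lerDl//; apply: (le_trans (nrmD _ _)); apply: lerD.
    by rewrite (le_trans (nrmM _ _))// ler_pM ?nrm_ge0.
  rewrite (le_trans (nrmM _ _))// ler_pM ?nrm_ge0 ?lerDl// (le_trans (nrmM _ _))// ler_wpM2l ?nrm_ge0//.
have qL : q * L <= e by rewrite -ler_pdivlMr// ge_min lexx orbT.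
have -> : e = q * (F * X) + X * (F * q + nrm g * q * X) + (e - q * L) by rewrite /L; ring.
by rewrite (le_trans (lerD n1' n2'))// lerDl subr_ge0.
Qed.

(** Continuity of the form in frequency and vector. It serves both directions: to pass from rational
    data to all, and from one good frequency in each small interval to all. *)
Lemma psd_dense : (forall w (x : 'cV[C]_m) e, 0 < e -> exists w' (x' : 'cV[C]_m),
    [/\ `|w' - w| <= e, nrm (x' - x) <= e & 0 <= complex.Re ((adjmx x' *m (g *m tf w' *m x')) 0 0)]) ->
  forall w, psdat a b c d g w.
Proof.
move=> h w; apply/psdatP => x; rewrite leNgt; apply/negP => lt0.
set y := complex.Re _ in lt0; have e0 : 0 < - y / 2 by rewrite divr_gt0// oppr_gt0.
have [dl dl0 hdl] := form_cont w x e0; have [w' [x' [h1 h2 h3]]] := h w x dl dl0.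
have := Re_close (hdl w' x' h1 h2); have := le_trans (le_Re_n1 _) (hdl w' x' h1 h2).
by rewrite cReD cReN ler_norml -/y => /andP[_ h4] _; lra.
Qed.
End PsdClosed.

Section Necessity.
Variables (R : realType) (nu : nat).
Hypothesis nu0 : (0 < nu)%N.
Local Notation C := R[i].
Local Notation V := 'rV[R]_nu.
Local Notation BT := (g_sigma_algebraType (@boxes R nu)).
Local Notation lam := (@lebesgue_measure R).
Local Notation TT := ([set s | inT s] : set BT).
Variables (mu : {measure set BT -> \bar R}) (D : set BT) (tv : R).
Hypotheses (mD : measurable D) (fD : (mu D < +oo)%E) (tv0 : 0 < tv).
Hypothesis mu_rect : forall B : 'I_nu -> set R, (forall i, measurable (B i)) ->
    mu [set s | forall i, B i (s 0 i)] = (\prod_(i < nu) lam (B i))%E.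
Hypotheses (DT : D `<=` TT) (TD : mu (TT `\` D) = 0%E).
Hypothesis orth : forall l : Zl nu, Cint mu D (fun s => fchar l s) = if l == 0 then tv%:C%C else 0.
Local Notation symM := (symM mu D).
Variables (n m r : nat) (A : Zl nu -> 'M[R]_n) (B : Zl nu -> 'M[R]_(n, m))
  (Ck : Zl nu -> 'M[R]_(r, n)) (Dk : Zl nu -> 'M[R]_(r, m)) (G : Zl nu -> 'M[R]_(m, r))
  (As : V -> 'M[C]_n) (Bs : V -> 'M[C]_(n, m)) (Cs : V -> 'M[C]_(r, n))
  (Ds : V -> 'M[C]_(r, m)) (Gs : V -> 'M[C]_(m, r)).
Hypotheses (sA : symM A As) (sB : symM B Bs) (sC : symM Ck Cs) (sD : symM Dk Ds) (sG : symM G Gs).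
Local Notation qs T s := (qf (As s) (Bs s) (Cs s) (Ds s) (Gs s) T).
Local Notation power := (power mu D tv As Bs Cs Ds Gs).
Hypothesis hA : forall s, inT s -> hurwitz (As s).
Hypothesis pas : forall T : R, 0 <= T -> forall N u, fin_input N u -> admissible u ->
  0 <= \int[lam]_(t in `[0, T]) power N u u t.

Lemma trigs1 (s : V) : trigs 0 (fun k : Zl nu => (k == 0)%:R) s = 1 :> C.
Proof.
have z : (0 : Zl nu) \in boxseq nu 0 by rewrite mem_boxseq; apply/forallP => i; rewrite mxE.
rewrite /trigs (bigD1_seq 0)//= ?boxseq_uniq// big1 ?addr0 ?fchar0 ?eqxx ?mulr1// => k /negPf ->.
by rewrite mul0r.
Qed.

(** Passivity gives nonnegative integrals of [Re q] against trigonometric weights, hence over every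
    grid cell, hence [Re q >= 0] almost everywhere by [cell_integral_ge0]. *)
Lemma work_null (T w : R) (c0 : 'cV[C]_m) : 0 <= T ->
  null_rV [set s | D s /\ complex.Re (qs T s (ev w c0) (ev w c0)) < 0].
Proof.
move=> T0; pose q (s : V) := complex.Re (qs T s (ev w c0) (ev w c0)).
have hp N p := trig_work_ge0 mD fD tv0 orth sA sB sC sD sG N p w c0 (pas T0) T0.
(* The constant weight 1 shows that the form itself is measurable and bounded on [D]. *)
have [[[mq _] [M hM]] _] := hp 0%N (fun k => (k == 0)%:R).
have mq' : measurable_fun D (q : BT -> R).
  apply: eq_measurable_fun mq => s _; rewrite trigs1.
  by rewrite cRe_realM /cabs2 /= expr1n expr0n /= addr0 mul1r.
have qM s : D s -> `|q s| <= `|M|.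
  move=> Dss; apply: (le_trans (le_Re_n1 _)); apply: (le_trans _ (ler_norm _)).
  by apply: (le_trans _ (hM s Dss)); rewrite trigs1 /cabs2 /= expr1n expr0n /= addr0 mul1r.
pose Q : V -> R := (q : BT -> R) \_ D.
have QE s : Q s = if s \in D then q s else 0 by rewrite /Q /patch.
apply: null_sub (cell_integral_ge0 nu0 mu_rect (Q := Q) (M := `|M|) _ _ _).
- by move=> s [Dss qs0]; split; [exact: DT|rewrite QE mem_set].
- by apply/(measurable_restrictT _ mD).
- by move=> s; rewrite QE; case: ifPn => [/set_mem/qM//|_]; rewrite normr0.
move=> N c N0 _.
have := cell_trig_ge0 (@cella R nu N c) (@cellb R nu N c) mu_rect mD DT fD mq' qM (fun N p => (hp N p).2).
rewrite /Rintegral integral_mkcond [in X in _ -> X]integral_mkcond.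
rewrite (_ : (_ \_ D) = ((fun s => (Q s)%:E) \_ [set s : BT | gridc N s = c])) //.
apply: funext => s; rewrite /patch QE.
have -> : (s \in [set s : BT | gridc N s = c]) = [forall i, @cella R nu N c 0 i <= s 0 i < @cellb R nu N c 0 i].
  apply/idP/forallP => [/set_mem/(gridcP _ _ N0)//|h]; apply/mem_set/(gridcP _ _ N0); exact: h.
by case: ifP => _; case: ifP => _; rewrite ?mul1r ?mul0r.
Qed.

Lemma cplx_rat_dense q (x : 'cV[C]_q) (e : R) : 0 < e -> exists z : 'cV[rat * rat]_q,
  nrm (\col_b ((ratr (z b 0).1 +i* ratr (z b 0).2)%C : C) - x) <= e.
Proof.
move=> e0; pose dl := e / (q.+1)%:R / 2; have dl0 : 0 < dl by rewrite !divr_gt0.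
have h (y : R) : {t : rat | `|ratr t - y| <= dl}.
  have yy : y - dl < y + dl by rewrite ltrBlDr -addrA ltrDl addr_gt0.
  apply: cid; have [t] := rat_in_itvoo yy.
  rewrite in_itv/= => /andP[h1 h2]; exists t; rewrite ler_norml; apply/andP; split; lra.
exists (\col_b (sval (h (complex.Re (x b 0))), sval (h (complex.Im (x b 0))))).
apply: (@le_trans _ _ (\sum_(b < q) (e / (q.+1)%:R))).
  apply: ler_sum => b _; rewrite big_ord1 !mxE /n1 cReD cImD cReN cImN /=.
  by apply: (le_trans (lerD (svalP (h _)) (svalP (h _)))); rewrite -splitr.
rewrite sumr_const card_ord -[leLHS]mulr_natr -mulrA ler_piMr ?(ltW e0)// mulrC ler_pdivrMr//.
by rewrite mul1r ler_nat.
Qed.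

(** Countably many exceptional sets, one for each integer horizon, rational frequency and vector
    with rational parts, together with the complement of [D]. Off their union [freq_necessary]
    applies to all rational data at once. *)
Lemma psd_null : exists N0 : set V, null_rV N0 /\
  forall s, inT s -> ~ N0 s -> forall w, psdat (As s) (Bs s) (Cs s) (Ds s) (Gs s) w.
Proof.
pose cz (z : 'cV[rat * rat]_m) : 'cV[C]_m := \col_b ((ratr (z b 0).1 +i* ratr (z b 0).2)%C : C).
pose bad (i : nat * rat * 'cV[rat * rat]_m) : set V :=
  [set s | D s /\ complex.Re (qs i.1.1%:R s (ev (ratr i.1.2) (cz i.2)) (ev (ratr i.1.2) (cz i.2))) < 0].
pose N0 k : set V := if k is k'.+1 then (if unpickle k' is Some i then bad i else set0) else TT `\` D.
exists (\bigcup_k N0 k); split.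
  apply: null_bigcup => -[|k] /=.
    apply: (mu0_null nu0 mu_rect _ _ TD) => [|s []//].
    by apply: measurableD => //; exact: measurable_inT.
  case: (unpickle k) => [i|]; first by apply: work_null; exact: ler0n.
  by apply: (@null_sub _ _ _ (bad (0%N, 0, 0))); [move=> s []|apply: work_null; exact: ler0n].
move=> s sT sN; have Dss : D s.
  by apply: contrapT => nD; apply: sN; exists 0%N.
apply: (psd_dense (hA sT)) => w x e e0.
have [z hz] := cplx_rat_dense x e0.
have ww : w - e < w + e by rewrite ltrBlDr -addrA ltrDl addr_gt0.
have [t] := rat_in_itvoo ww.
rewrite in_itv/= => /andP[h1 h2]; exists (ratr t), (cz z); split => //.
  by rewrite ler_norml; apply/andP; split; lra.
apply: (freq_necessary (hA sT)) => N; rewrite leNgt; apply/negP => lt0; apply: sN.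
by exists (pickle (N, t, z)).+1 => //=; rewrite pickleK.
Qed.

End Necessity.

(** * Sufficiency *)

Section L2Time.
Variables (R : realType) (nu : nat).
Local Notation lam := (@lebesgue_measure R).

Lemma l2sq_ge0 q (v : Zl nu -> 'cV[R]_q) : (0 <= l2sq v)%E.
Proof. by apply: esum_ge0 => k _; rewrite lee_fin sqnormR_ge0. Qed.

Lemma l2sq_cvg q (v : Zl nu -> 'cV[R]_q) :
  (bsum N (fun k => sqnormR (v k)))%:E @[N --> \oo] --> l2sq v.
Proof.
have -> : l2sq v = ereal_sup (range (fun N => (bsum N (fun k => sqnormR (v k)))%:E)).
  apply/eqP; rewrite eq_le; apply/andP; split; last first.
    by apply: ge_ereal_sup => _ [N _ <-]; apply: bsum_le_esum => k; exact: sqnormR_ge0.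
  have h N : ((bsum N (fun k => sqnormR (v k)))%:E <= ereal_sup (range (fun N => (bsum N (fun k => sqnormR (v k)))%:E)))%E.
    by apply: ereal_sup_ubound; exists N.
  move: h; case: (ereal_sup _) => [c h| |h]; last by have := h 0%N.
    by apply: esum_le_bsum => [k|N]; [exact: sqnormR_ge0|rewrite -lee_fin].
  by rewrite leey.
apply: ereal_nondecreasing_cvgn => M N MN; rewrite lee_fin.
by apply: le_bsum_box => // k; exact: sqnormR_ge0.
Qed.

Lemma l2sq_l2b q (v : Zl nu -> 'cV[R]_q) : (l2sq v < +oo)%E -> l2b v (fine (l2sq v)).
Proof.
move=> h N; rewrite -lee_fin fineK ?ge0_fin_numE ?l2sq_ge0//.
by apply: bsum_le_esum => k; exact: sqnormR_ge0.
Qed.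

Lemma measurable_bsum (D : set R) q N (v : R -> Zl nu -> 'cV[R]_q) :
  (forall k i, measurable_fun D (fun t => v t k i 0)) ->
  measurable_fun D (fun t => bsum N (fun k => sqnormR (v t k))).
Proof.
move=> mv; apply: measurable_sum => k; under eq_fun do rewrite sqnormR_col.
by apply: measurable_sum => i; exact: measurable_funX.
Qed.

Lemma measurable_l2sq (D : set R) q (v : R -> Zl nu -> 'cV[R]_q) : measurable D ->
  (forall k i, measurable_fun D (fun t => v t k i 0)) -> measurable_fun D (fun t => l2sq (v t)).
Proof.
move=> mD mv; apply: (emeasurable_fun_cvg (fun N t => (bsum N (fun k => sqnormR (v t k)))%:E)).
  by move=> N; apply/measurable_EFinP; exact: measurable_bsum.
by move=> t _; exact: l2sq_cvg.
Qed.

Variable m : nat.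
Definition trunc N (u : R -> Zl nu -> 'cV[R]_m) t k : 'cV[R]_m :=
  if k \in boxseq nu N then \col_b (if `|u t k b 0| <= N%:R then u t k b 0 else 0) else 0.

Section trunc.
Variable u : R -> Zl nu -> 'cV[R]_m.
Hypothesis mu : forall k i, measurable_fun [set: R] (fun t => u t k i 0).

Lemma measurable_trunc N k i : measurable_fun [set: R] (fun t => trunc N u t k i 0).
Proof.
rewrite /trunc; case: (boolP (k \in boxseq nu N)) => kN; under eq_fun do rewrite mxE; last exact: measurable_cst.
apply: measurable_fun_ifT => //; apply: measurable_fun_ler => //; exact: measurableT_comp.
Qed.

Lemma trunc_fin N : fin_input N (trunc N u).
Proof.
split=> [t k kN|k b T]; first by rewrite /trunc (negPf kN).
split; first by apply: cmf_real; apply: measurable_funTS; exact: measurable_trunc.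
exists N%:R => t _; rewrite n1_real /trunc; case: ifPn => _; rewrite mxE ?normr0//.
by case: ifPn => //; rewrite normr0.
Qed.

Lemma sqnormR_trunc N t k : sqnormR (trunc N u t k) <= sqnormR (u t k).
Proof.
rewrite /trunc; case: ifPn => _; last by rewrite sqnormR0 sqnormR_ge0.
rewrite !sqnormR_col; apply: ler_sum => b _; rewrite mxE; case: ifPn => //.
by rewrite expr0n sqr_ge0.
Qed.

Lemma sqnormR_truncB N t k : sqnormR (u t k - trunc N u t k) <= sqnormR (u t k).
Proof.
rewrite /trunc; case: ifPn => _; last by rewrite subr0.
rewrite !sqnormR_col; apply: ler_sum => b _; rewrite !mxE; case: ifPn => _; last by rewrite subr0.
by rewrite subrr expr0n sqr_ge0.
Qed.

Lemma le_l2sq q (v w : Zl nu -> 'cV[R]_q) : (forall k, sqnormR (v k) <= sqnormR (w k)) -> (l2sq v <= l2sq w)%E.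
Proof. by move=> h; apply: le_esum => k _; rewrite lee_fin. Qed.

(** Once [N >= max(1, U)], with [U] the squared norm, every entry satisfies [u^2 <= U <= N^2]: the
    amplitude cut is inactive and the error is the tail outside the cube. *)
Lemma trunc_cvg t : (l2sq (u t) < +oo)%E ->
  l2sq (fun k => u t k - trunc N u t k) @[N --> \oo] --> 0%E.
Proof.
move=> fu; have hU := l2sq_l2b fu; set U := fine _ in hU.
have U0 : 0 <= U by rewrite fine_ge0// l2sq_ge0.
have ub N k b : U <= N%:R -> (0 < N)%N -> `|u t k b 0| <= N%:R.
  move=> UN N0; have [L hL] := boxseq_exhaust [:: k].
  have kL : k \in boxseq nu L by apply: hL; rewrite inE.
  have h1 : u t k b 0 ^+ 2 <= U.
    apply: le_trans (hU L); rewrite /bsum (bigD1_seq k)//= ?boxseq_uniq// sqnormR_col (bigD1 b)//= -addrA lerDl.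
    by rewrite addr_ge0// sumr_ge0// => k' _; rewrite ?sqr_ge0 ?sqnormR_ge0.
  rewrite -(@ler_pXn2r _ 2) ?nnegrE//; rewrite real_normK ?num_real//; apply: (le_trans h1); apply: (le_trans UN).
  by rewrite expr2 ler_peMl// ler1n.
have tl N : U <= N%:R -> (0 < N)%N ->
    (l2sq (fun k => (u t k - trunc N u t k)%R) <= (U - bsum N (fun k => sqnormR (u t k)))%:E)%E.
  move=> UN N0; apply: esum_le_bsum => [k|L]; first exact: sqnormR_ge0.
  rewrite lerBrDr.
  pose z k := if k \in boxseq nu N then sqnormR (u t k) else 0.
  have z0 k : 0 <= z k by rewrite /z; case: ifP => // _; exact: sqnormR_ge0.
  have -> : bsum N (fun k => sqnormR (u t k)) = bsum N z by apply: eq_big_seq => k kN; rewrite /z kN.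
  apply: le_trans (hU (maxn L N)).
  apply: (@le_trans _ _ (bsum (maxn L N) (fun k => sqnormR (u t k - trunc N u t k) + z k))).
    rewrite bsumD; apply: lerD; apply: le_bsum_box; rewrite ?leq_maxl ?leq_maxr// => k; exact: sqnormR_ge0.
  apply: le_bsum => k; rewrite /z /trunc; case: ifPn => kN; last by rewrite subr0 addr0.
  rewrite (_ : u t k - _ = 0) ?sqnormR0 ?add0r//; apply/colP => b; rewrite !mxE ub// subrr.
  by [].
have cv : (U - bsum N (fun k => sqnormR (u t k)))%:E @[N --> \oo] --> 0%E.
  have h := @l2sq_cvg _ (u t); have fU : l2sq (u t) = U%:E by rewrite fineK// ge0_fin_numE// l2sq_ge0.
  have h' : bsum N (fun k => sqnormR (u t k)) @[N --> \oo] --> U.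
    by move: h; rewrite fU => /fine_cvg.
  apply: cvg_EFin; first by near=> N.
  by rewrite -[0](subrr U); apply: cvgB => //; exact: cvg_cst.
apply: (squeeze_cvge _ (cvg_cst 0%E) cv).
near=> N; rewrite l2sq_ge0/=; apply: tl; near: N; last by exists 1%N.
exists (Num.truncn U).+1 => // N /= hN; apply: (le_trans (ltW (truncnS_gt U))); by rewrite ler_nat.
Unshelve. all: by end_near. Qed.

Lemma trunc_int T e : admissible u -> 0 < T -> 0 < e -> exists N,
  (\int[lam]_(t in `[0%R, T]) l2sq (fun k => (u t k - trunc N u t k)%R) <= e%:E)%E.
Proof.
move=> [_ ha] T0 e0; have hT := ha T T0.
have mI' := mI 0 T.
have mw N : measurable_fun ([set` `[0, T]] : set R) (fun t => l2sq (fun k => u t k - trunc N u t k)).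
  apply: measurable_l2sq => // k i; apply: measurable_funTS; under eq_fun do rewrite !mxE.
  by apply: measurable_funB => //; exact: measurable_trunc.
have mU : measurable_fun ([set` `[0, T]] : set R) (fun t => l2sq (u t)).
  by apply: measurable_l2sq => // k i; apply: measurable_funTS.
have iU : lam.-integrable ([set` `[0, T]] : set R) (fun t => l2sq (u t)).
  apply/integrableP; split => //; under eq_integral do rewrite gee0_abs ?l2sq_ge0//.
  exact: hT.
have ae1 := integrable_ae mI' iU.
have c0 : {ae lam, forall t, ([set` `[0, T]] : set R) t ->
    l2sq (fun k => u t k - trunc N u t k) @[N --> \oo] --> 0%E}.
  by apply: filterS ae1 => t h Dt; apply: trunc_cvg; rewrite -ge0_fin_numE ?l2sq_ge0// h.
have bd : {ae lam, forall t N, ([set` `[0, T]] : set R) t ->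
    (`|l2sq (fun k => (u t k - trunc N u t k)%R)| <= l2sq (u t))%E}.
  by apply: aeW => t N _; rewrite gee0_abs ?l2sq_ge0//; apply: le_l2sq => k; exact: sqnormR_truncB.
have [_ _] := dominated_convergence mI' mw (measurable_cst 0%E) c0 iU bd.
rewrite integral0 => cv.
have /cv : nbhs (0%E : \bar R) (fun x => (x < e%:E)%E) by apply: open_ereal_lt'; rewrite lte_fin.
by move=> [N _ hN]; exists N; apply/ltW/hN => /=.
Qed.
End trunc.
End L2Time.

(** * A Gronwall inequality for square-summable families *)

Section Gronwall.
Variables (R : realType) (nu n : nat).
Local Notation lam := (@lebesgue_measure R).

(** Integrate [2 h g <= g^2 + h^2] with [h] the mean of [g]. The right-hand side is extended real
    because [g^2] need not be integrable. *)
Lemma sqr_integral_le (g : R -> R) (t : R) : 0 < t ->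
  lam.-integrable ([set` `[0, t]] : set R) (fun x => (g x)%:E) ->
  ((fine (\int[lam]_(x in `[0%R, t]) (g x)%:E) ^+ 2)%:E <=
   t%:E * \int[lam]_(x in `[0%R, t]) (g x ^+ 2)%:E)%E.
Proof.
move=> t0 ig; set c := fine _.
have mI' := mI 0 t; have mg : measurable_fun ([set` `[0, t]] : set R) g.
  by apply/measurable_EFinP; case/integrableP: ig.
have mg2 : measurable_fun ([set` `[0, t]] : set R) (fun x => g x ^+ 2) by exact: measurable_funX.
have g20 : (0 <= \int[lam]_(x in `[0%R, t]) (g x ^+ 2)%:E)%E.
  by apply: integral_ge0 => x _; rewrite lee_fin sqr_ge0.
have [fin|inf] := ltP (\int[lam]_(x in `[0%R, t]) (g x ^+ 2)%:E)%E +oo%E; last first.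
  by move: inf; rewrite leye_eq => /eqP ->; rewrite gt0_muley ?leey// lte_fin.
have i2 : lam.-integrable ([set` `[0, t]] : set R) (EFin \o (fun x => g x ^+ 2)).
  apply/integrableP; split; first exact/measurable_EFinP.
  by under eq_integral do rewrite /= ger0_norm ?sqr_ge0//.
pose h := c / t; have iy : lam.-integrable ([set` `[0, t]] : set R) (EFin \o (fun x => (2 * h) * g x)).
  exact: integrableZr.
have ic : lam.-integrable ([set` `[0, t]] : set R) (EFin \o (fun x => h ^+ 2)).
  by apply: (bounded_integrable (mI 0 t) (lam_fin 0 t) (M := `|h ^+ 2|)) => //; exact: measurable_cst.
have : \int[lam]_(x in `[0, t]) ((2 * h) * g x) <= \int[lam]_(x in `[0, t]) (g x ^+ 2 + h ^+ 2).
  apply: (le_Rintegral mI' iy); first by have := integrableD mI' i2 ic; apply: eq_integrable => // x _ /=; rewrite EFinD.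
  by move=> x _; have := sqr_ge0 (g x - h); rewrite sqrrB; lra.
rewrite (RintegralZl _ mI' ig) (RintegralD mI' i2 ic) (Rintegral_cst _ mI') (fine_lam (ltW t0)) subr0.
rewrite -[X in X%:E]/(c ^+ 2) -[X in (_ <= _ * X)%E]fineK ?ge0_fin_numE// -EFinM lee_fin.
move=> hI; have {}hI : 2 * h * c <= fine (\int[lam]_(x in `[0%R, t]) (g x ^+ 2)%:E)%E + h ^+ 2 * t := hI.
move: (fine (\int[lam]_(x in `[0%R, t]) (g x ^+ 2)%:E)%E) hI => I hI.
have ch : c = h * t by rewrite /h divfK// gt_eqF.
rewrite ch in hI *; nra.
Qed.

Lemma int_expR (L t : R) : 0 < L -> 0 <= t ->
  (\int[lam]_(x in `[0%R, t]) (expR (L * x))%:E <= (L^-1 * expR (L * t))%:E)%E.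
Proof.
move=> L0; rewrite le_eqVlt => /predU1P[<-|t0].
  rewrite set_itv1 integral_set1 lee_fin mulr_ge0 ?invr_ge0 ?(ltW L0) ?expR_ge0//.
have dF (x : R) : is_derive x 1 (fun x : R => L^-1 * expR (L * x)) (expR (L * x)).
  have -> : expR (L * x) = L^-1 *: (expR (L * x) * (L *: 1)).
    by rewrite /GRing.scale/= mulr1 mulrCA mulVf ?mulr1// gt_eqF.
  have -> : (fun x : R => L^-1 * expR (L * x)) = L^-1 *: (expR \o (fun x : R => L *: x)) by [].
  apply: is_deriveZ; apply: is_derive1_comp.
have cf (x : R) : {for x, continuous (fun x : R => expR (L * x))}.
  apply: continuous_comp; last exact: continuous_expR.
  by apply: cvgM; [exact: cvg_cst|exact: cvg_id].
have cF (x : R) : {for x, continuous (fun x : R => L^-1 * expR (L * x))}.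
  by apply: cvgM; [exact: cvg_cst|exact: cf].
rewrite (@continuous_FTC2 _ _ (fun x : R => L^-1 * expR (L * x)))//.
- by rewrite -EFinB lee_fin gerBl mulr_ge0 ?invr_ge0 ?(ltW L0) ?expR_ge0.
- by apply: continuous_subspaceT => x; exact: cf.
- split.
  + by move=> x _; have [] := dF x.
  + by apply: cvg_at_right_filter; exact: cF.
  + by apply: cvg_at_left_filter; exact: cF.
- by move=> x _; rewrite derive1E; have [_ ->] := dF x.
Qed.

Variables (e g : R -> Zl nu -> 'cV[R]_n) (om : R -> \bar R) (T L W M : R).
Hypotheses (T0 : 0 < T) (L0 : 0 < L) (W0 : 0 < W) (M0 : 0 <= M).
Hypothesis eM : forall t, 0 <= t <= T -> l2b (e t) M.
Hypothesis eg : forall t, 0 <= t <= T -> forall j i,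
  lam.-integrable ([set` `[0, t]] : set R) (fun x => (g x j i 0)%:E) /\
  e t j i 0 = fine (\int[lam]_(x in `[0%R, t]) (g x j i 0)%:E)%E.
Hypothesis mom : measurable_fun ([set` `[0, T]] : set R) om.
Hypothesis om0 : forall t, (0 <= om t)%E.
Hypothesis omW : (\int[lam]_(x in `[0%R, T]) om x <= W%:E)%E.
Hypothesis g_le : forall t K, 0 <= t <= T -> l2b (e t) K ->
  forall N, ((bsum N (fun j => sqnormR (g t j)))%:E <= (L * K)%:E + om t)%E.

Lemma gronwall_step N t : 0 < t <= T ->
  ((bsum N (fun j => sqnormR (e t j)))%:E <=
   t%:E * \int[lam]_(x in `[0%R, t]) (bsum N (fun j => sqnormR (g x j)))%:E)%E.
Proof.
move=> /andP[t0 tT]; have tT' : 0 <= t <= T by rewrite (ltW t0).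
have mg j i : measurable_fun ([set` `[0, t]] : set R) (fun x => (g x j i 0 ^+ 2)%:E).
  have /integrableP[/measurable_EFinP mg _] := (eg tT' j i).1.
  by apply/measurable_EFinP; exact: measurable_funX.
have E x : ((bsum N (fun j => sqnormR (g x j)))%:E = \sum_(j <- boxseq nu N) \sum_i (g x j i 0 ^+ 2)%:E)%E.
  by rewrite /bsum -sumEFin; apply: eq_bigr => j _; rewrite sqnormR_col -sumEFin.
under eq_integral do rewrite E.
rewrite ge0_integral_sum//; last 2 first.
- by move=> j; apply: emeasurable_sum => i; exact: mg.
- by move=> j x _; apply: sume_ge0 => i _; rewrite lee_fin sqr_ge0.
rewrite ge0_sume_distrr; last first.
  by move=> j _; apply: integral_ge0 => x _; apply: sume_ge0 => i _; rewrite lee_fin sqr_ge0.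
rewrite /bsum -sumEFin; apply: lee_sum => j _.
rewrite ge0_integral_sum//; last 2 first.
- by move=> i; exact: mg.
- by move=> i x _; rewrite lee_fin sqr_ge0.
rewrite ge0_sume_distrr; last by move=> i _; apply: integral_ge0 => x _; rewrite lee_fin sqr_ge0.
rewrite sqnormR_col -sumEFin; apply: lee_sum => i _; rewrite (eg tT' j i).2.
by apply: sqr_integral_le => //; exact: (eg tT' j i).1.
Qed.

(** At this rate [T * L] times the integral of [e^(c x)] over [[0, t]] is at most [e^(c t) / 2], so
    each pass halves the constant [K]. *)
Let c := 2 * (T * L).
Let c0 : 0 < c. Proof. by rewrite !mulr_gt0. Qed.

(* Comparing with multiples of e^(c t) avoids any measurability of the l2 norm of e. *)
Lemma gronwall_iter K : 0 <= K -> (forall t, 0 <= t <= T -> l2b (e t) (K * expR (c * t))) ->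
  forall t, 0 <= t <= T -> l2b (e t) ((K / 2 + T * W) * expR (c * t)).
Proof.
move=> K0 hK t /andP[t0 tT] N.
have e1 : 1 <= expR (c * t) by rewrite -expR0 ler_expR mulr_ge0 ?(ltW c0).
move: t0; rewrite le_eqVlt => /predU1P[t0|t0].
  have z0 j : sqnormR (e t j) = 0.
    have tT' : 0 <= t <= T by rewrite -t0 lexx ltW.
    rewrite sqnormR_col big1// => i _; rewrite (eg tT' j i).2.
    by rewrite -t0 set_itv1 integral_set1 expr0n.
  rewrite /bsum big1 => [|j _]; last exact: z0.
  by rewrite mulr_ge0 ?expR_ge0// addr_ge0 ?divr_ge0// mulr_ge0// ltW.
rewrite -lee_fin; apply: (le_trans (gronwall_step N _)); first by rewrite t0.
have tT' : 0 <= t <= T by rewrite (ltW t0).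
have sub x : ([set` `[0, t]] : set R) x -> 0 <= x <= T.
  by rewrite /= in_itv/= => /andP[-> /le_trans]; apply.
have mt := mI 0 t.
have mexp : measurable_fun ([set` `[0, t]] : set R) (fun x => (L * (K * expR (c * x)))%:E).
  apply/measurable_EFinP; apply: measurable_funM => //; apply: measurable_funM => //.
  by apply: measurableT_comp => //; apply: measurable_funM.
have mo : measurable_fun ([set` `[0, t]] : set R) om.
  by apply: measurable_funS mom => // x /sub; rewrite /= in_itv.
have h1 : (\int[lam]_(x in `[0%R, t]) (bsum N (fun j => sqnormR (g x j)))%:E <=
   \int[lam]_(x in `[0%R, t]) ((L * (K * expR (c * x)))%:E + om x))%E.
  by apply: le_integral_pw => x /sub xT; exact: (g_le xT (hK x xT)).
apply: (le_trans (lee_wpmul2l _ h1)); first by rewrite lee_fin ltW.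
rewrite ge0_integralD//; last first.
  by move=> x _; rewrite lee_fin !mulr_ge0 ?expR_ge0// ltW.
have i1 : (\int[lam]_(x in `[0%R, t]) (L * (K * expR (c * x)))%:E <= (L * K * (c^-1 * expR (c * t)))%:E)%E.
  under eq_integral do rewrite mulrA EFinM.
  rewrite ge0_integralZl_EFin//; last 2 first.
  - by apply/measurable_EFinP; apply: measurableT_comp => //; apply: measurable_funM.
  - by rewrite mulr_ge0// ltW.
  by rewrite [leRHS]EFinM lee_wpmul2l ?lee_fin ?mulr_ge0 ?(ltW L0)//; apply: int_expR => //; exact: ltW.
have i2 : (\int[lam]_(x in `[0%R, t]) om x <= W%:E)%E.
  apply: le_trans omW; apply: ge0_subset_integral => // x /sub; by rewrite /= in_itv.
apply: (le_trans (lee_wpmul2l _ (leeD i1 i2))); first by rewrite lee_fin ltW.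
rewrite -EFinD -EFinM lee_fin mulrDl.
have -> : L * K * (c^-1 * expR (c * t)) = K / 2 / T * expR (c * t).
  by rewrite /c; field; rewrite !gt_eqF.
rewrite mulrDr; apply: lerD.
  have tT1 : t / T <= 1 by rewrite ler_pdivrMr// mul1r.
  rewrite (_ : t * _ = (t / T) * (K / 2 * expR (c * t))); last by ring.
  by apply: ler_piMl => //; rewrite mulr_ge0 ?expR_ge0// divr_ge0.
rewrite -mulrA; apply: ler_pM; rewrite ?(ltW t0) ?(ltW W0)//.
by rewrite ler_peMr// ltW.
Qed.

(** The map [K -> K / 2 + T W] has the fixed point [2 T W]. Starting from the a priori bound [M],
    finitely many passes bring the excess below [2 T W]; the result no longer depends on [M]. *)
Lemma gronwall_l2 t : 0 <= t <= T -> l2b (e t) (4 * T * W * expR (c * T)).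
Proof.
move=> tT; have it k : forall t, 0 <= t <= T -> l2b (e t) ((M / 2 ^+ k + 2 * (T * W)) * expR (c * t)).
  elim: k => [|k ih] s sT N.
    apply: (le_trans (eM sT N)); rewrite expr0 divr1.
    have e1 : 1 <= expR (c * s) by case/andP: sT => s0 _; rewrite -expR0 ler_expR mulr_ge0 ?(ltW c0).
    have TW : 0 <= T * W by rewrite mulr_ge0// ltW.
    by rewrite -[leLHS]mulr1 ler_pM// lerDl mulr_ge0.
  have K0 : 0 <= M / 2 ^+ k + 2 * (T * W) by rewrite addr_ge0 ?divr_ge0 ?exprn_ge0// !mulr_ge0// ltW.
  have -> : M / 2 ^+ k.+1 + 2 * (T * W) = (M / 2 ^+ k + 2 * (T * W)) / 2 + T * W.
    by rewrite exprS; field; rewrite expf_neq0.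
  exact: gronwall_iter.
have TW : 0 < T * W by rewrite mulr_gt0.
pose k := (Num.truncn (M / (2 * (T * W)))).+1.
have hk : M / 2 ^+ k <= 2 * (T * W).
  rewrite ler_pdivrMr ?exprn_gt0// mulrC -ler_pdivrMr ?mulr_gt0//.
  apply: (le_trans (ltW (truncnS_gt _))); rewrite -natrX ler_nat; by apply: ltnW; apply: ltn_expl.
move=> N; apply: (le_trans (it k t tT N)); apply: ler_pM; rewrite ?expR_ge0//.
- by rewrite addr_ge0 ?divr_ge0 ?exprn_ge0// mulr_ge0// ltW.
- lra.
- by rewrite ler_expR ler_wpM2l ?(ltW c0)//; case/andP: tT.
Qed.
End Gronwall.

Lemma dot_telescope (R : realType) m (a b x y : 'cV[R]_m) :
  (a^T *m x) 0 0 = ((a - b)^T *m x) 0 0 + ((b^T *m (x - y)) 0 0 + (b^T *m y) 0 0).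
Proof.
have e : a^T *m x = (a - b)^T *m x + (b^T *m (x - y) + b^T *m y).
  by rewrite linearB/= mulmxBl mulmxBr subrK subrK.
by rewrite e mxE; congr (_ + _); rewrite mxE.
Qed.

Lemma close_arith (R : realType) (d U Y om L z1 z2 z3 : R) :
  `|z1| <= d^-1 * om + d^-1^-1 * Y -> `|z2| <= d * U + d^-1 * L ->
  z3 - (d * (U + Y) + d^-1 * (om + L)) <= z1 + (z2 + z3).
Proof. rewrite invrK !ler_norml => /andP[h1 _] /andP[h2 _]; lra. Qed.

(** * Passivity of the network from the frequency condition *)

Section Sufficiency.
Variables (R : realType) (nu : nat).
Local Notation C := R[i].
Local Notation V := 'rV[R]_nu.
Local Notation BT := (g_sigma_algebraType (@boxes R nu)).
Local Notation lam := (@lebesgue_measure R).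
Variables (mu : {measure set BT -> \bar R}) (D : set BT) (tv : R).
Hypotheses (mD : measurable D) (fD : (mu D < +oo)%E) (tv0 : 0 < tv).
Hypothesis orth : forall l : Zl nu, Cint mu D (fun s => fchar l s) = if l == 0 then tv%:C%C else 0.
Local Notation symM := (symM mu D).

Lemma l2b_ge0 q (v : Zl nu -> 'cV[R]_q) K : l2b v K -> 0 <= K.
Proof. by move=> /(_ 0%N); apply: le_trans; apply: bsum_ge0 => k; exact: sqnormR_ge0. Qed.

Lemma toep_bound p q (M : Zl nu -> 'M[R]_(p, q)) Ms : symM M Ms ->
  exists2 K, 0 < K & forall v c, l2b v c -> l2b (toep M v) (K * c).
Proof.
move=> sM; have [B B0 hB] := sym_nrm sM.
exists (p%:R * (q%:R * B ^+ 2) + 1) => [|v c vc N].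
  by rewrite ltr_wpDl// !mulr_ge0// sqr_ge0.
have hB' s : D s -> forall i b, n1 (Ms s i b) <= B.
  by move=> Dss i b; exact: le_trans (nrm_entry _ _ _) (hB s Dss).
apply: (le_trans (toep_l2 mD fD tv0 orth sM hB' vc N)).
by rewrite ler_wpM2r ?lerDl//; exact: l2b_ge0 vc.
Qed.

Variables (n m r : nat) (A : Zl nu -> 'M[R]_n) (B : Zl nu -> 'M[R]_(n, m))
  (Ck : Zl nu -> 'M[R]_(r, n)) (Dk : Zl nu -> 'M[R]_(r, m)) (G : Zl nu -> 'M[R]_(m, r))
  (As : V -> 'M[C]_n) (Bs : V -> 'M[C]_(n, m)) (Cs : V -> 'M[C]_(r, n))
  (Ds : V -> 'M[C]_(r, m)) (Gs : V -> 'M[C]_(m, r)).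
Hypotheses (sA : symM A As) (sB : symM B Bs) (sC : symM Ck Cs) (sD : symM Dk Ds) (sG : symM G Gs).
Local Notation qs T s := (qf (As s) (Bs s) (Cs s) (Ds s) (Gs s) T).
Local Notation state := (state mu D tv As Bs).

(** Each error term pairs a difference with a quantity that is merely bounded. Young's inequality
    puts the weight [d] on the bounded factor and [d^-1] on the difference. *)
Lemma supply_close KC KD KG (v v' : Zl nu -> 'cV[R]_m) (x x' : Zl nu -> 'cV[R]_n) (U om K K' E d : R) :
  0 < d -> 0 < KC -> 0 < KD -> 0 < KG ->
  (forall v c, l2b v c -> l2b (toep Ck v) (KC * c)) ->
  (forall v c, l2b v c -> l2b (toep Dk v) (KD * c)) ->
  (forall v c, l2b v c -> l2b (toep G v) (KG * c)) ->
  l2b v U -> l2b v' U -> l2b (fun k => v k - v' k) om ->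
  l2b x K -> l2b x' K' -> l2b (fun k => x k - x' k) E ->
  supply G v' (output Ck Dk x' v') -
   (d * (U + KG * (2 * (KC * K) + 2 * (KD * U))) + d^-1 * (om + KG * (2 * (KC * E) + 2 * (KD * om))))
  <= supply G v (output Ck Dk x v).
Proof.
move=> d0 KC0 KD0 KG0 hC hD hG hv hv' hw hx hx' he.
set y := output Ck Dk x v; set y' := output Ck Dk x' v'.
have ly : l2b y (2 * (KC * K) + 2 * (KD * U)) by apply: l2b_add; [exact: hC|exact: hD].
have ly' : l2b y' (2 * (KC * K') + 2 * (KD * U)) by apply: l2b_add; [exact: hC|exact: hD].
have lz : l2b (fun k => y k - y' k) (2 * (KC * E) + 2 * (KD * om)).
  rewrite (_ : (fun k => _) = fun k => toep Ck (fun l => x l - x' l) k + toep Dk (fun l => v l - v' l) k).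
    by apply: l2b_add; [exact: hC|exact: hD].
  apply: funext => k; rewrite (toepB mD fD tv0 orth k sC hx hx') (toepB mD fD tv0 orth k sD hv hv').
  by rewrite /y /y' /output opprD addrACA.
have dV : 0 < d^-1 by rewrite invr_gt0.
have [s1 b1] := dot_sumb dV hw (hG _ _ ly).
have [s2 b2] := dot_sumb d0 hv' (hG _ _ lz).
have [s3 b3] := dot_sumb d0 hv' (hG _ _ ly').
have e : supply G v y = zsum (fun j => ((v j - v' j)^T *m toep G y j) 0 0) +
   (zsum (fun j => ((v' j)^T *m toep G (fun k => y k - y' k) j) 0 0) + supply G v' y').
  apply: etrans (etrans (zsumD s1 (sumbD s2 s3)) (congr1 (fun z => _ + z) (zsumD s2 s3))).
  rewrite /supply.
  congr zsum; apply: funext => j; rewrite (toepB mD fD tv0 orth j sG ly ly').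
  exact: dot_telescope.
by rewrite e; exact: (close_arith (supply G v' y') b1 b2).
Qed.

Hypothesis qs_ge0 : forall s, D s -> forall v T, vt v -> 0 <= T -> 0 <= complex.Re (qs T s v v).

Lemma fin_work_ge0 N u T : fin_input N u -> 0 <= T ->
  lam.-integrable ([set` `[0, T]] : set R)
    (fun t => (supply G (u t) (output Ck Dk (state N u t) (u t)))%:E) /\
  (0 <= \int[lam]_(t in `[0%R, T]) (supply G (u t) (output Ck Dk (state N u t) (u t)))%:E)%E.
Proof.
move=> fu T0; have [i1 _ e1] := work_identity mD fD tv0 orth sA sB sC sD sG fu fu T0.
have pos t : ([set` `[0, T]] : set R) t -> 0 <= t by rewrite /= in_itv/= => /andP[].
have sE t : ([set` `[0, T]] : set R) t -> (power mu D tv As Bs Cs Ds Gs N u u t)%:E =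
    (supply G (u t) (output Ck Dk (state N u t) (u t)))%:E.
  by move=> /pos t0; rewrite (power_supply mD fD tv0 orth sA sB sC sD sG fu t0).
split; first by apply: (eq_integrable (mI 0 T) _ _ _ i1) => t /set_mem/sE.
have -> : (\int[lam]_(t in `[0%R, T]) (supply G (u t) (output Ck Dk (state N u t) (u t)))%:E =
  \int[lam]_(t in `[0%R, T]) (power mu D tv As Bs Cs Ds Gs N u u t)%:E)%E.
  by apply: eq_integral => t /set_mem/sE ->.
rewrite -[leRHS]fineK; last exact: (integrable_fin_num (mI 0 T) i1).
rewrite lee_fin -(pmulr_rge0 _ tv0) -[X in 0 <= X]/(complex.Re (_%:C%C : C)) -[X in tv * X]/(Rintegral _ _ _) -e1 /=.
by apply: Rintegral_ge0 => s Dss; apply: qs_ge0 => //; exact: vt_uh.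
Qed.

(** Gronwall on the difference of two solutions. Here [x] is an arbitrary state driven by [u], so
    this also does the work of a uniqueness theorem; the final bound is proportional to [W] and free
    of the a priori bounds [K], [K']. *)
Lemma state_close KA KB (u u' : R -> Zl nu -> 'cV[R]_m) x x' T K K' W :
  0 < T -> 0 < KA -> 0 < KB -> 0 < W ->
  (forall v c, l2b v c -> l2b (toep A v) (KA * c)) ->
  (forall v c, l2b v c -> l2b (toep B v) (KB * c)) ->
  is_state A B u x -> is_state A B u' x' ->
  (forall t, 0 <= t <= T -> l2b (x t) K) -> (forall t, 0 <= t <= T -> l2b (x' t) K') ->
  (forall t, exists c, l2b (u' t) c) ->
  (forall k i, measurable_fun [set: R] (fun t => u t k i 0 - u' t k i 0)) ->
  (\int[lam]_(t in `[0%R, T]) l2sq (fun k => (u t k - u' t k)%R) <= W%:E)%E ->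
  forall t, 0 <= t <= T ->
    l2b (fun k => x t k - x' t k) (4 * T * (2 * KB * W) * expR (2 * (T * (2 * KA)) * T)).
Proof.
move=> T0 KA0 KB0 W0 hA hB [_ [_ st]] [_ [_ st']] hx hx' hu' mu' hW.
pose g t j := (toep A (x t) j + toep B (u t) j) - (toep A (x' t) j + toep B (u' t) j).
pose om t := ((2 * KB)%:E * l2sq (fun k => (u t k - u' t k)%R))%E.
have KB2 : 0 < 2 * KB by rewrite mulr_gt0.
have ml : measurable_fun ([set` `[0, T]] : set R) (fun t => l2sq (fun k => u t k - u' t k)).
  by apply: measurable_l2sq => [|k i]; [exact: mI|apply: measurable_funTS; under eq_fun do rewrite !mxE; exact: mu'].
apply: (@gronwall_l2 R nu n (fun t k => x t k - x' t k) g om T (2 * KA) (2 * KB * W) (2 * K + 2 * K')).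
- exact: T0.
- by rewrite mulr_gt0.
- by rewrite mulr_gt0.
- have h00 : 0 <= (0 : R) <= T by rewrite lexx ltW.
  by apply: addr_ge0; apply: mulr_ge0 => //; [exact: l2b_ge0 (hx 0 h00)|exact: l2b_ge0 (hx' 0 h00)].
- by move=> t tT; apply: l2b_sub; [exact: hx|exact: hx'].
- move=> t /andP[t0 tT] j i; have [i1 e1] := st t t0 j i; have [i2 e2] := st' t t0 j i.
  have mt := mI 0 t; have ib := integrableB mt i1 i2.
  have gE z : ((g z j i 0)%:E = ((toep A (x z) j + toep B (u z) j)%R i 0)%:E - ((toep A (x' z) j + toep B (u' z) j)%R i 0)%:E)%E.
    by rewrite -EFinB /g [in LHS]mxE [X in _ + X]mxE.
  split; first by apply: eq_integrable ib => // z _; rewrite gE.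
  have eg : (\int[lam]_(z in `[0%R, t]) (g z j i 0)%:E =
      \int[lam]_(z in `[0%R, t]) ((toep A (x z) j + toep B (u z) j)%R i 0)%:E -
      \int[lam]_(z in `[0%R, t]) ((toep A (x' z) j + toep B (u' z) j)%R i 0)%:E)%E.
    by rewrite -integralB//; apply: eq_integral => z _; exact: gE.
  have f1 := integrable_fin_num mt i1; have f2 := integrable_fin_num mt i2.
  have fe : fine (\int[lam]_(z in `[0%R, t]) (g z j i 0)%:E)%E = x t j i 0 - x' t j i 0.
    rewrite eg.
    rewrite e1.
    rewrite e2.
    exact: (fineB f1 f2).
  rewrite fe.
  rewrite mxE; congr (_ + _).
  by rewrite mxE.
- by apply: measurable_funeM.
- by move=> t; rewrite mule_ge0 ?l2sq_ge0// lee_fin ltW.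
- rewrite ge0_integralZl_EFin//; last 2 first.
  + by move=> t _; exact: l2sq_ge0.
  + exact: ltW.
  by rewrite [leRHS]EFinM lee_wpmul2l// lee_fin ltW.
move=> t c tT hc N; rewrite /om.
(* At times where the input error has infinite norm the right-hand side is infinite. *)
have [fin|] := ltP (l2sq (fun k => u t k - u' t k)%R) +oo%E; last first.
  by rewrite leye_eq => /eqP ->; rewrite gt0_muley ?lte_fin// addey// leey.
have lw := l2sq_l2b fin; have [cu' lu'] := hu' t.
have lu : exists c', l2b (u t) c'.
  eexists; have := l2b_add lw lu'; rewrite (_ : (fun k => _) = u t); first by apply.
  by apply: funext => k; rewrite subrK.
have [cu {}lu] := lu.
rewrite -[l2sq _]fineK ?ge0_fin_numE ?l2sq_ge0// -EFinM -EFinD lee_fin.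
rewrite (_ : g t = fun j => toep A (fun k => x t k - x' t k) j + toep B (fun k => u t k - u' t k) j).
  rewrite -!mulrA; apply: (l2b_add (hA _ _ hc) (hB _ _ lw)).
apply: funext => j; rewrite (toepB mD fD tv0 orth j sA (hx t tT) (hx' t tT)) (toepB mD fD tv0 orth j sB lu lu').
by rewrite /g opprD addrACA.
Qed.

(** The supply rate along [x] is bounded below pointwise by that of a truncated input minus [h]. The
    former has nonnegative integral, and the integral of [h] is made at most an arbitrary [eta]. *)
Lemma passive_of_psd : passive A B Ck Dk G.
Proof.
move=> u x adm st T T0; have [ma fa] := adm.
have [KA KA0 hA] := toep_bound sA; have [KB KB0 hB] := toep_bound sB.
have [KC KC0 hC] := toep_bound sC; have [KD KD0 hD] := toep_bound sD; have [KG KG0 hG] := toep_bound sG.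
have [Kx hx'] := st.2.1 T T0.
have hx t : 0 <= t <= T -> l2b (x t) Kx.
  by move=> tT N; rewrite -lee_fin; apply: le_trans (hx' t tT); apply: bsum_le_esum => k; exact: sqnormR_ge0.
have Kx0 : 0 <= Kx by apply: (l2b_ge0 (hx 0 _)); rewrite lexx ltW.
set J := ([set` `[0, T]] : set R); have mJ : measurable J := mI 0 T.
have mU : measurable_fun J (fun t => l2sq (u t)).
  by apply: measurable_l2sq => // k i; apply: measurable_funTS.
have hfa := fa T T0; set IU := (\int[lam]_(t in `[0%R, T]) l2sq (u t))%E in hfa.
have IU0 : (0 <= IU)%E by apply: integral_ge0 => t _; exact: l2sq_ge0.
have fIU : IU \is a fin_num by rewrite ge0_fin_numE.
(* [b0 * W] will bound the contribution of the state error, [a0] that of [x] itself, and [a1] is the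
   common factor of the input and of its error. *)
pose b0 := KG * (2 * KC * (4 * T * (2 * KB) * expR (2 * (T * (2 * KA)) * T))).
pose a0 := KG * (2 * KC * Kx); pose a1 := 1 + KG * (2 * KD).
have a10 : 0 < a1 by rewrite ltr_pwDl// !mulr_ge0// ltW.
have a00 : 0 <= a0 by rewrite !mulr_ge0// ltW.
have b00 : 0 <= b0 by rewrite !mulr_ge0 ?expR_ge0// ltW.
apply/lee_addgt0Pr => eta eta0; rewrite -leeBlDr// sub0e.
(* Chosen before the truncation: the terms with weight [d] then total at most [eta / 2], whatever
   [N] is. *)
pose d := eta / 2 / (a0 * T + a1 * fine IU + 1).
have den1 : 0 < a0 * T + a1 * fine IU + 1.
  by rewrite ltr_wpDl// addr_ge0// mulr_ge0 ?fine_ge0// ltW.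
have d0 : 0 < d by rewrite !divr_gt0.
(* Chosen after [d], so that the terms with weight [d^-1] total at most [eta / 2]; it fixes the
   accuracy of the truncation. *)
pose W := d * (eta / 2) / (b0 * T + a1).
have den2 : 0 < b0 * T + a1 by rewrite ltr_wpDl// mulr_ge0// ltW.
have W0 : 0 < W by rewrite divr_gt0// mulr_gt0// divr_gt0.
have [N hN] := trunc_int ma adm T0 W0; set u' := trunc N u in hN.
have fu' : fin_input N u' := trunc_fin ma N.
pose x' := state N u'.
have st' : is_state A B u' x' := state_is_state mD fD tv0 orth sA sB sC sD sG fu'.
have [Kx' hx2] := l2b_state mD fD tv0 orth sA sB fu' (ltW T0).
(* The bound of [state_close], written through [b0] so that the constants in [h] match. *)
pose E := b0 / (KG * (2 * KC)) * W.
pose om t := l2sq (fun k => (u t k - u' t k)%R).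
have hE t : 0 <= t <= T -> l2b (fun k => x t k - x' t k) E.
  have -> : E = 4 * T * (2 * KB * W) * expR (2 * (T * (2 * KA)) * T).
    by rewrite /E /b0; field; rewrite !gt_eqF.
  apply: (state_close T0 KA0 KB0 W0 hA hB st st' hx hx2) => //.
  - by move=> s; exists (bsum N (fun k => sqnormR (u' s k))); apply: l2b_fin => k; exact: fu'.1.
  - by move=> k i; apply: measurable_funB => //; exact: measurable_trunc.
have mom : measurable_fun J om.
  apply: measurable_l2sq => // k i; apply: measurable_funTS; under eq_fun do rewrite !mxE.
  by apply: measurable_funB => //; exact: measurable_trunc.
pose S' t : R := supply G (u' t) (output Ck Dk (x' t) (u' t)).
have [iS S0] : lam.-integrable J (fun t => (S' t)%:E) /\ (0 <= \int[lam]_(t in J) (S' t)%:E)%E :=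
  fin_work_ge0 fu' (ltW T0).
pose h t := ((d * a0 + d^-1 * (b0 * W))%:E + ((d * a1)%:E * l2sq (u t) + (d^-1 * a1)%:E * om t))%E.
have dV : 0 < d^-1 by rewrite invr_gt0.
have da : 0 <= d * a1 by rewrite mulr_ge0// ltW.
have da' : 0 <= d^-1 * a1 by rewrite mulr_ge0// ltW.
have cst0 : 0 <= d * a0 + d^-1 * (b0 * W).
  apply: addr_ge0; first by apply: mulr_ge0 => //; exact: ltW.
  by apply: mulr_ge0; [exact: ltW|apply: mulr_ge0 => //; exact: ltW].
have p0 t : (0 <= (d * a1)%:E * l2sq (u t))%E by rewrite mule_ge0 ?l2sq_ge0// lee_fin.
have q0 t : (0 <= (d^-1 * a1)%:E * om t)%E by rewrite mule_ge0 ?l2sq_ge0// lee_fin.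
have h0 t : (0 <= h t)%E by apply: adde_ge0; [rewrite lee_fin|exact: adde_ge0].
have mh : measurable_fun J h.
  by apply: emeasurable_funD => //; apply: emeasurable_funD; exact: measurable_funeM.
have mp : measurable_fun J (fun t => (d * a1)%:E * l2sq (u t))%E by exact: measurable_funeM.
have mq : measurable_fun J (fun t => (d^-1 * a1)%:E * om t)%E by exact: measurable_funeM.
have lamJ : lam J = T%:E by rewrite /J lebesgue_measure_itv/= lte_fin T0 -EFinB subr0.
have Ih : (\int[lam]_(t in J) h t <= eta%:E)%E.
  apply: (@le_trans _ _ ((d * a0 + d^-1 * (b0 * W)) * T + (d * a1 * fine IU + d^-1 * a1 * W))%:E).
    rewrite /h ge0_integralD//; last exact: emeasurable_funD.
    rewrite ge0_integralD// integral_cst// !ge0_integralZl_EFin//; try by move=> t _; exact: l2sq_ge0.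
    rewrite [leRHS]EFinD; apply: leeD.
      by rewrite [leRHS]EFinM -lamJ.
    rewrite [leRHS]EFinD; apply: leeD; first by rewrite [leRHS]EFinM fineK.
    by rewrite [leRHS]EFinM lee_wpmul2l// lee_fin.
    by move=> t _; exact: adde_ge0.
  rewrite lee_fin.
  have e1 : d * (a0 * T + a1 * fine IU + 1) = eta / 2 by rewrite /d divfK// gt_eqF.
  have e2 : d^-1 * (W * (b0 * T + a1)) = eta / 2.
    have WE : W * (b0 * T + a1) = d * (eta / 2) by rewrite /W divfK// gt_eqF.
    by rewrite WE mulKf// gt_eqF.
  rewrite [leRHS]splitr -{1}e1 -e2.
  have -> : (d * a0 + d^-1 * (b0 * W)) * T + (d * a1 * fine IU + d^-1 * a1 * W) =
    d * (a0 * T + a1 * fine IU) + d^-1 * (W * (b0 * T + a1)) by ring.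
  by rewrite lerD2r ler_wpM2l ?(ltW d0)// lerDl.
have iH : lam.-integrable J h.
  apply/integrableP; split => //; under eq_integral do rewrite gee0_abs//.
  by apply: (le_lt_trans Ih); rewrite ltry.
have low : (- eta%:E <= \int[lam]_(t in J) ((S' t)%:E - h t))%E.
  by rewrite integralB// -[leLHS]add0e; apply: leeB.
(* Pointwise comparison of integrals, as measurability of the supply rate along [x] is not
   established. *)
apply: (le_trans low); apply: le_integral_pw => t; rewrite /J /= in_itv/= => tT.
(* Where the truncation error is infinite, [h] is infinite and the lower bound is minus infinity. *)
have [fin|] := ltP (om t) +oo%E; last first.
  rewrite leye_eq => /eqP omoo; rewrite /h omoo gt0_muley ?lte_fin ?mulr_gt0//.
  by rewrite addey ?addey ?leNye// ?gt_eqF// (lt_le_trans _ (p0 t)).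
have lw := l2sq_l2b fin; have lu' : l2b (u' t) _ := l2b_fin (fu'.1 t).
have lu0 : exists c, l2b (u t) c.
  eexists; have := l2b_add lw lu'; rewrite (_ : (fun k => _) = u t); first by apply.
  by apply: funext => k; rewrite subrK.
have finU : (l2sq (u t) < +oo)%E by have [c hc] := lu0; apply: (le_lt_trans (l2b_l2sq hc)); rewrite ltry.
have lu := l2sq_l2b finU.
have {}lu' : l2b (u' t) (fine (l2sq (u t))).
  by move=> L; apply: le_trans (lu L); apply: le_bsum => k; exact: sqnormR_trunc.
have hS := supply_close d0 KC0 KD0 KG0 hC hD hG lu lu' lw (hx t tT) (hx2 t tT) (hE t tT).
have fU : l2sq (u t) = (fine (l2sq (u t)))%:E by rewrite fineK// ge0_fin_numE// l2sq_ge0.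
have fo : om t = (fine (om t))%:E by rewrite fineK// ge0_fin_numE// l2sq_ge0.
have hR : h t = (d * a0 + d^-1 * (b0 * W) + (d * a1 * fine (l2sq (u t)) + d^-1 * a1 * fine (om t)))%:E.
  by rewrite /h {1}fU {1}fo.
rewrite hR -EFinB lee_fin; apply: le_trans hS.
rewrite -/(om t) -/(S' t); move: (fine (l2sq (u t))) (fine (om t)) => z1 z2.
rewrite lerB// le_eqVlt; apply/orP; left; apply/eqP; rewrite /a0 /a1 /E.
by field; rewrite !gt_eqF.
Qed.

End Sufficiency.

(** * Exceptional null sets and the equivalence *)

Section Assembly.
Variables (R : realType) (nu : nat).
Hypothesis nu0 : (0 < nu)%N.
Local Notation C := R[i].
Local Notation V := 'rV[R]_nu.
Local Notation BT := (g_sigma_algebraType (@boxes R nu)).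
Local Notation lam := (@lebesgue_measure R).
Local Notation TT := ([set s | inT s] : set BT).
Variable mu : {measure set BT -> \bar R}.
Hypothesis muI : forall f : V -> \bar R, (forall s, (0 <= f s)%E) -> measurable_fun [set: BT] (f : BT -> \bar R) ->
     torus_int nu (fun s => f (rv_of_seq nu s)) = (\int[mu]_(s in TT) f s)%E.
Hypothesis mu_rect : forall B : 'I_nu -> set R, (forall i, measurable (B i)) ->
    mu [set s | forall i, B i (s 0 i)] = (\prod_(i < nu) lam (B i))%E.
Let mT : @measurable _ BT TT := @measurable_inT R nu.

Lemma symbol_null p q (M : Zl nu -> 'M[R]_(p, q)) Ms : is_symbol M Ms ->
  exists Z : set BT, [/\ measurable Z, mu Z = 0%E &
    exists K, forall s, inT s -> ~ Z s -> sqnormC (Ms s) <= K].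
Proof.
move=> [_ [[K hK] _]]; have [Z [mZ hZ Z0]] := null_measurable mu_rect hK.
exists Z; split => //; exists K => s sT nZ; rewrite leNgt; apply/negP => lt; apply: nZ; exact: hZ.
Qed.

Lemma measurable_borel (f : V -> R) : borel_fun f -> measurable_fun [set: BT] (f : BT -> R).
Proof. by move=> bf _ Y mY; rewrite setTI; exact: bf. Qed.

Lemma psum_psums p q N (M : Zl nu -> 'M[R]_(p, q)) s i j : psum N M s i j = psums N (fun l => M l i j) s.
Proof.
rewrite /psum /psums bsum_sq summxE; apply: eq_bigr => k _.
by rewrite !mxE mulrC.
Qed.

Section Domain.
Variable D : set BT.
Hypotheses (mD : measurable D) (DT : D `<=` TT) (TD : mu (TT `\` D) = 0%E).

Lemma fin_D : (mu D < +oo)%E.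
Proof.
apply: (le_lt_trans (le_measure mu _ _ DT)); rewrite ?inE//.
exact: (mu_fin mu_rect).
Qed.

Lemma orth_D (l : Zl nu) : Cint mu D (fun s => fchar l s) = if l == 0 then (tvol R nu)%:C%C else 0.
Proof.
rewrite -(int_char muI mu_rect l); have fT := mu_fin mu_rect.
have cT : cbm TT (fun s : BT => fchar l s : C) := sub_cbm measurableT (@subsetT _ _) (cbm_fchar R l).
have TE : D = TT `\` (TT `\` D) by rewrite setDD; apply/esym/setIidr.
have m' : measurable (TT `\` D) by exact: measurableD.
apply: cext => /=; rewrite /Rintegral; congr fine; rewrite [in LHS]TE; apply/esym.
  exact: (negligible_integral m' mT (cbm_iRe mT fT cT) TD).
exact: (negligible_integral m' mT (cbm_iIm mT fT cT) TD).
Qed.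

Lemma symbol_sym p q (M : Zl nu -> 'M[R]_(p, q)) Ms : is_symbol M Ms ->
  (exists K, forall s, D s -> sqnormC (Ms s) <= K) -> symM mu D M Ms.
Proof.
move=> [bM [_ cM]] [K hK] i j; have [b1 b2] := bM i j.
have cf : cmf [set: BT] (fun s : BT => Ms s i j) by split; exact: measurable_borel.
have cD : cbm D (fun s : BT => Ms s i j).
  split; first by split; apply: measurable_funTS; [exact: cf.1|exact: cf.2].
  (* From [2 n1 <= n1^2 + 1] and [n1^2 <= 2 |z|^2 <= 2 K]. *)
  exists (1 + 2 * K) => s Ds; have h := n1_le_cabs2 (Ms s i j).
  have h2 : cabs2 (Ms s i j) <= K.
    apply: le_trans (hK s Ds); rewrite /sqnormC (bigD1 i)//= (bigD1 j)//= -addrA lerDl addr_ge0//.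
      by apply: sumr_ge0 => *; exact: cabs2_ge0.
    by apply: sumr_ge0 => *; apply: sumr_ge0 => *; exact: cabs2_ge0.
  have := sqr_ge0 (n1 (Ms s i j) - 1); nra.
split => //.
pose F N (s : V) := cabs2 (psums N (fun l => M l i j) s - Ms s i j).
have cps N : cmf [set: BT] (fun s : BT => psums N (fun l => M l i j) s - Ms s i j).
  apply: cmfD; last exact: cmfN.
  by apply: cmf_sum => k; apply: cmfM; [exact: cmf_cst|exact: (cbm_fchar R k).1].
have mF N : measurable_fun [set: BT] (F N : BT -> R).
  by apply: measurable_funD; apply: measurable_funX; [exact: (cps N).1|exact: (cps N).2].
have mE N : measurable_fun [set: BT] (fun s : BT => (F N s)%:E) by apply/measurable_EFinP.
have F0 N s : (0 <= (F N s)%:E)%E by rewrite lee_fin cabs2_ge0.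
have := cM i j; rewrite (_ : (fun N => _) = (fun N => \int[mu]_(s in TT) (F N s)%:E)%E); last first.
  apply: funext => N; rewrite -(muI (F0 N) (mE N)); congr torus_int; apply: funext => s.
  by rewrite /F -psum_psums.
move=> cvT; have cvD : (\int[mu]_(s in D) (F N s)%:E)%E @[N --> \oo] --> 0%E.
  apply: (squeeze_cvge _ (cvg_cst 0%E) cvT); apply: nearW => N; apply/andP; split.
    by apply: integral_ge0 => s _; exact: F0.
  by apply: ge0_subset_integral => //; apply: measurable_funTS; exact: mE.
exact: (fine_cvg cvD).
Qed.
End Domain.

Local Transparent res.
Lemma EmxE n m r (As : V -> 'M[C]_n) (Bs : V -> 'M[C]_(n, m)) (Cs : V -> 'M[C]_(r, n))
    (Ds : V -> 'M[C]_(r, m)) (Gs : V -> 'M[C]_(m, r)) w s :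
  psdmx (Emx As Bs Cs Ds Gs w s) = psdat (As s) (Bs s) (Cs s) (Ds s) (Gs s) w.
Proof. by []. Qed.
Local Opaque res.

Section Equivalence.
Variables (n m r : nat) (A : Zl nu -> 'M[R]_n) (B : Zl nu -> 'M[R]_(n, m))
  (Ck : Zl nu -> 'M[R]_(r, n)) (Dk : Zl nu -> 'M[R]_(r, m)) (G : Zl nu -> 'M[R]_(m, r))
  (As : V -> 'M[C]_n) (Bs : V -> 'M[C]_(n, m)) (Cs : V -> 'M[C]_(r, n))
  (Ds : V -> 'M[C]_(r, m)) (Gs : V -> 'M[C]_(m, r)).
Hypotheses (iA : is_symbol A As) (iB : is_symbol B Bs) (iC : is_symbol Ck Cs)
  (iD : is_symbol Dk Ds) (iG : is_symbol G Gs).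
Hypothesis hA : forall s, inT s -> hurwitz (As s).

(** Stated for every measurable [D] off [Z]: the converse direction has to remove further
    frequencies from the torus. *)
Lemma exceptional_set : exists Z : set BT, [/\ measurable Z, mu Z = 0%E &
  forall D : set BT, measurable D -> D `<=` TT `\` Z ->
  [/\ symM mu D A As, symM mu D B Bs, symM mu D Ck Cs, symM mu D Dk Ds & symM mu D G Gs]].
Proof.
have [ZA [mA A0 [KA hKA]]] := symbol_null iA; have [ZB [mB B0 [KB hKB]]] := symbol_null iB.
have [ZC [mC C0 [KC hKC]]] := symbol_null iC; have [ZD [mD D0 [KD hKD]]] := symbol_null iD.
have [ZG [mG G0 [KG hKG]]] := symbol_null iG.
exists (ZA `|` (ZB `|` (ZC `|` (ZD `|` ZG)))); split.
- by do ![apply: measurableU => //].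
- rewrite !measureU0//; by do ![apply: measurableU => //].
move=> D mDD hD.
have dT : D `<=` TT by move=> s /hD[].
split; apply: symbol_sym => //.
- by exists KA => s /hD[sT nZ]; apply: hKA => // h; apply: nZ; left.
- by exists KB => s /hD[sT nZ]; apply: hKB => // h; apply: nZ; right; left.
- by exists KC => s /hD[sT nZ]; apply: hKC => // h; apply: nZ; do 2 right; left.
- by exists KD => s /hD[sT nZ]; apply: hKD => // h; apply: nZ; do 3 right; left.
- by exists KG => s /hD[sT nZ]; apply: hKG => // h; apply: nZ; do 4 right.
Qed.

Lemma compl_null (Z : set BT) : measurable Z -> mu Z = 0%E ->
  [/\ measurable (TT `\` Z), TT `\` Z `<=` TT & mu (TT `\` (TT `\` Z)) = 0%E].
Proof.
move=> mZ Z0; split; [exact: measurableD|by move=> s []|].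
rewrite setDD; apply: (@subset_measure0 _ _ _ mu _ Z) => //; exact: measurableI.
Qed.

(** Passivity is tested on the states built by transforms, which are genuine states. The exceptional
    set depends on sigma alone, and its cylinder over all frequencies is null. *)
Lemma ae_psd_of_passive : passive A B Ck Dk G -> ae_psd As Bs Cs Ds Gs.
Proof.
move=> pas; have [Z [mZ Z0 hZ]] := exceptional_set.
have [mD DT TD] := compl_null mZ Z0; have [sA sB sC sD sG] := hZ _ mD (@subset_refl _ _).
have fD := fin_D mD DT; have orth := orth_D mD DT TD; have tv0 := tvol_gt0 R nu.
have pas' T : 0 <= T -> forall N u, fin_input N u -> admissible u ->
    0 <= \int[lam]_(t in `[0, T]) power mu (TT `\` Z) (tvol R nu) As Bs Cs Ds Gs N u u t.
  rewrite le_eqVlt => /predU1P[<- N u _ _|T0 N u fu au].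
    by rewrite set_itv1 Rintegral_set1.
  have st := state_is_state mD fD tv0 orth sA sB sC sD sG fu.
  have := pas u _ au st T T0; rewrite /Rintegral => h; apply: fine_ge0; apply: le_trans h _.
  rewrite le_eqVlt; apply/orP; left; apply/eqP; apply: eq_integral => t /set_mem.
  rewrite /= in_itv/= => /andP[t0 _].
  by rewrite (power_supply mD fD tv0 orth sA sB sC sD sG fu t0).
have [N0 [nN0 hN0]] := psd_null nu0 mD fD tv0 mu_rect DT TD orth sA sB sC sD sG hA pas'.
apply: null_sub (null_cylinder nN0) => z [w [s [zE [sT npsd]]]]; exists w, s; split => //.
by apply: contrapT => nN; apply: npsd; rewrite EmxE; exact: hN0.
Qed.

(** For each rational interval, the sigma at which all frequencies of the interval are bad form a
    set of measure zero. Off their countable union every neighbourhood of every frequency contains a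
    good one, and [psd_dense] yields the condition at all frequencies. *)
Lemma passive_of_ae_psd : ae_psd As Bs Cs Ds Gs -> passive A B Ck Dk G.
Proof.
move=> ae; have [Z [mZ Z0 hZ]] := exceptional_set.
pose bad : set 'rV[R]_(1 + nu) := [set z | exists (w : R) (s : V),
     z = row_mx (\row_(_ < 1) w) s /\ inT s /\ ~ psdmx (Emx As Bs Cs Ds Gs w s)].
(* Pairs in the wrong order receive the empty set, so that the family is indexed by all pairs of
   rationals. *)
have slice (i : rat * rat) : {Y : set BT | [/\ measurable Y, mu Y = 0%E & ratr i.1 < ratr i.2 :> R ->
    forall s : V, (forall w : R, ratr i.1 <= w <= ratr i.2 -> bad (row_mx (\row_(_ < 1) w) s)) -> Y s]}.
  apply: cid; have [lt|_] := ltP (ratr i.1 : R) (ratr i.2).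
    by have [Y [mY Y0 hY]] := slice_null mu_rect ae lt; exists Y.
  by exists set0; split => //.
pose Y k : set BT := if unpickle k is Some i then sval (slice i) else set0.
have mY k : measurable (Y k).
  by rewrite /Y; case: (unpickle k) => [i|//]; have [] := svalP (slice i).
have nY : mu (\bigcup_k Y k) = 0%E.
  apply: measure_negligible; first exact: bigcupT_measurable.
  apply: negligible_bigcup => k; apply/negligibleP => //.
  by rewrite /Y; case: (unpickle k) => [i|]; [have [] := svalP (slice i)|rewrite measure0].
have mW : measurable (Z `|` \bigcup_k Y k) by apply: measurableU => //; exact: bigcupT_measurable.
have W0 : mu (Z `|` \bigcup_k Y k) = 0%E by rewrite measureU0//; exact: bigcupT_measurable.
have [mD DT TD] := compl_null mW W0.
have [sA sB sC sD sG] := hZ _ mD (fun s h => conj h.1 (fun hz => h.2 (or_introl hz))).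
have fD := fin_D mD DT; have orth := orth_D mD DT TD; have tv0 := tvol_gt0 R nu.
apply: (passive_of_psd mD fD tv0 orth sA sB sC sD sG) => s [sT nW] v T tv T0.
apply: (freq_sufficient (hA sT)) => //; apply: (psd_dense (hA sT)) => w x e e0.
(* Rationals on both sides of [w] within [e]: a good frequency between them is within [e] of [w]. *)
have we : w - e < w by rewrite ltrBlDr ltrDl.
have [p] := rat_in_itvoo we; rewrite in_itv/= => /andP[p1 p2].
have we' : w < w + e by rewrite ltrDl.
have [q] := rat_in_itvoo we'; rewrite in_itv/= => /andP[q1 q2].
have [_ _ hY] := svalP (slice (p, q)).
have YE : Y (pickle (p, q)) = sval (slice (p, q)) by rewrite /Y (pickleK (p, q)).
have [w' [pw' nb]] : exists w' : R, ratr p <= w' <= ratr q /\ ~ bad (row_mx (\row_(_ < 1) w') s).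
  apply: contrapT => h; apply: nW; right; exists (pickle (p, q)); first exact: I.
  rewrite YE.
  apply: hY => [|w' pw']; first exact: lt_trans p2 q1.
  by apply: contrapT => nb; apply: h; exists w'.
have pw : psdat (As s) (Bs s) (Cs s) (Ds s) (Gs s) w'.
  by rewrite -EmxE; apply: contrapT => np; apply: nb; exists w', s.
exists w', x; split; last by have /psdatP := pw; apply.
  by case/andP: pw' => h1 h2; rewrite ler_norml; apply/andP; split; lra.
by rewrite subrr nrm0 ltW.
Qed.
End Equivalence.
End Assembly.

Theorem theorem2 (R : realType) (nu n m r : nat)
  (hnu : (0 < nu)%N) (hn : (0 < n)%N) (hm : (0 < m)%N) (hr : (0 < r)%N)
  (A : Zl nu -> 'M[R]_n) (B : Zl nu -> 'M[R]_(n, m))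
  (C : Zl nu -> 'M[R]_(r, n)) (D : Zl nu -> 'M[R]_(r, m))
  (G : Zl nu -> 'M[R]_(m, r))
  (As : 'rV[R]_nu -> 'M[R[i]]_n) (Bs : 'rV[R]_nu -> 'M[R[i]]_(n, m))
  (Cs : 'rV[R]_nu -> 'M[R[i]]_(r, n)) (Ds : 'rV[R]_nu -> 'M[R[i]]_(r, m))
  (Gs : 'rV[R]_nu -> 'M[R[i]]_(m, r)) :
  (\esum_(l in [set: Zl nu])
     (sqnormR (A l) + sqnormR (B l) + sqnormR (C l) + sqnormR (D l))%:E < +oo)%E ->
  (\esum_(l in [set: Zl nu]) (sqnormR (G l))%:E < +oo)%E ->
  is_symbol A As -> is_symbol B Bs -> is_symbol C Cs -> is_symbol D Ds ->
  is_symbol G Gs ->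
  (forall s : 'rV[R]_nu, inT s -> hurwitz (As s)) ->
  (passive A B C D G <-> ae_psd As Bs Cs Ds Gs).
Proof.
move=> _ _ iA iB iC iD iG hA; have [mu [muI mu_rect]] := torus_measure R nu.
split; first exact: (ae_psd_of_passive hnu muI mu_rect iA iB iC iD iG hA).
exact: (passive_of_ae_psd muI mu_rect iA iB iC iD iG hA).
Qed.
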